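(* Let $\rho:[0,\infty)\to[0,\infty)$ with $\int_{\mathbb{R}^n}\rho(|x|^2)\,dx<\infty$, and assume that $t\mapsto v_\rho(t)=-\log\rho(e^t)$ is convex and increasing. Let $\mu_\rho$ be the probability measure on $\mathbb{R}^n$ with density proportional to $\rho(|x|^2)$. Then for every even $f\in\mathcal{C}_c^\infty(\mathbb{R}^n)$ such that $\int f\,d\mu_\rho=0$, $$\int f^2\,d\mu_\rho\le\frac12\int H_\rho^{-1}\nabla f\cdot\nabla f\,d\mu_\rho,$$ where the positive matrix $H_\rho$ is given by $$\frac12H_\rho(y)=\frac{1}{|y|^2}\left[\left(I_n-\frac{y\otimes y}{|y|^2}\right)v_\rho'(t)+\frac{y\otimes y}{|y|^2}\,v_\rho''(t)\right],\qquad t=2\log|y|.$$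
   Context: $I_n$ is the $n\times n$ identity matrix, $y\otimes y=yy^T$, $|\cdot|$ is the Euclidean norm on $\mathbb{R}^n$, and $\mathcal{C}_c^\infty(\mathbb{R}^n)$ is the set of smooth compactly supported functions on $\mathbb{R}^n$. *)

(* Defs.v *)
From HB Require Import structures.
From mathcomp Require Import all_boot all_order all_algebra.
From mathcomp Require Import all_classical all_reals all_analysis.

Set Implicit Arguments.
Unset Strict Implicit.
Unset Printing Implicit Defensive.
Import Order.TTheory GRing.Theory Num.Theory.
Import numFieldNormedType.Exports.

Local Open Scope classical_set_scope.
Local Open Scope ring_scope.

(* R^n is 'rV[R]_n. Its sigma-algebra is the one generated by the coordinates
   (for T = R this is the Borel sigma-algebra of R^n). *)
Definition measure_rV_display : measure_display -> measure_display.
Proof. exact. Qed.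

Section measurable_rV.
Context {d} {T : sigmaRingType d}.
Variable n : nat.

Let coord (i : 'I_n) (x : 'rV[T]_n) : T := x ord0 i.

Let rV_set0 : g_sigma_preimage coord set0.
Proof. exact: sigma_algebra0. Qed.

Let rV_setC A : g_sigma_preimage coord A -> g_sigma_preimage coord (~` A).
Proof. exact: sigma_algebraC. Qed.

Let rV_bigcup (F : (set 'rV[T]_n)^nat) :
  (forall i, g_sigma_preimage coord (F i)) ->
  g_sigma_preimage coord (\bigcup_i (F i)).
Proof. exact: sigma_algebra_bigcup. Qed.

HB.instance Definition _ := @isMeasurable.Build (measure_rV_display d)
  'rV[T]_n (g_sigma_preimage coord) rV_set0 rV_setC rV_bigcup.

End measurable_rV.

Lemma measurable_coord d (T : sigmaRingType d) n (i : 'I_n) :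
  measurable_fun [set: 'rV[T]_n] (fun x : 'rV[T]_n => x ord0 i).
Proof.
move=> _ Y mY; rewrite setTI; apply: sub_sigma_algebra => /=.
rewrite -bigcup_seq/=; exists i => /=; first by rewrite mem_index_enum.
by exists Y => //; rewrite setTI.
Qed.

Lemma measurable_fun_rVP d1 d2 (T1 : measurableType d1)
    (T2 : measurableType d2) n (f : T1 -> 'rV[T2]_n) :
  (forall i, measurable_fun [set: T1] (fun x => f x ord0 i)) ->
  measurable_fun [set: T1] f.
Proof.
move=> mf; pose coord (i : 'I_n) (x : 'rV[T2]_n) : T2 := x ord0 i.
have prefS : g_sigma_preimage (fun i => coord i \o f) `<=` measurable.
  apply: smallest_sub; first exact: sigma_algebra_measurable.
  case: n f @coord mf => [|n] f coord mf; first by rewrite big_ord0.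
  rewrite -bigcup_mkord_ord; apply: bigcup_sub => i Ii.
  by move=> A [B mB <-]; exact: mf.
by move=> _ A mA; apply: prefS; rewrite g_sigma_preimage_comp; exists A.
Qed.

(* Lebesgue measure on R^n, by induction on n: the image of the product of the
   Lebesgue measures of R and R^n under (x, y) |-> (x, y_1, ..., y_n). *)
Section lebesgue_rV_step.
Context {R : realType} {n : nat}.

Definition rV_cons (p : measurableTypeR R * 'rV[R]_n) : 'rV[R]_n.+1 :=
  row_mx (p.1%:M : 'rV_1) p.2.

Definition rV_uncons (v : 'rV[R]_n.+1) : measurableTypeR R * 'rV[R]_n :=
  (v ord0 ord0, \row_i v ord0 (lift ord0 i)).

Lemma rV_cons0 p : rV_cons p ord0 ord0 = p.1.
Proof.
rewrite /rV_cons (_ : ord0 = lshift n (ord0 : 'I_1)); last exact: val_inj.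
by rewrite [LHS](@row_mxEl _ 1 1 n) mxE.
Qed.

Lemma rV_consS p i : rV_cons p ord0 (lift ord0 i) = p.2 ord0 i.
Proof.
rewrite /rV_cons (_ : lift ord0 i = @rshift 1 n i); last exact: val_inj.
exact: (@row_mxEr _ 1 1 n).
Qed.

Lemma rV_consK : cancel rV_cons rV_uncons.
Proof.
move=> p; rewrite /rV_uncons rV_cons0 [RHS]surjective_pairing; congr pair.
by apply/rowP => i; rewrite mxE rV_consS.
Qed.

Lemma measurable_rV_cons : measurable_fun setT rV_cons.
Proof.
apply: measurable_fun_rVP => i.
case: (unliftP ord0 i) => [j ->|->].
  rewrite (_ : (fun p => _) = (fun x : 'rV[R]_n => x ord0 j) \o snd).
    exact: measurableT_comp (@measurable_coord _ R n j) measurable_snd.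
  by apply/funext => p; exact: rV_consS.
rewrite (_ : (fun p => _) = fst); first exact: measurable_fst.
by apply/funext => p; exact: rV_cons0.
Qed.

Lemma measurable_rV_uncons : measurable_fun setT rV_uncons.
Proof.
apply: measurable_fun_pair => /=; first exact: measurable_coord.
apply: measurable_fun_rVP => i.
rewrite [X in measurable_fun _ X](_ : _ = fun v : 'rV[R]_n.+1 => v ord0 (lift ord0 i)).
  exact: measurable_coord.
by apply/funext => v /=; rewrite mxE.
Qed.

Variable m : {sigma_finite_measure set 'rV[R]_n -> \bar R}.

Definition lebesgue_cons : set 'rV[R]_n.+1 -> \bar R :=
  pushforward (@lebesgue_measure R \x m)%E rV_cons.

Let lebesgue_cons0 : lebesgue_cons set0 = 0%E.
Proof. by rewrite /lebesgue_cons /pushforward preimage_set0 measure0. Qed.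

Let lebesgue_cons_ge0 A : (0 <= lebesgue_cons A)%E.
Proof. exact: integral_ge0. Qed.

Let lebesgue_cons_sigma_additive : semi_sigma_additive lebesgue_cons.
Proof.
have H := @measure_semi_sigma_additive _ _ _
  (measure_function_pushforward__canonical__measure_function_Measure
     (@lebesgue_measure R \x m)%E measurable_rV_cons).
exact H.
Qed.

HB.instance Definition _ := isMeasure.Build _ _ _ lebesgue_cons
  lebesgue_cons0 lebesgue_cons_ge0 lebesgue_cons_sigma_additive.

Let lebesgue_cons_sigma_finite : sigma_finite setT lebesgue_cons.
Proof.
have /sigma_finiteP[F [FT Fnd mF]] := sigma_finiteT (@lebesgue_measure R).
have /sigma_finiteP[G [GT Gnd mG]] := sigma_finiteT m.
exists (fun k => rV_uncons @^-1` (F k `*` G k)).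
  apply/esym; rewrite -subTset => v _.
  have [i _ Fi] : (\bigcup_i F i) (rV_uncons v).1 by rewrite -FT.
  have [j _ Gj] : (\bigcup_i G i) (rV_uncons v).2 by rewrite -GT.
  exists (maxn i j) => //; split.
    by move: Fi; exact/subsetPset/Fnd/leq_maxl.
  by move: Gj; exact/subsetPset/Gnd/leq_maxr.
move=> k; have [mFk Fkoo] := mF k; have [mGk Gkoo] := mG k; split.
  rewrite -[X in measurable X]setTI.
  by apply: measurable_rV_uncons => //; exact: measurableX.
rewrite /lebesgue_cons /pushforward -comp_preimage.
rewrite (_ : rV_uncons \o rV_cons = id); last exact/funext/rV_consK.
by rewrite preimage_id product_measure1E// lte_mul_pinfty// ge0_fin_numE.
Qed.

HB.instance Definition _ := Measure_isSigmaFinite.Build _ _ _ lebesgue_cons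
  lebesgue_cons_sigma_finite.

End lebesgue_rV_step.

Fixpoint lebesgue_rV (R : realType) (n : nat) :
    {sigma_finite_measure set 'rV[R]_n -> \bar R} :=
  match n with
  | 0%N => \d_(0 : 'rV[R]_0)
  | n'.+1 => lebesgue_cons (lebesgue_rV R n')
  end.

Lemma lebesgue_rV_box (R : realType) n (A : 'I_n -> set R) :
  (forall i, measurable (A i)) ->
  lebesgue_rV R n [set x | forall i, A i (x ord0 i)] =
  (\prod_(i < n) lebesgue_measure (A i))%E.
Proof.
elim: n A => [|n IH] A mA.
  by rewrite big_ord0 /= diracE mem_set// => -[].
rewrite big_ord_recl -IH; last by move=> i; exact: mA.
rewrite /= /lebesgue_cons /pushforward.
rewrite (_ : _ @^-1` _ = A ord0 `*` [set x : 'rV[R]_n | forall i, A (lift ord0 i) (x ord0 i)]).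
  rewrite product_measure1E//; first exact: mA.
  rewrite (_ : [set x | _] = \bigcap_(i in [set: 'I_n]) [set x : 'rV[R]_n | A (lift ord0 i) (x ord0 i)]).
    apply: fin_bigcap_measurable => //.
    move=> i _; rewrite -[X in measurable X]setTI. apply: (measurable_coord i) => //; exact: mA.
  by apply/seteqP; split => x /= h i; [move=> _|]; apply: h.
apply/seteqP; split => [[a x] h|[a x] [/= h0 h] i].
  split=> [/=|i /=]; first by have := h ord0; rewrite rV_cons0.
  by have := h (lift ord0 i); rewrite rV_consS.
by case: (unliftP ord0 i) => [j ->|->]; rewrite ?rV_consS ?rV_cons0//; apply: h.
Qed.

Section euclidean.
Context {R : realType} {n : nat}.
Implicit Types (x : 'rV[R]_n) (f : 'rV[R]_n -> R).

Definition enorm x : R := Num.sqrt (\sum_i x ord0 i ^+ 2).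

Definition partial (i : 'I_n) f : 'rV[R]_n -> R := 'D_(delta_mx ord0 i) f.

Definition gradient f x : 'rV[R]_n := \row_i partial i f x.

Fixpoint Ck (k : nat) f : Prop :=
  continuous f /\
  if k is k'.+1 then
    forall i, (forall x, derivable f x (delta_mx ord0 i)) /\ Ck k' (partial i f)
  else True.

Definition smooth f := forall k, Ck k f.

Definition compactly_supported f := compact (closure [set x | f x != 0]).

(* The quadratic form H^-1 xi . xi of a symmetric positive semidefinite H.  When
   H is singular this is, as usual, the limit of (H + e I)^-1 xi . xi as e
   decreases to 0: eta . xi for any eta with eta H = xi, and +oo if xi is not in
   the range of H. *)
Definition inv_form (H : 'M[R]_n) (xi : 'rV[R]_n) : \bar R :=
  if H \in unitmx then ((xi *m invmx H *m xi^T) ord0 ord0)%:E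
  else if (xi <= H)%MS then ((xi *m pinvmx H *m xi^T) ord0 ord0)%:E
  else +oo%E.

End euclidean.

Section extended_convex.
Context {R : realType}.
Implicit Types (v : R -> \bar R).

(* Library convexity is for finite-valued functions only. *)
Definition convex_ereal v := forall (s t p : R), 0 <= p <= 1 ->
  (v (p * s + (1 - p) * t)%R <= p%:E * v s + (1 - p)%R%:E * v t)%E.

(* v' and v'' for a convex v : R -> ]-oo, +oo].  Such a v is right-differentiable
   everywhere in the interior of its domain, its right derivative is v' off a
   countable set, and that derivative, being monotone, is differentiable almost
   everywhere.  The two-sided derivative would not do for v'': it may fail to
   exist on a dense set, in which case its own derivative exists nowhere.  *)
Definition first_deriv v (t : R) : R :=
  lim ((fine (v (t + h)) - fine (v t)) / h @[h --> 0^'+]).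

Definition second_deriv v : R -> R := derive1 (first_deriv v).

End extended_convex.

Lemma first_deriv_EFin (R : realType) (v : R -> R) t : derivable v t 1 ->
  first_deriv (fun x => (v x)%:E) t = derive1 v t.
Proof.
move=> dv; rewrite /first_deriv. apply/cvg_lim => //=.
have : (fun h => h^-1 *: (v (h + t) - v t)) @ 0^' --> derive1 v t.
  rewrite derive1E; move: dv => /derivableP [dv <-] //.
  apply: cvg_trans dv; apply: near_eq_cvg; near=> h; congr (_ *: (v _ - _)).
  by rewrite /= [h%:A]mulr1.
move=> /cvg_dnbhs_at_right; apply: cvg_trans; apply: near_eq_cvg; near=> h.
by rewrite [t + h]addrC mulrC.
Unshelve. all: by end_near. Qed.

Section radial.
Context {R : realType} {n : nat}.
Implicit Types (rho : R -> R).

Definition v_of rho (t : R) : \bar R := (- lne (rho (expR t))%:E)%E.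

(* |x|^2 is written enorm x ^+ 2; row vectors make y (x) y the matrix y^T y. *)
Definition H_of rho (y : 'rV[R]_n) : 'M[R]_n :=
  let t := 2 * ln (enorm y) in
  let P := (enorm y ^+ 2)^-1 *: (y^T *m y) in
  2 *: ((enorm y ^+ 2)^-1 *:
    (first_deriv (v_of rho) t *: (1%:M - P) + second_deriv (v_of rho) t *: P)).

Definition density_proportional_to (mu : set 'rV[R]_n -> \bar R)
    (g : 'rV[R]_n -> R) := exists c : R, forall A, measurable A ->
  mu A = (c%:E * \int[lebesgue_rV R n]_(x in A) (g x)%:E)%E.

End radial.

(* Main.v *)
(* Write x = e^(t/2) theta with t = 2 ln |x|.  Up to constants mu is the product of
   the uniform measure on the sphere and of m(t) dt, m(t) = exp(n t / 2 - v(t)).  Split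
   f = F(t) + g(t, theta), F being the spherical mean.

   - F: the one-dimensional Brascamp-Lieb inequality, int m F^2 <= int m F'^2 / v''.
     With F(t) - F(s) = int_s^t F', Cauchy-Schwarz with weight v'' and Tonelli, it
     reduces to int int_(s < r < t) (v'(t) - v'(s)) m(s) m(t) <= m(r) int m.
   - g: integrating (g^2 e^(n t / 2))' against e^(-v) / v' gives, for each theta,
     int m g^2 <= int m (d_t g)^2 / v'' + (n / 2) int m g^2 / v'.
   - The last term is controlled by tangential derivatives through the Poincare
     inequality for even functions on the sphere, whose constant 1/(2n) (instead of
     1/(n-1) in general) is exactly what is needed.  It follows from the inequality
     Var(h) <= (1/2) int |grad h|^2 for even h under the Gaussian measure, applied to
     h(y) = |y|^2 g(y / |y|); the Gaussian inequality is obtained by tensorization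
     from the odd and even one-dimensional cases.

   The uniform measure on the sphere is represented as the law of y / |y| for a
   standard Gaussian vector y.  For a merely convex v, v' is the right derivative and
   v'' is bounded above by the lower limit of the difference quotients of v'. *)
From HB Require Import structures.
Require Import Defs.
From mathcomp Require Import all_boot all_order all_algebra.
From mathcomp Require Import all_classical all_reals all_analysis.
From mathcomp Require Import measurable_realfun ring lra.
Import Order.TTheory GRing.Theory Num.Theory.
Import numFieldNormedType.Exports.
Local Open Scope classical_set_scope.
Local Open Scope ring_scope.

Set Implicit Arguments.
Unset Strict Implicit.
Unset Printing Implicit Defensive.

(** * Lebesgue integrals on the line *)

(** The potential [v] may be [+oo], may have corners, and its second derivative may have a singular
    part. The working object is therefore [E t = rho (e^t)], for which convexity of [v] is a
    four-point product inequality. Derivatives of [E] and of the slope are limits of difference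
    quotients; each singular contribution has the favourable sign, so one-sided bounds and Fatou's
    lemma suffice. Since [v'] may vanish, [1 / v'] is first replaced by [1 / (v' + d)], at the price
    of [n / 2 + d] for [n / 2]. The constants close exactly: with [x = e^(t/2) theta], [(d_t f)^2]
    is [|x|^2 / 4] times the squared radial derivative, the factor found in [(1/2) H^-1], and the
    spherical inequality bounds [(n / 2) int g^2] by [|x|^2 / 4] times the squared tangential
    gradient. The area of the sphere is never computed: polar coordinates are used up to a constant,
    only shown to be finite and positive. Nor is the quadratic form of [H^-1] shown to be
    measurable: off a null set it is bounded below by a measurable function, and that is enough. *)

Section lebesgue_affine.
Context {R : realType}.
Notation mu := (@lebesgue_measure R).

Let push {d} {T : measurableType d} (f : measurableTypeR R -> T) (mf : measurable_fun setT f) :=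
  measure_function_pushforward__canonical__measure_function_Measure mu mf.

Lemma measurable_shift (c : R) :
  measurable_fun setT (fun x : measurableTypeR R => (x + c : measurableTypeR R)).
Proof. exact: measurable_funD. Qed.

Lemma lebesgue_measure_shift (c : R) (A : set R) : measurable A ->
  pushforward mu (fun x : measurableTypeR R => (x + c : measurableTypeR R)) A = mu A.
Proof.
move=> mA; apply/esym.
apply: (@lebesgue_measure_unique R (push (measurable_shift c))) => //= _ [[a b]] _ <-.
rewrite /pushforward (_ : _ @^-1` _ = `](a - c)%R, (b - c)%R]%classic).
  rewrite !lebesgue_measure_itv/= !lte_fin ltrD2r; case: ifP => // _.
  by rewrite -!EFinD; congr EFin; ring.
by apply/seteqP; split => x /=; rewrite !in_itv/= ltrBlDr lerBrDr.
Qed.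

Lemma ge0_integral_shift (c : R) (f : R -> \bar R) :
  measurable_fun setT f -> (forall x, (0 <= f x)%E) ->
  (\int[mu]_x f (x + c)%R = \int[mu]_x f x)%E.
Proof.
move=> mf f0.
rewrite -(@ge0_integral_pushforward _ _ _ _ _ _ (measurable_shift c) mu setT f)//.
by apply: (@eq_measure_integral _ _ _ _ mu (push (measurable_shift c)))
  => A mA _; exact: lebesgue_measure_shift.
Qed.

Let measurable_scale (c : R) : measurable_fun setT
  (fun x : measurableTypeR R => (c * x : measurableTypeR R)).
Proof. exact: measurable_funM. Qed.

Lemma lebesgue_measure_scale (c : R) (A : set R) : 0 < c -> measurable A ->
  mu ((fun x => c * x) @^-1` A) = (c^-1%:E * mu A)%E.
Proof.
move=> c0 mA.
have c0' : 0 <= c by exact: ltW.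
pose cn : {nonneg R} := NngNum c0'.
have -> : mu A = mscale cn (push (measurable_scale c)) A.
  apply: (@lebesgue_measure_unique R (mscale cn (push (measurable_scale c)))) => //= _ [[a b]] _ <-.
  rewrite /mscale/= /pushforward (_ : _ @^-1` _ = `](c^-1 * a)%R, (c^-1 * b)%R]%classic).
    rewrite !lebesgue_measure_itv/= !lte_fin ltr_pM2l ?invr_gt0//; case: ifP => // _.
      by rewrite -!EFinD -EFinM; congr EFin; field; exact: lt0r_neq0.
    by rewrite mule0.
  by apply/seteqP; split => x /=; rewrite !in_itv/= !(mulrC c^-1) ltr_pdivrMr// ler_pdivlMr// (mulrC x).
by rewrite /mscale/= muleA -EFinM mulVf ?mul1e ?lt0r_neq0.
Qed.

Lemma ge0_integral_scale (c : R) (f : R -> \bar R) : 0 < c ->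
  measurable_fun setT f -> (forall x, (0 <= f x)%E) ->
  (\int[mu]_x f (c * x)%R = c^-1%:E * \int[mu]_x f x)%E.
Proof.
move=> c0 mf f0.
rewrite -(@ge0_integral_pushforward _ _ _ _ _ _ (measurable_scale c) mu setT f)//.
have c0' : 0 <= c^-1 by rewrite invr_ge0 ltW.
pose cn : {nonneg R} := NngNum c0'.
rewrite (_ : c^-1 = cn%:num)// -(ge0_integral_mscale mu measurableT cn)//.
by apply: (@eq_measure_integral _ _ _ _ (mscale cn mu) (push (measurable_scale c)))
  => A mA _; exact: lebesgue_measure_scale.
Qed.

Let measurable_opp : measurable_fun setT
  (fun x : measurableTypeR R => (- x : measurableTypeR R)).
Proof. exact: measurable_funN. Qed.

Lemma ge0_integral_opp (f : R -> \bar R) :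
  measurable_fun setT f -> (forall x, (0 <= f x)%E) ->
  (\int[mu]_x f (- x)%R = \int[mu]_x f x)%E.
Proof.
move=> mf f0.
rewrite -(@ge0_integral_pushforward _ _ _ _ _ _ measurable_opp mu setT f)//.
by apply: (@eq_measure_integral _ _ _ _ mu (push measurable_opp))
  => A mA _; exact: lebesgue_measureN.
Qed.

End lebesgue_affine.

(** * Fatou's lemma for one-sided limits, and integration by parts by translation *)

Lemma limn_einf_ge {R : realType} (u : R^nat) (x : R) :
  (forall e, 0 < e -> \forall k \near \oo, x - e <= u k) ->
  (x%:E <= limn_einf (EFin \o u))%E.
Proof.
move=> H; apply/lee_addgt0Pr => e e0.
have [N _ HN] := H e e0.
rewrite -leeBlDr//; rewrite limn_einf_lim.
have -> : limn (einfs (EFin \o u)) = ereal_sup (range (einfs (EFin \o u))).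
  by apply/cvg_lim => //; exact: cvg_einfs_sup.
apply: ereal_sup_ge; exists (einfs (EFin \o u) N) => //.
apply: le_ereal_inf_tmp => _ [k /= Nk <-].
by rewrite -EFinD lee_fin; exact: HN.
Qed.

Section fatou_le.
Context d (T : measurableType d) (R : realType) (mu : {measure set T -> \bar R}).

(** Fatou in the form that the whole proof uses: the [g k] need not converge, it is enough that at
    each point they eventually exceed [f - e]. Difference quotients of monotone functions give
    exactly this much, their singular part being dropped. *)
Lemma fatou_le (g : (T -> R)^nat) (f : T -> R) (c : (\bar R)^nat) (l : \bar R) :
  (forall k, measurable_fun setT (g k)) -> (forall k x, 0 <= g k x) ->
  measurable_fun setT f -> (forall x, 0 <= f x) ->
  (forall x e, 0 < e -> \forall k \near \oo, f x - e <= g k x) ->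
  (forall k, (\int[mu]_x (g k x)%:E <= c k)%E) -> c @ \oo --> l ->
  (\int[mu]_x (f x)%:E <= l)%E.
Proof.
move=> mg g0 mf f0 fg gc cl.
apply: (@le_trans _ _ (\int[mu]_x limn_einf (fun k => (g k x)%:E))%E).
  apply: ge0_le_integral => //.
  - by move=> x _; rewrite lee_fin.
  - exact/measurable_EFinP.
  - rewrite /limn_einf; apply: measurableT_comp => //.
    apply: measurable_fun_limn_esup => k; apply: measurableT_comp => //.
    exact/measurable_EFinP.
  - by move=> x _; apply: limn_einf_ge => e; exact: fg.
apply: (@le_trans _ _ (limn_einf (fun k => \int[mu]_x (g k x)%:E))%E).
  apply: fatou => //; first by move=> k; exact/measurable_EFinP.
  by move=> k x _; rewrite lee_fin.
have <- := (cvg_limn_einf_sup cl).1.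
rewrite !limn_einf_lim; apply: lee_lim; [exact: is_cvg_einfs..|].
apply: nearW => n; apply: le_ereal_inf_tmp => _ [k /= nk <-].
by apply: le_trans (gc k); apply: ereal_inf_lbound; exists k.
Qed.

End fatou_le.

Section fatou_translate.
Context {R : realType}.
Notation mu := (@lebesgue_measure R).

Lemma integrable_ge0 d (T : measurableType d) (m : {measure set T -> \bar R})
    (f : T -> R) : measurable_fun setT f -> (forall x, 0 <= f x) ->
  (\int[m]_x (f x)%:E < +oo)%E -> m.-integrable setT (EFin \o f).
Proof.
move=> mf f0 ioo; apply/integrableP; split; first exact/measurable_EFinP.
by under eq_integral do rewrite /= ger0_norm//.
Qed.

(* Integration by parts against the (possibly singular) nonincreasing function
   [G]: a translation of the variable moves the difference quotient from [G] to
   [q], and Fatou's lemma keeps the absolutely continuous part of [- G']. *)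
Lemma ge0_integral_by_parts_le (q q1 G d B : R -> R) :
  measurable_fun setT q -> measurable_fun setT q1 -> measurable_fun setT G ->
  measurable_fun setT d ->
  (forall t, 0 <= q t) -> (forall t, 0 <= G t) -> (forall t, 0 <= d t) ->
  (forall s t, s <= t -> G t <= G s) ->
  (forall t e, 0 < e ->
    \forall k \near \oo, d t - e <= k.+1%:R * (G t - G (t + k.+1%:R^-1))) ->
  (forall t, k.+1%:R * (q t - q (t - k.+1%:R^-1)) @[k --> \oo] --> q1 t) ->
  (forall t k, `|k.+1%:R * (q t - q (t - k.+1%:R^-1))| * G t <= B t) ->
  mu.-integrable setT (EFin \o B) ->
  (\int[mu]_t (q t * G t)%:E < +oo)%E ->
  mu.-integrable setT (fun t => (q1 t * G t)%:E) /\
  (\int[mu]_t (q t * d t)%:E <= \int[mu]_t (q1 t * G t)%:E)%E.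
Proof.
move=> mq mq1 mG md q0 G0 d0 Gni Gd qq1 qB iB iqG.
have mS f c : measurable_fun setT f -> measurable_fun setT (fun t : R => f (t + c) : R).
  move=> mf; apply: measurableT_comp => //; exact: measurable_shift.
pose Q k t := k.+1%:R * (q t - q (t - k.+1%:R^-1)) * G t.
have mQ k : measurable_fun setT (Q k).
  apply: measurable_funM => //; apply: measurable_funM => //.
  by apply: measurable_funB => //; exact: mS.
(* The quotients of [q] converge and are dominated by [B], so this side is a true limit; only the
   side of [G] has to go through Fatou. *)
have [| | | | |iq1G _ cvgQ] := @dominated_convergence _ _ _ mu setT measurableT
  (fun k t => (Q k t)%:E) (fun t => (q1 t * G t)%:E) (EFin \o B).
- by move=> k; apply/measurable_EFinP; exact: mQ.
- by apply/measurable_EFinP; exact: measurable_funM.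
- apply/aeW => t _; apply: cvg_EFin; first exact: nearW.
  by apply: cvgMl; exact: qq1.
- exact: iB.
- apply/aeW => t k _; rewrite lee_fin /Q normrM (ger0_norm (G0 t)).
  exact: qB.
split=> //.
apply: (@fatou_le _ _ _ mu
  (fun k t => q t * (k.+1%:R * (G t - G (t + k.+1%:R^-1)))) _
  (fun k => \int[mu]_t (Q k t)%:E)%E) => //.
- move=> k; apply: measurable_funM => //; apply: measurable_funM => //.
  by apply: measurable_funB => //; exact: mS.
- by move=> k t; rewrite mulr_ge0// mulr_ge0// subr_ge0 Gni// lerDl invr_ge0 ler0n.
- exact: measurable_funM.
- by move=> t; rewrite mulr_ge0.
- move=> t e e0.
  (* Dividing by [1 + q t] absorbs the factor [q t] and also covers [q t = 0]. *)
  have e'0 : 0 < e / (1 + q t) by rewrite divr_gt0// ltr_pwDl.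
  near=> k.
  have Hk : d t - e / (1 + q t) <= k.+1%:R * (G t - G (t + k.+1%:R^-1)).
    by near: k; exact: Gd.
  apply: le_trans (ler_wpM2l (q0 t) Hk).
  rewrite mulrBr lerD2l lerN2 mulrA ler_pdivrMr ?ltr_pwDl//.
  by rewrite mulrC ler_wpM2l ?(ltW e0)// lerDr.
- move=> k; have k0 : 0 < k.+1%:R^-1 :> R by rewrite invr_gt0.
  have mqG : measurable_fun setT (fun t : R => q t * G t) by exact: measurable_funM.
  have mqGs : measurable_fun setT (fun t : R => q t * G (t + k.+1%:R^-1)).
    by apply: measurable_funM => //; exact: mS.
  have mqsG : measurable_fun setT (fun t : R => q (t - k.+1%:R^-1) * G t).
    by apply: measurable_funM => //; exact: mS.
  (* Translation invariance is the discrete integration by parts: a forward step of [G] becomes a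
     backward step of [q]. *)
  have qGs : (\int[mu]_t (q t * G (t + k.+1%:R^-1))%:E =
              \int[mu]_t (q (t - k.+1%:R^-1) * G t)%:E)%E.
    rewrite -(ge0_integral_shift k.+1%:R^-1
      (f := fun t => (q (t - k.+1%:R^-1) * G t)%:E)).
    + by under [RHS]eq_integral do rewrite addrK.
    + exact/measurable_EFinP.
    + by move=> t; rewrite lee_fin mulr_ge0.
  have iqG' : mu.-integrable setT (fun t => (q t * G t)%:E).
    by apply: integrable_ge0 => // t; rewrite mulr_ge0.
  have iqGs : (\int[mu]_t (q t * G (t + k.+1%:R^-1))%:E < +oo)%E.
    apply: le_lt_trans iqG; apply: ge0_le_integral => //.
    + by move=> t _; rewrite lee_fin mulr_ge0.
    + exact/measurable_EFinP.
    + exact/measurable_EFinP.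
    + move=> t _; rewrite lee_fin ler_wpM2l//.
      by apply: Gni; rewrite lerDl ltW.
  have iqGs' : mu.-integrable setT (fun t => (q t * G (t + k.+1%:R^-1))%:E).
    by apply: integrable_ge0 => // t; rewrite mulr_ge0.
  have iqsG' : mu.-integrable setT (fun t => (q (t - k.+1%:R^-1) * G t)%:E).
    by apply: integrable_ge0; [|move=> t; rewrite mulr_ge0|rewrite -qGs].
  rewrite [leLHS](_ : _ = \int[mu]_t (k.+1%:R%:E *
      ((q t * G t)%:E - (q t * G (t + k.+1%:R^-1))%:E)))%E; last first.
    by apply: eq_integral => t _; rewrite -EFinB -EFinM; congr EFin; ring.
  rewrite [leRHS](_ : _ = \int[mu]_t (k.+1%:R%:E *
      ((q t * G t)%:E - (q (t - k.+1%:R^-1) * G t)%:E)))%E; last first.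
    by apply: eq_integral => t _; rewrite -EFinB -EFinM /Q; congr EFin; ring.
  rewrite !integralZl//; [|exact: integrableB..].
  by rewrite !integralB// qGs.
Unshelve. all: end_near. Qed.

End fatou_translate.

(** * The one-dimensional inequalities along a ray *)

Section difference_quotients.
Context {R : realType}.

(** The sign of [c] selects forward or backward quotients; [c = -1] is the case that the integration
    by parts produces. *)
Lemma is_derive_cvg_seq (q : R -> R) (t l c : R) : c != 0 -> is_derive t 1 q l ->
  k.+1%:R * (q (t + c * k.+1%:R^-1) - q t) @[k --> \oo] --> c * l.
Proof.
move=> c0 [dq ql].
have H : h^-1 *: (q (h *: 1 + t) - q t) @[h --> 0^'] --> l by rewrite -ql; exact: dq.
have S : c * k.+1%:R^-1 @[k --> \oo] --> (0 : R).
  by rewrite -[X in _ --> X](mulr0 c); apply: cvgMr; exact: cvg_harmonic.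
have /(_ (fun k => c * k.+1%:R^-1)) := (cvgr_dnbhsP _ _ _).1 H.
case/(_ _)/Wrap.
  by split=> // n; rewrite mulf_neq0// invr_eq0 pnatr_eq0.
move=> Hc; have : c * ((c * n.+1%:R^-1)^-1 *: (q ((c * n.+1%:R^-1) *: 1 + t) - q t))
    @[n --> \oo] --> c * l by apply: cvgMr; exact: Hc.
apply: cvg_trans; apply: near_eq_cvg; near=> k.
rewrite /= [_ *: 1]mulr1 /GRing.scale/= invfM invrK (addrC t); by field.
Unshelve. all: end_near. Qed.

End difference_quotients.

(* The radial data in the variable [t = log |x|^2]: [E t = rho (e^t)] is
   log-concave and nonincreasing, [u] is the right derivative of [- ln E], and
   [b] is a measurable lower bound of the derivative of [u]. *)
Record log_profile {R : realType} (E u b : R -> R) : Prop := LogProfile {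
  lp_mE : measurable_fun setT E;
  lp_mu : measurable_fun setT u;
  lp_mb : measurable_fun setT b;
  lp_E0 : forall t, 0 <= E t;
  lp_u0 : forall t, 0 <= u t;
  lp_b0 : forall t, 0 <= b t;
  lp_Eni : forall s t, s <= t -> E t <= E s;
  lp_und : forall s t, s <= t -> 0 < E t -> u s <= u t;
  lp_lc : forall s t e, s <= t -> 0 <= e -> E s * E (t + e) <= E (s + e) * E t;
  lp_Eu : forall t, 0 < E t ->
    k.+1%:R * (E t - E (t + k.+1%:R^-1)) @[k --> \oo] --> u t * E t;
  lp_ub : forall t, 0 < E t -> forall e, 0 < e ->
    \forall k \near \oo, b t - e <= k.+1%:R * (u (t + k.+1%:R^-1) - u t)
}.

Section log_profile_theory.
Context {R : realType} (E u b : R -> R) (p : log_profile E u b).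
Notation mu := (@lebesgue_measure R).

(** Right continuity is a by-product of [lp_Eu]: the increment is [1 / (k + 1)] times a convergent
    sequence. *)
Lemma lp_Eright t : 0 < E t -> E (t + k.+1%:R^-1) @[k --> \oo] --> E t.
Proof.
move=> Et.
have H : E t - (k.+1%:R^-1 * (k.+1%:R * (E t - E (t + k.+1%:R^-1))))
    @[k --> \oo] --> E t - 0 * (u t * E t).
  apply: cvgB; first exact: cvg_cst.
  by apply: cvgM; [exact: cvg_harmonic|exact: (lp_Eu p)].
rewrite mul0r subr0 in H; apply: cvg_trans H; apply: near_eq_cvg.
near=> k; field; by rewrite nat1r.
Unshelve. all: end_near. Qed.

Lemma lp_right t : 0 < E t -> \forall k \near \oo, 0 < E (t + k.+1%:R^-1).
Proof. by move=> Et; have /cvgr_gt := lp_Eright Et; exact. Qed.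

(** With [E' = - u E], the formal derivative of [- E / (u + d)] is
    [E u / (u + d) + E u' / (u + d)^2]. Since [u] may jump, its quotients [x] may be unbounded; but
    they enter only through [x / (c + x / (k + 1))] with [c = u t + d], which increases with [x], so
    a lower bound of [x] slightly below [b t] is enough. *)
Lemma lp_quotient_rate (d t e : R) : 0 < d -> 0 < e ->
  \forall k \near \oo, E t * (u t / (u t + d) + b t / (u t + d) ^+ 2) - e <=
    k.+1%:R * (E t / (u t + d) -
               E (t + k.+1%:R^-1) / (u (t + k.+1%:R^-1) + d)).
Proof.
move=> d0 e0.
have ud0 s : 0 < u s + d by rewrite ltr_wpDl// (lp_u0 p).
have := lp_E0 p t; rewrite le_eqVlt => /predU1P[Et0|Et].
  near=> k; rewrite -Et0 !mul0r add0r sub0r.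
  have -> : E (t + k.+1%:R^-1) = 0.
    apply/eqP; rewrite eq_le (lp_E0 p) andbT Et0.
    by apply: (lp_Eni p); rewrite lerDl invr_ge0.
  by rewrite mul0r oppr0 mulr0 oppr_le0 ltW.
set c := u t + d; have c0 : 0 < c := ud0 t.
(* Lowering [b t] by this amount lowers [E t * (b t / c^2)] by exactly [e / 4]. *)
pose y := b t - (e / 4) * c ^+ 2 / E t.
have cvg1 : c^-1 * (k.+1%:R * (E t - E (t + k.+1%:R^-1))) +
    E (t + k.+1%:R^-1) * (c^-1 * (y / (c + y * k.+1%:R^-1))) @[k --> \oo] -->
    c^-1 * (u t * E t) + E t * (c^-1 * (y / (c + y * 0))).
  apply: cvgD; first by apply: cvgMr; exact: (lp_Eu p).
  apply: cvgM; first exact: lp_Eright.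
  apply: cvgMr; apply: cvgMr; apply: cvgV; first by rewrite mulr0 addr0 lt0r_neq0.
  by apply: cvgD; [exact: cvg_cst|apply: cvgMr; exact: cvg_harmonic].
have lim1 : c^-1 * (u t * E t) + E t * (c^-1 * (y / (c + y * 0))) =
    E t * (u t / c + b t / c ^+ 2) - e / 4.
  by rewrite /y; field; rewrite !lt0r_neq0.
have cvg2 : E (t + k.+1%:R^-1) @[k --> \oo] --> E t by exact: lp_Eright.
(* If [y <= 0], the curvature term is itself at most [e / 4] and the monotonicity of [u] suffices.
   If [y > 0], all denominators are positive and the monotone comparison in [x] applies. *)
have [y0|y0] := leP y 0.
- have H1 : c^-1 * (k.+1%:R * (E t - E (t + k.+1%:R^-1))) @[k --> \oo] -->
      c^-1 * (u t * E t) by apply: cvgMr; exact: (lp_Eu p).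
  have /cvgrPdist_le/(_ (e / 2)) := H1; rewrite divr_gt0// => /(_ isT) H2.
  near=> k.
  have Ek : 0 < E (t + k.+1%:R^-1) by near: k; exact: lp_right.
  have uk : u t <= u (t + k.+1%:R^-1).
    by apply: (lp_und p) => //; rewrite lerDl invr_ge0.
  have : `|c^-1 * (u t * E t) - c^-1 * (k.+1%:R * (E t - E (t + k.+1%:R^-1)))|
     <= e / 2 by near: k.
  rewrite ler_norml => /andP[_ H3].
  have H4 : E t * (b t / c ^+ 2) <= e / 4.
    move: y0; rewrite /y subr_le0 ler_pdivlMr// => y0.
    by rewrite mulrA ler_pdivrMr ?exprn_gt0// mulrC.
  have H5 : c^-1 * (k.+1%:R * (E t - E (t + k.+1%:R^-1))) <=
    k.+1%:R * (E t / c - E (t + k.+1%:R^-1) / (u (t + k.+1%:R^-1) + d)).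
    rewrite mulrCA ler_wpM2l// mulrBr (mulrC _ (E t)) (mulrC _ (E (_ + _))).
    rewrite lerD2l lerN2 ler_wpM2l ?(ltW Ek)//.
    by rewrite lef_pV2 ?posrE// lerD2r.
  rewrite mulrDr.
  have -> : E t * (u t / c) = c^-1 * (u t * E t) by ring.
  lra.
- have /cvgrPdist_le/(_ (e / 4)) := cvg1; rewrite divr_gt0// => /(_ isT) H2.
  near=> k.
  have Ek : 0 < E (t + k.+1%:R^-1) by near: k; exact: lp_right.
  have uk : u t <= u (t + k.+1%:R^-1).
    by apply: (lp_und p) => //; rewrite lerDl invr_ge0.
  have : `|c^-1 * (u t * E t) + E t * (c^-1 * (y / (c + y * 0))) -
     (c^-1 * (k.+1%:R * (E t - E (t + k.+1%:R^-1))) +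
    E (t + k.+1%:R^-1) * (c^-1 * (y / (c + y * k.+1%:R^-1))))|
     <= e / 4 by near: k.
  rewrite lim1 ler_norml => /andP[_ H3].
  have H4 : y <= k.+1%:R * (u (t + k.+1%:R^-1) - u t).
    near: k; apply: (lp_ub p) => //.
    by rewrite !mulr_gt0 ?invr_gt0 ?exprn_gt0 ?divr_gt0.
  set x := k.+1%:R * _ in H4.
  have k0 : 0 < k.+1%:R^-1 :> R by rewrite invr_gt0.
  have ukE : u (t + k.+1%:R^-1) + d = c + x * k.+1%:R^-1.
    by rewrite /x /c; field; rewrite ?nat1r.
  have H5 : y / (c + y * k.+1%:R^-1) <= x / (c + x * k.+1%:R^-1).
    rewrite ler_pdivrMr; last by rewrite addr_gt0// mulr_gt0.
    rewrite mulrAC ler_pdivlMr; last first.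
      by rewrite addr_gt0// mulr_gt0// (lt_le_trans y0).
    rewrite -subr_ge0 [leRHS](_ : _ = c * (x - y)); last by ring.
    by rewrite mulr_ge0 ?(ltW c0)// subr_ge0.
  have -> : k.+1%:R * (E t / c - E (t + k.+1%:R^-1) / (u (t + k.+1%:R^-1) + d)) =
     c^-1 * (k.+1%:R * (E t - E (t + k.+1%:R^-1))) +
      E (t + k.+1%:R^-1) * (c^-1 * (x / (c + x * k.+1%:R^-1))).
    rewrite -ukE /x /c; field.
    by rewrite !lt0r_neq0.
  have H6 : E (t + k.+1%:R^-1) * (c^-1 * (y / (c + y * k.+1%:R^-1))) <=
    E (t + k.+1%:R^-1) * (c^-1 * (x / (c + x * k.+1%:R^-1))).
    by rewrite ler_wpM2l ?(ltW Ek)// ler_wpM2l// invr_ge0 ltW.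
  lra.
Unshelve. all: end_near. Qed.

End log_profile_theory.

Section integral_tools.
Context d (T : measurableType d) (R : realType) (mu : {measure set T -> \bar R}).

Lemma le_integral_ge0 (D : set T) (f g : T -> \bar R) : measurable D ->
  mu.-integrable D f -> measurable_fun D g -> (forall x, D x -> (0 <= g x)%E) ->
  (forall x, D x -> (f x <= g x)%E) ->
  (\int[mu]_(x in D) f x <= \int[mu]_(x in D) g x)%E.
Proof.
move=> mD fi mg g0 fg.
have [->|goo] := eqVneq (\int[mu]_(x in D) g x)%E +oo%E; first exact: leey.
have gi : mu.-integrable D g.
  apply/integrableP; split=> //.
  rewrite (eq_integral g) ?ltey// => x /[!inE] Dx.
  by rewrite gee0_abs// g0.
by apply: le_integral => // x /[!inE] Dx; exact: fg.
Qed.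

End integral_tools.

(** * The weighted Poincare inequality on the line *)

Section weighted_poincare.
Context {R : realType}.
Notation mu := (@lebesgue_measure R).

(** Real powers are measurable; writing the inverse as [x * (x^2)^(-1)] keeps their base
    nonnegative, restores the sign, and gives the value [0] at [0]. *)
Lemma measurable_invr : measurable_fun setT (@GRing.inv R).
Proof.
rewrite (_ : @GRing.inv R = fun x => x * (x ^+ 2) `^ (-1)).
  apply: measurable_funM => //.
  by apply: (@measurableT_comp _ _ _ _ _ _ (fun x : R => x `^ (-1))).
apply/funext => x; rewrite powR_inv1 ?sqr_ge0//.
have [->|x0] := eqVneq x 0; first by rewrite invr0 mul0r.
by field.
Qed.

(** For [b > 0] the difference of the two sides is the square [b^-1 (g1 - g b w)^2]. The extended
    inverse makes the bound true at [b = 0] too: the right side is then [+oo], unless [g1 = 0], in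
    which case the left side vanishes. *)
Lemma weighted_amgm (g g1 w b : R) : 0 <= b ->
  ((2 * g * g1 * w)%:E <= (g1 ^+ 2)%:E * b%:E^-1 + (g ^+ 2 * b * w ^+ 2)%:E)%E.
Proof.
move=> b0; rewrite /inve; have [->|bn0] := eqVneq b 0.
  have [->|g10] := eqVneq g1 0.
    by rewrite mulr0 mul0r expr0n/= mul0e add0e mulr0 mul0r.
  by rewrite gt0_muley ?addye ?leey// lte_fin exprn_even_gt0.
have {}b0 : 0 < b by rewrite lt_def bn0.
rewrite -EFinM -EFinD lee_fin -subr_ge0.
rewrite [leRHS](_ : _ = b^-1 * (g1 - g * b * w) ^+ 2).
  by rewrite mulr_ge0 ?sqr_ge0// invr_ge0 ltW.
by field.
Qed.

Lemma measurable_inve (b : R -> R) : measurable_fun setT b ->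
  (forall t, 0 <= b t) -> measurable_fun setT (fun t => (b t)%:E^-1)%E.
Proof.
move=> mb b0; pose h (x : R) : \bar R := (x%:E^-1)%E.
have -> : (fun t => (b t)%:E^-1)%E = h \o b by [].
apply: measurableT_comp => //.
rewrite (_ : h = fun x => if x == 0 then +oo%E else (x^-1)%:E); last exact/funext.
apply: measurable_fun_if => //.
- exact: measurable_fun_eqr.
- apply/measurable_EFinP; apply: measurable_funTS; exact: measurable_invr.
Qed.

(** The derivative of [g^2 e^(a t)] is integrated against [E / (u + d)]. The arithmetic-geometric
    inequality with weight [b] splits the cross term into the wanted energy and the curvature
    integral [A2], which also stands on the left and cancels. The identity
    [1 = u / (u + d) + d / (u + d)] then turns [a] into [a + d]. The shift [d] keeps the weight
    bounded where the slope vanishes. *)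
Lemma lp_weighted_poincare (E u b : R -> R) (p : log_profile E u b)
    (a d K : R) (g g1 : R -> R) : 0 <= a -> 0 < d ->
  (\int[mu]_t (E t * expR (a * t))%:E < +oo)%E ->
  (forall t, `|g t| <= K) -> (forall t, `|g1 t| <= K) ->
  measurable_fun setT g1 -> (forall t : R, is_derive t 1 g (g1 t)) ->
  (\int[mu]_t (E t * expR (a * t) * g t ^+ 2)%:E <=
   \int[mu]_t ((E t * expR (a * t) * g1 t ^+ 2)%:E * (b t)%:E^-1) +
   (a + d)%:E * \int[mu]_t (E t * expR (a * t) * g t ^+ 2 / (u t + d))%:E)%E.
Proof.
move=> a0 d0 mfin gK g1K mg1 gg1.
set m := fun t => E t * expR (a * t).
have K0 : 0 <= K by exact: le_trans (gK 0).
have m0 t : 0 <= m t by rewrite mulr_ge0 ?expR_ge0 ?(lp_E0 p).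
have mE := lp_mE p; have mu_ := lp_mu p; have mb := lp_mb p.
have mexp : measurable_fun setT (fun t : R => expR (a * t)).
  by apply: measurableT_comp => //; exact: mulrl_measurable.
have mm : measurable_fun setT m by exact: measurable_funM.
have mg : measurable_fun setT g.
  apply: continuous_measurable_fun => t.
  by apply/differentiable_continuous/derivable1_diffP; case: (gg1 t).
have ud0 t : 0 < u t + d by rewrite ltr_wpDl ?(lp_u0 p).
have mphi : measurable_fun setT (fun t : R => (u t + d)^-1).
  apply: (@measurableT_comp _ _ _ _ _ _ (@GRing.inv R)); first exact: measurable_invr.
  exact: measurable_funD.
have phi0 t : 0 <= (u t + d)^-1 by rewrite invr_ge0 ltW.
have b0 := lp_b0 p.
have u0 := lp_u0 p.
have mg2 : measurable_fun setT (fun t : R => g t ^+ 2) by exact: measurable_funX.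
pose q t := g t ^+ 2 * expR (a * t).
pose q1 t := (2 * g t * g1 t + a * g t ^+ 2) * expR (a * t).
pose G t := E t / (u t + d).
pose D t := E t * (u t / (u t + d) + b t / (u t + d) ^+ 2).
pose C := (2 * K * K + a * K ^+ 2).
have C0 : 0 <= C by rewrite addr_ge0 ?mulr_ge0 ?exprn_ge0.
have mphi2 : measurable_fun setT (fun t : R => (u t + d) ^- 2).
  under eq_fun do rewrite -exprVn.
  exact: measurable_funX.
have dq t : is_derive (t : R) 1 q (q1 t).
  rewrite /q.
  have dg := gg1 t.
  have -> : q1 t = (g t ^+ 2) *: (a * expR (a * t)) + expR (a * t) *: (2 * g t * g1 t).
    by rewrite /q1 /GRing.scale/=; ring.
  apply: is_deriveM.
    by apply: is_derive_eq; rewrite /GRing.scale/=; ring.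
  by apply: is_derive_eq; rewrite /GRing.scale/=; ring.
have q1C s : `|q1 s| <= C * expR (a * s).
  rewrite /q1 normrM (ger0_norm (expR_ge0 _)) ler_wpM2r ?expR_ge0//.
  rewrite (le_trans (ler_normD _ _))// lerD//.
    rewrite -mulrA -mulrA !normrM gtr0_norm// ler_wpM2l// ler_pM//.
  rewrite normrM (ger0_norm a0) ler_wpM2l// normrX.
  by rewrite lerXn2r// nnegrE.
have q0 t : 0 <= q t by rewrite mulr_ge0 ?sqr_ge0 ?expR_ge0.
have G0 t : 0 <= G t by rewrite mulr_ge0 ?(lp_E0 p).
have [|||||||||||||i1 H] := @ge0_integral_by_parts_le R q q1 G D
  (fun t => C / d * m t).
- exact: measurable_funM.
- apply: measurable_funM => //; apply: measurable_funD; last exact: measurable_funM.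
  by apply: measurable_funM => //; exact: measurable_funM.
- exact: measurable_funM.
- apply: measurable_funM => //; apply: measurable_funD; exact: measurable_funM.
- exact: q0.
- exact: G0.
- by move=> t; rewrite mulr_ge0 ?(lp_E0 p)// addr_ge0// mulr_ge0// invr_ge0 exprn_ge0// ltW.
- move=> s t st; rewrite /G.
  have := lp_E0 p t; rewrite le_eqVlt => /predU1P[<-|Et].
    by rewrite mul0r mulr_ge0 ?(lp_E0 p).
  rewrite ler_pM ?(lp_E0 p) ?(lp_Eni p)//.
  by rewrite lef_pV2 ?posrE// lerD2r (lp_und p).
- move=> t e e0; exact: (lp_quotient_rate p).
- move=> t; have N10 : (-1 : R) != 0 by rewrite oppr_eq0 oner_neq0.
  have := is_derive_cvg_seq N10 (dq t).
  move=> /cvgN; rewrite mulN1r opprK; apply: cvg_trans; apply: near_eq_cvg.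
  by near=> k; rewrite fctE mulN1r -mulrN opprB.
- move=> t k.
  have k0 : 0 < k.+1%:R^-1 :> R by rewrite invr_gt0.
  (* The mean value point satisfies [c < t], so the quotient is at most [C e^(a c) <= C e^(a t)] as
     [a >= 0]; together with [G <= E / d] this is the domination. *)
  have [||c ct ->] := @MVT R q q1 (t - k.+1%:R^-1) t.
  + by rewrite ltrBlDr ltrDl.
  + apply: continuous_subspaceT => x.
    by apply/differentiable_continuous/derivable1_diffP; case: (dq x).
  rewrite (_ : _ * (_ * _) = q1 c); last by field; rewrite nat1r.
  apply: (@le_trans _ _ (C * expR (a * t) * G t)).
    rewrite ler_wpM2r ?mulr_ge0 ?(lp_E0 p)// (le_trans (q1C c))// ler_wpM2l// ler_expR.
    by rewrite ler_wpM2l// (itvP ct).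
  rewrite /G /m.
  rewrite [leRHS](_ : _ = C * expR (a * t) * (E t / d)); last by ring.
  rewrite ler_wpM2l ?mulr_ge0 ?expR_ge0// ler_wpM2l ?(lp_E0 p)//.
  by rewrite lef_pV2 ?posrE// lerDr.
- have im : mu.-integrable setT (fun t => (m t)%:E) by exact: integrable_ge0.
  by have := integrableZl measurableT (C / d) im.
- apply: (@le_lt_trans _ _ (\int[mu]_t ((K ^+ 2 / d)%:E * (m t)%:E))%E).
    apply: ge0_le_integral => //.
    + by move=> t _; rewrite lee_fin mulr_ge0.
    + apply/measurable_EFinP; apply: measurable_funM; exact: measurable_funM.
    + apply: measurable_funeM; exact/measurable_EFinP.
    + move=> t _; rewrite -EFinM lee_fin /q /G /m.
      rewrite [leLHS](_ : _ = (g t ^+ 2 / (u t + d)) * (E t * expR (a * t))); last by ring.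
      apply: ler_wpM2r; first exact: m0.
      rewrite ler_pM ?sqr_ge0//.
        by rewrite -(real_normK (num_real (g t))) lerXn2r ?nnegrE.
      by rewrite lef_pV2 ?posrE// lerDr.
  rewrite ge0_integralZl//; last 3 first.
  + exact/measurable_EFinP.
  + by move=> t _; rewrite lee_fin.
  + by rewrite lee_fin divr_ge0 ?sqr_ge0// ltW.
  by rewrite lte_mul_pinfty// lee_fin divr_ge0 ?sqr_ge0// ltW.
set A1 := (\int[mu]_t (m t * g t ^+ 2 * (u t / (u t + d)))%:E)%E.
set A2 := (\int[mu]_t (m t * g t ^+ 2 * (b t / (u t + d) ^+ 2))%:E)%E.
set A3 := (\int[mu]_t (m t * g t ^+ 2 / (u t + d))%:E)%E.
pose Z := (\int[mu]_t ((m t * g1 t ^+ 2)%:E * (b t)%:E^-1))%E.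
change (\int[mu]_t (m t * g t ^+ 2)%:E <= Z + (a + d)%:E * A3)%E.
have mA1 : measurable_fun setT (fun t => (m t * g t ^+ 2 * (u t / (u t + d)))%:E).
  by apply/measurable_EFinP; apply: measurable_funM; exact: measurable_funM.
have mA2 : measurable_fun setT (fun t => (m t * g t ^+ 2 * (b t / (u t + d) ^+ 2))%:E).
  by apply/measurable_EFinP; apply: measurable_funM; exact: measurable_funM.
have mA3 : measurable_fun setT (fun t => (m t * g t ^+ 2 / (u t + d))%:E).
  by apply/measurable_EFinP; apply: measurable_funM => //; exact: measurable_funM.
have mZ : measurable_fun setT (fun t => (m t * g1 t ^+ 2)%:E * (b t)%:E^-1)%E.
  apply: emeasurable_funM; last exact: measurable_inve.
  by apply/measurable_EFinP; apply: measurable_funM => //; exact: measurable_funX.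
have mg0 t : 0 <= m t * g t ^+ 2 by rewrite mulr_ge0 ?sqr_ge0.
have mg10 t : 0 <= m t * g1 t ^+ 2 by rewrite mulr_ge0 ?sqr_ge0.
have ge1 t : (0 <= (m t * g t ^+ 2 * (u t / (u t + d)))%:E)%E.
  by rewrite lee_fin mulr_ge0// mulr_ge0.
have ge2 t : (0 <= (m t * g t ^+ 2 * (b t / (u t + d) ^+ 2))%:E)%E.
  by rewrite lee_fin mulr_ge0// mulr_ge0// invr_ge0 exprn_ge0// ltW.
have ge3 t : (0 <= (m t * g t ^+ 2 / (u t + d))%:E)%E.
  by rewrite lee_fin mulr_ge0.
have geZ t : (0 <= (m t * g1 t ^+ 2)%:E * (b t)%:E^-1)%E.
  by rewrite mule_ge0 ?lee_fin// inve_ge0 lee_fin.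
have HL : (A1 + A2 = \int[mu]_t (q t * D t)%:E)%E.
  rewrite -ge0_integralD//; apply: eq_integral => t _.
  by rewrite -EFinD /q /D /m; congr EFin; ring.
have HR : (\int[mu]_t (q1 t * G t)%:E <= Z + A2 + a%:E * A3)%E.
  have mA3' := measurable_funeM a%:E mA3.
  have ge3' t : (0 <= a%:E * (m t * g t ^+ 2 / (u t + d))%:E)%E by rewrite mule_ge0.
  have mZA2 := emeasurable_funD mZ mA2.
  have geZA2 t : (0 <= (m t * g1 t ^+ 2)%:E * (b t)%:E^-1 +
      (m t * g t ^+ 2 * (b t / (u t + d) ^+ 2))%:E)%E by rewrite adde_ge0.
  have -> : (Z + A2 + a%:E * A3 = \int[mu]_t ((m t * g1 t ^+ 2)%:E * (b t)%:E^-1 +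
      (m t * g t ^+ 2 * (b t / (u t + d) ^+ 2))%:E +
      a%:E * (m t * g t ^+ 2 / (u t + d))%:E))%E.
    by rewrite !ge0_integralD// ge0_integralZl.
  apply: le_integral_ge0 => //.
  - exact: emeasurable_funD.
  - by move=> t _; rewrite adde_ge0.
  move=> t _.
  have -> : q1 t * G t = m t * (2 * g t * g1 t * (u t + d)^-1) +
    a * (m t * g t ^+ 2 / (u t + d)) by rewrite /q1 /G /m; ring.
  rewrite EFinD -EFinM leeD2r// !EFinM.
  have := weighted_amgm (g t) (g1 t) (u t + d)^-1 (b0 t).
  move=> /(lee_wpmul2l (m0 t : (0 <= (m t)%:E)%E)).
  rewrite -!EFinM => /le_trans; apply.
  rewrite ge0_muleDr; last 2 first.
    by rewrite mule_ge0 ?inve_ge0 ?lee_fin ?sqr_ge0.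
    by rewrite lee_fin mulr_ge0 ?sqr_ge0// mulr_ge0 ?sqr_ge0.
  rewrite leeD//; first by rewrite muleA -EFinM.
  rewrite -EFinM lee_fin exprVn -subr_ge0 [leRHS](_ : _ = 0)// /m.
  by ring.
(* Cancelling [A2] requires it to be finite: it is a part of the left side, which the integration by
   parts bounds by the integral of an integrable function. *)
have A2fin : A2 \is a fin_num.
  rewrite ge0_fin_numE; last by apply: integral_ge0.
  apply: (@le_lt_trans _ _ (A1 + A2)%E).
    by rewrite leeDr//; apply: integral_ge0.
  by rewrite HL; apply: le_lt_trans H _; apply: integrable_lty.
have HF : (A1 <= Z + a%:E * A3)%E.
  rewrite -(leeD2rE A1 _ A2fin) HL (le_trans H)// (le_trans HR)//.
  by rewrite addeAC.
have -> : (\int[mu]_t (m t * g t ^+ 2)%:E = A1 + d%:E * A3)%E.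
  rewrite -ge0_integralZl// -?ge0_integralD//.
  - apply: eq_integral => t _; rewrite -EFinM -EFinD; congr EFin.
    by field; rewrite lt0r_neq0.
  - by move=> t _; rewrite mule_ge0// lee_fin ltW.
  - exact: measurable_funeM.
  - by rewrite lee_fin ltW.
rewrite EFinD ge0_muleDl ?lee_fin ?(ltW d0)//.
by rewrite addeA leeD2r.
Unshelve. all: end_near. Qed.

End weighted_poincare.

(** * Cauchy-Schwarz on an interval, with the curvature as weight *)

Section cauchy_schwarz_step.
Context {R : realType} (E u b : R -> R) (p : log_profile E u b).
Notation mu := (@lebesgue_measure R).

(** A quadratic polynomial in [y] that stays nonnegative has a nonpositive discriminant. This is
    Cauchy-Schwarz without square roots; the integrated form only needs the pointwise bound on
    [2 y F1]. *)
Lemma sqr_le_discr (D A B : R) : 0 <= A -> 0 <= B ->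
  (forall y, 2 * y * D <= A + y ^+ 2 * B) -> D ^+ 2 <= A * B.
Proof.
move=> A0 B0 H; have [B_eq0|Bn0] := eqVneq B 0.
  have [->|Dn0] := eqVneq D 0; first by rewrite expr0n mulr_ge0.
  (* With [B = 0] a linear function of [y] is bounded; this value of [y] would give [A + 1 <= A]. *)
  have := H ((A + 1) / (2 * D)); rewrite B_eq0 mulr0 addr0.
  rewrite (_ : 2 * _ * D = A + 1); last by field.
  by rewrite -lerBrDl subrr ler10.
have {}B0 : 0 < B by rewrite lt_def Bn0.
have := H (D / B); rewrite -subr_ge0.
rewrite (_ : _ - _ = (A * B - D ^+ 2) / B); last by field.
by rewrite pmulr_lge0 ?invr_gt0// subr_ge0.
Qed.

(** The increment of [u] from [s], frozen outside []s, t[]. It is monotone and bounded on the whole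
    line once [E t > 0], whereas [u] itself is known to be monotone only where [E] is positive. *)
Let z s t r : R := if r <= s then 0 else if r < t then u r - u s else u t - u s.

(** Fatou applied to the quotients of [z]: whatever the step, their integral over [r < t] is exactly
    [u t - u s], by a translation. The inequality is strict when [u] has a singular part. *)
Lemma lp_integral_b (s t : R) : s < t -> 0 < E t ->
  (\int[mu]_(r in `[s, t[) (b r)%:E <= (u t - u s)%:E)%E.
Proof.
move=> st Et; set U := u t - u s.
have Epos r : r <= t -> 0 < E r by move=> /(lp_Eni p); exact: lt_le_trans.
have U0 : 0 <= U by rewrite subr_ge0 (lp_und p)// ltW.
have z0 r : 0 <= z s t r.
  rewrite /z; case: ifPn => // sr; rewrite -ltNge in sr; case: ifPn => // rt.
  by rewrite subr_ge0 (lp_und p) ?(ltW sr)// Epos// ltW.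
have zU r : z s t r <= U.
  rewrite /z; case: ifPn => // sr; case: ifPn => // rt.
  by rewrite lerD2r (lp_und p)// ltW.
have znd r r' : r <= r' -> z s t r <= z s t r'.
  move=> rr'; have [rs|sr] := leP r s; first by rewrite {1}/z rs.
  have sr' : s < r' by exact: lt_le_trans rr'.
  rewrite /z !(leNgt _ s) sr sr' /=.
  have [rt|tr] := ltP r t; last by rewrite ltNge (le_trans tr rr').
  by case: ifPn => r't; rewrite lerD2r (lp_und p)// ?(ltW rt)// Epos// ltW.
have mz : measurable_fun setT (z s t).
  have -> : z s t = fun r => if r <= s then 0 else if r < t then u r - u s else u t - u s by [].
  apply: measurable_fun_ifT => //; first exact: measurable_fun_ler.
  apply: measurable_fun_ifT => //; first exact: measurable_fun_ltr.
  by apply: measurable_funB => //; exact: lp_mu p.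
rewrite integral_mkcond.
pose ind r : R := if r < t then 1 else 0.
have mind : measurable_fun setT ind.
  by apply: measurable_fun_ifT => //; exact: measurable_fun_ltr.
have ind0 r : 0 <= ind r by rewrite /ind; case: ifP.
pose f r : R := if (s <= r) && (r < t) then b r else 0.
have mf : measurable_fun setT f.
  apply: measurable_fun_ifT => //; last exact: lp_mb p.
  by apply: measurable_and; [exact: measurable_fun_ler|exact: measurable_fun_ltr].
rewrite [leLHS](_ : _ = \int[mu]_r (f r)%:E)%E; last first.
  apply: eq_integral => r _; rewrite patchE /f; case: ifPn => [|/negP].
    by rewrite inE/= in_itv/= => ->.
  by rewrite inE/= in_itv/= => /negP/negbTE ->.
apply: (@fatou_le _ _ _ mu (fun k r => ind r * (k.+1%:R * (z s t (r + k.+1%:R^-1) - z s t r)))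
   _ (fun=> U%:E)) => //.
- move=> k; apply: measurable_funM => //; apply: measurable_funM => //.
  apply: measurable_funB => //.
  by apply: (measurableT_comp mz); exact: measurable_shift.
- by move=> k r; rewrite mulr_ge0// mulr_ge0// subr_ge0 znd// lerDl invr_ge0.
- by move=> r; rewrite /f; case: ifP => // _; exact: lp_b0 p _.
- move=> r e e0; rewrite /f; case: ifPn => [/andP[sr rt]|_]; last first.
    apply: nearW => k; rewrite sub0r (@le_trans _ _ 0) ?oppr_le0 ?(ltW e0)//.
    by rewrite mulr_ge0// mulr_ge0// subr_ge0 znd// lerDl invr_ge0.
  near=> k.
  have rk : r + k.+1%:R^-1 < t.
    rewrite -ltrBrDl; near: k.
    have := @cvg_harmonic R; move/cvgr_lt => /(_ (t - r)); rewrite subr_gt0; exact.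
  have k0 : 0 < k.+1%:R^-1 :> R by rewrite invr_gt0.
  rewrite /ind rt mul1r.
  have -> : z s t (r + k.+1%:R^-1) - z s t r = u (r + k.+1%:R^-1) - u r.
    have srk : s < r + k.+1%:R^-1 by rewrite (le_lt_trans sr)// ltrDl.
    rewrite /z (leNgt _ s) srk/= rk; move: sr; rewrite le_eqVlt => /predU1P[->|sr].
      by rewrite lexx subr0.
    by rewrite (leNgt _ s) sr/= rt; ring.
  by near: k; apply: (lp_ub p) => //; rewrite Epos// ltW.
- move=> k; have k0 : 0 < k.+1%:R^-1 :> R by rewrite invr_gt0.
  set e := k.+1%:R^-1 in k0 *.
  pose ze r := ind r * z s t r.
  have mze : measurable_fun setT ze by exact: measurable_funM.
  have ze0 r : 0 <= ze r by rewrite mulr_ge0.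
  have zeoo : (\int[mu]_r (ze r)%:E < +oo)%E.
    apply: (@le_lt_trans _ _ (\int[mu]_(r in `[s, t]) U%:E)%E); last first.
      by rewrite integral_cst//= lebesgue_measure_itv/=; case: ifP => _; rewrite ?mule0 ?ltry// -EFinM ltry.
    rewrite [leRHS]integral_mkcond; apply: ge0_le_integral => //.
    + by move=> r _; rewrite lee_fin.
    + exact/measurable_EFinP.
    + apply/(measurable_restrictT _ _).1 => //.
    + move=> r _; rewrite patchE; case: ifPn => [_|/negP].
        rewrite lee_fin /ze /ind; case: ifP => _; by rewrite ?mul1r ?mul0r.
      rewrite inE/= in_itv/= => H.
      rewrite lee_fin /ze /ind; case: ifPn => rt; rewrite ?mul0r// mul1r /z.
      case: ifPn => // rs; exfalso; apply: H.
      by rewrite (ltW rt) andbT ltW// ltNge.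
  pose cut r : R := if (t <= r) && (r < t + e) then U else 0.
  have mcut : measurable_fun setT cut.
    apply: measurable_fun_ifT => //.
    by apply: measurable_and; [exact: measurable_fun_ler|exact: measurable_fun_ltr].
  (* After the shift by [e] the domain [r < t] becomes [r < t + e]; the extra piece lies on the
     plateau of [z], of height [U], and contributes [e * U]. *)
  have shft : (\int[mu]_r (ind r * z s t (r + e))%:E =
      \int[mu]_r (ze r)%:E + \int[mu]_r (cut r)%:E)%E.
    rewrite -ge0_integralD//; last 4 first.
    + by move=> r _; rewrite lee_fin.
    + exact/measurable_EFinP.
    + by move=> r _; rewrite lee_fin /cut; case: ifP.
    + exact/measurable_EFinP.
    rewrite -(ge0_integral_shift e (f := fun r => (ze r)%:E + (cut r)%:E)%E).
    + apply: eq_integral => r _; rewrite -EFinD; congr EFin.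
      rewrite /ze /cut /ind; rewrite ltrD2r.
      have [rt|tr] := ltP r t; rewrite ?andbF ?mul0r ?andbT.
        rewrite !mul1r /z; have [tre|ret] := leP t (r + e).
          by rewrite mul0r add0r (leNgt _ s) (lt_le_trans st tre).
        by rewrite mul1r addr0.
      rewrite ltNge (le_trans tr) ?lerDl ?(ltW k0)//=.
      by rewrite mul0r addr0.
    + by apply: emeasurable_funD; exact/measurable_EFinP.
    + by move=> r; rewrite adde_ge0// lee_fin// /cut; case: ifP.
  have cutE : (\int[mu]_r (cut r)%:E = (e * U)%:E)%E.
    rewrite (_ : (fun _ => _) = (EFin \o cst U) \_ `[t, t + e[); last first.
      apply/funext => r; rewrite patchE /cut; case: ifPn => [H|H].
        by rewrite mem_set//= in_itv.
      by rewrite memNset//= in_itv/=; exact/negP.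
    rewrite -integral_mkcond/= integral_cst//= lebesgue_measure_itv/= lte_fin ltrDl k0.
    by rewrite -EFinD -EFinM; congr EFin; ring.
  have ize : mu.-integrable setT (fun r => (ze r)%:E) by exact: integrable_ge0.
  have mzs : measurable_fun setT (fun r : R => ind r * z s t (r + e)).
    apply: measurable_funM => //.
    by apply: (measurableT_comp mz); exact: measurable_shift.
  have izs : mu.-integrable setT (fun r => (ind r * z s t (r + e))%:E).
    apply: integrable_ge0 => //; first by move=> r; rewrite mulr_ge0.
    by rewrite shft cutE lte_add_pinfty// ltry.
  rewrite [leLHS](_ : _ = \int[mu]_r (k.+1%:R%:E *
      ((ind r * z s t (r + e))%:E - (ze r)%:E)))%E; last first.
    by apply: eq_integral => r _; rewrite -EFinB -EFinM /ze; congr EFin; ring.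
  rewrite integralZl//; last exact: integrableB.
  rewrite integralB// shft cutE addeAC subee ?add0e; last first.
    by rewrite ge0_fin_numE// integral_ge0// => r _; rewrite lee_fin.
  by rewrite -EFinM mulrA divff ?pnatr_eq0// mul1r.
- exact: cvg_cst.
Unshelve. all: end_near. Qed.

(** Cauchy-Schwarz for [F1 = (F1 / sqrt b) sqrt b], then [lp_integral_b] for the integral of [b].
    The finiteness hypothesis makes the discriminant argument one between real numbers. *)
Lemma lp_increment_le (F F1 : R -> R) (s t : R) : s < t -> 0 < E t ->
  continuous F1 -> (forall r : R, is_derive r 1 F (F1 r)) ->
  (\int[mu]_(r in `[s, t[) ((F1 r ^+ 2)%:E * (b r)%:E^-1) < +oo)%E ->
  (((F t - F s) ^+ 2)%:E <=
   (u t - u s)%:E * \int[mu]_(r in `[s, t[) ((F1 r ^+ 2)%:E * (b r)%:E^-1))%E.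
Proof.
move=> st Et cF1 dF; set W := (X in (X < _)%E) => Woo.
have b0 := lp_b0 p.
have mF1 : measurable_fun setT F1 by exact: continuous_measurable_fun.
have mW : measurable_fun setT (fun r => (F1 r ^+ 2)%:E * (b r)%:E^-1)%E.
  apply: emeasurable_funM; last by apply: measurable_inve => //; exact: lp_mb p.
  by apply/measurable_EFinP; exact: measurable_funX.
have geW r : (0 <= (F1 r ^+ 2)%:E * (b r)%:E^-1)%E.
  by rewrite mule_ge0 ?lee_fin ?sqr_ge0// inve_ge0 lee_fin.
have W0 : (0 <= W)%E by exact: integral_ge0.
have Wfin : W \is a fin_num by rewrite ge0_fin_numE.
have U0 : 0 <= u t - u s by rewrite subr_ge0 (lp_und p)// ltW.
have cF : continuous F.
  by move=> x; apply/differentiable_continuous/derivable1_diffP; case: (dF x).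
have FTC : (\int[mu]_(r in `[s, t[) (F1 r)%:E = (F t - F s)%:E)%E.
  rewrite integral_itv_bndo_bndc; last first.
    by apply/measurable_EFinP; apply: measurable_funTS.
  rewrite (@continuous_FTC2 _ F1 F)//.
  - exact: continuous_subspaceT.
  - split.
    + by move=> x _; case: (dF x).
    + by apply: cvg_at_right_filter; exact: cF.
    + by apply: cvg_at_left_filter; exact: cF.
  - by move=> x _; rewrite derive1E; case: (dF x).
change (((F t - F s) ^+ 2)%:E <= (u t - u s)%:E * W)%E.
rewrite -(fineK Wfin) -EFinM lee_fin mulrC.
apply: sqr_le_discr => //; first exact: fine_ge0.
move=> y; rewrite -lee_fin EFinD (fineK Wfin).
have iF1 : mu.-integrable `[s, t[ (EFin \o F1).
  have icc : mu.-integrable `[s, t] (EFin \o F1).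
    by apply: continuous_compact_integrable; [exact: segment_compact|exact: continuous_subspaceT].
  apply: integrableS icc => //; exact: subset_itv_co_cc.
have -> : ((2 * y * (F t - F s))%:E = \int[mu]_(r in `[s, t[) ((2 * y)%:E * (F1 r)%:E))%E.
  by rewrite integralZl// FTC EFinM.
apply: (@le_trans _ _ (W + (y ^+ 2)%:E * \int[mu]_(r in `[s, t[) (b r)%:E)%E); last first.
  rewrite leeD2l// (EFinM (y ^+ 2)); apply: lee_wpmul2l; first by rewrite lee_fin sqr_ge0.
  exact: lp_integral_b.
have mb : measurable_fun `[s, t[ (fun r => (b r)%:E).
  by apply/measurable_EFinP; apply: measurable_funTS; exact: lp_mb p.
rewrite -ge0_integralZl//; last 2 first.
- by move=> r _; rewrite lee_fin.
- by rewrite lee_fin sqr_ge0.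
rewrite -ge0_integralD//; last 3 first.
- exact: measurable_funTS.
- by move=> r _; rewrite mule_ge0 ?lee_fin ?sqr_ge0.
- exact: measurable_funeM.
apply: le_integral_ge0 => //.
- exact: integrableZl.
- apply: emeasurable_funD; [exact: measurable_funTS|exact: measurable_funeM].
- by move=> r _; rewrite adde_ge0// mule_ge0 ?lee_fin ?sqr_ge0.
- move=> r _.
  have := weighted_amgm y (F1 r) 1 (b0 r).
  by rewrite mulr1 expr1n mulr1 -!EFinM.
Qed.

End cauchy_schwarz_step.

Lemma integral_prodM d1 d2 (T1 : measurableType d1) (T2 : measurableType d2)
    (R : realType) (m1 : {sigma_finite_measure set T1 -> \bar R})
    (m2 : {sigma_finite_measure set T2 -> \bar R}) (f : T1 -> R) (g : T2 -> R) :
  measurable_fun setT f -> measurable_fun setT g ->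
  (forall x, 0 <= f x) -> (forall y, 0 <= g y) ->
  (\int[(m1 \x m2)%E]_z (f z.1 * g z.2)%:E =
   (\int[m1]_x (f x)%:E) * \int[m2]_y (g y)%:E)%E.
Proof.
move=> mf mg f0 g0.
rewrite fubini_tonelli1; last 2 first.
- apply/measurable_EFinP; apply: measurable_funM.
    exact: measurableT_comp mf measurable_fst.
  exact: measurableT_comp mg measurable_snd.
- by move=> x; rewrite lee_fin mulr_ge0.
rewrite -ge0_integralZr//; last 3 first.
- exact/measurable_EFinP.
- by move=> x _; rewrite lee_fin.
- by apply: integral_ge0 => y _; rewrite lee_fin.
apply: eq_integral => x _; rewrite /fubini_F/=.
under eq_integral do rewrite EFinM.
rewrite ge0_integralZl//.
- exact/measurable_EFinP.
- by move=> y _; rewrite lee_fin.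
- by rewrite lee_fin.
Qed.

(** * The two-point kernel of the one-dimensional Brascamp-Lieb inequality *)

Section pair_kernel.
(** The identity [(x + y) (y + z) - x z = y (x + (y + z))], stated without a subtraction of extended
    reals. *)
Let fin_cancel {R : realType} (x y z w : \bar R) (n : R) :
  x \is a fin_num -> y \is a fin_num -> z \is a fin_num -> w \is a fin_num ->
  (w + n%:E * (x * z) = n%:E * ((x + y) * (y + z)) ->
   w = n%:E * y * (x + (y + z)))%E.
Proof.
case: x => [x||]//; case: y => [y||]//; case: z => [z||]//; case: w => [w||]//.
move=> _ _ _ _ [H]; rewrite -!EFinD -!EFinM; congr EFin.
by rewrite -[LHS](addrK (n * (x * z))) H; ring.
Qed.

Context {R : realType} (E u b : R -> R) (p : log_profile E u b) (a : R).
Hypothesis a0 : 0 <= a.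
Notation mu := (@lebesgue_measure R).
Let m t := E t * expR (a * t).
Hypothesis moo : (\int[mu]_t (m t)%:E < +oo)%E.

(** The weight that [F1 r ^+ 2 / b r] receives from the pair [(z.1, z.2)] when
    [(F z.2 - F z.1) ^+ 2] is bounded by means of [lp_increment_le]. *)
Definition pair_kernel (r : R) (z : measurableTypeR R * measurableTypeR R) : R :=
  if (z.1 <= r) && (r < z.2) then
    E z.1 * expR (a * z.1) * (E z.2 * expR (a * z.2)) * (u z.2 - u z.1) else 0.

Lemma pair_kernel_ge0 r z : 0 <= pair_kernel r z.
Proof.
rewrite /pair_kernel; case: ifPn => // /andP[zr rz].
have := lp_E0 p z.2; rewrite le_eqVlt => /predU1P[<-|Ez].
  by rewrite mul0r mulr0 mul0r.
have E0 := lp_E0 p.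
rewrite mulr_ge0//; first by rewrite mulr_ge0// mulr_ge0// expR_ge0.
by rewrite subr_ge0 (lp_und p)// (le_trans zr)// ltW.
Qed.

(** Since [m' = (a - u) m], the kernel is [d/ds - d/dt] applied to [m s * m t]. Integrated over
    [s <= r < t], it leaves the boundary terms [m r * int_(t > r) m] and [m r * int_(s <= r) m],
    which add up to [m r * int m]. The proof works with the quotients of
    [m (s + e) * m t - m s * m (t + e)]: log-concavity makes them nonnegative, so Fatou applies. *)
Lemma pair_kernel_integral_le r :
  (\int[(mu \x mu)%E]_z (pair_kernel r z)%:E <= (m r)%:E * \int[mu]_t (m t)%:E)%E.
Proof.
have E0 := lp_E0 p.
have m0 t : 0 <= m t by rewrite mulr_ge0 ?expR_ge0.
have mE := lp_mE p; have mu_ := lp_mu p.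
have mexp : measurable_fun setT (fun t : R => expR (a * t)).
  by apply: measurableT_comp => //; exact: mulrl_measurable.
have mm : measurable_fun setT m by exact: measurable_funM.
have mms e : measurable_fun setT (fun t : R => m (t + e)).
  by apply: (measurableT_comp mm); exact: measurable_shift.
pose lo (t : R) : R := if t <= r then 1 else 0.
pose hi (t : R) : R := if r < t then 1 else 0.
have mlo : measurable_fun setT lo.
  by apply: measurable_fun_ifT => //; exact: measurable_fun_ler.
have mhi : measurable_fun setT hi.
  by apply: measurable_fun_ifT => //; exact: measurable_fun_ltr.
have lo0 t : 0 <= lo t by rewrite /lo; case: ifP.
have hi0 t : 0 <= hi t by rewrite /hi; case: ifP.
have lohi t : lo t + hi t = 1.
  by rewrite /lo /hi; case: leP; rewrite ?addr0 ?add0r.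
have kerE z : pair_kernel r z = lo z.1 * hi z.2 * (m z.1 * m z.2 * (u z.2 - u z.1)).
  rewrite /pair_kernel /lo /hi; case: ifPn => [/andP[-> ->]|].
    by rewrite !mul1r.
  by rewrite negb_and => /orP[/negbTE ->|/negbTE ->]; rewrite ?mulr0 !mul0r.
have m1 (f : R -> R) : measurable_fun setT f ->
    measurable_fun setT (fun z : measurableTypeR R * measurableTypeR R => f z.1).
  by move=> mf; exact: measurableT_comp mf measurable_fst.
have m2 (f : R -> R) : measurable_fun setT f ->
    measurable_fun setT (fun z : measurableTypeR R * measurableTypeR R => f z.2).
  by move=> mf; exact: measurableT_comp mf measurable_snd.
pose g k (z : measurableTypeR R * measurableTypeR R) : R := lo z.1 * hi z.2 *
  (k.+1%:R * (m (z.1 + k.+1%:R^-1) * m z.2 - m z.1 * m (z.2 + k.+1%:R^-1))).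
have g_ge0 k z : 0 <= g k z.
  rewrite /g /lo /hi; case: (leP z.1 r) => [zr|_]; last by rewrite !mul0r.
  case: (ltP r z.2) => [rz|_]; last by rewrite mulr0 mul0r.
  rewrite !mul1r mulr_ge0// subr_ge0 /m.
  set e := k.+1%:R^-1.
  rewrite [leLHS](_ : _ = E z.1 * E (z.2 + e) * expR (a * z.1 + a * (z.2 + e))); last first.
    by rewrite expRD; ring.
  rewrite [leRHS](_ : _ = E (z.1 + e) * E z.2 * expR (a * (z.1 + e) + a * z.2)); last first.
    by rewrite expRD; ring.
  rewrite (_ : a * (z.1 + e) + a * z.2 = a * z.1 + a * (z.2 + e)); last by ring.
  by rewrite ler_wpM2r ?expR_ge0// (lp_lc p)// ?(le_trans zr) ?(ltW rz)// invr_ge0.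
have mg k : measurable_fun setT (g k).
  apply: measurable_funM; first by apply: measurable_funM; [exact: m1|exact: m2].
  apply: measurable_funM => //; apply: measurable_funB; apply: measurable_funM.
  - exact: (m1 _ (mms _)).
  - exact: m2.
  - exact: m1.
  - exact: (m2 _ (mms _)).
apply: (@fatou_le _ _ _ _ g _ (fun k => (m r * expR (a * k.+1%:R^-1))%:E * \int[mu]_t (m t)%:E)%E) => //.
- rewrite (funext kerE).
  apply: measurable_funM; first by apply: measurable_funM; [exact: m1|exact: m2].
  apply: measurable_funM; first by apply: measurable_funM; [exact: m1|exact: m2].
  by apply: measurable_funB; [exact: m2|exact: m1].
- exact: pair_kernel_ge0.
- move=> z e e0.
  have triv : pair_kernel r z = 0 ->
      \forall k \near \oo, pair_kernel r z - e <= g k z.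
    move=> ->; apply: nearW => k; rewrite sub0r (@le_trans _ _ 0)//.
    by rewrite oppr_le0 ltW.
  have := lp_E0 p z.2; rewrite le_eqVlt => /predU1P[Ez0|Ez2].
    by apply: triv; rewrite /pair_kernel -Ez0 mul0r mulr0 mul0r if_same.
  case: (boolP ((z.1 <= r) && (r < z.2))) => [|/negbTE H]; last first.
    by apply: triv; rewrite /pair_kernel H.
  move=> /andP[zr rz].
  have Ez1 : 0 < E z.1.
    by apply: lt_le_trans Ez2 _; apply: (lp_Eni p); rewrite (le_trans zr) ?ltW.
  (* Both products carry the same exponential factor, the sum of the two arguments being the same,
     so [a] drops out and only quotients of [E] remain. *)
  have cv : expR (a * z.1 + a * z.2) * (expR (a * k.+1%:R^-1) *
     (E z.1 * (k.+1%:R * (E z.2 - E (z.2 + k.+1%:R^-1))) -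
      E z.2 * (k.+1%:R * (E z.1 - E (z.1 + k.+1%:R^-1))))) @[k --> \oo] -->
     expR (a * z.1 + a * z.2) * (expR (a * 0) *
     (E z.1 * (u z.2 * E z.2) - E z.2 * (u z.1 * E z.1))).
    apply: cvgMr; apply: cvgM.
      apply: continuous_cvg; first exact: continuous_expR.
      by apply: cvgMr; exact: cvg_harmonic.
    by apply: cvgB; apply: cvgMr; exact: (lp_Eu p).
  have /cvgrPdist_le/(_ e e0) := cv; apply: filterS => k.
  have -> : expR (a * z.1 + a * z.2) * (expR (a * 0) *
     (E z.1 * (u z.2 * E z.2) - E z.2 * (u z.1 * E z.1))) = pair_kernel r z.
    by rewrite /pair_kernel zr rz/= mulr0 expR0 expRD; ring.
  rewrite ler_norml => /andP[_]; rewrite lerBlDr -lerBlDl => /le_trans; apply.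
  rewrite le_eqVlt; apply/orP; left; apply/eqP.
  rewrite /g /lo /hi zr rz !mul1r /m !mulrDr !expRD; ring.
- move=> k; set e := k.+1%:R^-1.
  have e0 : 0 < e by rewrite invr_gt0.
  pose A := (\int[mu]_t (lo t * m t)%:E)%E.
  pose B := (\int[mu]_t (hi t * m t)%:E)%E.
  pose mid (t : R) : R := if (r < t) && (t <= r + e) then 1 else 0.
  pose hi' (t : R) : R := if r + e < t then 1 else 0.
  have mmid : measurable_fun setT mid.
    apply: measurable_fun_ifT => //.
    by apply: measurable_and; [exact: measurable_fun_ltr|exact: measurable_fun_ler].
  have mhi' : measurable_fun setT hi'.
    by apply: measurable_fun_ifT => //; exact: measurable_fun_ltr.
  have mid0 t : 0 <= mid t by rewrite /mid; case: ifP.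
  have hi'0 t : 0 <= hi' t by rewrite /hi'; case: ifP.
  pose I := (\int[mu]_t (mid t * m t)%:E)%E.
  pose B' := (\int[mu]_t (hi' t * m t)%:E)%E.
  have ge0f (f : R -> R) : (forall t, 0 <= f t) -> forall t : R, (0 <= (f t * m t)%:E)%E.
    by move=> f0 t; rewrite lee_fin mulr_ge0.
  have mef (f : R -> R) : measurable_fun setT f ->
      measurable_fun setT (fun t : R => (f t * m t)%:E).
    by move=> mf; apply/measurable_EFinP; exact: measurable_funM.
  have fin (f : R -> R) : measurable_fun setT f -> (forall t, 0 <= f t) ->
      (forall t, f t <= 1) -> (\int[mu]_t (f t * m t)%:E)%E \is a fin_num.
    move=> mf f0 f1; rewrite ge0_fin_numE; last first.
      by apply: integral_ge0 => t _; exact: ge0f.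
    apply: le_lt_trans moo; apply: ge0_le_integral => //.
    + by move=> t _; exact: ge0f.
    + exact: mef.
    + exact/measurable_EFinP.
    + by move=> t _; rewrite lee_fin ler_piMl.
  have fA : A \is a fin_num by apply: fin => // t; rewrite /lo; case: ifP.
  have fI : I \is a fin_num by apply: fin => // t; rewrite /mid; case: ifP.
  have fB' : B' \is a fin_num by apply: fin => // t; rewrite /hi'; case: ifP.
  have BE : (B = I + B')%E.
    rewrite -ge0_integralD//; [|by move=> *; exact: ge0f|exact: mef|by move=> *; exact: ge0f|exact: mef].
    apply: eq_integral => t _; rewrite -EFinD -mulrDl; congr (_ * _)%:E.
    rewrite /hi /mid /hi'; case: (ltP r t) => rt /=.
      by case: leP; rewrite ?addr0 ?add0r.
    by rewrite ltNge (le_trans rt) ?addr0// lerDl ltW.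
  have ME : (\int[mu]_t (m t)%:E = A + B)%E.
    rewrite -ge0_integralD//; [|by move=> *; exact: ge0f|exact: mef|by move=> *; exact: ge0f|exact: mef].
    by apply: eq_integral => t _; rewrite -EFinD -mulrDl lohi mul1r.
  have AE : (\int[mu]_t (lo t * m (t + e))%:E = A + I)%E.
    rewrite -ge0_integralD//; [|by move=> *; exact: ge0f|exact: mef|by move=> *; exact: ge0f|exact: mef].
    rewrite -(ge0_integral_shift e (f := fun t => (lo t * m t)%:E + (mid t * m t)%:E)%E).
    + apply: eq_integral => t _; rewrite -EFinD -mulrDl; congr (_ * _)%:E.
      rewrite /lo /mid lerD2r; case: (leP (t + e) r) => tr /=.
        by rewrite (le_trans _ tr) ?addr0// lerDl ltW.
      by rewrite add0r.
    + by apply: emeasurable_funD; exact: mef.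
    + by move=> t; rewrite adde_ge0// ge0f.
  have B'E : (\int[mu]_t (hi t * m (t + e))%:E = B')%E.
    rewrite /B' -(ge0_integral_shift e (f := fun t => (hi' t * m t)%:E)).
    + by apply: eq_integral => t _; rewrite /hi /hi' ltrD2r.
    + exact: mef.
    + exact: ge0f.
  have P1 := integral_prodM mu mu (measurable_funM mlo (mms e)) (measurable_funM mhi mm).
  have P2 := integral_prodM mu mu (measurable_funM mlo mm) (measurable_funM mhi (mms e)).
  have {}P1 := P1 (fun t => mulr_ge0 (lo0 t) (m0 _)) (fun t => mulr_ge0 (hi0 t) (m0 _)).
  have {}P2 := P2 (fun t => mulr_ge0 (lo0 t) (m0 _)) (fun t => mulr_ge0 (hi0 t) (m0 _)).
  rewrite /= in P1 P2.
  (* After translating each factor, the lower half-line gains the strip []r, r + e]] and the upper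
     one loses it. The integral of [g k] is thus [k + 1] times [(A + I) B - A B'], where
     [B = I + B']. *)
  have key : (\int[(mu \x mu)%E]_z (g k z)%:E + k.+1%:R%:E * (A * B') =
      k.+1%:R%:E * ((A + I) * B))%E.
    rewrite -AE -P1 -{1}B'E -P2.
    rewrite -!ge0_integralZl//; last first.
    + by move=> z _; rewrite lee_fin mulr_ge0// mulr_ge0.
    + apply/measurable_EFinP; apply: measurable_funM.
        by apply: (m1 (fun t => lo t * m t)); exact: measurable_funM.
      by apply: (m2 (fun t => hi t * m (t + e))); exact: measurable_funM.
    + by move=> z _; rewrite lee_fin mulr_ge0// mulr_ge0.
    + apply/measurable_EFinP; apply: measurable_funM.
        by apply: (m1 (fun t => lo t * m (t + e))); exact: measurable_funM.
      by apply: (m2 (fun t => hi t * m t)); exact: measurable_funM.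
    rewrite -ge0_integralD//; last 4 first.
    + by move=> z _; rewrite lee_fin.
    + exact/measurable_EFinP.
    + by move=> z _; rewrite -EFinM lee_fin mulr_ge0// mulr_ge0// mulr_ge0.
    + apply: measurable_funeM; apply/measurable_EFinP; apply: measurable_funM.
        by apply: (m1 (fun t => lo t * m t)); exact: measurable_funM.
      by apply: (m2 (fun t => hi t * m (t + e))); exact: measurable_funM.
    by apply: eq_integral => z _; rewrite -!EFinM -EFinD /g -/e; congr EFin; ring.
  (* On the strip, of length [e = 1 / (k + 1)], [E] is at most [E r] and the exponential is at most
     [e^(a (r + e))]. *)
  have Ile : (k.+1%:R%:E * I <= (m r * expR (a * e))%:E)%E.
    rewrite (_ : m r * expR (a * e) = k.+1%:R * (e * (m r * expR (a * e)))); last first.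
      by rewrite mulrA mulfV ?mul1r// pnatr_eq0.
    rewrite (EFinM k.+1%:R); apply: lee_wpmul2l => //.
    rewrite /I; apply: (@le_trans _ _ (\int[mu]_(t in `]r, (r + e)%R]) (m r * expR (a * e))%:E)%E).
      rewrite [leRHS]integral_mkcond; apply: ge0_le_integral => //.
      - by move=> t _; exact: ge0f.
      - exact: mef.
      - exact/(measurable_restrictT _ _).1.
      - move=> t _; rewrite patchE /mid.
        have -> : (t \in `]r, (r + e)%R]%classic) = (r < t) && (t <= r + e).
          by rewrite mem_setE in_itv.
        case: ifPn => [/andP[rt tr]|_]; last by rewrite mul0r.
        rewrite mul1r lee_fin /m -mulrA -expRD ler_pM ?expR_ge0//.
          by apply: (lp_Eni p); exact: ltW.
        by rewrite ler_expR -mulrDr ler_wpM2l.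
    rewrite integral_cst//= lebesgue_measure_itv/= lte_fin ltrDl e0 -EFinD -EFinM.
    by rewrite lee_fin addrAC subrr add0r mulrC.
  have -> : (\int[(mu \x mu)%E]_z (g k z)%:E = k.+1%:R%:E * I * (A + B))%E.
    have fg : (\int[(mu \x mu)%E]_z (g k z)%:E)%E \is a fin_num.
      have : (\int[(mu \x mu)%E]_z (g k z)%:E + k.+1%:R%:E * (A * B'))%E \is a fin_num.
        by rewrite key BE fin_numM// fin_numM// fin_numD ?fA ?fI ?fB'.
      by rewrite fin_numD => /andP[].
    by rewrite BE; apply: fin_cancel => //; rewrite -BE.
  rewrite ME; apply: lee_wpmul2r => //.
  by rewrite adde_ge0//; apply: integral_ge0 => t _; exact: ge0f.
- have fM : (\int[mu]_t (m t)%:E)%E \is a fin_num.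
    by rewrite ge0_fin_numE// integral_ge0// => t _; rewrite lee_fin.
  rewrite -(fineK fM) -EFinM.
  under eq_fun do rewrite -EFinM.
  apply: cvg_EFin; first exact: nearW.
  rewrite [X in _ --> X](_ : _ = m r * expR (a * 0) * fine (\int[mu]_t (m t)%:E)); last first.
    by rewrite mulr0 expR0 mulr1.
  apply: cvgMl; apply: cvgMr.
  apply: continuous_cvg; first exact: continuous_expR.
  by apply: cvgMr; exact: cvg_harmonic.
Qed.

End pair_kernel.

Section product_sigma_finite.
Context d1 d2 (T1 : measurableType d1) (T2 : measurableType d2) (R : realType).
Variable m1 : {sigma_finite_measure set T1 -> \bar R}.
Variable m2 : {sigma_finite_measure set T2 -> \bar R}.

Lemma product_measure_sigma_finite : sigma_finite setT (m1 \x m2)%E.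
Proof.
have /sigma_finiteP[F [TF ndF Foo]] := sigma_finiteT m1.
have /sigma_finiteP[G [TG ndG Goo]] := sigma_finiteT m2.
exists (fun n => F n `*` G n).
  apply/esym; rewrite -subTset => -[x y] _.
  have [i _ Fi] : (\bigcup_i F i) x by rewrite -TF.
  have [j _ Gj] : (\bigcup_i G i) y by rewrite -TG.
  exists (maxn i j) => //; split.
    by move: Fi; exact/subsetPset/ndF/leq_maxl.
  by move: Gj; exact/subsetPset/ndG/leq_maxr.
move=> k; have [mFk Fk] := Foo k; have [mGk Gk] := Goo k.
split; first exact: measurableX.
by rewrite product_measure1E// lte_mul_pinfty// ge0_fin_numE.
Qed.

(* Stated apart because the library's instance for products of sigma-finite
   measures is shadowed by the one for products of probabilities. *)
Definition product_sigma_finite_measure :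
    {sigma_finite_measure set (T1 * T2)%type -> \bar R} :=
  HB.pack (m1 \x m2)%E
    (Measure_isSigmaFinite.Build _ _ _ (m1 \x m2)%E product_measure_sigma_finite).

End product_sigma_finite.

(** * The one-dimensional Brascamp-Lieb inequality *)

Section brascamp_lieb.
Context {R : realType} (E u b : R -> R) (p : log_profile E u b).
Notation mu := (@lebesgue_measure R).

(** Duplicating the variable removes the mean: for mean zero, the double integral of
    [m s * m t * (F t - F s) ^+ 2] is [2 M V]. On [s < t] the increments are bounded by
    [lp_increment_le]; integrating in [(s, t)] before [r] produces [M] times the right-hand side,
    and [0 < M < +oo] is divided out. *)
Lemma lp_brascamp_lieb (a K : R) (F F1 : R -> R) : 0 <= a ->
  (0 < \int[mu]_t (E t * expR (a * t))%:E < +oo)%E ->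
  (forall t, `|F t| <= K) -> continuous F1 ->
  (forall t : R, is_derive t 1 F (F1 t)) ->
  (\int[mu]_t (E t * expR (a * t) * F t)%:E = 0)%E ->
  (\int[mu]_t (E t * expR (a * t) * F t ^+ 2)%:E <=
   \int[mu]_t ((E t * expR (a * t) * F1 t ^+ 2)%:E * (b t)%:E^-1))%E.
Proof.
move=> a0 /andP[M0 Moo] FK cF1 dF F0.
set m := fun t => E t * expR (a * t).
have E0 := lp_E0 p; have b0 := lp_b0 p.
have mE := lp_mE p; have mu_ := lp_mu p; have mb := lp_mb p.
have m0 t : 0 <= m t by rewrite mulr_ge0 ?expR_ge0.
have mexp : measurable_fun setT (fun t : R => expR (a * t)).
  by apply: measurableT_comp => //; exact: mulrl_measurable.
have mm : measurable_fun setT m by exact: measurable_funM.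
have mF : measurable_fun setT F.
  apply: continuous_measurable_fun => t.
  by apply/differentiable_continuous/derivable1_diffP; case: (dF t).
have mF1 : measurable_fun setT F1 by exact: continuous_measurable_fun.
have K0 : 0 <= K by exact: le_trans (FK 0).
pose w t := ((F1 t ^+ 2)%:E * (b t)%:E^-1)%E.
have mw : measurable_fun setT w.
  apply: emeasurable_funM; last exact: measurable_inve.
  by apply/measurable_EFinP; exact: measurable_funX.
have w0 t : (0 <= w t)%E by rewrite mule_ge0 ?lee_fin ?sqr_ge0// inve_ge0 lee_fin.
have -> : (\int[mu]_t ((m t * F1 t ^+ 2)%:E * (b t)%:E^-1) =
           \int[mu]_t ((m t)%:E * w t))%E.
  by apply: eq_integral => t _; rewrite EFinM muleA.
set Z := (X in (_ <= X)%E).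
have [->|Zoo] := eqVneq Z +oo%E; first exact: leey.
have {}Zoo : (Z < +oo)%E by rewrite ltey.
pose M := (\int[mu]_t (m t)%:E)%E.
change (is_true (0 < M)%E) in M0; change (is_true (M < +oo)%E) in Moo.
change (\int[mu]_t (m t * F t)%:E = 0)%E in F0.
have fM : M \is a fin_num by rewrite ge0_fin_numE ?ltW.
pose V := (\int[mu]_t (m t * F t ^+ 2)%:E)%E; change (V <= Z)%E.
have mmF2 : measurable_fun setT (fun t => m t * F t ^+ 2).
  by apply: measurable_funM => //; exact: measurable_funX.
have mF2_ge0 t : 0 <= m t * F t ^+ 2 by rewrite mulr_ge0// sqr_ge0.
have Voo : (V < +oo)%E.
  apply: (@le_lt_trans _ _ ((K ^+ 2)%:E * M)%E); last first.
    by rewrite lte_mul_pinfty// lee_fin sqr_ge0.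
  rewrite -ge0_integralZl//; last 3 first.
  - exact/measurable_EFinP.
  - by move=> t _; rewrite lee_fin.
  - by rewrite lee_fin sqr_ge0.
  apply: ge0_le_integral => //.
  - by move=> t _; rewrite lee_fin.
  - exact/measurable_EFinP.
  - by apply: measurable_funeM; exact/measurable_EFinP.
  - move=> t _; rewrite -EFinM lee_fin mulrC ler_wpM2r//.
    by rewrite -(real_normK (num_real (F t))) lerXn2r ?nnegrE.
have fV : V \is a fin_num.
  by rewrite ge0_fin_numE// integral_ge0// => t _; rewrite lee_fin.
have im : mu.-integrable setT (fun t => (m t)%:E) by exact: integrable_ge0.
have imF2 : mu.-integrable setT (fun t => (m t * F t ^+ 2)%:E) by exact: integrable_ge0.
have imF : mu.-integrable setT (fun t => (m t * F t)%:E).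
  have imK := integrableZl measurableT K im; apply: le_integrable imK => //.
    by apply/measurable_EFinP; exact: measurable_funM.
  move=> t _; rewrite /= lee_fin (normrM (m t)) (normrM K) mulrC (ger0_norm K0).
  by rewrite (ger0_norm (m0 t)) ler_wpM2r.
pose H (s t : R) : R := m s * m t * (F t - F s) ^+ 2.
have H0 s t : 0 <= H s t by rewrite mulr_ge0 ?sqr_ge0// mulr_ge0.
have innerH s : (\int[mu]_t (H s t)%:E = (m s * (fine V + F s ^+ 2 * fine M))%:E)%E.
  have -> : (\int[mu]_t (H s t)%:E =
      \int[mu]_t ((m s)%:E * (m t * F t ^+ 2)%:E +
        ((- 2 * m s * F s)%:E * (m t * F t)%:E + (m s * F s ^+ 2)%:E * (m t)%:E)))%E.
    by apply: eq_integral => t _; rewrite -!EFinM -!EFinD /H; congr EFin; ring.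
  rewrite integralD//; [|exact: integrableZl|by apply: integrableD => //; exact: integrableZl].
  rewrite integralD//; [|exact: integrableZl|exact: integrableZl].
  rewrite !integralZl// -/M -/V F0 mule0 add0e.
  rewrite -{1}(fineK fV) -{1}(fineK fM) -!EFinM -EFinD.
  by congr EFin; ring.
have MV : (\int[mu]_s \int[mu]_t (H s t)%:E = (2%:R)%:E * (M * V))%E.
  under eq_integral do rewrite innerH.
  have -> : (\int[mu]_s (m s * (fine V + F s ^+ 2 * fine M))%:E =
      \int[mu]_s ((fine V)%:E * (m s)%:E + (fine M)%:E * (m s * F s ^+ 2)%:E))%E.
    by apply: eq_integral => t _; rewrite -!EFinM -!EFinD; congr EFin; ring.
  rewrite integralD//; [|exact: integrableZl|exact: integrableZl].
  rewrite !integralZl// -/M -/V !fineK// (muleC V) -mule2n.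
  by rewrite -mule_natl.
pose T := (measurableTypeR R * measurableTypeR R)%type.
pose Hlt (z : T) : R := if z.1 < z.2 then H z.1 z.2 else 0.
have m1 (f : R -> R) : measurable_fun setT f ->
    measurable_fun setT (fun z : T => f z.1).
  by move=> mf; exact: measurableT_comp mf measurable_fst.
have m2 (f : R -> R) : measurable_fun setT f ->
    measurable_fun setT (fun z : T => f z.2).
  by move=> mf; exact: measurableT_comp mf measurable_snd.
have mid1 : measurable_fun setT (fun z : T => z.1 : R) by exact: (m1 id).
have mid2 : measurable_fun setT (fun z : T => z.2 : R) by exact: (m2 id).
have mHz : measurable_fun setT (fun z : T => H z.1 z.2).
  apply: measurable_funM; first by apply: measurable_funM; [exact: m1|exact: m2].
  by apply: measurable_funX; apply: measurable_funB; [exact: m2|exact: m1].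
have mHlt : measurable_fun setT Hlt.
  by apply: measurable_fun_ifT => //; exact: measurable_fun_ltr.
have Hlt0 z : 0 <= Hlt z by rewrite /Hlt; case: ifP.
pose X := (\int[(mu \x mu)%E]_z (Hlt z)%:E)%E.
(* [H] vanishes on the diagonal and is symmetric, so each of the two open half-planes carries half
   of the integral. *)
have split2 : (\int[mu]_s \int[mu]_t (H s t)%:E = (2%:R)%:E * X)%E.
  pose Hgt (z : T) : R := if z.2 < z.1 then H z.1 z.2 else 0.
  have mHgt : measurable_fun setT Hgt.
    by apply: measurable_fun_ifT => //; exact: measurable_fun_ltr.
  have Hgt0 z : 0 <= Hgt z by rewrite /Hgt; case: ifP.
  have e1 : (\int[mu]_s \int[mu]_t (H s t)%:E = \int[(mu \x mu)%E]_z (H z.1 z.2)%:E)%E.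
    rewrite (fubini_tonelli1 (fun z : T => (H z.1 z.2)%:E))//.
    - exact/measurable_EFinP.
    - by move=> z; rewrite lee_fin.
  have e2 : (\int[(mu \x mu)%E]_z (Hgt z)%:E = X)%E.
    rewrite /X (fubini_tonelli1 (fun z : T => (Hgt z)%:E))//; last exact/measurable_EFinP.
    rewrite (fubini_tonelli2 (fun z : T => (Hlt z)%:E)); last 2 first.
    - exact/measurable_EFinP.
    - by move=> z; rewrite lee_fin.
    apply: eq_integral => x _; apply: eq_integral => y _; congr EFin.
    rewrite /Hgt /Hlt /=; case: ifP => // _; rewrite /H -[(F x - F y) ^+ 2]sqrrN opprB.
    by rewrite (mulrC (m y)).
  rewrite e1 mule_natl mule2n -{1}e2 -ge0_integralD//; last 4 first.
  - by move=> z _; rewrite lee_fin.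
  - exact/measurable_EFinP.
  - by move=> z _; rewrite lee_fin.
  - exact/measurable_EFinP.
  apply: eq_integral => z _; rewrite -EFinD /Hgt /Hlt; congr EFin.
  case: ltgtP => [||e]; rewrite ?addr0 ?add0r//.
  by rewrite /H e subrr expr0n mulr0.
have key z : ((Hlt z)%:E <= \int[mu]_r ((pair_kernel E u a r z)%:E * w r))%E.
  have P0 : (0 <= \int[mu]_r ((pair_kernel E u a r z)%:E * w r))%E.
    by apply: integral_ge0 => r _; rewrite mule_ge0// lee_fin (pair_kernel_ge0 p).
  rewrite /Hlt; case: ifPn => // st.
  have := E0 z.2; rewrite le_eqVlt => /predU1P[Ez0|Ez2].
    by rewrite /H /m -Ez0 mul0r mulr0 mul0r.
  have mz1 : 0 < m z.1.
    by rewrite mulr_gt0 ?expR_gt0// (lt_le_trans Ez2)// (lp_Eni p)// ltW.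
  have mz2 : 0 < m z.2 by rewrite mulr_gt0 ?expR_gt0.
  (* On [[z.1, z.2[] the weight [m] is at least [E z.2 * e^(a z.1) > 0], so the finiteness of the
     global integral [Z] passes to the interval. *)
  have Woo : (\int[mu]_(r in `[z.1, z.2[) w r < +oo)%E.
    have c0 : 0 < E z.2 * expR (a * z.1) by rewrite mulr_gt0 ?expR_gt0.
    suff : ((E z.2 * expR (a * z.1))%:E * \int[mu]_(r in `[z.1, z.2[) w r <= Z)%E.
      move=> le; have := le_lt_trans le Zoo; rewrite muleC.
      by rewrite -lte_pdivlMr// => /lt_le_trans; apply; exact: leey.
    rewrite -ge0_integralZl//; last 2 first.
    - exact: measurable_funTS.
    - by rewrite lee_fin ltW.
    rewrite integral_mkcond; apply: ge0_le_integral => //.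
    - by move=> r _; rewrite patchE; case: ifP => // _; rewrite mule_ge0// lee_fin ltW.
    - apply/(measurable_restrictT _ _).1 => //; apply: measurable_funTS.
      exact: measurable_funeM.
    - by apply: emeasurable_funM => //; exact/measurable_EFinP.
    - move=> r _; rewrite patchE; case: ifPn => [|_]; last by rewrite mule_ge0// lee_fin.
      rewrite mem_setE in_itv/= => /andP[zr rz]; rewrite lee_wpmul2r// lee_fin.
      by rewrite ler_pM ?expR_ge0// ?(lp_Eni p) ?ler_expR ?ler_wpM2l// ltW.
  have inc := lp_increment_le p st Ez2 cF1 dF Woo.
  apply: (@le_trans _ _ ((m z.1 * m z.2)%:E * ((u z.2 - u z.1)%:E *
     \int[mu]_(r in `[z.1, z.2[) w r))%E).
    by rewrite /H EFinM; apply: lee_wpmul2l => //; rewrite lee_fin mulr_ge0.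
  rewrite muleA -EFinM integral_mkcond -ge0_integralZl//; last 3 first.
  - by apply/(measurable_restrictT _ _).1 => //; exact: measurable_funTS.
  - by move=> r _; rewrite patchE; case: ifP.
  - by rewrite lee_fin !mulr_ge0// subr_ge0 (lp_und p)// ltW.
  rewrite le_eqVlt; apply/orP; left; apply/eqP; apply: eq_integral => r _.
  rewrite patchE mem_setE in_itv/= /pair_kernel; case: ifP => // _.
  by rewrite mule0 mul0e.
have mker : measurable_fun setT (fun y : T * measurableTypeR R => pair_kernel E u a y.2 y.1).
  have my1 (f : T -> R) : measurable_fun setT f ->
      measurable_fun setT (fun y : T * measurableTypeR R => f y.1).
    by move=> mf; exact: measurableT_comp mf measurable_fst.
  have my2 : measurable_fun setT (fun y : T * measurableTypeR R => y.2 : R).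
    exact: measurable_snd.
  apply: measurable_fun_ifT => //.
    apply: measurable_and.
      by apply: measurable_fun_ler => //; exact: (my1 (fun z => z.1)).
    by apply: measurable_fun_ltr => //; exact: (my1 (fun z => z.2)).
  apply: (my1 (fun z : T => m z.1 * m z.2 * (u z.2 - u z.1))).
  apply: measurable_funM; first by apply: measurable_funM; [exact: m1|exact: m2].
  by apply: measurable_funB; [exact: m2|exact: m1].
have mkw : measurable_fun setT (fun y : T * measurableTypeR R =>
    ((pair_kernel E u a y.2 y.1)%:E * w y.2)%E).
  apply: emeasurable_funM; first exact/measurable_EFinP.
  exact: measurableT_comp mw measurable_snd.
have kw0 y : (0 <= (pair_kernel E u a y.2 y.1)%:E * w y.2)%E.
  by rewrite mule_ge0// lee_fin (pair_kernel_ge0 p).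
have XZ : (X <= M * Z)%E.
  apply: (@le_trans _ _ (\int[(mu \x mu)%E]_z \int[mu]_r
      ((pair_kernel E u a r z)%:E * w r))%E).
    apply: ge0_le_integral; first exact: measurableT.
    - by move=> z _; rewrite lee_fin.
    - exact/measurable_EFinP.
    - exact: (measurable_fun_fubini_tonelli_F (m2 := mu) (fun y : T * measurableTypeR R =>
        ((pair_kernel E u a y.2 y.1)%:E * w y.2)%E)).
    - by move=> z _; exact: key.
  pose mu2 := product_sigma_finite_measure mu mu.
  have -> : (\int[(mu \x mu)%E]_z \int[mu]_r ((pair_kernel E u a r z)%:E * w r) =
      \int[mu]_r \int[(mu \x mu)%E]_z ((pair_kernel E u a r z)%:E * w r))%E.
    exact: (fubini_tonelli (m1 := mu2) (m2 := mu) (fun y : T * measurableTypeR R =>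
        ((pair_kernel E u a y.2 y.1)%:E * w y.2)%E) mkw kw0).
  rewrite -ge0_integralZl//; last 3 first.
  - by apply: emeasurable_funM => //; exact/measurable_EFinP.
  - by move=> t _; rewrite mule_ge0// lee_fin.
  - exact: ltW.
  apply: ge0_le_integral => //.
  - by move=> r _; apply: integral_ge0 => z _; rewrite mule_ge0// lee_fin (pair_kernel_ge0 p).
  - exact: (measurable_fun_fubini_tonelli_G (m1 := mu2) (fun y : T * measurableTypeR R =>
        ((pair_kernel E u a y.2 y.1)%:E * w y.2)%E)).
  - by apply: measurable_funeM; apply: emeasurable_funM => //; exact/measurable_EFinP.
  - move=> r _.
    rewrite ge0_integralZr//; last 2 first.
    + apply/measurable_EFinP.
      exact: (measurableT_comp mker (measurable_pair2 r)).
    + by move=> z _; rewrite lee_fin (pair_kernel_ge0 p).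
    rewrite [leRHS]muleA; apply: lee_wpmul2r; first exact: w0.
    by rewrite [leRHS]muleC; exact: (pair_kernel_integral_le p a0 Moo).
have : ((2%:R)%:E * (M * V) <= (2%:R)%:E * (M * Z))%E.
  by rewrite -MV split2; apply: lee_wpmul2l.
by rewrite lee_pmul2l// lee_pmul2l.
Qed.

End brascamp_lieb.

(** * Measures on R^n *)

Section rV_measure.
Context {R : realType}.
Notation mu := (@lebesgue_measure R).
Implicit Types n : nat.

Lemma measurable_cube_rV n (x : 'rV[R]_n) (e : R) :
  measurable [set y : 'rV[R]_n | forall i, `|x ord0 i - y ord0 i| < e].
Proof.
rewrite (_ : [set y : 'rV[R]_n | _] =
    \bigcap_(i in [set: 'I_n]) [set y : 'rV[R]_n | `|x ord0 i - y ord0 i| < e]).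
  apply: fin_bigcap_measurable => // i _.
  have mf : measurable_fun setT (fun y : 'rV[R]_n => `|x ord0 i - y ord0 i| : R).
    apply: measurableT_comp => //; apply: measurable_funB => //.
    exact: measurable_coord.
  rewrite (_ : [set y : 'rV[R]_n | _] =
    (fun y : 'rV[R]_n => `|x ord0 i - y ord0 i|) @^-1` `]-oo, e[%classic).
    by rewrite -[X in measurable X]setTI; apply: mf => //; exact: measurable_itv.
  by apply/seteqP; split => y /=; rewrite in_itv.
by apply/seteqP; split => y /= h i; [move=> _|]; apply: h.
Qed.

(** The sigma-algebra comes from the coordinates and the topology from cubes. Cubes with rational
    centre and radius [1 / (k + 1)] form a countable base, which links the two. *)
Lemma open_measurable_rV n (U : set 'rV[R]_n) : open U -> measurable U.
Proof.
move=> oU.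
pose B (q : 'rV[rat]_n * nat) : set 'rV[R]_n :=
  [set y : 'rV[R]_n | forall i, `|ratr (q.1 ord0 i) - y ord0 i| < q.2.+1%:R^-1 ].
have mB q : measurable (B q).
  have := measurable_cube_rV (\row_i ratr (q.1 ord0 i)) q.2.+1%:R^-1.
  by congr measurable; apply/seteqP; split => y /= h i; have := h i; rewrite mxE.
pose C q := if pselect (B q `<=` U) then B q else set0.
have -> : U = \bigcup_q C q; last first.
  apply: countable_bigcupT_measurable => [|q]; first exact: countableP.
  by rewrite /C; case: (pselect _) => ?; [exact: mB|exact: measurable0].
apply/seteqP; split => [x Ux|x [q _]]; last by rewrite /C; case: pselect => // h; exact: h.
have /nbhs_ballP[e /= e0 xeU] : nbhs x U by exact: open_nbhs_nbhs.
have [k _ ke] : \forall k \near \oo, k.+1%:R^-1 < e / 2.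
  have := @cvg_harmonic R; move/cvgr_lt => /(_ (e / 2)); apply; exact: divr_gt0.
have {}ke := ke k (leqnn k).
have k0 : 0 < k.+1%:R^-1 :> R by rewrite invr_gt0.
have qex (i : 'I_n) : exists q : rat, `|ratr q - x ord0 i| < k.+1%:R^-1.
  have [|q] := @rat_in_itvoo R (x ord0 i - k.+1%:R^-1) (x ord0 i + k.+1%:R^-1).
    by rewrite ltrBlDr -addrA ltrDl addr_gt0.
  by rewrite in_itv/= => qx; exists q; rewrite ltr_distl.
pose q : 'rV[rat]_n * nat := (\row_i projT1 (cid (qex i)), k).
have Bx : B q x by move=> i /=; rewrite mxE; exact: projT2 (cid (qex i)).
exists q => //; rewrite /C; case: pselect => // -[] y By; apply: xeU.
split=> // i j; rewrite (ord1 i) /ball/=.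
rewrite (splitr e) -(subrKA (ratr (q.1 ord0 j))) (le_lt_trans (ler_normD _ _))// ltrD//.
  by rewrite distrC (lt_trans (Bx j)).
by rewrite (lt_trans (By j)).
Qed.

Lemma continuous_measurable_rV n (f : 'rV[R]_n -> R) :
  continuous f -> measurable_fun setT f.
Proof.
move=> cf; apply: (measurability _ (RGenOInfty.measurableE R)) => //.
move=> _ [_ [a ->] <-]; rewrite setTI; apply: open_measurable_rV.
apply: open_comp; [by move=> x _; exact: cf|].
exact: interval_open.
Qed.

Lemma measurable_scaler_rV n (s : R) :
  measurable_fun setT (fun x : 'rV[R]_n => s *: x).
Proof.
apply: measurable_fun_rVP => i.
rewrite (_ : (fun x => _) = fun x : 'rV[R]_n => s * x ord0 i); last first.
  by apply/funext => x; rewrite mxE.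
by apply: measurable_funM => //; exact: measurable_coord.
Qed.

Lemma measurable_enorm n : measurable_fun setT (@enorm R n).
Proof.
apply: (@measurableT_comp _ _ _ _ _ _ (@Num.sqrt R)).
  by apply: continuous_measurable_fun => x; exact: sqrt_continuous.
apply: measurable_sum => i; apply: measurable_funX; exact: measurable_coord.
Qed.

Lemma enorm_ge0 n (x : 'rV[R]_n) : 0 <= enorm x. Proof. exact: sqrtr_ge0. Qed.

Lemma enorm_sqr n (x : 'rV[R]_n) : enorm x ^+ 2 = \sum_i x ord0 i ^+ 2.
Proof. by rewrite sqr_sqrtr// sumr_ge0// => i _; exact: sqr_ge0. Qed.

Lemma enormZ n (s : R) (x : 'rV[R]_n) : enorm (s *: x) = `|s| * enorm x.
Proof.
apply/eqP; rewrite -(@eqrXn2 _ 2)// ?mulr_ge0 ?enorm_ge0//.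
rewrite exprMn !enorm_sqr real_normK ?num_real// mulr_sumr.
by apply/eqP; apply: eq_bigr => i _; rewrite mxE exprMn.
Qed.

Lemma enorm_eq0 n (x : 'rV[R]_n) : (enorm x == 0) = (x == 0).
Proof.
rewrite -(@eqrXn2 _ 2) ?enorm_ge0// enorm_sqr expr0n/= psumr_eq0; last first.
  by move=> i _; exact: sqr_ge0.
apply/allP/eqP => [h|-> i _]; last by rewrite /= mxE expr0n/= eqxx.
apply/rowP => i; rewrite mxE; apply/eqP; rewrite -sqrf_eq0.
by have /(_ (mem_index_enum i)) := h i.
Qed.

Lemma enorm_rV_cons n (x : R) (y : 'rV[R]_n) :
  enorm (rV_cons (x, y)) ^+ 2 = x ^+ 2 + enorm y ^+ 2.
Proof.
rewrite !enorm_sqr big_ord_recl rV_cons0; congr (_ + _).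
by apply: eq_bigr => i _; rewrite rV_consS.
Qed.

Lemma rV_consZ n (s x : R) (y : 'rV[R]_n) :
  s *: rV_cons (x, y) = rV_cons (s * x, s *: y).
Proof.
apply/rowP => i; rewrite mxE; case: (unliftP ord0 i) => [j ->|->].
  by rewrite !rV_consS mxE.
by rewrite !rV_cons0.
Qed.

Lemma measurable_rV_cons_l n (y : 'rV[R]_n) :
  measurable_fun setT (fun x : measurableTypeR R => rV_cons (x, y)).
Proof. exact: measurableT_comp (@measurable_rV_cons R n) (measurable_pair2 y). Qed.

Lemma measurable_rV_cons_r n (x : R) :
  measurable_fun setT (fun y : 'rV[R]_n => rV_cons (x, y)).
Proof. exact: measurableT_comp (@measurable_rV_cons R n) (measurable_pair1 x). Qed.

Lemma ge0_integral_lebesgue_rVS n (f : 'rV[R]_n.+1 -> \bar R) :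
  measurable_fun setT f -> (forall x, (0 <= f x)%E) ->
  (\int[lebesgue_rV R n.+1]_x f x =
   \int[mu]_x \int[lebesgue_rV R n]_y f (rV_cons (x, y)))%E.
Proof.
move=> mf f0; rewrite /= /lebesgue_cons.
rewrite (@ge0_integral_pushforward _ _ _ _ _ _ (@measurable_rV_cons R n) _ setT f)//.
rewrite preimage_setT fubini_tonelli1//; last by move=> z; exact: f0.
exact: measurableT_comp mf (@measurable_rV_cons R n).
Qed.

Lemma ge0_integral_rV_scale n (s : R) (f : 'rV[R]_n -> \bar R) : 0 < s ->
  measurable_fun setT f -> (forall x, (0 <= f x)%E) ->
  (\int[lebesgue_rV R n]_x f (s *: x) =
   (s ^- n)%:E * \int[lebesgue_rV R n]_x f x)%E.
Proof.
move=> s0; elim: n f => [|n IH] f mf f0.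
  rewrite expr0 invr1 mul1e; apply: eq_integral => x _; congr f.
  by apply/rowP => -[].
have mfs : measurable_fun setT (fun x : 'rV[R]_n.+1 => f (s *: x)).
  exact: measurableT_comp mf (measurable_scaler_rV _).
rewrite !ge0_integral_lebesgue_rVS//.
pose g x := (\int[lebesgue_rV R n]_y f (rV_cons (x, y)))%E.
have mg : measurable_fun setT g.
  apply: (measurable_fun_fubini_tonelli_F (fun p => f (rV_cons p))) => //.
  exact: measurableT_comp mf (@measurable_rV_cons R n).
have g0 x : (0 <= g x)%E by exact: integral_ge0.
have sn0 : 0 <= s ^- n by rewrite invr_ge0 exprn_ge0// ltW.
transitivity (\int[mu]_x ((s ^- n)%:E * g (s * x)%R))%E.
  apply: eq_integral => x _; rewrite /g.
  under eq_integral do rewrite rV_consZ.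
  rewrite (IH (fun y => f (rV_cons (s * x, y))))//.
  exact: measurableT_comp mf (measurable_rV_cons_r _).
rewrite ge0_integralZl; [| |by apply: (measurableT_comp mg); exact: measurable_funM| |].
- rewrite ge0_integral_scale// muleA -EFinM; congr (_%:E * _)%E.
  by rewrite exprSr invfM.
- exact: measurableT.
- by move=> x _; exact: g0.
- by rewrite lee_fin.
Qed.

(** The origin will be discarded throughout the passage to polar coordinates. In dimension zero the
    measure is the Dirac mass at that very point, hence the condition on [n]. *)
Lemma lebesgue_rV_set0 n : (0 < n)%N -> lebesgue_rV R n [set 0] = 0%E.
Proof.
case: n => // n _.
have -> : [set 0 : 'rV[R]_n.+1] = [set x : 'rV[R]_n.+1 | forall i, [set 0 : R] (x ord0 i)].
  apply/seteqP; split => [x /= -> i|x /= h]; first by rewrite mxE.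
  by apply/rowP => i; rewrite mxE h.
rewrite (@lebesgue_rV_box R n.+1 (fun=> [set 0]))//.
by rewrite big_ord_recl lebesgue_measure_set1 mul0e.
Qed.

End rV_measure.

(** * Powers of a probability on the line, and measures given by a density *)

Section prob_rV.
Context {R : realType} (nu : probability (measurableTypeR R) R).

Section step.
Context n (m : probability 'rV[R]_n R).

Definition prob_cons : set 'rV[R]_n.+1 -> \bar R :=
  pushforward (nu \x m)%E (@rV_cons R n).

Let prob_cons0 : prob_cons set0 = 0%E.
Proof. by rewrite /prob_cons /pushforward preimage_set0 measure0. Qed.

Let prob_cons_ge0 A : (0 <= prob_cons A)%E.
Proof. exact: (measure_ge0 (nu \x m)%E). Qed.

Let prob_cons_sigma_additive : semi_sigma_additive prob_cons.
Proof.
exact: (@measure_semi_sigma_additive _ _ _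
  (measure_function_pushforward__canonical__measure_function_Measure
     (nu \x m)%E (@measurable_rV_cons R n))).
Qed.

HB.instance Definition _ := isMeasure.Build _ _ _ prob_cons
  prob_cons0 prob_cons_ge0 prob_cons_sigma_additive.

Let prob_cons_setT : prob_cons setT = 1%E.
Proof. by rewrite /prob_cons /pushforward preimage_setT; exact: probability_setT. Qed.

HB.instance Definition _ := Measure_isProbability.Build _ _ _ prob_cons
  prob_cons_setT.

End step.

Fixpoint prob_rV (n : nat) : probability 'rV[R]_n R :=
  match n with
  | 0%N => \d_(0 : 'rV[R]_0)
  | n'.+1 => prob_cons (prob_rV n')
  end.

Lemma ge0_integral_prob_rVS n (f : 'rV[R]_n.+1 -> \bar R) :
  measurable_fun setT f -> (forall x, (0 <= f x)%E) ->
  (\int[prob_rV n.+1]_x f x =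
   \int[nu]_x \int[prob_rV n]_y f (rV_cons (x, y)))%E.
Proof.
move=> mf f0.
rewrite (@ge0_integral_pushforward _ _ _ _ _ _ (@measurable_rV_cons R n) _ setT f)//.
rewrite preimage_setT fubini_tonelli1//; last by move=> z; exact: f0.
exact: measurableT_comp mf (@measurable_rV_cons R n).
Qed.

End prob_rV.

Section density.
Context d (T : measurableType d) (R : realType).
Variables (m l : {measure set T -> \bar R}) (g : T -> R).
Hypotheses (mg : measurable_fun setT g) (g0 : forall x, 0 <= g x).
Hypothesis mE : forall A, measurable A -> m A = (\int[l]_(x in A) (g x)%:E)%E.

Import HBNNSimple.

Lemma ge0_integral_density (f : T -> \bar R) :
  measurable_fun setT f -> (forall x, (0 <= f x)%E) ->
  (\int[m]_x f x = \int[l]_x (f x * (g x)%:E))%E.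
Proof.
move=> mf f0.
pose f_ := nnsfun_approx measurableT mf.
have mge : measurable_fun setT (fun x => (g x)%:E) by exact/measurable_EFinP.
have fg0 n x : (0 <= (f_ n x)%:E * (g x)%:E)%E by rewrite mule_ge0// lee_fin.
transitivity (limn (fun n => \int[m]_x (f_ n x)%:E))%E.
  rewrite -monotone_convergence//.
  - apply: eq_integral => y _; apply/esym/cvg_lim => //.
    by apply: cvg_nnsfun_approx.
  - by move=> n; exact/measurable_EFinP/measurable_funP.
  - by move=> n y _; rewrite lee_fin.
  - by move=> y _ i j ij; rewrite lee_fin; exact/lefP/nd_nnsfun_approx.
rewrite [X in limn X](_ : _ = (fun n => \int[l]_x ((f_ n x)%:E * (g x)%:E))%E).
  rewrite -monotone_convergence//; last 2 first.
    - by move=> n; apply: emeasurable_funM => //; exact/measurable_EFinP.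
    - move=> x _ i j ij; apply: lee_wpmul2r; first by rewrite lee_fin.
      by rewrite lee_fin; exact/lefP/nd_nnsfun_approx.
  apply: eq_integral => x _; apply/cvg_lim => //.
  have Hf : (f_ n x)%:E @[n --> \oo] --> f x by apply: cvg_nnsfun_approx.
  exact: cvgeZr.
apply/funext => n.
transitivity (\sum_(k \in range (f_ n)) k%:E * m (f_ n @^-1` [set k]))%E.
  under eq_integral do rewrite fimfunE -fsumEFin//.
  rewrite ge0_integral_fsum//; last 2 first.
  - by move=> r; exact/measurable_EFinP/measurable_funM.
  - by move=> r x _; rewrite nnfun_muleindic_ge0.
  apply: eq_fsbigr => r _; rewrite integralZl_indic_nnsfun// integral_indic//=.
  by rewrite setIT.
transitivity (\sum_(k \in range (f_ n))
    \int[l]_x ((k * \1_(f_ n @^-1` [set k]) x)%:E * (g x)%:E))%E.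
  apply: eq_fsbigr => r; rewrite inE => -[x _ rx].
  have r0 : 0 <= r by rewrite -rx.
  under eq_integral do rewrite EFinM -muleA.
  rewrite ge0_integralZl//; last 2 first.
  - by apply: emeasurable_funM => //; exact/measurable_EFinP.
  - by move=> y _; rewrite mule_ge0 ?lee_fin.
  rewrite mE//; congr (_ * _)%E.
  rewrite integral_mkcond; apply: eq_integral => y _.
  rewrite patchE indicE; case: ifPn => _; first by rewrite mul1e.
  by rewrite mul0e.
rewrite -ge0_integral_fsum//; last 2 first.
- by move=> r; apply: emeasurable_funM => //; exact/measurable_EFinP/measurable_funM.
- by move=> r x _; rewrite mule_ge0 ?nnfun_muleindic_ge0// lee_fin.
apply: eq_integral => x _; rewrite [in RHS]fimfunE -fsumEFin//.
rewrite ge0_mule_fsuml//.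
by move=> r; rewrite nnfun_muleindic_ge0.
Qed.

End density.

(** * Hardy-type inequalities *)

Section hardy.
Context {R : realType}.
Notation mu := (@lebesgue_measure R).

(** Tonelli on the region [P x r]. In the applications the pointwise bound is Cauchy-Schwarz on the
    segment from a base point to [x], [q x] being the weight of that segment, and [k r] collects all
    the [x] whose segment passes through [r]. *)
Lemma ge0_integral_hardy (P : R -> R -> bool) (g2 q s k phi : R -> R) :
  measurable_fun setT (fun z : R * R => P z.1 z.2) ->
  measurable_fun setT g2 -> measurable_fun setT q -> measurable_fun setT s ->
  measurable_fun setT k -> measurable_fun setT phi ->
  (forall x, 0 <= g2 x) -> (forall x, 0 <= q x) -> (forall x, 0 <= s x) ->
  (forall x, 0 <= k x) -> (forall x, 0 <= phi x) ->
  (forall x, ((g2 x)%:E <= (q x)%:E * \int[mu]_r (if P x r then s r else 0)%:E)%E) ->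
  (forall r, (\int[mu]_x (if P x r then q x * phi x else 0)%:E <= (k r)%:E)%E) ->
  (\int[mu]_x (g2 x * phi x)%:E <= \int[mu]_r (s r * k r)%:E)%E.
Proof.
move=> mP mg mq ms mk mphi g0 q0 s0 k0 phi0 Hg Hk.
have m1 (f : R -> R) : measurable_fun setT f ->
    measurable_fun setT (fun z : measurableTypeR R * measurableTypeR R => f z.1).
  by move=> mf; exact: measurableT_comp mf measurable_fst.
have m2 (f : R -> R) : measurable_fun setT f ->
    measurable_fun setT (fun z : measurableTypeR R * measurableTypeR R => f z.2).
  by move=> mf; exact: measurableT_comp mf measurable_snd.
pose J (z : measurableTypeR R * measurableTypeR R) : R :=
  if P z.1 z.2 then q z.1 * phi z.1 * s z.2 else 0.
have mJ : measurable_fun setT J.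
  apply: measurable_fun_ifT => //; apply: measurable_funM; last exact: m2.
  by apply: (m1 (fun x => q x * phi x)); exact: measurable_funM.
have J0 z : (0 <= (J z)%:E)%E.
  by rewrite lee_fin /J; case: ifP => // _; rewrite mulr_ge0// mulr_ge0.
have mJE : measurable_fun setT (fun z => (J z)%:E) by exact/measurable_EFinP.
have mPs x : measurable_fun setT (fun r : R => if P x r then s r else 0).
  apply: measurable_fun_ifT => //.
  exact: (measurableT_comp mP (measurable_pair1 (x : measurableTypeR R))).
have mPq r : measurable_fun setT (fun x : R => if P x r then q x * phi x else 0).
  apply: measurable_fun_ifT => //; last exact: measurable_funM.
  exact: (measurableT_comp mP (measurable_pair2 (r : measurableTypeR R))).
apply: (@le_trans _ _ (\int[mu]_x \int[mu]_r (J (x, r))%:E)%E).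
  apply: ge0_le_integral => //.
  - by move=> x _; rewrite lee_fin mulr_ge0.
  - by apply/measurable_EFinP; exact: measurable_funM.
  - exact: (measurable_fun_fubini_tonelli_F (fun z => (J z)%:E)).
  - move=> x _; rewrite mulrC EFinM.
    apply: (@le_trans _ _ ((phi x)%:E * ((q x)%:E * \int[mu]_r (if P x r then s r else 0)%:E))%E).
      by apply: lee_wpmul2l; [rewrite lee_fin|exact: Hg].
    rewrite muleA -EFinM -ge0_integralZl//; last 3 first.
    + by apply/measurable_EFinP; exact: mPs.
    + by move=> r _; rewrite lee_fin; case: ifP.
    + by rewrite lee_fin mulr_ge0.
    rewrite le_eqVlt; apply/orP; left; apply/eqP; apply: eq_integral => r _.
    rewrite -EFinM /J/=; congr EFin; case: ifP => _; last by rewrite mulr0.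
    by rewrite (mulrC (phi x)).
rewrite (fubini_tonelli (fun z => (J z)%:E))//.
apply: ge0_le_integral => //.
- by move=> r _; exact: integral_ge0.
- exact: (measurable_fun_fubini_tonelli_G (fun z => (J z)%:E)).
- by apply/measurable_EFinP; exact: measurable_funM.
- move=> r _; rewrite (EFinM (s r)).
  apply: (@le_trans _ _ ((s r)%:E * \int[mu]_x (if P x r then q x * phi x else 0)%:E)%E).
    rewrite -ge0_integralZl//; last 3 first.
    + by apply/measurable_EFinP; exact: mPq.
    + by move=> x _; rewrite lee_fin; case: ifP => // _; rewrite mulr_ge0.
    + by rewrite lee_fin.
    rewrite le_eqVlt; apply/orP; left; apply/eqP; apply: eq_integral => x _.
    rewrite -EFinM /J/=; congr EFin; case: ifP => _; last by rewrite mulr0.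
    by rewrite mulrC.
  by apply: lee_wpmul2l; [rewrite lee_fin|exact: Hk].
Qed.

(** Cauchy-Schwarz with weight [be = B']. Positivity is asked only to the right of [s], so that the
    weight [2 r] can be used from [s = 0]. *)
Lemma sqr_increment_le (h h1 B be : R -> R) (s t : R) : s < t ->
  continuous h1 -> (forall r : R, is_derive r 1 h (h1 r)) ->
  continuous be -> (forall r : R, is_derive r 1 B (be r)) ->
  (forall r, s < r -> 0 < be r) ->
  (((h t - h s) ^+ 2)%:E <=
   (B t - B s)%:E * \int[mu]_(r in `]s, t]) (h1 r ^+ 2 / be r)%:E)%E.
Proof.
move=> st ch1 dh cbe dB be0.
have FTC (F F1 : R -> R) : continuous F1 -> (forall r : R, is_derive r 1 F (F1 r)) ->
    (\int[mu]_(r in `]s, t]) (F1 r)%:E = (F t - F s)%:E)%E /\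
    mu.-integrable `]s, t] (fun r => (F1 r)%:E).
  move=> cF1 dF.
  have mF1 : measurable_fun setT F1 by exact: continuous_measurable_fun.
  have cF : continuous F.
    by move=> x; apply/differentiable_continuous/derivable1_diffP; case: (dF x).
  split.
    rewrite integral_itv_obnd_cbnd; last by apply/measurable_EFinP; apply: measurable_funTS.
    rewrite (@continuous_FTC2 _ F1 F)//.
    - exact: continuous_subspaceT.
    - split.
      + by move=> x _; case: (dF x).
      + by apply: cvg_at_right_filter; exact: cF.
      + by apply: cvg_at_left_filter; exact: cF.
    - by move=> x _; rewrite derive1E; case: (dF x).
  have icc : mu.-integrable `[s, t] (EFin \o F1).
    by apply: continuous_compact_integrable; [exact: segment_compact|exact: continuous_subspaceT].
  by apply: integrableS icc => //; exact: subset_itv_oc_cc.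
have [FTCh ih1] := FTC h h1 ch1 dh.
have [FTCB ibe] := FTC B be cbe dB.
have mh1 : measurable_fun setT h1 by exact: continuous_measurable_fun.
have mbe : measurable_fun setT be by exact: continuous_measurable_fun.
have sbe r : `]s, t]%classic r -> 0 < be r.
  by rewrite /= in_itv/= => /andP[sr _]; exact: be0.
have U0 : 0 < B t - B s.
  have [|c ct ->] := @MVT R B be s t st (fun x _ => dB x).
  - apply: continuous_subspaceT => x.
    by apply/differentiable_continuous/derivable1_diffP; case: (dB x).
  by rewrite mulr_gt0 ?subr_gt0// be0// (itvP ct).
set W := (\int[mu]_(r in _) _)%E.
have mW : measurable_fun `]s, t] (fun r => (h1 r ^+ 2 / be r)%:E).
  apply/measurable_EFinP; apply: measurable_funTS; apply: measurable_funM.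
    exact: measurable_funX.
  by apply: (@measurableT_comp _ _ _ _ _ _ (@GRing.inv R)); first exact: measurable_invr.
have geW r : `]s, t]%classic r -> (0 <= (h1 r ^+ 2 / be r)%:E)%E.
  by move=> /sbe b0; rewrite lee_fin mulr_ge0 ?sqr_ge0// invr_ge0 ltW.
have W0 : (0 <= W)%E by exact: integral_ge0.
have [->|Woo] := eqVneq W +oo%E; first by rewrite gt0_muley ?lte_fin// leey.
have Wfin : W \is a fin_num by rewrite ge0_fin_numE// ltey.
rewrite -(fineK Wfin) -EFinM lee_fin mulrC.
apply: sqr_le_discr; [exact: fine_ge0|exact: ltW|].
move=> y; rewrite -lee_fin EFinD (fineK Wfin).
have -> : ((2 * y * (h t - h s))%:E = \int[mu]_(r in `]s, t]) ((2 * y)%:E * (h1 r)%:E))%E.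
  by rewrite integralZl// FTCh EFinM.
have -> : ((y ^+ 2 * (B t - B s))%:E = \int[mu]_(r in `]s, t]) ((y ^+ 2)%:E * (be r)%:E))%E.
  by rewrite integralZl// FTCB EFinM.
have mbe' : measurable_fun `]s, t] (fun r => (y ^+ 2)%:E * (be r)%:E)%E.
  by apply: measurable_funeM; apply/measurable_EFinP; exact: measurable_funTS.
have gebe r : `]s, t]%classic r -> (0 <= (y ^+ 2)%:E * (be r)%:E)%E.
  by move=> /sbe b0; rewrite mule_ge0 ?lee_fin ?sqr_ge0// ltW.
rewrite -ge0_integralD//.
apply: le_integral_ge0 => //.
- exact: integrableZl.
- exact: emeasurable_funD.
- by move=> r rst; rewrite adde_ge0 ?geW ?gebe.
- move=> r /sbe b0; rewrite -!EFinM -EFinD lee_fin -subr_ge0.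
  rewrite [leRHS](_ : _ = (be r)^-1 * (h1 r - y * be r) ^+ 2).
    by rewrite mulr_ge0 ?sqr_ge0// invr_ge0 ltW.
  by field; rewrite lt0r_neq0.
Qed.

End hardy.

(** * Poincare inequalities for parity classes of the standard Gaussian *)

Section gauss1.
Context {R : realType}.
Notation mu := (@lebesgue_measure R).

Definition gfun (x : R) : R := expR (- (x ^+ 2 / 2)).

Lemma gfun_gt0 x : 0 < gfun x. Proof. exact: expR_gt0. Qed.

Lemma is_derive_gfun (x : R) : is_derive x 1 gfun (- x * gfun x).
Proof.
by rewrite /gfun; apply: is_derive_eq; rewrite /GRing.scale/=; field.
Qed.

Lemma continuous_gfun : continuous gfun.
Proof.
by move=> x; apply/differentiable_continuous/derivable1_diffP; case: (is_derive_gfun x).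
Qed.

Lemma measurable_gfun : measurable_fun setT gfun.
Proof. exact: continuous_measurable_fun continuous_gfun. Qed.

Lemma gfunN x : gfun (- x) = gfun x. Proof. by rewrite /gfun sqrrN. Qed.

(** The constant comes from [y <= e^y] at [y = x^2 / 4], squared. Decay of order four is more than
    the boundary terms [gfun x] and [x * gfun x] need. *)
Lemma gfun_le (x : R) : 0 < x -> gfun x <= 16 / x ^+ 4.
Proof.
move=> x0; rewrite /gfun expRN.
have x40 : 0 < x ^+ 4 by rewrite exprn_gt0.
rewrite -[leRHS]invrK lef_pV2 ?posrE ?expR_gt0 ?invr_gt0 ?divr_gt0//.
rewrite invf_div (_ : x ^+ 2 / 2 = x ^+ 2 / 4 + x ^+ 2 / 4); last by field.
rewrite expRD -expr2.
have e : x ^+ 2 / 4 <= expR (x ^+ 2 / 4).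
  by rewrite (le_trans _ (expR_ge1Dx _))// lerDr.
rewrite (_ : x ^+ 4 / 16 = (x ^+ 2 / 4) ^+ 2); last by field.
by rewrite lerXn2r// nnegrE ?expR_ge0// divr_ge0 ?sqr_ge0.
Qed.

Lemma gfun_cvg0 k : (k <= 3)%N -> x ^+ k * gfun x @[x --> +oo] --> (0 : R).
Proof.
move=> k3; apply: (@squeeze_cvgr _ _ _ _ (cst 0) (fun x => 16 * x^-1)).
- near=> x; have x1 : 1 <= x by near: x; exact: nbhs_pinfty_ge.
  have x0 : 0 < x by exact: lt_le_trans x1.
  apply/andP; split; first by rewrite mulr_ge0 ?exprn_ge0 ?(ltW x0) ?(ltW (gfun_gt0 _)).
  apply: (@le_trans _ _ (x ^+ 3 * (16 / x ^+ 4))).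
    by rewrite ler_pM ?exprn_ge0 ?(ltW x0) ?(ltW (gfun_gt0 _)) ?gfun_le// ler_weXn2l.
  by rewrite le_eqVlt; apply/orP; left; apply/eqP; field; rewrite lt0r_neq0.
- exact: cvg_cst.
- rewrite -[X in _ --> X](mulr0 16); apply: cvgMr.
  apply/gtr0_cvgV0; last exact: cvg_id.
  by near=> x; near: x; exact: nbhs_pinfty_gt.
Unshelve. all: end_near. Qed.

Lemma gfun_tail (F f : R -> R) (c : R) :
  (forall x, c <= x -> 0 <= f x) -> continuous f ->
  (forall x : R, is_derive x 1 F (f x)) -> F x @[x --> +oo] --> (0 : R) ->
  (\int[mu]_(x in `[c, +oo[) (f x)%:E = (- F c)%:E)%E.
Proof.
move=> f0 cf dF F0.
have cF : continuous F.
  by move=> x; apply/differentiable_continuous/derivable1_diffP; case: (dF x).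
rewrite (@ge0_continuous_FTC2y _ f F c 0)// ?sub0r//.
- by rewrite sub0e EFinN.
- exact: continuous_subspaceT.
- by apply: cvg_at_right_filter; exact: cF.
- by move=> x _; rewrite derive1E; case: (dF x).
Qed.

Lemma gfun_tail1 (c : R) : 0 <= c ->
  (\int[mu]_(x in `[c, +oo[) (x * gfun x)%:E = (gfun c)%:E)%E.
Proof.
move=> c0; rewrite -[gfun c]opprK.
apply: (@gfun_tail (fun x => - gfun x)).
- by move=> x cx; rewrite mulr_ge0 ?(le_trans c0 cx) ?ltW ?gfun_gt0.
- by move=> x; apply: cvgM; [exact: cvg_id|exact: continuous_gfun].
- move=> x; have dg := is_derive_gfun x.
  by apply: is_derive_eq; rewrite mulNr opprK.
- rewrite -oppr0; apply: cvgN.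
  have := gfun_cvg0 (leq0n 3); apply: cvg_trans; apply: near_eq_cvg.
  by near=> x; rewrite expr0 mul1r.
Unshelve. all: end_near. Qed.

(** An antiderivative is [- x * gfun x]. The factor [x^2 - 1] is the second Hermite polynomial,
    extremal for the even inequality; its zero [1] is the point where even functions will be
    centred. *)
Lemma gfun_tail2 (c : R) : 1 <= c ->
  (\int[mu]_(x in `[c, +oo[) ((x ^+ 2 - 1) * gfun x)%:E = (c * gfun c)%:E)%E.
Proof.
move=> c1; rewrite -[c * gfun c]opprK.
apply: (@gfun_tail (fun x => - (x * gfun x))).
- move=> x cx; rewrite mulr_ge0 ?(ltW (gfun_gt0 _))// subr_ge0.
  by apply: exprn_ege1; exact: le_trans c1 cx.
- move=> x; apply: cvgM; last exact: continuous_gfun.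
  apply: cvgB; last exact: cvg_cst.
  exact: exprn_continuous.
- move=> x; have dg := is_derive_gfun x.
  by apply: is_derive_eq; rewrite /GRing.scale/=; ring.
- rewrite -oppr0; apply: cvgN.
  have := @gfun_cvg0 1 isT; apply: cvg_trans; apply: near_eq_cvg.
  by near=> x; rewrite expr1.
Unshelve. all: end_near. Qed.

Lemma gfun_head (c : R) : 0 <= c ->
  (\int[mu]_(x in `[0%R, c]) ((1 - x ^+ 2) * gfun x)%:E = (c * gfun c)%:E)%E.
Proof.
rewrite le_eqVlt => /predU1P[<-|c0].
  by rewrite set_itv1 integral_set1 mul0r.
have dF (x : R) : is_derive x 1 (fun x => x * gfun x) ((1 - x ^+ 2) * gfun x).
  have dg := is_derive_gfun x.
  by apply: is_derive_eq; rewrite /GRing.scale/=; ring.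
have cF : continuous (fun x : R => x * gfun x).
  by move=> x; apply/differentiable_continuous/derivable1_diffP; case: (dF x).
rewrite (@continuous_FTC2 _ (fun x => (1 - x ^+ 2) * gfun x) (fun x => x * gfun x))//.
- by rewrite mul0r sube0.
- apply: continuous_subspaceT => x; apply: cvgM; last exact: continuous_gfun.
  apply: cvgB; first exact: cvg_cst.
  exact: exprn_continuous.
- split.
  + by move=> x _; case: (dF x).
  + by apply: cvg_at_right_filter; exact: cF.
  + by apply: cvg_at_left_filter; exact: cF.
- by move=> x _; rewrite derive1E; case: (dF x).
Qed.

Lemma integral_if (P : R -> bool) (f : R -> R) :
  (\int[mu]_x (if P x then f x else 0)%:E =
   \int[mu]_(x in [set x | P x]) (f x)%:E)%E.
Proof.
rewrite [RHS]integral_mkcond; apply: eq_integral => x _; rewrite patchE.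
case: ifPn => Px; first by rewrite mem_set.
by rewrite memNset//=; exact/negP.
Qed.

Lemma integral_even (f : R -> R) : (forall x, 0 <= f x) -> continuous f ->
  (forall x, f (- x) = f x) ->
  (\int[mu]_x (f x)%:E = 2%:E * \int[mu]_x (if (0 <= x)%R then f x else 0%R)%:E)%E.
Proof.
move=> f0 cf fN; rewrite integral_if ge0_symfun_integralT// => x /=.
by rewrite fN.
Qed.

(** Integration by parts in the guise of Tonelli: [x^(k+1)] is the integral of [(k + 1) r^k] over
    [[0, x]], and [gfun_tail1] integrates the remaining [x * gfun x] from [r] on. *)
Lemma gfun_moment k :
  (\int[mu]_x (if (0 <= x)%R then x ^+ k.+2 * gfun x else 0)%:E =
   k.+1%:R%:E * \int[mu]_x (if (0 <= x)%R then x ^+ k * gfun x else 0%R)%:E)%E.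
Proof.
pose J (z : measurableTypeR R * measurableTypeR R) : R :=
  if (0 <= z.2) && (z.2 <= z.1) then k.+1%:R * z.2 ^+ k * (z.1 * gfun z.1) else 0.
have m1 (f : R -> R) : measurable_fun setT f ->
    measurable_fun setT (fun z : measurableTypeR R * measurableTypeR R => f z.1).
  by move=> mf; exact: measurableT_comp mf measurable_fst.
have m2 (f : R -> R) : measurable_fun setT f ->
    measurable_fun setT (fun z : measurableTypeR R * measurableTypeR R => f z.2).
  by move=> mf; exact: measurableT_comp mf measurable_snd.
have mid1 : measurable_fun setT (fun z : measurableTypeR R * measurableTypeR R => z.1 : R) by exact: (m1 id).
have mid2 : measurable_fun setT (fun z : measurableTypeR R * measurableTypeR R => z.2 : R) by exact: (m2 id).
have mJ : measurable_fun setT (fun z => (J z)%:E).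
  apply/measurable_EFinP; apply: measurable_fun_ifT => //.
    by apply: measurable_and; exact: measurable_fun_ler.
  apply: measurable_funM.
    by apply: (m2 (fun r => k.+1%:R * r ^+ k)); apply: measurable_funM.
  by apply: (m1 (fun r => r * gfun r)); apply: measurable_funM => //; exact: measurable_gfun.
have J0 z : (0 <= (J z)%:E)%E.
  rewrite lee_fin /J; case: ifP => // /andP[z2 z21].
  by rewrite !mulr_ge0 ?exprn_ge0 ?(ltW (gfun_gt0 _))// (le_trans z2).
transitivity (\int[mu]_x \int[mu]_r (J (x, r))%:E)%E.
  apply: eq_integral => x _; case: ifPn => x0; last first.
    rewrite integral0_eq// => r _; rewrite /J/=; case: ifPn => // /andP[r0 rx].
    by move: x0; rewrite (le_trans r0 rx).
  rewrite /J/= (integral_if (fun r => (0 <= r) && (r <= x))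
    (fun r => k.+1%:R * r ^+ k * (x * gfun x))).
  rewrite (_ : [set r | _] = `[0, x]%classic); last first.
    by apply/seteqP; split => r /=; rewrite in_itv.
  move: x0; rewrite le_eqVlt => /predU1P[<-|x0].
    by rewrite set_itv1 integral_set1 expr0n mul0r.
  pose F (r : R) := r ^+ k.+1 * (x * gfun x).
  have dF (r : R) : is_derive r 1 F (k.+1%:R * r ^+ k * (x * gfun x)).
    have dX : is_derive r 1 (fun r : R => r ^+ k.+1) (k.+1%:R * r ^+ k).
      have := is_deriveX k.+1 (is_derive_id r (1 : R)).
      by rewrite exprfctE /GRing.scale/= mulr1.
    by rewrite /F; apply: is_derive_eq; rewrite /GRing.scale/=; ring.
  have cF : continuous F.
    by move=> r; apply/differentiable_continuous/derivable1_diffP; case: (dF r).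
  rewrite (@continuous_FTC2 _ (fun r => k.+1%:R * r ^+ k * (x * gfun x)) F)//.
  - by rewrite /F expr0n/= mul0r sube0; congr EFin; rewrite (exprSr _ k.+1); ring.
  - apply: continuous_subspaceT => r; apply: cvgMl; apply: cvgMr.
    exact: exprn_continuous.
  - split.
    + by move=> r _; case: (dF r).
    + by apply: cvg_at_right_filter; exact: cF.
    + by apply: cvg_at_left_filter; exact: cF.
  - by move=> r _; rewrite derive1E; case: (dF r).
rewrite (fubini_tonelli (m1 := mu) (m2 := mu) (fun z => (J z)%:E) mJ J0).
rewrite -ge0_integralZl//; last 2 first.
- apply/measurable_EFinP; apply: measurable_fun_ifT => //.
    exact: measurable_fun_ler.
  by apply: measurable_funM => //; exact: measurable_gfun.
- by move=> x _; rewrite lee_fin; case: ifP => // x0; rewrite mulr_ge0 ?exprn_ge0 ?(ltW (gfun_gt0 _)).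
apply: eq_integral => r _; rewrite /J/=.
case: (boolP (0 <= r)) => r0/=; last by rewrite mule0 integral0_eq.
transitivity ((k.+1%:R * r ^+ k)%:E * \int[mu]_(x in `[r, +oo[) (x * gfun x)%:E)%E.
  rewrite -ge0_integralZl//; last 3 first.
  - apply/measurable_EFinP; apply: measurable_funTS; apply: measurable_funM => //.
    exact: measurable_gfun.
  - move=> x; rewrite /= in_itv/= andbT lee_fin => rx.
    by rewrite mulr_ge0 ?(le_trans r0 rx) ?(ltW (gfun_gt0 _)).
  - by rewrite lee_fin mulr_ge0// exprn_ge0.
  rewrite (integral_if (fun x => r <= x) (fun x => k.+1%:R * r ^+ k * (x * gfun x))).
  rewrite (_ : [set x | _] = `[r, +oo[%classic)//.
  by apply/seteqP; split => x /=; rewrite in_itv/= andbT.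
by rewrite gfun_tail1// -!EFinM; congr EFin; ring.
Qed.

(** Hardy's argument from the base point [0]: [h x ^+ 2] is at most [x] times the integral of
    [h1 ^+ 2] over []0, x]], and the tail integral of [x * gfun x] from [r] is exactly [gfun r].
    Nothing is lost for [h x = x], hence the constant one. *)
Lemma gauss_odd_half (h h1 : R -> R) : continuous h1 ->
  (forall x : R, is_derive x 1 h (h1 x)) -> h 0 = 0 ->
  (\int[mu]_x (if (0 <= x)%R then h x ^+ 2 * gfun x else 0)%:E <=
   \int[mu]_x (if (0 <= x)%R then h1 x ^+ 2 * gfun x else 0)%:E)%E.
Proof.
move=> ch1 dh h00.
have ch : continuous h.
  by move=> x; apply/differentiable_continuous/derivable1_diffP; case: (dh x).
have mh := continuous_measurable_fun ch.
have mh1 := continuous_measurable_fun ch1.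
have mle : measurable_fun setT (fun x : R => 0 <= x) by exact: measurable_fun_ler.
have mid1 : measurable_fun setT (fun z : R * R => z.1) by exact: measurable_fst.
have mid2 : measurable_fun setT (fun z : R * R => z.2) by exact: measurable_snd.
have mif (f : R -> R) : measurable_fun setT f ->
    measurable_fun setT (fun x : R => if 0 <= x then f x else 0).
  by move=> mf; apply: measurable_fun_ifT.
have eM (f : R -> R) : (\int[mu]_x (if (0 <= x)%R then f x * gfun x else 0)%:E =
    \int[mu]_x ((if (0 <= x)%R then f x else 0) * gfun x)%:E)%E.
  by apply: eq_integral => x _; case: ifP => //; rewrite mul0r.
rewrite (eM (fun x => h x ^+ 2)) (eM (fun x => h1 x ^+ 2)).
apply: (@ge0_integral_hardy R (fun x r => (0 < r) && (r <= x))
  (fun x => if 0 <= x then h x ^+ 2 else 0) (fun x => if 0 <= x then x else 0)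
  (fun x => if 0 <= x then h1 x ^+ 2 else 0) gfun gfun).
- by apply: measurable_and; [exact: measurable_fun_ltr|exact: measurable_fun_ler].
- by apply: mif; exact: measurable_funX.
- exact: mif.
- by apply: mif; exact: measurable_funX.
- exact: measurable_gfun.
- exact: measurable_gfun.
- by move=> x; case: ifP => // _; exact: sqr_ge0.
- by move=> x; case: ifP.
- by move=> x; case: ifP => // _; exact: sqr_ge0.
- by move=> x; rewrite ltW ?gfun_gt0.
- by move=> x; rewrite ltW ?gfun_gt0.
- move=> x; case: ifPn => x0; last by rewrite mul0e.
  move: x0; rewrite le_eqVlt => /predU1P[<-|x0]; first by rewrite h00 expr0n mul0e.
  have c1 : continuous (cst 1 : R -> R) by move=> ?; exact: cvg_cst.
  have d1 (r : R) : is_derive r 1 id ((cst 1 : R -> R) r) by exact: is_derive_id.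
  have := @sqr_increment_le R h h1 id (cst 1) 0 x x0 ch1 dh c1 d1 (fun _ _ => ltr01).
  rewrite h00 subr0 => /le_trans; apply.
  rewrite subr0; apply: lee_wpmul2l; first by rewrite lee_fin ltW.
  rewrite (integral_if (fun r => (0 < r) && (r <= x)) (fun r => if 0 <= r then h1 r ^+ 2 else 0)).
  rewrite (_ : [set r | _] = `]0, x]%classic); last first.
    by apply/seteqP; split => r /=; rewrite in_itv.
  rewrite le_eqVlt; apply/orP; left; apply/eqP; apply: eq_integral => r.
  by rewrite mem_setE in_itv/= => /andP[/ltW -> _]; rewrite divr1.
- move=> r; have [r0|r0] := ltP 0 r; last first.
    by rewrite integral0_eq ?lee_fin ?ltW ?gfun_gt0// => x _; rewrite (negbTE (_ : ~~ _)).
  have := gfun_tail1 (ltW r0) => <-.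
  rewrite le_eqVlt; apply/orP; left; apply/eqP.
  rewrite (_ : `[r, +oo[%classic = [set x | r <= x]); last first.
    by apply/seteqP; split => x /=; rewrite in_itv/= andbT.
  rewrite -integral_if; apply: eq_integral => x _ /=.
  by case: ifP => // rx; rewrite (le_trans (ltW r0) rx).
Qed.

(** Hardy's argument from the base point [1] with weight [2 r], the derivative of [r^2], so that
    nothing is lost for [h x = x^2]. The factor [|x^2 - 1|] then integrates to [r * gfun r] on
    either side: over [[r, +oo[] when [r > 1], over [[0, r]] when [r <= 1]. Divided by [2 r], this
    gives the constant one half. *)
Lemma gauss_even_half (h h1 : R -> R) : continuous h1 ->
  (forall x : R, is_derive x 1 h (h1 x)) ->
  (\int[mu]_x (if (0 <= x)%R then (h x - h 1) ^+ 2 * gfun x else 0)%:E <=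
   2^-1%:E * \int[mu]_x (if (0 <= x)%R then h1 x ^+ 2 * gfun x else 0)%:E)%E.
Proof.
move=> ch1 dh.
have ch : continuous h.
  by move=> x; apply/differentiable_continuous/derivable1_diffP; case: (dh x).
have mh := continuous_measurable_fun ch.
have mh1 := continuous_measurable_fun ch1.
have mid1 : measurable_fun setT (fun z : R * R => z.1) by exact: measurable_fst.
have mid2 : measurable_fun setT (fun z : R * R => z.2) by exact: measurable_snd.
have mg := measurable_gfun.
have g0 x : 0 <= gfun x by rewrite ltW ?gfun_gt0.
have mif (P : R -> bool) (f : R -> R) : measurable_fun setT P -> measurable_fun setT f ->
    measurable_fun setT (fun x : R => if P x then f x else 0).
  by move=> mP mf; apply: measurable_fun_ifT.
have mle0 : measurable_fun setT (fun x : R => 0 <= x) by exact: measurable_fun_ler.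
have mle1 : measurable_fun setT (fun x : R => 1 <= x) by exact: measurable_fun_ler.
have mlt1 : measurable_fun setT (fun x : R => 1 < x) by exact: measurable_fun_ltr.
have mle01 : measurable_fun setT (fun x : R => (0 <= x) && (x <= 1)).
  by apply: measurable_and; exact: measurable_fun_ler.
have mlt01 : measurable_fun setT (fun x : R => (0 <= x) && (x < 1)).
  by apply: measurable_and; [exact: measurable_fun_ler|exact: measurable_fun_ltr].
have mh2 : measurable_fun setT (fun x => (h x - h 1) ^+ 2).
  by apply: measurable_funX; exact: measurable_funB.
have ms : measurable_fun setT (fun r => h1 r ^+ 2 / (2 * r)).
  apply: measurable_funM; first exact: measurable_funX.
  apply: (@measurableT_comp _ _ _ _ _ _ (@GRing.inv R)); first exact: measurable_invr.
  exact: measurable_funM.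
have mrg : measurable_fun setT (fun r : R => r * gfun r) by exact: measurable_funM.
have cbe : continuous (fun r : R => 2 * r) by move=> ?; apply: cvgMr; exact: cvg_id.
have dB (r : R) : is_derive r 1 (fun r => r ^+ 2) (2 * r).
  by apply: is_derive_eq; rewrite /GRing.scale/=; ring.
pose sR (r : R) := if 1 < r then h1 r ^+ 2 / (2 * r) else 0.
pose sL (r : R) := if (0 <= r) && (r <= 1) then h1 r ^+ 2 / (2 * r) else 0.
pose kR (r : R) := if 1 < r then r * gfun r else 0.
pose kL (r : R) := if (0 <= r) && (r <= 1) then r * gfun r else 0.
have sR0 r : 0 <= sR r.
  rewrite /sR; case: ifP => // r1; rewrite mulr_ge0 ?sqr_ge0// invr_ge0 mulr_ge0//.
  by rewrite ltW// (lt_trans _ r1).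
have sL0 r : 0 <= sL r.
  by rewrite /sL; case: ifP => // /andP[r0 _]; rewrite mulr_ge0 ?sqr_ge0// invr_ge0 mulr_ge0.
have kR0 r : 0 <= kR r.
  by rewrite /kR; case: ifP => // r1; rewrite mulr_ge0// ltW// (lt_trans _ r1).
have kL0 r : 0 <= kL r.
  by rewrite /kL; case: ifP => // /andP[r0 _]; rewrite mulr_ge0.
have HR : (\int[mu]_x ((if (1 <= x)%R then (h x - h 1) ^+ 2 else 0) * gfun x)%:E <=
    \int[mu]_r (sR r * kR r)%:E)%E.
  apply: (@ge0_integral_hardy R (fun x r => (1 < r) && (r <= x)) _
    (fun x => if 1 <= x then x ^+ 2 - 1 else 0)) => //.
  - by apply: measurable_and; [exact: measurable_fun_ltr|exact: measurable_fun_ler].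
  - exact: mif.
  - by apply: mif => //; apply: measurable_funB.
  - exact: mif.
  - exact: mif.
  - by move=> x; case: ifP => // _; exact: sqr_ge0.
  - by move=> x; case: ifP => // x1; rewrite subr_ge0 exprn_ege1.
  - move=> x; case: ifPn => x1; last by rewrite mul0e.
    move: x1; rewrite le_eqVlt => /predU1P[<-|x1]; first by rewrite subrr expr0n/= expr1n subrr mul0e.
    have := @sqr_increment_le R h h1 (fun r => r ^+ 2) (fun r => 2 * r) 1 x x1 ch1 dh cbe dB.
    rewrite expr1n => /(_ _)/le_trans; apply.
      by move=> r r1; rewrite mulr_gt0// (lt_trans _ r1).
    apply: lee_wpmul2l; first by rewrite lee_fin subr_ge0 exprn_ege1// ltW.
    rewrite (integral_if (fun r => (1 < r) && (r <= x)) sR).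
    rewrite (_ : [set r | _] = `]1, x]%classic); last first.
      by apply/seteqP; split => r /=; rewrite in_itv.
    rewrite le_eqVlt; apply/orP; left; apply/eqP; apply: eq_integral => r.
    by rewrite mem_setE in_itv/= /sR => /andP[-> _].
  - move=> r; rewrite /kR; have [r1|r1] := ltP 1 r; last by rewrite integral0_eq.
    rewrite -(gfun_tail2 (ltW r1)).
    rewrite le_eqVlt; apply/orP; left; apply/eqP.
    rewrite (_ : `[r, +oo[%classic = [set x | r <= x]); last first.
      by apply/seteqP; split => x /=; rewrite in_itv/= andbT.
    rewrite -integral_if; apply: eq_integral => x _ /=.
    by case: ifP => // rx; rewrite (le_trans (ltW r1) rx).
have HL : (\int[mu]_x ((if ((0 <= x) && (x < 1))%R then (h x - h 1) ^+ 2 else 0) * gfun x)%:E <=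
    \int[mu]_r (sL r * kL r)%:E)%E.
  apply: (@ge0_integral_hardy R (fun x r => [&& 0 <= x, x < r & r <= 1]) _
    (fun x => if (0 <= x) && (x < 1) then 1 - x ^+ 2 else 0)) => //.
  - apply: measurable_and; first exact: measurable_fun_ler.
    by apply: measurable_and; [exact: measurable_fun_ltr|exact: measurable_fun_ler].
  - exact: mif.
  - by apply: mif => //; apply: measurable_funB.
  - exact: mif.
  - exact: mif.
  - by move=> x; case: ifP => // _; exact: sqr_ge0.
  - by move=> x; case: ifP => // /andP[x0 x1]; rewrite subr_ge0 exprn_ile1// ltW.
  - move=> x; case: ifPn => [/andP[x0 x1]|_]; last by rewrite mul0e.
    have := @sqr_increment_le R h h1 (fun r => r ^+ 2) (fun r => 2 * r) x 1 x1 ch1 dh cbe dB.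
    rewrite expr1n -(sqrrN (h 1 - h x)) opprB => /(_ _)/le_trans; apply.
      by move=> r r1; rewrite mulr_gt0// (le_lt_trans x0).
    apply: lee_wpmul2l; first by rewrite lee_fin subr_ge0 exprn_ile1// ltW.
    rewrite (integral_if (fun r => [&& 0 <= x, x < r & r <= 1]) sL) x0/=.
    rewrite (_ : [set r | _] = `]x, 1%R]%classic); last first.
      by apply/seteqP; split => r /=; rewrite in_itv.
    rewrite le_eqVlt; apply/orP; left; apply/eqP; apply: eq_integral => r.
    by rewrite mem_setE in_itv/= /sL => /andP[xr ->]; rewrite (le_trans x0 (ltW xr)).
  - move=> r; rewrite /kL; case: ifPn => [/andP[r0 r1]|r01]; last first.
      rewrite integral0_eq// => x _; case: ifPn => // /and3P[x0 xr r1].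
      by move: r01; rewrite r1 (le_trans x0 (ltW xr)).
    rewrite -(gfun_head r0) -integral_itv_bndo_bndc; last first.
      apply/measurable_EFinP; apply: measurable_funTS; apply: measurable_funM => //.
      exact: measurable_funB.
    rewrite le_eqVlt; apply/orP; left; apply/eqP.
    rewrite (_ : `[0%R, r[%classic = [set x : R | (0 <= x) && (x < r)]); last first.
      by apply/seteqP; split => x /=; rewrite in_itv.
    rewrite -integral_if; apply: eq_integral => x _ /=.
    rewrite r1 andbT; case: ifP => // /andP[x0 xr].
    by rewrite x0 (lt_le_trans xr r1).
have -> : (\int[mu]_x (if (0 <= x)%R then (h x - h 1) ^+ 2 * gfun x else 0)%:E =
   \int[mu]_x ((if (1 <= x)%R then (h x - h 1) ^+ 2 else 0) * gfun x)%:E +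
   \int[mu]_x ((if ((0 <= x) && (x < 1))%R then (h x - h 1) ^+ 2 else 0) * gfun x)%:E)%E.
  rewrite -ge0_integralD//; last 4 first.
  - by move=> x _; rewrite lee_fin mulr_ge0//; case: ifP => // _; exact: sqr_ge0.
  - by apply/measurable_EFinP; apply: measurable_funM => //; exact: mif.
  - by move=> x _; rewrite lee_fin mulr_ge0//; case: ifP => // _; exact: sqr_ge0.
  - by apply/measurable_EFinP; apply: measurable_funM => //; exact: mif.
  apply: eq_integral => x _; rewrite -EFinD -mulrDl; congr EFin.
  have [x0|x0] := leP 0 x; last first.
    by rewrite leNgt (lt_trans x0)//= addr0 mul0r.
  by case: ltP => /= x1; rewrite ?addr0 ?add0r.
apply: (le_trans (leeD HR HL)).
rewrite -ge0_integralZl//; last 2 first.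
- apply/measurable_EFinP; apply: mif => //; apply: measurable_funM => //.
  exact: measurable_funX.
- by move=> x _; rewrite lee_fin; case: ifP => // _; rewrite mulr_ge0 ?sqr_ge0.
rewrite -ge0_integralD//; last 4 first.
- by move=> x _; rewrite lee_fin mulr_ge0.
- by apply/measurable_EFinP; apply: measurable_funM; exact: mif.
- by move=> x _; rewrite lee_fin mulr_ge0.
- by apply/measurable_EFinP; apply: measurable_funM; exact: mif.
apply: ge0_le_integral => //.
- by move=> x _; rewrite adde_ge0// lee_fin mulr_ge0.
- by apply: emeasurable_funD; apply/measurable_EFinP; apply: measurable_funM; exact: mif.
- apply: measurable_funeM; apply/measurable_EFinP; apply: mif => //; apply: measurable_funM => //.
  exact: measurable_funX.
- move=> x _; rewrite -EFinM -EFinD lee_fin /sR /kR /sL /kL.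
  have [x1|x1] := ltP 1 x.
    rewrite andbF mul0r addr0 (le_trans ler01 (ltW x1)).
    rewrite le_eqVlt; apply/orP; left; apply/eqP; field.
    by rewrite lt0r_neq0// (lt_trans ltr01).
  rewrite andbT mul0r add0r; case: ifPn => x0; last by rewrite !mulr0.
  (* At [0] the convention [0^-1 = 0] makes the left side vanish, so only an inequality holds at
     this point. *)
  have [->|xn0] := eqVneq x 0; first by rewrite mulr0 invr0 mulr0 mul0r mulr_ge0// mulr_ge0// sqr_ge0.
  by rewrite le_eqVlt; apply/orP; left; apply/eqP; field.
Qed.

End gauss1.

Lemma continuous_sqr_comp {R : realType} (T : topologicalType) (g : T -> R) :
  continuous g -> continuous (fun x => g x ^+ 2).
Proof.
move=> cg x; apply: (@continuous_comp _ _ _ g (fun x => x ^+ 2)); first exact: cg.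
exact: exprn_continuous.
Qed.

Lemma integral_prob_cst d (T : measurableType d) (R : realType)
  (P : probability T R) (k : \bar R) : (\int[P]_x k = k)%E.
Proof.
have := integral_cst P measurableT k.
by rewrite [X in (_ * X)%E]probability_setT mule1.
Qed.

(** * The standard normal law on the line *)

Section normal01.
Context {R : realType}.
Notation mu := (@lebesgue_measure R).

Definition normal01 : probability (measurableTypeR R) R := normal_prob 0 1.

Definition gpeak : R := normal_peak 1.

Lemma gpeak_gt0 : 0 < gpeak. Proof. by rewrite normal_peak_gt0// oner_neq0. Qed.

Lemma ge0_integral_normal01 (f : R -> \bar R) :
  measurable_fun setT f -> (forall x, (0 <= f x)%E) ->
  (\int[normal01]_x f x = \int[mu]_x (f x * (gpeak * gfun x)%:E))%E.
Proof.
move=> mf f0.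
have pdfE x : normal_pdf 0 1 x = gpeak * gfun x :> R.
  rewrite /normal_pdf oner_eq0 /gfun; congr (_ * expR _).
  by rewrite subr0 expr1n mulNr.
rewrite (@ge0_integral_density _ _ _ normal01 mu (fun x => gpeak * gfun x))//.
- by apply: measurable_funM => //; exact: measurable_gfun.
- by move=> x; rewrite mulr_ge0 ?ltW ?gpeak_gt0 ?gfun_gt0.
- move=> A mA; rewrite [LHS]/(normal_prob 0 1 A) /normal_prob.
  by apply: eq_integral => x _; rewrite pdfE.
Qed.

Lemma ge0_integral_normal01N (f : R -> \bar R) :
  measurable_fun setT f -> (forall x, (0 <= f x)%E) ->
  (\int[normal01]_x f (- x)%R = \int[normal01]_x f x)%E.
Proof.
move=> mf f0.
have mfN : measurable_fun setT (fun x : R => f (- x)) by apply: measurableT_comp.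
rewrite !ge0_integral_normal01//.
rewrite -(ge0_integral_opp (f := fun x => f x * (gpeak * gfun x)%:E)%E).
- by apply: eq_integral => x _; rewrite gfunN.
- apply: emeasurable_funM => //; apply/measurable_EFinP; apply: measurable_funM => //.
  exact: measurable_gfun.
- by move=> x; rewrite mule_ge0// lee_fin mulr_ge0 ?ltW ?gpeak_gt0 ?gfun_gt0.
Qed.

Lemma integral_normal01_even (f : R -> R) : (forall x, 0 <= f x) -> continuous f ->
  (forall x, f (- x) = f x) ->
  (\int[normal01]_x (f x)%:E =
   (2 * gpeak)%:E * \int[mu]_x (if (0 <= x)%R then f x * gfun x else 0%R)%:E)%E.
Proof.
move=> f0 cf fN; rewrite ge0_integral_normal01//; last first.
  by apply/measurable_EFinP; exact: continuous_measurable_fun.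
have mg := continuous_measurable_fun cf; have mgf := @measurable_gfun R.
transitivity (\int[mu]_x (gpeak%:E * (f x * gfun x)%:E))%E.
  by apply: eq_integral => x _; rewrite -!EFinM; congr EFin; ring.
rewrite ge0_integralZl//; last 3 first.
- by apply/measurable_EFinP; exact: measurable_funM.
- by move=> x _; rewrite lee_fin mulr_ge0 ?(ltW (gfun_gt0 _)).
- by rewrite lee_fin ltW ?gpeak_gt0.
rewrite (integral_even (f := fun x => f x * gfun x)).
- by rewrite muleA -EFinM (mulrC gpeak).
- by move=> x; rewrite mulr_ge0 ?(ltW (gfun_gt0 _)).
- by move=> x; apply: cvgM; [exact: cf|exact: continuous_gfun].
- by move=> x; rewrite fN gfunN.
Qed.

Let gp2 : (0 <= (2 * gpeak)%:E)%E.
Proof. by rewrite lee_fin mulr_ge0// ltW// gpeak_gt0. Qed.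

Lemma normal01_odd_poincare (h h1 : R -> R) : continuous h1 ->
  (forall x : R, is_derive x 1 h (h1 x)) ->
  (forall x, h (- x) = - h x) -> (forall x, h1 (- x) = h1 x) ->
  (\int[normal01]_x (h x ^+ 2)%:E <= \int[normal01]_x (h1 x ^+ 2)%:E)%E.
Proof.
move=> ch1 dh hN h1N.
have ch : continuous h.
  by move=> x; apply/differentiable_continuous/derivable1_diffP; case: (dh x).
have h00 : h 0 = 0.
  by have := hN 0; rewrite oppr0 => /eqP; rewrite -addr_eq0 -mulr2n mulrn_eq0/= => /eqP.
rewrite (@integral_normal01_even (fun x => h x ^+ 2)); last 3 first.
- by move=> x; exact: sqr_ge0.
- exact: continuous_sqr_comp.
- by move=> x; rewrite hN sqrrN.
rewrite (@integral_normal01_even (fun x => h1 x ^+ 2)); last 3 first.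
- by move=> x; exact: sqr_ge0.
- exact: continuous_sqr_comp.
- by move=> x; rewrite h1N.
by apply: lee_wpmul2l => //; exact: gauss_odd_half.
Qed.

(** The centre [h 1] is in general not the mean; as the mean minimises the quadratic deviation, the
    same bound will pass to the variance. *)
Lemma normal01_even_poincare (h h1 : R -> R) : continuous h1 ->
  (forall x : R, is_derive x 1 h (h1 x)) ->
  (forall x, h (- x) = h x) -> (forall x, h1 (- x) = - h1 x) ->
  (\int[normal01]_x ((h x - h 1%R) ^+ 2)%:E <=
   2^-1%:E * \int[normal01]_x (h1 x ^+ 2)%:E)%E.
Proof.
move=> ch1 dh hN h1N.
have ch : continuous h.
  by move=> x; apply/differentiable_continuous/derivable1_diffP; case: (dh x).
rewrite (@integral_normal01_even (fun x => (h x - h 1) ^+ 2)); last 3 first.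
- by move=> x; exact: sqr_ge0.
- apply: (continuous_sqr_comp (g := fun x => h x - h 1)) => x.
  by apply: cvgB; [exact: ch|exact: cvg_cst].
- by move=> x; rewrite hN.
rewrite (@integral_normal01_even (fun x => h1 x ^+ 2)); last 3 first.
- by move=> x; exact: sqr_ge0.
- exact: continuous_sqr_comp.
- by move=> x; rewrite h1N sqrrN.
rewrite muleCA; apply: lee_wpmul2l => //; exact: gauss_even_half.
Qed.

Lemma normal01_moments :
  (\int[normal01]_x (x ^+ 2)%:E = 1 /\ \int[normal01]_x (x ^+ 4)%:E = 3%:E)%E.
Proof.
have M k : ~~ odd k -> (\int[normal01]_x (x ^+ k.+2)%:E =
    k.+1%:R%:E * \int[normal01]_x (x ^+ k)%:E)%E.
  move=> ek; have E j : ~~ odd j -> (\int[normal01]_x (x ^+ j)%:E = (2 * gpeak)%:E *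
      \int[mu]_x (if (0 <= x)%R then x ^+ j * gfun x else 0%R)%:E)%E.
    move=> ej; rewrite (@integral_normal01_even (fun x => x ^+ j))//.
    - by move=> x; rewrite exprn_even_ge0.
    - exact: exprn_continuous.
    - by move=> x; rewrite exprNn -signr_odd (negbTE ej) mul1r.
  rewrite !E//; last by rewrite /= negbK.
  by rewrite gfun_moment muleCA.
have M0 : (\int[normal01]_x (x ^+ 0)%:E = 1)%E.
  by under eq_integral do rewrite expr0; rewrite integral_prob_cst.
have M2 : (\int[normal01]_x (x ^+ 2)%:E = 1)%E by rewrite M// M0 mule1.
by split=> //; rewrite M// M2 mule1.
Qed.

End normal01.

(** * Variance, and differentiation under the integral sign *)

Section probability_variance.
Context d (T : measurableType d) (R : realType) (P : probability T R).

Lemma integrable_sqr (g : T -> R) : measurable_fun setT g ->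
  (\int[P]_x (g x ^+ 2)%:E < +oo)%E -> P.-integrable setT (EFin \o g).
Proof.
move=> mg goo.
have i1 : P.-integrable setT (EFin \o (fun x => 1 + g x ^+ 2)).
  apply: integrable_ge0.
  - by apply: measurable_funD => //; exact: measurable_funX.
  - by move=> x; rewrite addr_ge0 ?sqr_ge0.
  - under eq_integral do rewrite EFinD.
    rewrite ge0_integralD//; last 2 first.
    + by move=> x _; rewrite lee_fin sqr_ge0.
    + by apply/measurable_EFinP; exact: measurable_funX.
    by rewrite integral_prob_cst lte_add_pinfty ?ltry.
apply: le_integrable i1 => //; first exact/measurable_EFinP.
move=> x _; rewrite /= lee_fin [leRHS]ger0_norm ?addr_ge0 ?sqr_ge0//.
(* This square gives [|g x| <= g x ^+ 2 + 1/4]. *)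
have := sqr_ge0 (`|g x| - 2^-1); rewrite sqrrB real_normK ?num_real//.
rewrite -mulr_natr; have := normr_ge0 (g x); lra.
Qed.

(** The variance decomposition. It allows any convenient centre to be exchanged for the mean, and
    its case [c = 0] is Jensen's inequality for the square. *)
Lemma integral_sqr_sub (g : T -> R) (c : R) : measurable_fun setT g ->
  (\int[P]_x (g x ^+ 2)%:E < +oo)%E ->
  (\int[P]_x ((g x - c) ^+ 2)%:E =
   \int[P]_x ((g x - (\int[P]_y g y)%R) ^+ 2)%:E +
   (((\int[P]_y g y)%R - c) ^+ 2)%:E)%E.
Proof.
move=> mg goo; set m := (\int[P]_y g y)%R.
have ig := integrable_sqr mg goo.
have ig2 : P.-integrable setT (fun x => (g x ^+ 2)%:E).
  by apply: integrable_ge0 => //; [exact: measurable_funX|move=> x; exact: sqr_ge0].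
have icst (k : R) : P.-integrable setT (fun=> k%:E).
  exact: finite_measure_integrable_cst.
have mE : (\int[P]_x (g x)%:E = m%:E)%E.
  by rewrite /m /Rintegral fineK//; exact: integrable_fin_num.
have key k : (\int[P]_x ((g x - k) ^+ 2)%:E =
    \int[P]_x (g x ^+ 2)%:E + ((- 2 * k) * m + k ^+ 2)%:E)%E.
  transitivity (\int[P]_x ((g x ^+ 2)%:E + ((- 2 * k)%:E * (g x)%:E + (k ^+ 2)%:E)))%E.
    by apply: eq_integral => x _; rewrite -EFinM -!EFinD; congr EFin; ring.
  have iZ := integrableZl measurableT (- 2 * k) ig.
  rewrite integralD//; last exact: integrableD.
  rewrite integralD// integralZl// integral_prob_cst.
  by rewrite (mE : (\int[P]_x (EFin \o g) x = _)%E) -EFinM -EFinD.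
rewrite (key c) (key m) -addeA -EFinD; congr (_ + _%:E)%E; ring.
Qed.

Lemma sqr_Rintegral_le (g : T -> R) : measurable_fun setT g ->
  (\int[P]_x (g x ^+ 2)%:E < +oo)%E ->
  (((\int[P]_y g y)%R ^+ 2)%:E <= \int[P]_x (g x ^+ 2)%:E)%E.
Proof.
move=> mg goo; have := integral_sqr_sub 0 mg goo.
under eq_integral do rewrite subr0.
rewrite subr0 => ->; rewrite leeDr//.
by apply: integral_ge0 => x _; rewrite lee_fin sqr_ge0.
Qed.

End probability_variance.

(** The dominating function may depend on the range [B] of the parameter, because integrands of
    quadratic growth have no dominating function valid for all parameters at once. Locally, []t - 1,
    t + 1[] lies in the range [|t| + 1]. *)
Lemma Rintegral_C1 d (T : measurableType d) (R : realType)
    (P : {measure set T -> \bar R}) (f df : R -> T -> R) :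
  (forall s, measurable_fun setT (f s)) -> (forall s, measurable_fun setT (df s)) ->
  (forall (x : T) (s : R), is_derive s 1 (fun r => f r x) (df s x)) ->
  (forall x, continuous (fun r => df r x)) ->
  (forall B : R, exists2 G, P.-integrable setT (EFin \o G) &
    forall s x, `|s| <= B -> `|f s x| <= G x /\ `|df s x| <= G x) ->
  (forall s : R, is_derive s 1 (fun s => \int[P]_x f s x) (\int[P]_x df s x)) /\
  continuous (fun s => \int[P]_x df s x).
Proof.
move=> mf mdf dfE cdf bnd.
have loc (t s : R) : `]t - 1, t + 1[%classic s -> `|s| <= `|t| + 1.
  rewrite /= in_itv/= -ltr_distlC => ts.
  by rewrite -[s](subrK t) addrC (le_trans (ler_normD _ _))// lerD2l ltW// distrC.
have tt (t : R) : `]t - 1, t + 1[%classic t by rewrite /= in_itv/= ltrBlDr ltrDl ltr01.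
have int (g : R -> T -> R) (G : T -> R) (t : R) : measurable_fun setT (g t) ->
    P.-integrable setT (EFin \o G) ->
    (forall x, `|g t x| <= G x) -> P.-integrable setT (EFin \o g t).
  move=> mg iG gG; apply: le_integrable iG => //; first exact/measurable_EFinP.
  by move=> x _ /=; rewrite lee_fin (le_trans (gG x))// ler_norm.
have d1E x t : partial1of2 f t x = df t x.
  by rewrite partial1of2E; exact: derive_val.
split=> t; have [G iG fG] := bnd (`|t| + 1).
  have G0 x : 0 <= G x by apply: le_trans (normr_ge0 (f t x)) _; have [] := fG t x (loc _ _ (tt t)).
  have iff s : `]t - 1, t + 1[%classic s -> P.-integrable setT (EFin \o f s).
    by move=> /loc ts; apply: (int _ G) => // x; have [] := fG s x ts.
  have df1 s x : `]t - 1, t + 1[%classic s -> setT x -> derivable (f^~ x) s 1.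
    by move=> _ _; have [] := dfE x s.
  have bd s x : `]t - 1, t + 1[%classic s -> setT x -> `|partial1of2 f s x| <= G x.
    by move=> /loc ts _; rewrite d1E; have [] := fG s x ts.
  apply: DeriveDef.
    exact: (derivable_under_integral measurableT (tt t) iff df1 G0 iG bd).
  rewrite -derive1E (differentiation_under_integral measurableT (tt t) iff df1 G0 iG bd).
  by apply: eq_Rintegral => x _; rewrite d1E.
have := @continuity_under_integral _ _ _ P df setT measurableT (t - 1) (t + 1) _ _ G iG _ t.
apply; last exact/mem_set/tt.
- by move=> s /loc ts; apply: (int _ G) => // x; have [] := fG s x ts.
- by apply: aeW => x _ s _; exact: cdf.
- by move=> s /loc ts; apply: aeW => x _; have [] := fG s x ts.
Qed.

(** * Gaussian measure on R^n: functions of quadratic growth and parity in one coordinate *)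

Section gauss_rV.
Context {R : realType}.
Notation nu := (@normal01 R).
Notation gauss := (prob_rV nu).
Implicit Types n : nat.

(** Differentiability is asked only along coordinate lines, with explicit partial derivatives. This
    class is stable under slicing, reflection and averaging over a coordinate, the operations of the
    induction on dimension. Quadratic growth fits the degree-two functions to which the inequality
    is applied, and their squares have a finite integral by the fourth moment. *)
Record C1_growth n (f : 'rV[R]_n -> R) (d : 'I_n -> 'rV[R]_n -> R) (K : R) : Prop :=
  C1Growth {
  cg_mf : measurable_fun setT f;
  cg_md : forall i, measurable_fun setT (d i);
  cg_derive : forall x i (t : R),
    is_derive t 1 (fun s => f (x + s *: delta_mx ord0 i)) (d i (x + t *: delta_mx ord0 i));
  cg_cont : forall x i, continuous (fun s : R => d i (x + s *: delta_mx ord0 i));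
  cg_f : forall x, `|f x| <= K * (1 + enorm x ^+ 2);
  cg_d : forall i x, `|d i x| <= K * (1 + enorm x ^+ 2)
}.

Lemma rV_cons_shift0 n (x t : R) (y : 'rV[R]_n) :
  rV_cons (x, y) + t *: delta_mx ord0 ord0 = rV_cons (x + t, y).
Proof.
apply/rowP => i; rewrite [LHS]mxE [X in _ + X]mxE [X in _ * X]mxE.
case: (unliftP ord0 i) => [j ->|->]; first by rewrite !rV_consS mulr0 addr0.
by rewrite !rV_cons0 mulr1.
Qed.

Lemma rV_cons_shiftS n (x t : R) (y : 'rV[R]_n) (j : 'I_n) :
  rV_cons (x, y) + t *: delta_mx ord0 (lift ord0 j) =
  rV_cons (x, y + t *: delta_mx ord0 j).
Proof.
apply/rowP => i; rewrite [LHS]mxE [X in _ + X]mxE [X in _ * X]mxE.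
case: (unliftP ord0 i) => [k ->|->].
  by rewrite !rV_consS !mxE (inj_eq (@lift_inj _ ord0)).
by rewrite !rV_cons0 mulr0 addr0.
Qed.

Lemma rV_consN n (x : R) (y : 'rV[R]_n) : - rV_cons (x, y) = rV_cons (- x, - y).
Proof. by rewrite -scaleN1r rV_consZ mulN1r scaleN1r. Qed.

Lemma cg_slice0 n f d K (y : 'rV[R]_n) : C1_growth f d K ->
  (forall t : R, is_derive t 1 (fun s => f (rV_cons (s, y))) (d ord0 (rV_cons (t, y)))) /\
  continuous (fun t : R => d ord0 (rV_cons (t, y))).
Proof.
move=> cg; split=> t.
  have := cg_derive cg (rV_cons (0, y)) ord0 t.
  rewrite rV_cons_shift0 add0r.
  by under eq_fun do rewrite rV_cons_shift0 add0r.
have := @cg_cont _ _ _ _ cg (rV_cons (0, y)) ord0 t.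
rewrite /continuous_at rV_cons_shift0 add0r.
by under eq_fun do rewrite rV_cons_shift0 add0r.
Qed.

Lemma cg_sliceS n f d K (x : R) : C1_growth f d K ->
  C1_growth (fun y : 'rV[R]_n => f (rV_cons (x, y)))
            (fun j y => d (lift ord0 j) (rV_cons (x, y))) (K * (1 + x ^+ 2)).
Proof.
move=> cg.
have K0 : 0 <= K.
  have := le_trans (normr_ge0 _) (cg_f cg 0).
  by rewrite pmulr_lge0// ltr_pwDl// sqr_ge0.
have le1 (y : 'rV[R]_n) : K * (1 + enorm (rV_cons (x, y)) ^+ 2) <=
    K * (1 + x ^+ 2) * (1 + enorm y ^+ 2).
  rewrite -mulrA ler_wpM2l// enorm_rV_cons.
  have := sqr_ge0 x; have := sqr_ge0 (enorm y); nra.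
split.
- exact: measurableT_comp (cg_mf cg) (measurable_rV_cons_r _).
- move=> j; exact: measurableT_comp (cg_md cg _) (measurable_rV_cons_r _).
- move=> y j t; have := cg_derive cg (rV_cons (x, y)) (lift ord0 j) t.
  by rewrite rV_cons_shiftS; under eq_fun do rewrite rV_cons_shiftS.
- move=> y j; have := @cg_cont _ _ _ _ cg (rV_cons (x, y)) (lift ord0 j).
  by under eq_fun do rewrite rV_cons_shiftS.
- by move=> y; rewrite (le_trans (cg_f cg _)).
- by move=> i y; rewrite (le_trans (cg_d cg _ _)).
Qed.

Lemma cg_comb n (f g : 'rV[R]_n -> R) df dg K e : `|e| <= 1 ->
  C1_growth f df K -> C1_growth g dg K ->
  C1_growth (fun x => (f x + e * g x) / 2) (fun i x => (df i x + e * dg i x) / 2) K.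
Proof.
move=> e1 cf cg.
have K0 : 0 <= K.
  have := le_trans (normr_ge0 _) (cg_f cf 0).
  by rewrite pmulr_lge0// ltr_pwDl// sqr_ge0.
have bnd u v B : `|u| <= B -> `|v| <= B -> `|(u + e * v) / 2| <= B.
  move=> uB vB; rewrite normrM (@ger0_norm _ 2^-1)// ler_pdivrMr//.
  rewrite (le_trans (ler_normD _ _))// mulr_natr mulr2n lerD//.
  by rewrite normrM (le_trans _ vB)// ler_piMl.
split.
- apply: measurable_funM => //; apply: measurable_funD; first exact: cg_mf cf.
  by apply: measurable_funM => //; exact: cg_mf cg.
- move=> i; apply: measurable_funM => //; apply: measurable_funD; first exact: cg_md cf i.
  by apply: measurable_funM => //; exact: cg_md cg i.
- move=> x i t; have d1 := cg_derive cf x i t; have d2 := cg_derive cg x i t.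
  by apply: is_derive_eq; rewrite /GRing.scale/=; field.
- move=> x i s; apply: cvgMl; apply: cvgD; first exact: (@cg_cont _ _ _ _ cf x i s).
  by apply: cvgMr; exact: (@cg_cont _ _ _ _ cg x i s).
- by move=> x; apply: bnd; [exact: cg_f cf x|exact: cg_f cg x].
- by move=> i x; apply: bnd; [exact: cg_d cf i x|exact: cg_d cg i x].
Qed.

Lemma ge0_integral_gaussS_swap n (f : 'rV[R]_n.+1 -> \bar R) :
  measurable_fun setT f -> (forall x, (0 <= f x)%E) ->
  (\int[gauss n.+1]_v f v = \int[gauss n]_y \int[nu]_x f (rV_cons (x, y)))%E.
Proof.
move=> mf f0; rewrite ge0_integral_prob_rVS//.
apply: (fubini_tonelli (fun p => f (rV_cons p))) => //.
exact: measurableT_comp mf (@measurable_rV_cons R n).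
Qed.

Lemma rV_unconsK n : cancel (@rV_uncons R n) (@rV_cons R n).
Proof.
move=> v; apply/rowP => i; case: (unliftP ord0 i) => [j ->|->].
  by rewrite rV_consS mxE.
by rewrite rV_cons0.
Qed.

Section parity.
Context n.
Implicit Types f : 'rV[R]_n.+1 -> R.

Definition flip0 (v : 'rV[R]_n.+1) := rV_cons (- v ord0 ord0, (rV_uncons v).2).

Lemma flip0_cons x y : flip0 (rV_cons (x, y)) = rV_cons (- x, y).
Proof. by rewrite /flip0 rV_consK rV_cons0. Qed.

Lemma measurable_flip0 : measurable_fun setT flip0.
Proof.
apply: (measurableT_comp (@measurable_rV_cons R n)).
apply: measurable_fun_pair => /=.
  apply: measurable_funN; exact: measurable_coord.
exact: measurableT_comp measurable_snd (@measurable_rV_uncons R n).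
Qed.

Lemma ge0_integral_flip0 (f : 'rV[R]_n.+1 -> \bar R) :
  measurable_fun setT f -> (forall x, (0 <= f x)%E) ->
  (\int[gauss n.+1]_v f (flip0 v) = \int[gauss n.+1]_v f v)%E.
Proof.
move=> mf f0.
have mff : measurable_fun setT (fun v => f (flip0 v)) by exact: measurableT_comp mf measurable_flip0.
rewrite (ge0_integral_gaussS_swap mff); last by move=> x; exact: f0.
rewrite (ge0_integral_gaussS_swap mf f0); apply: eq_integral => y _.
under eq_integral do rewrite flip0_cons.
apply: (ge0_integral_normal01N (f := fun x => f (rV_cons (x, y)))) => //.
exact: measurableT_comp mf (measurable_rV_cons_l _).
Qed.

(** The factors [1] and [-1] are kept so that both parts are instances of the combination treated in
    [cg_comb]. *)
Definition even0 f v := (f v + 1 * f (flip0 v)) / 2.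
Definition odd0 f v := (f v + -1 * f (flip0 v)) / 2.

Lemma measurable_even0 f : measurable_fun setT f -> measurable_fun setT (even0 f).
Proof.
move=> mf; apply: measurable_funM => //; apply: measurable_funD => //.
by apply: measurable_funM => //; exact: measurableT_comp mf measurable_flip0.
Qed.

Lemma measurable_odd0 f : measurable_fun setT f -> measurable_fun setT (odd0 f).
Proof.
move=> mf; apply: measurable_funM => //; apply: measurable_funD => //.
by apply: measurable_funM => //; exact: measurableT_comp mf measurable_flip0.
Qed.

(** The reflection preserves the Gaussian measure, so the parallelogram identity for [f] and its
    reflection can be integrated. It is proved doubled, which involves only sums of nonnegative
    extended reals. *)
Lemma integral_parity f : measurable_fun setT f ->
  (\int[gauss n.+1]_v (f v ^+ 2)%:E =
   \int[gauss n.+1]_v (even0 f v ^+ 2)%:E + \int[gauss n.+1]_v (odd0 f v ^+ 2)%:E)%E.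
Proof.
move=> mf.
have mff : measurable_fun setT (fun v => f (flip0 v)) by exact: measurableT_comp mf measurable_flip0.
have me := measurable_even0 mf; have mo := measurable_odd0 mf.
have sq (g : 'rV[R]_n.+1 -> R) : measurable_fun setT g ->
    measurable_fun setT (fun v => (g v ^+ 2)%:E).
  by move=> mg; apply/measurable_EFinP; exact: measurable_funX.
have sq0 (g : 'rV[R]_n.+1 -> R) v : (0 <= (g v ^+ 2)%:E)%E by rewrite lee_fin sqr_ge0.
have e : (\int[gauss n.+1]_v (f v ^+ 2)%:E + \int[gauss n.+1]_v (f v ^+ 2)%:E =
   2%:E * (\int[gauss n.+1]_v (even0 f v ^+ 2)%:E + \int[gauss n.+1]_v (odd0 f v ^+ 2)%:E))%E.
  rewrite -[in X in (_ + X)%E](ge0_integral_flip0 (f := fun v => (f v ^+ 2)%:E)); [|exact: sq|by []].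
  rewrite -!ge0_integralD//; [|exact: sq|exact: sq|exact: sq|exact: sq].
  rewrite -ge0_integralZl//; last 2 first.
  - by apply: emeasurable_funD; exact: sq.
  - by move=> v _; rewrite adde_ge0.
  apply: eq_integral => v _; rewrite -!EFinD -EFinM; congr EFin.
  by rewrite /even0 /odd0; field.
have {e} : (2%:E * \int[gauss n.+1]_v (f v ^+ 2)%:E = 2%:E *
    (\int[gauss n.+1]_v (even0 f v ^+ 2)%:E + \int[gauss n.+1]_v (odd0 f v ^+ 2)%:E))%E.
  by rewrite -e mule_natl mule2n.
by move=> e; apply/eqP; rewrite eq_le; apply/andP; split;
  rewrite -(@lee_pmul2l _ 2%:E)// ?lte_fin// e.
Qed.

Lemma integral_even0_le f : measurable_fun setT f ->
  (\int[gauss n.+1]_v (even0 f v ^+ 2)%:E <= \int[gauss n.+1]_v (f v ^+ 2)%:E)%E.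
Proof.
move=> mf; rewrite (integral_parity mf) leeDl//; apply: integral_ge0 => v _.
by rewrite lee_fin sqr_ge0.
Qed.

Definition sgn0 (i : 'I_n.+1) : R := if i == ord0 then -1 else 1.

Lemma enorm_flip0 v : enorm (flip0 v) = enorm v.
Proof.
rewrite -[v in LHS]rV_unconsK -[v in RHS]rV_unconsK flip0_cons.
by rewrite /enorm !big_ord_recl !rV_cons0 sqrrN; congr (Num.sqrt (_ + _));
  apply: eq_bigr => i _; rewrite !rV_consS.
Qed.

Lemma flip0_shift v (t : R) (i : 'I_n.+1) :
  flip0 (v + t *: delta_mx ord0 i) = flip0 v + (sgn0 i * t) *: delta_mx ord0 i.
Proof.
rewrite -[v]rV_unconsK; case: (unliftP ord0 i) => [j ->|->].
  by rewrite rV_cons_shiftS !flip0_cons rV_cons_shiftS /sgn0/= mul1r.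
by rewrite rV_cons_shift0 !flip0_cons rV_cons_shift0 /sgn0/= mulN1r opprD.
Qed.

Lemma cg_flip0 f d K : C1_growth f d K ->
  C1_growth (fun v => f (flip0 v)) (fun i v => sgn0 i * d i (flip0 v)) K.
Proof.
move=> cg; split.
- exact: measurableT_comp (cg_mf cg) measurable_flip0.
- move=> i; apply: measurable_funM => //.
  exact: measurableT_comp (cg_md cg _) measurable_flip0.
- move=> x i t.
  have -> : (fun s => f (flip0 (x + s *: delta_mx ord0 i))) =
      (fun s => f (flip0 x + s *: delta_mx ord0 i)) \o (fun s => sgn0 i * s).
    by apply/funext => s /=; rewrite flip0_shift.
  rewrite flip0_shift mulrC; apply: is_derive1_comp.
    exact: (cg_derive cg).
  by apply: is_derive_eq; rewrite /GRing.scale/= mulr1.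
- move=> x i s; apply: cvgMr.
  have -> : (fun s => d i (flip0 (x + s *: delta_mx ord0 i))) =
      (fun s => d i (flip0 x + s *: delta_mx ord0 i)) \o (fun s => sgn0 i * s).
    by apply/funext => r /=; rewrite flip0_shift.
  rewrite flip0_shift; apply: (@cvg_comp _ _ _ (fun s : R => sgn0 i * s)
    (fun s => d i (flip0 x + s *: delta_mx ord0 i)) _ (nbhs (sgn0 i * s))).
    exact: mulrl_continuous.
  exact: (@cg_cont _ _ _ _ cg (flip0 x) i (sgn0 i * s)).
- by move=> x; rewrite (le_trans (cg_f cg _))// enorm_flip0.
- move=> i x; rewrite normrM (_ : `|sgn0 i| = 1) ?mul1r; last first.
    by rewrite /sgn0; case: ifP => _; rewrite ?normrN normr1.
  by rewrite (le_trans (cg_d cg _ _))// enorm_flip0.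
Qed.

End parity.

End gauss_rV.

(** * The Gaussian inequality for odd functions *)

Section gauss_poincare.
Context {R : realType}.
Notation nu := (@normal01 R).
Notation gauss := (prob_rV nu).

Lemma measurable_sqr_EFin d (T : measurableType d) (g : T -> R) :
  measurable_fun setT g -> measurable_fun setT (fun v => (g v ^+ 2)%:E).
Proof. by move=> mg; apply/measurable_EFinP; exact: measurable_funX. Qed.

Lemma sqr_EFin_ge0 (x : R) : (0 <= (x ^+ 2)%:E)%E.
Proof. by rewrite lee_fin sqr_ge0. Qed.

Lemma ge0_le_integralT d (T : measurableType d) (P : {measure set T -> \bar R})
    (f g : T -> \bar R) : measurable_fun setT f -> measurable_fun setT g ->
  (forall x, (0 <= f x)%E) -> (forall x, (f x <= g x)%E) ->
  (\int[P]_x f x <= \int[P]_x g x)%E.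
Proof. by move=> mf mg f0 fg; apply: ge0_le_integral. Qed.

Lemma integral_sqr_ge0 d (T : measurableType d) (P : {measure set T -> \bar R})
  (g : T -> R) : (0 <= \int[P]_x (g x ^+ 2)%:E)%E.
Proof. by apply: integral_ge0 => x _; exact: sqr_EFin_ge0. Qed.

Lemma measurable_integral_sqr_slice n (g : 'rV[R]_n.+1 -> R) : measurable_fun setT g ->
  measurable_fun setT (fun x : R => \int[gauss n]_y (g (rV_cons (x, y)) ^+ 2)%:E)%E.
Proof.
move=> mg; apply: (measurable_fun_fubini_tonelli_F (fun p => (g (rV_cons p) ^+ 2)%:E)).
  by apply: measurable_sqr_EFin; exact: measurableT_comp mg (@measurable_rV_cons R n).
by move=> x; exact: sqr_EFin_ge0.
Qed.

Lemma measurable_integral_sqr_line n (g : 'rV[R]_n.+1 -> R) : measurable_fun setT g ->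
  measurable_fun setT (fun y : 'rV[R]_n => \int[nu]_x (g (rV_cons (x, y)) ^+ 2)%:E)%E.
Proof.
move=> mg; apply: (measurable_fun_fubini_tonelli_G (fun p => (g (rV_cons p) ^+ 2)%:E)).
  by apply: measurable_sqr_EFin; exact: measurableT_comp mg (@measurable_rV_cons R n).
by move=> x; exact: sqr_EFin_ge0.
Qed.

Lemma integral_sqr_slice n (g : 'rV[R]_n.+1 -> R) : measurable_fun setT g ->
  (\int[gauss n.+1]_v (g v ^+ 2)%:E =
   \int[nu]_x \int[gauss n]_y (g (rV_cons (x, y)) ^+ 2)%:E)%E.
Proof.
move=> mg; apply: ge0_integral_prob_rVS => [|x]; last exact: sqr_EFin_ge0.
exact: measurable_sqr_EFin.
Qed.

Lemma integral_sqr_line n (g : 'rV[R]_n.+1 -> R) : measurable_fun setT g ->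
  (\int[gauss n.+1]_v (g v ^+ 2)%:E =
   \int[gauss n]_y \int[nu]_x (g (rV_cons (x, y)) ^+ 2)%:E)%E.
Proof.
move=> mg; apply: ge0_integral_gaussS_swap => [|x]; last exact: sqr_EFin_ge0.
exact: measurable_sqr_EFin.
Qed.

Lemma cg_even0 n (f : 'rV[R]_n.+1 -> R) d K : C1_growth f d K ->
  C1_growth (even0 f) (fun i v => (d i v + 1 * (sgn0 i * d i (flip0 v))) / 2) K.
Proof. by move=> cg; apply: cg_comb => //; [rewrite normr1|exact: cg_flip0]. Qed.

Lemma cg_odd0 n (f : 'rV[R]_n.+1 -> R) d K : C1_growth f d K ->
  C1_growth (odd0 f) (fun i v => (d i v + -1 * (sgn0 i * d i (flip0 v))) / 2) K.
Proof. by move=> cg; apply: cg_comb => //; [rewrite normrN normr1|exact: cg_flip0]. Qed.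

(** Differentiation in the reflected coordinate exchanges parities: the derivative of the odd part
    is the even part of the derivative. The one-dimensional odd inequality then applies on every
    line. *)
Lemma gauss_odd0_le n (f : 'rV[R]_n.+1 -> R) d K : C1_growth f d K ->
  (\int[gauss n.+1]_v (odd0 f v ^+ 2)%:E <= \int[gauss n.+1]_v (even0 (d ord0) v ^+ 2)%:E)%E.
Proof.
move=> cg; have cgo := cg_odd0 cg.
have me := measurable_even0 (cg_md cg ord0).
have mo := cg_mf cgo.
rewrite !integral_sqr_line//; apply: ge0_le_integralT => [| |y|y].
- exact: measurable_integral_sqr_line.
- exact: measurable_integral_sqr_line.
- exact: integral_sqr_ge0.
have [dd cd] := cg_slice0 y cgo.
have dE t : (d ord0 (rV_cons (t, y)) + -1 * (sgn0 ord0 * d ord0 (flip0 (rV_cons (t, y))))) / 2 =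
    even0 (d ord0) (rV_cons (t, y)).
  by rewrite /even0 /sgn0/=; field.
rewrite (_ : (fun t => _) = (fun t => even0 (d ord0) (rV_cons (t, y)))) in cd; last first.
  by apply/funext => t; rewrite dE.
apply: (normal01_odd_poincare cd).
- by move=> t; have := dd t; rewrite dE.
- by move=> x; rewrite /odd0 !flip0_cons opprK; field.
- by move=> x; rewrite /even0 !flip0_cons opprK; field.
Qed.

(** Induction on the dimension. The part odd in the first coordinate is controlled on lines by the
    first derivative; the part even in it must be odd in the remaining coordinates, so the induction
    hypothesis applies to its slices. In dimension zero an odd function vanishes. *)
Lemma gauss_odd_poincare n (f : 'rV[R]_n -> R) d K : C1_growth f d K ->
  (forall x, f (- x) = - f x) ->
  (\int[gauss n]_v (f v ^+ 2)%:E <= \sum_(i < n) \int[gauss n]_v (d i v ^+ 2)%:E)%E.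
Proof.
elim: n f d K => [|n IH] f d K cg fN.
  rewrite big_ord0 integral0_eq// => x _.
  have -> : f x = 0 by have := fN x; rewrite (_ : - x = x); [lra|apply/rowP => -[]].
  by rewrite expr0n.
have mf := cg_mf cg; rewrite (integral_parity mf) addeC big_ord_recl.
apply: leeD.
  by apply: le_trans (gauss_odd0_le cg) _; exact: (integral_even0_le (cg_md cg _)).
apply: (@le_trans _ _ (\sum_(i < n) \int[gauss n.+1]_v (even0 (d (lift ord0 i)) v ^+ 2)%:E)%E);
  last by apply: lee_sum => i _; exact: (integral_even0_le (cg_md cg _)).
have me i := measurable_even0 (cg_md cg i).
have mee := measurable_even0 mf.
rewrite integral_sqr_slice//.
rewrite (eq_bigr (fun i => \int[nu]_x \int[gauss n]_y
    (even0 (d (lift ord0 i)) (rV_cons (x, y)) ^+ 2)%:E)%E); last first.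
  by move=> i _; rewrite integral_sqr_slice.
rewrite -ge0_integral_sum//; last 2 first.
- by move=> i; exact: measurable_integral_sqr_slice.
- by move=> i x _; exact: integral_sqr_ge0.
apply: ge0_le_integralT => [| |x|x].
- exact: measurable_integral_sqr_slice.
- by apply: emeasurable_sum => i _; exact: measurable_integral_sqr_slice.
- exact: integral_sqr_ge0.
have cge := cg_sliceS x (cg_even0 cg).
have := IH _ _ _ cge; rewrite (eq_bigr (fun i => \int[gauss n]_y
    (even0 (d (lift ord0 i)) (rV_cons (x, y)) ^+ 2)%:E)%E).
  apply => y.
  have e1 : f (rV_cons (x, - y)) = - f (rV_cons (- x, y)) by rewrite -fN rV_consN opprK.
  have e2 : f (rV_cons (- x, - y)) = - f (rV_cons (x, y)) by rewrite -fN rV_consN.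
  by rewrite /even0 !flip0_cons e1 e2; field.
by move=> i _; apply: eq_integral => y _; rewrite /even0 /sgn0/= mul1r.
Qed.

End gauss_poincare.

(** * Averaging over one Gaussian coordinate *)

Section gauss_even.
Context {R : realType}.
Notation nu := (@normal01 R).
Notation gauss := (prob_rV nu).

Lemma cg_K0 n (f : 'rV[R]_n -> R) d K : C1_growth f d K -> 0 <= K.
Proof.
move=> cg; have := le_trans (normr_ge0 _) (cg_f cg 0).
by rewrite pmulr_lge0// ltr_pwDl// sqr_ge0.
Qed.

Lemma integral_normal01_dominate (a b : R) : 0 <= a -> 0 <= b ->
  (\int[nu]_x (a + b * x ^+ 2)%:E = (a + b)%:E)%E.
Proof.
move=> a0 b0; have [m2 _] := @normal01_moments R.
have -> : (\int[nu]_x (a + b * x ^+ 2)%:E = \int[nu]_x (a%:E + b%:E * (x ^+ 2)%:E))%E.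
  by apply: eq_integral => x _; rewrite -EFinM -EFinD.
have mx2 : measurable_fun setT (fun x : R => (x ^+ 2)%:E).
  by apply/measurable_EFinP; exact: measurable_funX.
rewrite ge0_integralD//; last 2 first.
- by move=> x _; rewrite mule_ge0// lee_fin ?sqr_ge0.
- exact: measurable_funeM.
rewrite integral_prob_cst ge0_integralZl//; last by move=> x _; rewrite lee_fin sqr_ge0.
by rewrite m2 mule1.
Qed.

Lemma integrable_normal01_dominate (a b : R) : 0 <= a -> 0 <= b ->
  nu.-integrable setT (EFin \o (fun x => a + b * x ^+ 2)).
Proof.
move=> a0 b0; apply: integrable_ge0.
- by apply: measurable_funD => //; apply: measurable_funM => //; exact: measurable_funX.
- by move=> x; rewrite addr_ge0// mulr_ge0// sqr_ge0.
- by rewrite integral_normal01_dominate ?ltry.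
Qed.

Lemma integral_sqr_line_fin n (f : 'rV[R]_n.+1 -> R) K (y : 'rV[R]_n) : 0 <= K ->
  measurable_fun setT f -> (forall v, `|f v| <= K * (1 + enorm v ^+ 2)) ->
  (\int[nu]_x (f (rV_cons (x, y)) ^+ 2)%:E < +oo)%E.
Proof.
move=> K0 mf fK; have [m2 m4] := @normal01_moments R.
pose A := K * (1 + enorm y ^+ 2).
have A0 : 0 <= A by rewrite mulr_ge0// addr_ge0// sqr_ge0.
apply: (@le_lt_trans _ _ (\int[nu]_x ((2 * A ^+ 2)%R%:E + (2 * K ^+ 2)%R%:E * (x ^+ 4)%:E))%E).
  apply: ge0_le_integralT => [| |x|x].
  - apply: measurable_sqr_EFin; exact: measurableT_comp mf (measurable_rV_cons_l _).
  - apply: emeasurable_funD => //; apply: measurable_funeM.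
    by apply/measurable_EFinP; exact: measurable_funX.
  - exact: sqr_EFin_ge0.
  rewrite -EFinM -EFinD lee_fin -[f _ ^+ 2]real_normK ?num_real//.
  have le1 : `|f (rV_cons (x, y))| <= A + K * x ^+ 2.
    by rewrite (le_trans (fK _))// enorm_rV_cons /A; nra.
  apply: (@le_trans _ _ ((A + K * x ^+ 2) ^+ 2)); first by rewrite lerXn2r// nnegrE// addr_ge0// mulr_ge0// sqr_ge0.
  (* This square gives [(A + K x^2)^2 <= 2 A^2 + 2 K^2 x^4], which the fourth moment makes
     integrable. *)
  have := sqr_ge0 (A - K * x ^+ 2); nra.
rewrite ge0_integralD//; last 3 first.
- by move=> x _; rewrite lee_fin mulr_ge0// sqr_ge0.
- by move=> x _; apply: mule_ge0; rewrite lee_fin ?exprn_even_ge0// mulr_ge0// sqr_ge0.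
- apply: measurable_funeM; by apply/measurable_EFinP; exact: measurable_funX.
rewrite integral_prob_cst ge0_integralZl//; last 3 first.
- by apply/measurable_EFinP; exact: measurable_funX.
- by move=> x _; rewrite lee_fin exprn_even_ge0.
- by rewrite lee_fin mulr_ge0// sqr_ge0.
by rewrite m4 -EFinM -EFinD ltry.
Qed.

Lemma measurable_Rintegral_line n (f : 'rV[R]_n.+1 -> R) : measurable_fun setT f ->
  measurable_fun setT (fun y : 'rV[R]_n => \int[nu]_x f (rV_cons (x, y))).
Proof.
move=> mf; apply: (measurableT_comp (@fine_measurable R setT measurableT)).
rewrite (_ : (fun y => _) = (fun y : 'rV[R]_n =>
    \int[nu]_x ((EFin \o f)^\+ (rV_cons (x, y))) - \int[nu]_x ((EFin \o f)^\- (rV_cons (x, y))))%E).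
  have mEf : measurable_fun setT (EFin \o f) by exact/measurable_EFinP.
  have line (h : 'rV[R]_n.+1 -> \bar R) : measurable_fun setT h -> (forall v, (0 <= h v)%E) ->
      measurable_fun setT (fun y : 'rV[R]_n => \int[nu]_x h (rV_cons (x, y)))%E.
    move=> mh h0; apply: (measurable_fun_fubini_tonelli_G (m1 := nu) (fun p => h (rV_cons p))) => //.
    exact: measurableT_comp mh (@measurable_rV_cons R n).
  apply: emeasurable_funB; first exact: (line _ (measurable_funepos mEf)).
  exact: (line _ (measurable_funeneg mEf)).
apply/funext => y; rewrite [LHS]integralE.
by congr (_ - _)%E; apply: eq_integral => x _; rewrite ?funeposE ?funenegE.
Qed.

(** Averaging the bound [K (1 + x^2 + |y|^2)] in [x] gives [K (2 + |y|^2)], whence the new constant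
    [2 K]. *)
Lemma cg_Rintegral n (f : 'rV[R]_n.+1 -> R) d K : C1_growth f d K ->
  C1_growth (fun y : 'rV[R]_n => \int[nu]_x f (rV_cons (x, y)))
    (fun i y => \int[nu]_x d (lift ord0 i) (rV_cons (x, y))) (2 * K).
Proof.
move=> cg; have K0 := cg_K0 cg.
have bnd (g : 'rV[R]_n.+1 -> R) (y : 'rV[R]_n) : measurable_fun setT g ->
    (forall v, `|g v| <= K * (1 + enorm v ^+ 2)) ->
    `|\int[nu]_x g (rV_cons (x, y))| <= 2 * K * (1 + enorm y ^+ 2).
  move=> mg gK; set A := K * (1 + enorm y ^+ 2).
  have A0 : 0 <= A by rewrite mulr_ge0// addr_ge0// sqr_ge0.
  have gA x : `|g (rV_cons (x, y))| <= A + K * x ^+ 2.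
    by rewrite (le_trans (gK _))// enorm_rV_cons /A; nra.
  have mgy : measurable_fun setT (fun x : R => g (rV_cons (x, y))).
    exact: measurableT_comp mg (measurable_rV_cons_l _).
  have ig : nu.-integrable setT (EFin \o (fun x => g (rV_cons (x, y)))).
    apply: le_integrable (integrable_normal01_dominate A0 K0) => //.
      exact/measurable_EFinP.
    by move=> x _; rewrite /= lee_fin (le_trans (gA x))// ler_norm.
  apply: le_trans (le_normr_Rintegral measurableT ig) _.
  apply: (@le_trans _ _ (\int[nu]_x (A + K * x ^+ 2))).
    apply: le_Rintegral => //; last exact: integrable_normal01_dominate.
    exact: integrable_norm ig.
  rewrite /Rintegral integral_normal01_dominate//= /A.
  by have := mulr_ge0 K0 (sqr_ge0 (enorm y)); lra.
have C1 (y : 'rV[R]_n) (i : 'I_n) := @Rintegral_C1 _ _ R nu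
  (fun s x => f (rV_cons (x, y + s *: delta_mx ord0 i)))
  (fun s x => d (lift ord0 i) (rV_cons (x, y + s *: delta_mx ord0 i))).
have C2 (y : 'rV[R]_n) (i : 'I_n) :
  (forall s : R, is_derive s 1
     (fun s => \int[nu]_x f (rV_cons (x, y + s *: delta_mx ord0 i)))
     (\int[nu]_x d (lift ord0 i) (rV_cons (x, y + s *: delta_mx ord0 i)))) /\
  continuous (fun s : R => \int[nu]_x d (lift ord0 i) (rV_cons (x, y + s *: delta_mx ord0 i))).
  apply: C1.
  - by move=> s; exact: measurableT_comp (cg_mf cg) (measurable_rV_cons_l _).
  - by move=> s; exact: measurableT_comp (cg_md cg _) (measurable_rV_cons_l _).
  - move=> x s; have := cg_derive cg (rV_cons (x, y)) (lift ord0 i) s.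
    by rewrite rV_cons_shiftS; under eq_fun do rewrite rV_cons_shiftS.
  - move=> x; have := @cg_cont R _ _ _ _ cg (rV_cons (x, y)) (lift ord0 i).
    by under eq_fun do rewrite rV_cons_shiftS.
  (* This [A] is uniform in the shift: the squared norm of [y] moved by [s] along an axis is at most
     [2 |y|^2 + 2 B^2] when [|s| <= B]. *)
  - move=> B; pose A := K * (1 + 2 * enorm y ^+ 2 + 2 * B ^+ 2).
    have A0 : 0 <= A by rewrite mulr_ge0// !addr_ge0// mulr_ge0// sqr_ge0.
    exists (fun x => A + K * x ^+ 2); first exact: integrable_normal01_dominate.
    move=> s x sB.
    have le1 : K * (1 + enorm (rV_cons (x, y + s *: delta_mx ord0 i)) ^+ 2) <= A + K * x ^+ 2.
      rewrite enorm_rV_cons.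
      have : enorm (y + s *: delta_mx ord0 i) ^+ 2 <= 2 * enorm y ^+ 2 + 2 * B ^+ 2.
        have sB2 : s ^+ 2 <= B ^+ 2 by rewrite -[s ^+ 2]real_normK ?num_real// lerXn2r// nnegrE (le_trans _ sB).
        rewrite !enorm_sqr (le_trans (y := \sum_j (2 * y ord0 j ^+ 2 + 2 * (s * (j == i)%:R) ^+ 2)))//.
          apply: ler_sum => j _; rewrite !mxE eqxx/=.
          by have := sqr_ge0 (y ord0 j - s * (j == i)%:R); nra.
        rewrite big_split/= -!mulr_sumr lerD2l ler_wpM2l//.
        rewrite (bigD1 i)//= eqxx mulr1 big1 ?addr0// => j /negPf ->.
        by rewrite mulr0 expr0n.
      by rewrite /A; nra.
    by split; apply: le_trans le1; [exact: cg_f cg _|exact: cg_d cg _ _].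
split.
- exact: measurable_Rintegral_line (cg_mf cg).
- by move=> i; exact: measurable_Rintegral_line (cg_md cg _).
- by move=> y i t; have [+ _] := C2 y i; exact.
- by move=> y i; have [_ +] := C2 y i.
- by move=> y; exact: bnd (cg_mf cg) (cg_f cg).
- by move=> i y; exact: bnd (cg_md cg _) (cg_d cg _).
Qed.

End gauss_even.

(** * The Gaussian inequality for even functions, with constant one half *)

Section gauss_even_poincare.
Context {R : realType}.
Notation nu := (@normal01 R).
Notation gauss := (prob_rV nu).

Lemma measurable_integral_sqr_center n (f : 'rV[R]_n.+1 -> R) (F : 'rV[R]_n -> R) :
  measurable_fun setT f -> measurable_fun setT F ->
  measurable_fun setT (fun y => \int[nu]_x ((f (rV_cons (x, y)) - F y) ^+ 2)%:E)%E.
Proof.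
move=> mf mF; apply: (measurable_fun_fubini_tonelli_G (m1 := nu)
  (fun p : measurableTypeR R * 'rV[R]_n => ((f (rV_cons p) - F p.2) ^+ 2)%:E)).
  apply: measurable_sqr_EFin; apply: measurable_funB.
    exact: measurableT_comp mf (@measurable_rV_cons R n).
  exact: measurableT_comp mF measurable_snd.
by move=> p; exact: sqr_EFin_ge0.
Qed.

(** On each line the one-dimensional inequality is centred at the value in [1]; by the variance
    decomposition, centring at the mean [F y] can only decrease the left side. *)
Lemma gauss_even0_mean_le n (f : 'rV[R]_n.+1 -> R) d K : C1_growth f d K ->
  let F (y : 'rV[R]_n) := (\int[nu]_x f (rV_cons (x, y)))%R in
  (forall v, f (flip0 v) = f v) ->
  (forall v, d ord0 (flip0 v) = - d ord0 v) ->
  (\int[gauss n]_y \int[nu]_x ((f (rV_cons (x, y)) - F y) ^+ 2)%:E <=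
   2^-1%:E * \int[gauss n.+1]_v (d ord0 v ^+ 2)%:E)%E.
Proof.
move=> cg F fN dN; have mf := cg_mf cg; have md := cg_md cg ord0.
have mF : measurable_fun setT F by exact: measurable_Rintegral_line.
rewrite integral_sqr_line// -ge0_integralZl//; last 2 first.
- exact: measurable_integral_sqr_line.
- by move=> y _; exact: integral_sqr_ge0.
apply: ge0_le_integralT => [| |y|y].
- exact: measurable_integral_sqr_center.
- by apply: measurable_funeM; exact: measurable_integral_sqr_line.
- exact: integral_sqr_ge0.
have [dd cd] := cg_slice0 y cg.
have mfy : measurable_fun setT (fun x : R => f (rV_cons (x, y))).
  exact: measurableT_comp mf (measurable_rV_cons_l _).
have le1 := @integral_sqr_sub _ _ _ nu (fun x => f (rV_cons (x, y))) (f (rV_cons (1, y))) mfy (integral_sqr_line_fin y (cg_K0 cg) mf (cg_f cg)).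
apply: (@le_trans _ _ (\int[nu]_x ((f (rV_cons (x, y)) - f (rV_cons (1%R, y))) ^+ 2)%:E)%E).
  by rewrite [leRHS]le1 leeDl// sqr_EFin_ge0.
apply: (@normal01_even_poincare R (fun x => f (rV_cons (x, y)))) => //.
- by move=> x; rewrite -flip0_cons fN.
- by move=> x; rewrite -flip0_cons dN.
Qed.

(** Induction on the dimension, after splitting by parity in the first coordinate. The even part has
    variance on lines with constant one half, and its line average is an even function of the other
    coordinates, left to the induction hypothesis. The odd part is odd in the first coordinate and
    odd in the others: it has two bounds with constant one, through disjoint sets of derivatives,
    and their average has constant one half. The centre is left unspecified, since the mean can
    replace it later. *)
Lemma gauss_even_poincare n (f : 'rV[R]_n -> R) d K : C1_growth f d K ->
  (forall x, f (- x) = f x) ->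
  exists c : R, (\int[gauss n]_v ((f v - c) ^+ 2)%:E <=
    2^-1%:E * \sum_(i < n) \int[gauss n]_v (d i v ^+ 2)%:E)%E.
Proof.
elim: n f d K => [|n IH] f d K cg fN.
  exists (f 0); rewrite big_ord0 mule0 integral0_eq// => x _.
  by rewrite (_ : x = 0) ?subrr ?expr0n//; apply/rowP => -[].
have fN' (x : R) y : f (rV_cons (x, - y)) = f (rV_cons (- x, y)).
  by rewrite -fN rV_consN opprK.
have mf := cg_mf cg; have md := cg_md cg.
have cge := cg_even0 cg; have cgo := cg_odd0 cg.
pose fe := even0 f; pose F (y : 'rV[R]_n) := (\int[nu]_x fe (rV_cons (x, y)))%R.
have cgF := cg_Rintegral cge.
have FN y : F (- y) = F y.
  apply: eq_Rintegral => x _; rewrite /fe /even0 !flip0_cons !fN' opprK.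
  by rewrite !mul1r addrC.
have [c Fc] := IH _ _ _ cgF FN; exists c.
have me i := measurable_even0 (md i); have mo i := measurable_odd0 (md i).
have mfe : measurable_fun setT fe := measurable_even0 mf.
pose I (g : 'rV[R]_n.+1 -> R) := (\int[gauss n.+1]_v (g v ^+ 2)%:E)%E.
have I0 g : (0 <= I g)%E by exact: integral_sqr_ge0.
have split_fc : (\int[gauss n.+1]_v ((f v - c) ^+ 2)%:E = I (fun v => fe v - c)%R + I (odd0 f))%E.
  rewrite (@integral_parity _ _ (fun v => f v - c)); last exact: measurable_funB.
  by congr (_ + _)%E; apply: eq_integral => v _; congr ((_ ^+ 2)%:E);
    rewrite /fe /even0 /odd0; field.
have odd1 : (I (odd0 f) <= I (even0 (d ord0)))%E by exact: gauss_odd0_le cg.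
(* As [f] is even, each slice of its odd part in the first coordinate is an odd function of the
   remaining ones. *)
have odd2 : (I (odd0 f) <= \sum_(i < n) I (odd0 (d (lift ord0 i))))%E.
  rewrite {1}/I integral_sqr_slice; last exact: cg_mf cgo.
  rewrite (eq_bigr (fun i => \int[nu]_x \int[gauss n]_y
      (odd0 (d (lift ord0 i)) (rV_cons (x, y)) ^+ 2)%:E)%E); last first.
    by move=> i _; rewrite /I integral_sqr_slice.
  rewrite -ge0_integral_sum//; last 2 first.
  - by move=> i; exact: measurable_integral_sqr_slice.
  - by move=> i x _; exact: integral_sqr_ge0.
  apply: ge0_le_integralT => [| |x|x].
  - by apply: measurable_integral_sqr_slice; exact: cg_mf cgo.
  - by apply: emeasurable_sum => i _; exact: measurable_integral_sqr_slice.
  - exact: integral_sqr_ge0.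
  have := gauss_odd_poincare (cg_sliceS x cgo); rewrite (eq_bigr (fun i => \int[gauss n]_y
      (odd0 (d (lift ord0 i)) (rV_cons (x, y)) ^+ 2)%:E)%E).
    by apply => y; rewrite /odd0 !flip0_cons !fN' opprK; field.
  by move=> i _; apply: eq_integral => y _; rewrite /odd0 /sgn0/= mul1r.
(* Jensen: the derivatives of the average are averages of derivatives. *)
have dF_le i : (\int[gauss n]_y (((\int[nu]_x ((d (lift ord0 i) (rV_cons (x, y)) +
      1 * (sgn0 (lift ord0 i) * d (lift ord0 i) (flip0 (rV_cons (x, y))))) / 2))%R) ^+ 2)%:E <=
    I (even0 (d (lift ord0 i))))%E.
  rewrite /I integral_sqr_line//; apply: ge0_le_integralT => [| |y|y].
  - by apply: measurable_sqr_EFin; exact: cg_md cgF i.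
  - exact: measurable_integral_sqr_line.
  - exact: sqr_EFin_ge0.
  have -> : (\int[nu]_x (even0 (d (lift ord0 i)) (rV_cons (x, y)) ^+ 2)%:E =
      \int[nu]_x (((d (lift ord0 i) (rV_cons (x, y)) + 1 * (sgn0 (lift ord0 i) *
        d (lift ord0 i) (flip0 (rV_cons (x, y))))) / 2) ^+ 2)%:E)%E.
    by apply: eq_integral => x _; rewrite /even0 /sgn0/= !mul1r.
  have md' := cg_md cge (lift ord0 i).
  apply: sqr_Rintegral_le; first exact: measurableT_comp md' (measurable_rV_cons_l _).
  exact: (integral_sqr_line_fin y (cg_K0 cge) md' (cg_d cge (lift ord0 i))).
have even1 : (I (fun v => fe v - c)%R <= 2^-1%:E * I (odd0 (d ord0)) +
    2^-1%:E * \sum_(i < n) I (even0 (d (lift ord0 i))))%E.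
  rewrite /I integral_sqr_line; last exact: measurable_funB.
  have -> : (\int[gauss n]_y \int[nu]_x ((fe (rV_cons (x, y)) - c) ^+ 2)%:E =
      \int[gauss n]_y (\int[nu]_x ((fe (rV_cons (x, y)) - F y) ^+ 2)%:E + ((F y - c) ^+ 2)%:E))%E.
    apply: eq_integral => y _; apply: integral_sqr_sub.
      exact: measurableT_comp mfe (measurable_rV_cons_l _).
    exact: (integral_sqr_line_fin y (cg_K0 cge) mfe (cg_f cge)).
  have mF : measurable_fun setT F by exact: measurable_Rintegral_line.
  rewrite ge0_integralD//; last 4 first.
  - by move=> y _; exact: integral_sqr_ge0.
  - exact: measurable_integral_sqr_center.
  - by move=> y _; exact: sqr_EFin_ge0.
  - by apply: measurable_sqr_EFin; exact: measurable_funB.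
  apply: leeD; last first.
    apply: le_trans Fc _; apply: lee_wpmul2l => //; apply: lee_sum => i _; exact: dF_le.
  have := gauss_even0_mean_le cge; rewrite -/F => /(_ _ _); rewrite /I.
  rewrite (_ : (\int[gauss n.+1]_v _)%E = (\int[gauss n.+1]_v (odd0 (d ord0) v ^+ 2)%:E)%E).
    apply => v; rewrite -[v]rV_unconsK.
      by rewrite /fe /even0 !flip0_cons opprK; field.
    by rewrite /sgn0/= !flip0_cons opprK; field.
  by apply: eq_integral => v _; rewrite /odd0 /sgn0/=; congr ((_ ^+ 2)%:E); field.
rewrite split_fc big_ord_recl (integral_parity (md ord0)).
rewrite (eq_bigr (fun i => I (even0 (d (lift ord0 i))) + I (odd0 (d (lift ord0 i))))%E); last first.
  by move=> i _; rewrite (integral_parity (md _)).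
rewrite big_split/= -/(I _) -/(I (odd0 (d ord0))).
(* The mean of the two bounds [odd1] and [odd2]. The derivative parts used here are exactly those
   that [even1] leaves free, so that each parity part of each derivative occurs once. *)
have half : (I (odd0 f) <= 2^-1%:E * (I (even0 (d ord0)) + \sum_(i < n) I (odd0 (d (lift ord0 i)))))%E.
  by rewrite lee_pdivlMl// mule_natl mule2n; exact: leeD.
apply: le_trans (leeD even1 half) _.
have S0 (G : 'I_n -> 'rV[R]_n.+1 -> R) : (0 <= \sum_(i < n) I (G i))%E by exact: sume_ge0.
move: (I0 (odd0 (d ord0))) (I0 (even0 (d ord0)))
  (S0 (fun i => even0 (d (lift ord0 i)))) (S0 (fun i => odd0 (d (lift ord0 i)))).
move: (I (odd0 (d ord0))) (I (even0 (d ord0))) => o e o0 e0.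
move: (\sum_(i < n) _)%E (\sum_(i < n) _)%E => E O E0 O0.
by rewrite !ge0_muleDr ?adde_ge0// addeACA [X in (X + _)%E]addeC.
Qed.

End gauss_even_poincare.

(** * Polar coordinates *)

Section polar.
Context {R : realType}.
Notation nu := (@normal01 R).
Notation gauss := (prob_rV nu).
Notation mu := (@lebesgue_measure R).
Notation leb n := (lebesgue_rV R n).

Definition gauss_pdf n (y : 'rV[R]_n) : R := gpeak ^+ n * expR (- (enorm y ^+ 2 / 2)).

Lemma measurable_gauss_pdf n : measurable_fun setT (@gauss_pdf n).
Proof.
apply: measurable_funM => //; apply: measurableT_comp => //.
apply: measurable_funN; apply: measurable_funM => //; apply: measurable_funX.
exact: measurable_enorm.
Qed.

Lemma gauss_pdf_ge0 n (y : 'rV[R]_n) : 0 <= gauss_pdf y.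
Proof. by rewrite mulr_ge0 ?expR_ge0// exprn_ge0// ltW// gpeak_gt0. Qed.

Lemma gauss_pdf_cons n x (y : 'rV[R]_n) :
  gauss_pdf (rV_cons (x, y)) = gpeak * gfun x * gauss_pdf y.
Proof.
rewrite /gauss_pdf enorm_rV_cons mulrDl opprD expRD exprS -/(gfun x).
by rewrite !mulrA; congr (_ * _); rewrite -!mulrA; congr (_ * _); rewrite mulrC.
Qed.

Lemma ge0_integral_gauss n (f : 'rV[R]_n -> \bar R) :
  measurable_fun setT f -> (forall y, (0 <= f y)%E) ->
  (\int[gauss n]_y f y = \int[leb n]_y (f y * (gauss_pdf y)%:E))%E.
Proof.
elim: n f => [|n IH] f mf f0.
  rewrite /= !integral_dirac// /gauss_pdf; last first.
    by apply: emeasurable_funM => //; apply/measurable_EFinP; exact: (@measurable_gauss_pdf 0).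
  by rewrite !diracT !mul1e expr0 mul1r enorm_sqr big_ord0 mul0r oppr0 expR0 mule1.
have mg : measurable_fun setT (fun v => (f v * (gauss_pdf v)%:E)%E).
  by apply: emeasurable_funM => //; apply/measurable_EFinP; exact: measurable_gauss_pdf.
have mfx x : measurable_fun setT (fun y : 'rV[R]_n => f (rV_cons (x, y))).
  exact: measurableT_comp mf (measurable_rV_cons_r _).
rewrite ge0_integral_prob_rVS// ge0_integral_lebesgue_rVS//; last first.
  by move=> v; rewrite mule_ge0// lee_fin gauss_pdf_ge0.
rewrite ge0_integral_normal01; last 2 first.
- exact: (measurable_fun_fubini_tonelli_F (fun p => f (rV_cons p))
    (measurableT_comp mf (@measurable_rV_cons R n))).
- by move=> x; apply: integral_ge0.
apply: eq_integral => x _; rewrite IH//.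
rewrite -ge0_integralZr//; last 3 first.
- by apply: emeasurable_funM => //; apply/measurable_EFinP; exact: measurable_gauss_pdf.
- by move=> y _; rewrite mule_ge0// lee_fin gauss_pdf_ge0.
- by rewrite lee_fin mulr_ge0// ltW// ?gpeak_gt0// gfun_gt0.
by apply: eq_integral => y _; rewrite gauss_pdf_cons -muleA -EFinM mulrC.
Qed.

Lemma measurable_scaler_pair n (s : R -> R) : measurable_fun setT s ->
  measurable_fun setT (fun p : measurableTypeR R * 'rV[R]_n => s p.1 *: p.2).
Proof.
move=> ms; apply: measurable_fun_rVP => i.
rewrite (_ : (fun p => _) = fun p : measurableTypeR R * 'rV[R]_n => s p.1 * p.2 ord0 i); last first.
  by apply/funext => p; rewrite mxE.
apply: measurable_funM; first exact: measurableT_comp ms measurable_fst.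
exact: measurableT_comp (@measurable_coord _ R n i) measurable_snd.
Qed.

(** At the origin the value is [0], by [0^-1 = 0]; identities on the sphere therefore carry the
    condition [y != 0]. *)
Definition unit_rV n (y : 'rV[R]_n) := (enorm y)^-1 *: y.

Lemma measurable_unit_rV n : measurable_fun setT (@unit_rV n).
Proof.
apply: measurable_fun_rVP => i.
rewrite (_ : (fun p => _) = fun p : 'rV[R]_n => (enorm p)^-1 * p ord0 i); last first.
  by apply/funext => p; rewrite mxE.
apply: measurable_funM; last exact: measurable_coord.
by apply: (measurableT_comp (@measurable_invr R)); exact: measurable_enorm.
Qed.

Lemma expR_half_shift (t r : R) : 0 < r -> expR ((t + 2 * ln r) / 2) = expR (t / 2) * r.
Proof.
by move=> r0; rewrite mulrDl expRD mulrAC divff ?pnatr_eq0// mul1r lnK.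
Qed.

Lemma expR_dim_shift n (t r : R) : 0 < r ->
  expR (n%:R / 2 * (t + 2 * ln r)) = expR (n%:R / 2 * t) * r ^+ n.
Proof.
move=> r0; rewrite mulrDr expRD; congr (_ * _).
by rewrite mulrA mulfVK ?pnatr_eq0// expRM_natl lnK.
Qed.

End polar.

Section polar_formula.
Context {R : realType} (n : nat) (n_gt0 : (0 < n)%N).
Notation nu := (@normal01 R).
Notation gauss := (prob_rV nu n).
Notation mu := (@lebesgue_measure R).
Notation leb := (lebesgue_rV R n).
Notation a := (n%:R / 2 : R).
Implicit Types (f : 'rV[R]_n -> \bar R).

Lemma integral_rV_off0 f g : measurable_fun setT f -> measurable_fun setT g ->
  (forall y, y != 0 -> f y = g y) -> (\int[leb]_y f y = \int[leb]_y g y)%E.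
Proof.
move=> mf mg fg; apply: ae_eq_integral => //.
exists [set 0]; split.
- rewrite (_ : [set 0] = @enorm R n @^-1` [set 0]).
    by rewrite -[X in measurable X]setTI; apply: measurable_enorm => //; exact: measurable_set1.
  apply/seteqP; split=> y /=; first by move=> ->; apply/eqP; rewrite enorm_eq0.
  by move/eqP; rewrite enorm_eq0 => /eqP.
- exact: lebesgue_rV_set0.
- move=> y /= ny; apply/eqP/negPn/negP => y0; apply: ny => _; exact: fg.
Qed.

(** The integral of the Gaussian density along a ray, in the variable [t]. It equals two over the
    area of the unit sphere, but only its positivity and finiteness are ever used. *)
Definition radial_mass : \bar R :=
  (\int[mu]_t (gpeak ^+ n * expR (- (expR (- t) / 2)) * expR (- (a * t)))%:E)%E.

Let mexp (c : R) : measurable_fun setT (fun t : R => expR (c * t)).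
Proof. by apply: measurableT_comp => //; exact: mulrl_measurable. Qed.

Lemma measurable_dilation f : measurable_fun setT f ->
  measurable_fun setT (fun p : measurableTypeR R * 'rV[R]_n =>
    f (expR (p.1 / 2) *: p.2) * (expR (a * p.1))%:E)%E.
Proof.
move=> mf; apply: emeasurable_funM.
  apply: (measurableT_comp mf).
  apply: (@measurable_scaler_pair R n (fun t => expR (t / 2))).
  by apply: measurableT_comp => //; exact: mulrr_measurable.
apply/measurable_EFinP; exact: measurableT_comp (mexp a) measurable_fst.
Qed.

(** A shift of [t] by [2 ln |y|] trades the unit vector for [y] itself; the weight [e^(a t)] with
    [a = n / 2] then yields precisely [|y|^n]. *)
Lemma integral_ray f (y : 'rV[R]_n) : measurable_fun setT f -> (forall x, (0 <= f x)%E) -> y != 0 ->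
  (\int[mu]_t (f (expR (t / 2) *: unit_rV y) * (expR (a * t))%:E) =
   (enorm y ^+ n)%:E * \int[mu]_t (f (expR (t / 2) *: y) * (expR (a * t))%:E))%E.
Proof.
move=> mf f0 y0.
have r0 : 0 < enorm y by rewrite lt_neqAle eq_sym enorm_eq0 y0 enorm_ge0.
have mray z : measurable_fun setT (fun t : R => (f (expR (t / 2) *: z) * (expR (a * t))%:E)%E).
  exact: measurableT_comp (measurable_dilation mf) (measurable_pair2 z).
rewrite -(ge0_integral_shift (2 * ln (enorm y))) => [|//|t]; last first.
  by rewrite mule_ge0// lee_fin expR_ge0.
rewrite -ge0_integralZl//; last 3 first.
- exact: mray.
- by move=> t _; rewrite mule_ge0// lee_fin expR_ge0.
- by rewrite lee_fin exprn_ge0// ltW.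
apply: eq_integral => t _.
rewrite expR_half_shift// expR_dim_shift// /unit_rV scalerA mulfK ?gt_eqF//.
by rewrite EFinM muleA [in RHS]muleC.
Qed.

(** The same shift removes [|y|], and the Gaussian density does not depend on the direction of [y]:
    the ray integral is a constant. *)
Lemma integral_ray_mass (y : 'rV[R]_n) : y != 0 ->
  (\int[mu]_t (gauss_pdf (expR (- (t / 2)) *: y) * enorm y ^+ n * expR (- (a * t)))%:E =
   radial_mass)%E.
Proof.
move=> y0; have r0 : 0 < enorm y by rewrite lt_neqAle eq_sym enorm_eq0 y0 enorm_ge0.
have mt : measurable_fun setT (fun t : R => gauss_pdf (expR (- (t / 2)) *: y) * enorm y ^+ n * expR (- (a * t))).
  apply: measurable_funM.
    apply: measurable_funM => //; apply: (measurableT_comp (@measurable_gauss_pdf R n)).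
    apply: measurable_fun_rVP => i.
    rewrite (_ : (fun t => _) = fun t : R => expR (- (t / 2)) * y ord0 i); last first.
      by apply/funext => t; rewrite mxE.
    apply: measurable_funM => //; apply: measurableT_comp => //; apply: measurable_funN.
    exact: mulrr_measurable.
  by apply: measurableT_comp => //; apply: measurable_funN; exact: mulrl_measurable.
rewrite -(ge0_integral_shift (2 * ln (enorm y))) => [|//|t]; last 2 first.
- exact/measurable_EFinP.
- by rewrite lee_fin mulr_ge0 ?expR_ge0// mulr_ge0 ?gauss_pdf_ge0// exprn_ge0// enorm_ge0.
apply: eq_integral => t _; congr EFin.
rewrite !expRN expR_half_shift// expR_dim_shift// invfM -mulrA; congr (_ * _).
  rewrite /gauss_pdf enormZ gtr0_norm ?mulr_gt0 ?invr_gt0 ?expR_gt0//.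
  have -> : (expR (t / 2))^-1 / enorm y * enorm y = expR (- (t / 2)).
    by rewrite expRN mulfVK ?gt_eqF.
  have -> : expR (- (t / 2)) ^+ 2 = (expR t)^-1.
    by rewrite -expRM_natl -expRN; congr expR; field.
  by rewrite expRN.
by rewrite invfM mulrCA divff ?mulr1// expf_neq0// gt_eqF.
Qed.

(** Polar coordinates without a surface measure. The normalisation of [y] is undone by the shift in
    [t], the integrals are exchanged, a dilation of [R^n] moves the factor [e^(t/2)] from [f] to the
    Gaussian density, and after a second exchange the [t]-integral no longer contains [f] and is the
    constant [radial_mass]. *)
Lemma polar_aux f : measurable_fun setT f -> (forall x, (0 <= f x)%E) ->
  (\int[gauss]_y \int[mu]_t (f (expR (t / 2) *: unit_rV y) * (expR (a * t))%:E) =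
   radial_mass * \int[leb]_y f y)%E.
Proof.
move=> mf f0.
have mlin := measurable_dilation mf.
have mpair : measurable_fun setT (fun p : measurableTypeR R * 'rV[R]_n =>
    f (expR (p.1 / 2) *: unit_rV p.2) * (expR (a * p.1))%:E)%E.
  have mq : measurable_fun setT (fun p : measurableTypeR R * 'rV[R]_n => (p.1, unit_rV p.2)).
    apply: measurable_fun_pair; first exact: measurable_fst.
    exact: measurableT_comp (@measurable_unit_rV R n) measurable_snd.
  exact: measurableT_comp mlin mq.
have lin0 (p : measurableTypeR R * 'rV[R]_n) : (0 <= f (expR (p.1 / 2) *: p.2) * (expR (a * p.1))%:E)%E.
  by rewrite mule_ge0// lee_fin expR_ge0.
have mG : measurable_fun setT (fun y : 'rV[R]_n =>
    \int[mu]_t (f (expR (t / 2) *: unit_rV y) * (expR (a * t))%:E))%E.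
  apply: (measurable_fun_fubini_tonelli_G (m1 := mu) (fun p : measurableTypeR R * 'rV[R]_n =>
    f (expR (p.1 / 2) *: unit_rV p.2) * (expR (a * p.1))%:E)%E) => //.
  by move=> p; rewrite mule_ge0// lee_fin expR_ge0.
rewrite ge0_integral_gauss//; last first.
  by move=> y; apply: integral_ge0 => t _; rewrite mule_ge0// lee_fin expR_ge0.
pose h (y : 'rV[R]_n) : R := gauss_pdf y * enorm y ^+ n.
have h0 y : 0 <= h y by rewrite mulr_ge0 ?gauss_pdf_ge0// exprn_ge0// enorm_ge0.
have mh : measurable_fun setT h.
  by apply: measurable_funM; [exact: measurable_gauss_pdf|apply: measurable_funX; exact: measurable_enorm].
have mpr : measurable_fun setT (fun p : measurableTypeR R * 'rV[R]_n =>
    (f (expR (p.1 / 2) *: p.2) * (expR (a * p.1))%:E) * (h p.2)%:E)%E.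
  apply: emeasurable_funM => //; apply/measurable_EFinP.
  exact: measurableT_comp mh measurable_snd.
have pr0 (p : measurableTypeR R * 'rV[R]_n) :
    (0 <= (f (expR (p.1 / 2) *: p.2) * (expR (a * p.1))%:E) * (h p.2)%:E)%E.
  by rewrite mule_ge0// lee_fin.
have -> : (\int[leb]_y (\int[mu]_t (f (expR (t / 2) *: unit_rV y) * (expR (a * t))%:E)
    * (gauss_pdf y)%:E) = \int[leb]_y \int[mu]_t ((f (expR (t / 2) *: y) * (expR (a * t))%:E) * (h y)%:E))%E.
  apply: integral_rV_off0.
  - by apply: emeasurable_funM => //; apply/measurable_EFinP; exact: measurable_gauss_pdf.
  - exact: (measurable_fun_fubini_tonelli_G (m1 := mu) (fun p : measurableTypeR R * 'rV[R]_n =>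
      (f (expR (p.1 / 2) *: p.2) * (expR (a * p.1))%:E) * (h p.2)%:E)%E mpr pr0).
  - move=> y y0; rewrite integral_ray// ge0_integralZr//; last 3 first.
    + exact: measurableT_comp mlin (measurable_pair2 y).
    + by move=> t _; exact: (lin0 (t, y)).
    + by rewrite lee_fin.
    by rewrite /h EFinM muleC muleA [RHS]muleC.
rewrite -(fubini_tonelli (m1 := mu) (fun p : measurableTypeR R * 'rV[R]_n =>
      (f (expR (p.1 / 2) *: p.2) * (expR (a * p.1))%:E) * (h p.2)%:E)%E mpr pr0).
pose k (t : R) (y : 'rV[R]_n) : R := gauss_pdf (expR (- (t / 2)) *: y) * enorm y ^+ n * expR (- (a * t)).
have k0 t y : 0 <= k t y.
  by rewrite mulr_ge0 ?expR_ge0// mulr_ge0 ?gauss_pdf_ge0// exprn_ge0// enorm_ge0.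
have mk : measurable_fun setT (fun p : measurableTypeR R * 'rV[R]_n => k p.1 p.2).
  apply: measurable_funM; last first.
    have := mexp (- a); under eq_fun do rewrite mulNr.
    by move=> me; exact: measurableT_comp me measurable_fst.
  apply: measurable_funM; last first.
    by apply: measurable_funX; exact: measurableT_comp (@measurable_enorm R n) measurable_snd.
  apply: (measurableT_comp (@measurable_gauss_pdf R n)).
  apply: (@measurable_scaler_pair R n (fun t => expR (- (t / 2)))).
  by apply: measurableT_comp => //; apply: measurable_funN; exact: mulrr_measurable.
have mfk : measurable_fun setT (fun p : measurableTypeR R * 'rV[R]_n => f p.2 * (k p.1 p.2)%:E)%E.
  apply: emeasurable_funM; last exact/measurable_EFinP.
  exact: measurableT_comp mf measurable_snd.
have fk0 (p : measurableTypeR R * 'rV[R]_n) : (0 <= f p.2 * (k p.1 p.2)%:E)%E.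
  by rewrite mule_ge0// lee_fin.
have -> : (\int[mu]_t \int[leb]_y ((f (expR (t / 2) *: y) * (expR (a * t))%:E) * (h y)%:E) =
    \int[mu]_t \int[leb]_y (f y * (k t y)%:E))%E.
  (* The Jacobian [s^-n] of the dilation cancels [e^(a t) = s^n]. *)
  apply: eq_integral => t _; set s := expR (t / 2).
  have s0 : 0 < s by exact: expR_gt0.
  have sN : expR (- (t / 2)) = s^-1 by rewrite expRN.
  have sa : expR (a * t) = s ^+ n by rewrite -expRM_natl; congr expR; rewrite mulrA mulrAC.
  have mq : measurable_fun setT (fun y => (f y * (s ^+ n * h (s^-1 *: y))%:E)%E).
    apply: emeasurable_funM => //; apply/measurable_EFinP; apply: measurable_funM => //.
    exact: measurableT_comp mh (@measurable_scaler_rV R n _).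
  have q0 y : (0 <= f y * (s ^+ n * h (s^-1 *: y))%:E)%E.
    by rewrite mule_ge0// lee_fin mulr_ge0// exprn_ge0// ltW.
  have sn0 : (0 <= (s ^- n)%:E)%E by rewrite lee_fin invr_ge0 exprn_ge0// ltW.
  transitivity (\int[leb]_y (f (s *: y) * (s ^+ n * h (s^-1 *: (s *: y)))%:E))%E.
    by apply: eq_integral => y _; rewrite scalerA mulVf ?gt_eqF// scale1r sa [in RHS]EFinM [in RHS]muleA.
  rewrite (ge0_integral_rV_scale s0 mq q0) -ge0_integralZl//.
  apply: eq_integral => y _; rewrite muleCA -EFinM; congr (_ * _%:E)%E.
  rewrite mulrA mulVf ?mul1r; last by rewrite expf_neq0// gt_eqF.
  rewrite /h /k enormZ gtr0_norm ?invr_gt0// exprMn sN exprVn expRN sa.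
  by rewrite mulrA mulrAC.
rewrite (fubini_tonelli (m1 := mu) (m2 := leb) (fun p : measurableTypeR R * 'rV[R]_n => f p.2 * (k p.1 p.2)%:E)%E mfk fk0).
rewrite -ge0_integralZl//; last first.
  apply: integral_ge0 => t _.
  by rewrite lee_fin mulr_ge0 ?expR_ge0// mulr_ge0 ?expR_ge0// exprn_ge0// ltW// gpeak_gt0.
apply: integral_rV_off0.
- exact: (measurable_fun_fubini_tonelli_G (m1 := mu) (fun p : measurableTypeR R * 'rV[R]_n => f p.2 * (k p.1 p.2)%:E)%E mfk fk0).
- exact: measurable_funeM.
- move=> y y0; rewrite -(integral_ray_mass y0) muleC -ge0_integralZl//.
  + apply/measurable_EFinP; exact: measurableT_comp mk (measurable_pair2 y).
  + by move=> t _; rewrite lee_fin k0.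
Qed.

End polar_formula.

(** * Second and fourth Gaussian moments of the norm *)

Section gauss_moments.
Context {R : realType}.
Notation nu := (@normal01 R).
Notation gauss := (prob_rV nu).

Lemma ge0_integral_prob_affine d (T : measurableType d) (P : probability T R)
    (f g : T -> R) (c p q : R) :
  measurable_fun setT f -> measurable_fun setT g ->
  (forall x, 0 <= f x) -> (forall x, 0 <= g x) -> 0 <= c -> 0 <= p -> 0 <= q ->
  (\int[P]_x (c + p * f x + q * g x)%:E =
   c%:E + p%:E * \int[P]_x (f x)%:E + q%:E * \int[P]_x (g x)%:E)%E.
Proof.
move=> mf mg f0 g0 c0 p0 q0.
have Zl (h : T -> R) (k : R) : measurable_fun setT h -> (forall x, 0 <= h x) -> 0 <= k ->
    (\int[P]_x (k * h x)%:E = k%:E * \int[P]_x (h x)%:E)%E.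
  move=> mh h0 k0; under eq_integral do rewrite EFinM.
  apply: ge0_integralZl => //; first exact/measurable_EFinP.
  by move=> x _; rewrite lee_fin.
have D (h k : T -> R) : measurable_fun setT h -> measurable_fun setT k ->
    (forall x, 0 <= h x) -> (forall x, 0 <= k x) ->
    (\int[P]_x (h x + k x)%:E = \int[P]_x (h x)%:E + \int[P]_x (k x)%:E)%E.
  move=> mh mk h0 k0; under eq_integral do rewrite EFinD.
  apply: ge0_integralD => //; try exact/measurable_EFinP; by move=> x _; rewrite lee_fin.
have mpf : measurable_fun setT (fun x => p * f x) by exact: measurable_funM.
have mqg : measurable_fun setT (fun x => q * g x) by exact: measurable_funM.
have pf0 x : 0 <= p * f x by exact: mulr_ge0.
rewrite D//; [|exact: measurable_funD|by move=> x; exact: addr_ge0|by move=> x; exact: mulr_ge0].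
by rewrite (D (fun=> c))// !Zl// integral_prob_cst.
Qed.

Lemma gauss_enorm_sqr n : (\int[gauss n]_y (enorm y ^+ 2)%:E = n%:R%:E)%E.
Proof.
elim: n => [|n IH].
  by rewrite integral0_eq// => x _; rewrite enorm_sqr big_ord0.
have [m2 _] := @normal01_moments R.
have mn m : measurable_fun setT (fun y : 'rV[R]_m => enorm y ^+ 2).
  by apply: measurable_funX; exact: measurable_enorm.
have mx : measurable_fun setT (fun x : R => x ^+ 2) by exact: measurable_funX.
rewrite ge0_integral_prob_rVS; last 2 first.
- by apply/measurable_EFinP; exact: mn.
- by move=> x; rewrite lee_fin sqr_ge0.
transitivity (\int[nu]_x (n%:R + 1 * x ^+ 2 + 0 * x ^+ 2)%:E)%E.
  apply: eq_integral => x _.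
  transitivity (\int[gauss n]_y (x ^+ 2 + 1 * enorm y ^+ 2 + 0 * enorm y ^+ 2)%:E)%E.
    by apply: eq_integral => y _; rewrite enorm_rV_cons mul1r mul0r addr0.
  rewrite ge0_integral_prob_affine ?sqr_ge0//; try (by move=> y; exact: sqr_ge0);
    try exact: mn.
  by rewrite IH mul1e mul0e adde0 mul1r mul0r addr0 addrC.
rewrite ge0_integral_prob_affine//; try by move=> y; exact: sqr_ge0.
by rewrite m2 mule1 mul0e adde0 -EFinD natr1.
Qed.

Lemma gauss_enorm_pow4 n : (\int[gauss n]_y (enorm y ^+ 4)%:E = (n%:R * (n%:R + 2))%:E)%E.
Proof.
elim: n => [|n IH].
  rewrite integral0_eq ?mul0r// => x _.
  by rewrite (exprM _ 2 2) enorm_sqr big_ord0 expr0n.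
have [m2 m4] := @normal01_moments R.
have mn m : measurable_fun setT (fun y : 'rV[R]_m => enorm y ^+ 2).
  by apply: measurable_funX; exact: measurable_enorm.
have mn4 m : measurable_fun setT (fun y : 'rV[R]_m => enorm y ^+ 4).
  by apply: measurable_funX; exact: measurable_enorm.
have mx : measurable_fun setT (fun x : R => x ^+ 2) by exact: measurable_funX.
have mx4 : measurable_fun setT (fun x : R => x ^+ 4) by exact: measurable_funX.
have p4 (x : R) : 0 <= x ^+ 4 by rewrite exprn_even_ge0.
rewrite ge0_integral_prob_rVS; last 2 first.
- by apply/measurable_EFinP; exact: mn4.
- by move=> x; rewrite lee_fin.
transitivity (\int[nu]_x (n%:R * (n%:R + 2) + (2 * n%:R) * x ^+ 2 + 1 * x ^+ 4)%:E)%E.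
  apply: eq_integral => x _.
  transitivity (\int[gauss n]_y (x ^+ 4 + (2 * x ^+ 2) * enorm y ^+ 2 + 1 * enorm y ^+ 4)%:E)%E.
    apply: eq_integral => y _; congr EFin.
    by rewrite (exprM _ 2 2) enorm_rV_cons; ring.
  rewrite ge0_integral_prob_affine//; try (by rewrite mulr_ge0// sqr_ge0);
    try (by move=> y; rewrite exprn_even_ge0); try exact: mn; try exact: mn4.

  by rewrite IH gauss_enorm_sqr mul1e -!EFinM -!EFinD; congr EFin; ring.
rewrite ge0_integral_prob_affine//;
  try (by move=> y; exact: sqr_ge0); try (by rewrite mulr_ge0// addr_ge0).
by rewrite m2 m4 mule1 mul1e -!EFinD; congr EFin; rewrite -natr1; ring.
Qed.

End gauss_moments.

(** * The radial constant is positive and finite *)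

Section polar_mass.
Context {R : realType} (n : nat) (n_gt0 : (0 < n)%N).
Notation nu := (@normal01 R).
Notation gauss := (prob_rV nu n).
Notation mu := (@lebesgue_measure R).
Notation leb := (lebesgue_rV R n).
Notation a := (n%:R / 2 : R).
Notation mass := (@radial_mass R n).

Let a_gt0 : 0 < a. Proof. by rewrite divr_gt0// ltr0n. Qed.

Let mass_pdf (t : R) : R := gpeak ^+ n * expR (- (expR (- t) / 2)) * expR (- (a * t)).

Let mass_pdf_ge0 t : 0 <= mass_pdf t.
Proof. by rewrite mulr_ge0 ?expR_ge0// mulr_ge0 ?expR_ge0// exprn_ge0// ltW// gpeak_gt0. Qed.

Let measurable_mass_pdf : measurable_fun setT mass_pdf.
Proof.
apply: measurable_funM; last first.
  by apply: measurableT_comp => //; apply: measurable_funN; exact: mulrl_measurable.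
apply: measurable_funM => //; apply: measurableT_comp => //; apply: measurable_funN.
by apply: measurable_funM => //; apply: measurableT_comp => //; exact: measurable_funN.
Qed.

Lemma radial_mass_gt0 : (0 < mass)%E.
Proof.
pose c := gpeak ^+ n * expR (- (1 / 2)) * expR (- a) : R.
have c0 : 0 < c by rewrite !mulr_gt0 ?expR_gt0// exprn_gt0// gpeak_gt0.
apply: (@lt_le_trans _ _ (\int[mu]_(t in `[0%R, 1%R]) c%:E)%E).
  by rewrite integral_cst//= lebesgue_measure_itv/= lte_fin ltr01 oppr0 adde0 mule1 lte_fin.
rewrite integral_mkcond; apply: ge0_le_integralT => [| |t|t].
- by apply/(measurable_restrictT _ _).1.
- exact/measurable_EFinP.
- by rewrite patchE; case: ifP => // _; rewrite lee_fin ltW.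
rewrite patchE; case: ifPn => [|_]; last by rewrite lee_fin; exact: mass_pdf_ge0.
rewrite mem_setE in_itv/= => /andP[t0 t1]; rewrite lee_fin /c.
rewrite ler_pM ?mulr_ge0 ?expR_ge0 ?exprn_ge0 ?(ltW gpeak_gt0)//.
  rewrite ler_wpM2l ?exprn_ge0 ?(ltW gpeak_gt0)// ler_expR lerN2 ler_pM2r//.
  by rewrite -expR0 ler_expR oppr_le0.
by rewrite ler_expR lerN2 ler_piMr// ltW.
Qed.

(** The origin is left out so that the ray integral at [y = 0], where [unit_rV y = 0], vanishes
    instead of diverging. *)
Let unit_ball (y : 'rV[R]_n) : R := if (y != 0) && (enorm y <= 1) then 1 else 0.

Let measurable_unit_ball : measurable_fun setT unit_ball.
Proof.
have -> : unit_ball = fun y => if (0 < enorm y) && (enorm y <= 1) then 1 else 0.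
  by apply/funext => y; rewrite /unit_ball lt0r enorm_eq0 enorm_ge0 andbT.
apply: measurable_fun_ifT => //; apply: measurable_and.
  by apply: measurable_fun_ltr => //; exact: measurable_enorm.
by apply: measurable_fun_ler => //; exact: measurable_enorm.
Qed.

(** The punctured ball contains the cube []0, 1/n]^n], on which [x_i^2 <= x_i <= 1/n]. *)
Lemma unit_ball_gt0 : (0 < \int[leb]_y (unit_ball y)%:E)%E.
Proof.
pose A (i : 'I_n) : set R := [set` `]0, n%:R^-1]].
pose B := [set x : 'rV[R]_n | forall i, A i (x ord0 i)].
have mB : measurable B.
  rewrite (_ : B = \bigcap_(i in [set: 'I_n]) [set x : 'rV[R]_n | A i (x ord0 i)]).
    apply: fin_bigcap_measurable => // i _; rewrite -[X in measurable X]setTI.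
    by apply: (measurable_coord i) => //; exact: measurable_itv.
  by apply/seteqP; split => x /= h i; [move=> _|]; apply: h.
apply: (@lt_le_trans _ _ (\int[leb]_(y in B) 1)%E).
  have boxE : leb B = (\prod_(i < n) mu (A i))%E.
    by apply: lebesgue_rV_box => i; exact: measurable_itv.
  rewrite integral_cst// mul1e [X in (_ < X)%E]boxE.
  apply: (big_ind (fun x => 0 < x)%E) => // [x y|i _]; first exact: mule_gt0.
  by rewrite /A/= lebesgue_measure_itv/= lte_fin invr_gt0 ltr0n n_gt0 sube0 lte_fin invr_gt0 ltr0n.
rewrite integral_mkcond; apply: ge0_le_integralT => [| |y|y].
- by apply/(measurable_restrictT _ _).1.
- exact/measurable_EFinP.
- by rewrite patchE; case: ifP.
rewrite patchE; case: ifPn => [|_]; last by rewrite lee_fin /unit_ball; case: ifP.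
rewrite inE /B/= => yA; rewrite lee_fin /unit_ball ifT//; apply/andP; split.
  apply/eqP => y0; have := yA (Ordinal n_gt0); rewrite y0 mxE /A/= in_itv/= ltxx//.
rewrite -(@expr_le1 _ 2) ?enorm_ge0// enorm_sqr.
apply: (@le_trans _ _ (\sum_(i < n) n%:R^-1)); last first.
  by rewrite sumr_const card_ord -(mulr_natl (n%:R^-1)) divff// pnatr_eq0 -lt0n.
apply: ler_sum => i _; have := yA i; rewrite /A/= in_itv/= => /andP[y0 y1].
apply: (@le_trans _ _ (y ord0 i)) => //; rewrite expr2 ler_piMl//; first exact: ltW.
by rewrite (le_trans y1)// invf_le1 ?ltr0n// ler1n.
Qed.

(** [polar_aux] for the punctured unit ball: the left side is at most the integral of [e^(a t)] over
    [t <= 0], that is [1 / a], while on the right the constant multiplies a positive volume. *)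
Lemma radial_mass_lty : (mass < +oo)%E.
Proof.
have b0 y : (0 <= (unit_ball y)%:E)%E by rewrite lee_fin /unit_ball; case: ifP.
have mb : measurable_fun setT (fun y => (unit_ball y)%:E) by exact/measurable_EFinP.
have := polar_aux n_gt0 mb b0.
set L := (X in X = _) => e.
pose g (t : R) : R := if t <= 0 then expR (a * t) else 0.
have mg : measurable_fun setT g.
  apply: measurable_fun_ifT => //; first exact: measurable_fun_ler.
  by apply: measurableT_comp => //; exact: mulrl_measurable.
have g0 t : 0 <= g t by rewrite /g; case: ifP => // _; exact: expR_ge0.
have gE : (\int[mu]_t (g t)%:E = (a^-1)%:E)%E.
  rewrite -ge0_integral_opp; [|exact/measurable_EFinP|by move=> t; rewrite lee_fin].
  transitivity (\int[mu]_t ((a^-1)%:E * (exponential_pdf a t)%:E))%E.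
    apply: eq_integral => t _; rewrite -EFinM; congr EFin.
    rewrite /g /exponential_pdf patchE mem_setE in_itv/= andbT oppr_le0.
    by case: ifP => _; rewrite ?mulr0// mulrA mulVf ?gt_eqF// mul1r mulrN mulNr.
  rewrite ge0_integralZl//; last 2 first.
  - by apply/measurable_EFinP; exact: measurable_exponential_pdf.
  - by move=> t _; rewrite lee_fin exponential_pdf_ge0// ltW.
  by rewrite integral_exponential_pdf// mule1.
have Loo : (L <= (a^-1)%:E)%E.
  apply: (@le_trans _ _ (\int[gauss]_y (a^-1)%:E)%E); last by rewrite integral_prob_cst.
  apply: ge0_le_integralT => [| |y|y].
  - have mpair : measurable_fun setT (fun p : measurableTypeR R * 'rV[R]_n =>
        (unit_ball (expR (p.1 / 2) *: unit_rV p.2))%:E * (expR (a * p.1))%:E)%E.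
      have mq : measurable_fun setT (fun p : measurableTypeR R * 'rV[R]_n => (p.1, unit_rV p.2)).
        apply: measurable_fun_pair; first exact: measurable_fst.
        exact: measurableT_comp (@measurable_unit_rV R n) measurable_snd.
      exact: measurableT_comp (measurable_dilation mb) mq.
    apply: (measurable_fun_fubini_tonelli_G (m1 := mu) (fun p : measurableTypeR R * 'rV[R]_n =>
      (unit_ball (expR (p.1 / 2) *: unit_rV p.2))%:E * (expR (a * p.1))%:E)%E mpair) => p.
    by rewrite mule_ge0// lee_fin expR_ge0.
  - exact: measurable_cst.
  - by apply: integral_ge0 => t _; rewrite mule_ge0// lee_fin expR_ge0.
  rewrite -gE; apply: ge0_le_integralT => [| |t|t].
  - have := measurableT_comp (measurable_dilation mb) (measurable_pair2 (unit_rV y)); exact.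
  - exact/measurable_EFinP.
  - by rewrite mule_ge0// lee_fin expR_ge0.
  rewrite -EFinM lee_fin /unit_ball /g; case: ifPn => [/andP[+ +]|_]; last first.
    by rewrite mul0r; case: ifP => // _; exact: expR_ge0.
  have [->|y0 _] := eqVneq y 0; first by rewrite /unit_rV !scaler0 eqxx.
  rewrite enormZ enormZ !gtr0_norm ?invr_gt0 ?expR_gt0 ?lt_neqAle ?enorm_ge0 1?eq_sym ?enorm_eq0 ?y0//.
  rewrite mulVf ?enorm_eq0// mulr1 -expR0 ler_expR pmulr_lle0// => ->.
  by rewrite expR0 mul1r.
have := le_lt_trans Loo (ltry _); rewrite e => {}e.
rewrite ltNge leye_eq; apply/negP => /eqP m; move: e.
by rewrite m gt0_mulye ?unit_ball_gt0.
Qed.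

End polar_mass.

(** * Independence of the norm and the direction of a Gaussian vector *)

Section independence.
Context {R : realType} (n : nat) (n_gt0 : (0 < n)%N).
Notation nu := (@normal01 R).
Notation gauss := (prob_rV nu n).
Notation mu := (@lebesgue_measure R).
Notation leb := (lebesgue_rV R n).
Notation a := (n%:R / 2 : R).
Notation mass := (@radial_mass R n).

Lemma integral_gauss_off0 (f g : 'rV[R]_n -> \bar R) : measurable_fun setT f -> measurable_fun setT g ->
  (forall y, (0 <= f y)%E) -> (forall y, (0 <= g y)%E) ->
  (forall y, y != 0 -> f y = g y) -> (\int[gauss]_y f y = \int[gauss]_y g y)%E.
Proof.
move=> mf mg f0 g0 fg; have mp := @measurable_gauss_pdf R n.
rewrite !ge0_integral_gauss//; apply: integral_rV_off0 => //.
- by apply: emeasurable_funM => //; exact/measurable_EFinP.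
- by apply: emeasurable_funM => //; exact/measurable_EFinP.
- by move=> y y0; rewrite fg.
Qed.

Lemma enorm_unit (y : 'rV[R]_n) : y != 0 -> enorm (unit_rV y) = 1.
Proof.
move=> y0; rewrite enormZ ger0_norm ?invr_ge0 ?enorm_ge0// mulVf//.
by rewrite enorm_eq0.
Qed.

Lemma enorm_ray (t : R) (y : 'rV[R]_n) : y != 0 -> enorm (expR t *: unit_rV y) = expR t.
Proof. by move=> y0; rewrite enormZ enorm_unit// mulr1 gtr0_norm ?expR_gt0. Qed.

Lemma unit_ray (t : R) (y : 'rV[R]_n) : y != 0 -> unit_rV (expR t *: unit_rV y) = unit_rV y.
Proof.
by move=> y0; rewrite /unit_rV enorm_ray// scalerA mulVf ?scale1r// gt_eqF ?expR_gt0.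
Qed.

Lemma radial_mass_fin : exists2 C : R, 0 < C & mass = C%:E.
Proof.
have m0 := @radial_mass_gt0 R n; have moo := @radial_mass_lty R n n_gt0.
have fm : mass \is a fin_num by rewrite ge0_fin_numE ?ltW.
by exists (fine mass); [rewrite fine_gt0// m0 moo|rewrite fineK].
Qed.

Lemma mule_mass_inj (x y : \bar R) : (mass * x = mass * y -> x = y)%E.
Proof.
have [C C0 ->] := radial_mass_fin => e.
by apply/eqP; rewrite eq_le; apply/andP; split; rewrite -(@lee_pmul2l _ C%:E)// e.
Qed.

(** After [polar_aux] the integral along a ray is a fixed number times the value of [G] at the
    direction. The case [G = 1] identifies this number as [mass] times the integral of [psi], and
    [mass] is cancelled. *)
Lemma gauss_independence (psi : R -> \bar R) (G : 'rV[R]_n -> \bar R) :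
  measurable_fun setT psi -> measurable_fun setT G ->
  (forall r, (0 <= psi r)%E) -> (forall y, (0 <= G y)%E) ->
  (\int[gauss]_y (psi (enorm y) * G (unit_rV y)) =
   (\int[gauss]_y psi (enorm y)) * \int[gauss]_y G (unit_rV y))%E.
Proof.
move=> mpsi mG psi0 G0.
pose w (t : R) := (psi (expR (t / 2)) * (gpeak ^+ n * expR (- (expR (t / 2) ^+ 2 / 2)) * expR (a * t))%:E)%E.
have me (c : R) : measurable_fun setT (fun t : R => expR (t * c)).
  by apply: measurableT_comp => //; exact: mulrr_measurable.
have mw : measurable_fun setT w.
  apply: emeasurable_funM; first exact: measurableT_comp mpsi (me _).
  apply/measurable_EFinP; apply: measurable_funM; last first.
    by apply: measurableT_comp => //; exact: mulrl_measurable.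
  apply: measurable_funM => //; apply: measurableT_comp => //; apply: measurable_funN.
  by apply: measurable_funM => //; apply: measurable_funX; exact: me.
have w0 t : (0 <= w t)%E.
  by rewrite mule_ge0// lee_fin mulr_ge0 ?expR_ge0// mulr_ge0 ?expR_ge0// exprn_ge0// ltW// gpeak_gt0.
have key (H : 'rV[R]_n -> \bar R) : measurable_fun setT H -> (forall y, (0 <= H y)%E) ->
    (mass * \int[gauss]_y (psi (enorm y) * H (unit_rV y)) =
     (\int[gauss]_y H (unit_rV y)) * \int[mu]_t w t)%E.
  move=> mH H0.
  have mpH : measurable_fun setT (fun y : 'rV[R]_n => psi (enorm y) * H (unit_rV y))%E.
    apply: emeasurable_funM; first exact: measurableT_comp mpsi (@measurable_enorm R n).
    exact: measurableT_comp mH (@measurable_unit_rV R n).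
  have pH0 y : (0 <= psi (enorm y) * H (unit_rV y))%E by rewrite mule_ge0.
  rewrite ge0_integral_gauss//.
  have mq : measurable_fun setT (fun y : 'rV[R]_n => psi (enorm y) * H (unit_rV y) * (gauss_pdf y)%:E)%E.
    by apply: emeasurable_funM => //; apply/measurable_EFinP; exact: measurable_gauss_pdf.
  have q0 y : (0 <= psi (enorm y) * H (unit_rV y) * (gauss_pdf y)%:E)%E.
    by rewrite mule_ge0// lee_fin gauss_pdf_ge0.
  rewrite -(polar_aux n_gt0 mq q0).
  have mHu : measurable_fun setT (fun y => H (unit_rV y)) by exact: measurableT_comp mH (@measurable_unit_rV R n).
  have Iw0 : (0 <= \int[mu]_t w t)%E by exact: integral_ge0.
  rewrite muleC -ge0_integralZl//.
  apply: integral_gauss_off0.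
  - have mpair : measurable_fun setT (fun p : measurableTypeR R * 'rV[R]_n => (p.1, unit_rV p.2)).
      apply: measurable_fun_pair; first exact: measurable_fst.
      exact: measurableT_comp (@measurable_unit_rV R n) measurable_snd.
    have mfull := measurableT_comp (measurable_dilation mq) mpair.
    apply: (measurable_fun_fubini_tonelli_G (m1 := mu) _ mfull) => p.
    by rewrite /= mule_ge0// lee_fin expR_ge0.
  - exact: measurable_funeM.
  - by move=> y; apply: integral_ge0 => t _; rewrite mule_ge0// lee_fin expR_ge0.
  - by move=> y; rewrite mule_ge0.
  - move=> y y0; rewrite muleC -ge0_integralZl//.
    apply: eq_integral => t _; rewrite /w enorm_ray// unit_ray// /gauss_pdf enorm_ray//.
    by rewrite [(psi _ * H _)%E]muleC -!muleA -EFinM.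
apply: mule_mass_inj; rewrite (key G)// muleA.
have := key (fun=> 1%E) (measurable_cst _) (fun=> lee01).
by under eq_integral do rewrite mule1; rewrite integral_prob_cst mul1e => ->; rewrite muleC.
Qed.

End independence.

(** * The chain rule for continuously differentiable functions *)

Lemma cvg_sumr {R : realType} (T : Type) (F : set_system T) {FF : Filter F}
    (I : finType) (g : I -> T -> R) (l : I -> R) :
  (forall i, g i h @[h --> F] --> l i) -> \sum_i g i h @[h --> F] --> \sum_i l i.
Proof.
move=> gl; elim: (index_enum I) => [|i s IH].
  by rewrite big_nil; under eq_fun do rewrite big_nil; exact: cvg_cst.
by rewrite big_cons; under eq_fun do rewrite big_cons; exact: cvgD.
Qed.

Section chain_rule.
Context {R : realType} (n : nat).
Implicit Types (f : 'rV[R]_n -> R) (x y : 'rV[R]_n).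

Lemma is_derive_line f i (x : 'rV[R]_n) (s : R) : (forall x, derivable f x (delta_mx ord0 i)) ->
  is_derive s 1 (fun r : R => f (x + r *: delta_mx ord0 i)) (partial i f (x + s *: delta_mx ord0 i)).
Proof.
move=> df; set e := delta_mx ord0 i; set g := fun r => _.
have eq1 : (fun h : R => h^-1 *: ((g \o shift s) (h *: 1) - g s)) =
    (fun h : R => h^-1 *: ((f \o shift (x + s *: e)) (h *: e) - f (x + s *: e))).
  apply/funext => h; rewrite /g /= /shift/=; congr (_ *: (f _ - _)).
  by rewrite [h%:A]mulr1 scalerDl addrCA addrC.
apply: DeriveDef; first by rewrite /derivable eq1; exact: df.
by rewrite /derive eq1.
Qed.

Lemma mvt_sym (g g' : R -> R) (d : R) : (forall x : R, is_derive x 1 g (g' x)) ->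
  exists2 c, `|c| <= `|d| & g d - g 0 = g' c * d.
Proof.
move=> dg.
have cg (A : set R) : {within A, continuous g}.
  by apply: continuous_subspaceT => x; apply/differentiable_continuous/derivable1_diffP; case: (dg x).
case: (ltgtP d 0) => [d0|d0|->]; last by exists 0; rewrite ?normr0// subrr mulr0.
- have [c] := @MVT _ g g' d 0 d0 (fun r _ => dg r) (cg _).
  rewrite in_itv/= => /andP[dc c0] e; exists c.
    by rewrite !ltr0_norm// lerN2 ltW.
  by apply: oppr_inj; rewrite opprB e sub0r mulrN.
- have [c] := @MVT _ g g' 0 d d0 (fun r _ => dg r) (cg _).
  rewrite in_itv/= => /andP[c0 cd] e; exists c; last by rewrite e subr0.
  by rewrite !gtr0_norm// ltW.
Qed.

Record C1_rV f : Prop := C1RV {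
  C1_derivable : forall i x, derivable f x (delta_mx ord0 i);
  C1_continuous : forall i, continuous (partial i f)
}.

(** From [x] to [y] one coordinate is changed at a time, through the points [z k]; on each step the
    mean value theorem applies, and the continuity of the partial derivatives compares them with
    their values at [x]. *)
Lemma C1_taylor f x (e : R) : C1_rV f -> 0 < e ->
  exists2 d : R, 0 < d & forall y, (forall i, `|y ord0 i - x ord0 i| < d) ->
    `|f y - f x - \sum_i partial i f x * (y ord0 i - x ord0 i)| <=
    e * \sum_i `|y ord0 i - x ord0 i|.
Proof.
move=> C1 e0.
have cont i : exists2 d : R, 0 < d & forall y, (forall j, `|y ord0 j - x ord0 j| < d) ->
    `|partial i f y - partial i f x| <= e.
  have /cvgrPdist_le/(_ _ e0) := @C1_continuous f C1 i x.
  move=> /nbhs_ballP[d /= d0 H]; exists d => // y yd; rewrite distrC; apply: H.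
  by split=> // i0 j; rewrite (ord1 i0) /ball/= distrC.
have [d dP] : {d : 'I_n -> R & forall i, 0 < d i /\ forall y, (forall j, `|y ord0 j - x ord0 j| < d i) ->
    `|partial i f y - partial i f x| <= e}.
  have h i : {d : R | 0 < d /\ forall y, (forall j, `|y ord0 j - x ord0 j| < d) ->
    `|partial i f y - partial i f x| <= e}.
    by apply: cid; have [d d0 H] := cont i; exists d.
  by exists (fun i => sval (h i)) => i; exact: (svalP (h i)).
have [D D0 DP] : exists2 D : R, 0 < D & forall i, D <= d i.
  exists (\big[Num.min/1]_i d i); last by move=> i; exact: bigmin_le.
  apply: (big_ind (fun r : R => 0 < r)) => // [r s r0 s0|i _]; last by case: (dP i).
  by rewrite lt_min r0 s0.
exists D => // y yD.
pose z (k : nat) : 'rV[R]_n := \row_i (if (i < k)%N then y ord0 i else x ord0 i).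
have z0 : z 0%N = x by apply/rowP => i; rewrite mxE.
have zn : z n = y by apply/rowP => i; rewrite mxE ltn_ord.
have zS (i : 'I_n) : z i.+1 = z i + (y ord0 i - x ord0 i) *: delta_mx ord0 i.
  apply/rowP => j; rewrite !mxE eqxx/= ltnS leq_eqVlt (inj_eq val_inj).
  have [->|ji] := eqVneq j i; first by rewrite ltnn mulr1 addrC subrK.
  by rewrite mulr0 addr0.
have step (i : 'I_n) : `|f (z i.+1) - f (z i) - partial i f x * (y ord0 i - x ord0 i)| <=
    e * `|y ord0 i - x ord0 i|.
  have [c cd] := mvt_sym (y ord0 i - x ord0 i)
    (fun s => is_derive_line (z i) s (@C1_derivable f C1 i)).
  rewrite -zS scale0r addr0 => ->; rewrite -mulrBl normrM ler_wpM2r//.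
  have [_] := dP i; apply=> j; rewrite !mxE eqxx/=; apply: lt_le_trans (DP i).
  have [->|ji] := eqVneq j i.
    by rewrite ltnn mulr1 addrAC subrr add0r (le_lt_trans cd).
  by rewrite mulr0 addr0; case: ifP => _; rewrite ?yD// subrr normr0.
have -> : f y - f x = \sum_(i < n) (f (z i.+1) - f (z i)).
  by rewrite -{1}zn -{1}z0 -(@telescope_sumr _ 0 n (fun k => f (z k)))// big_mkord.
rewrite -sumrB mulr_sumr (le_trans (ler_norm_sum _ _ _))//.
by apply: ler_sum => i _; exact: step.
Qed.

(** Differentiability is assumed along the axes only; [C1_taylor] turns it into a first-order
    expansion, which survives composition with a curve whose coordinates are differentiable. *)
Lemma C1_chain f (c : R -> 'rV[R]_n) (c' : 'I_n -> R) (t : R) : C1_rV f ->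
  (forall i, is_derive t 1 (fun s => c s ord0 i) (c' i)) ->
  is_derive t 1 (fun s => f (c s)) (\sum_i partial i f (c t) * c' i).
Proof.
move=> C1 dc.
pose q i (h : R) := h^-1 *: (c (h *: 1 + t) ord0 i - c t ord0 i).
have qc i : q i h @[h --> 0^'] --> c' i.
  by have [d1 d2] := dc i; rewrite -d2; exact: d1.
have lin : \sum_i partial i f (c t) * q i h @[h --> 0^'] --> \sum_i partial i f (c t) * c' i.
  by apply: cvg_sumr => i; apply: cvgMr; exact: qc.
have M : \sum_i `|q i h| @[h --> 0^'] --> \sum_i `|c' i|.
  by apply: cvg_sumr => i; apply: cvg_norm; exact: qc.
have cc i : c (h *: 1 + t) ord0 i @[h --> 0^'] --> c t ord0 i.
  have [d1 _] := dc i; move/derivable1_diffP/differentiable_continuous : d1 => ct.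
  have /cvgrPdist_lt h0 := ct.
  apply/cvgrPdist_lt => e e0; have /nbhs_ballP[d /= d0 H] := h0 _ e0.
  apply/nbhs_ballP; exists d => //= h hd _; apply: H; rewrite /ball/= in hd *.
  by rewrite [h%:A]mulr1 opprD addrCA subrr addr0 -[- h]sub0r.
have res : h^-1 *: (f (c (h *: 1 + t)) - f (c t)) @[h --> 0^'] --> \sum_i partial i f (c t) * c' i.
  apply/cvgrPdist_le => e e0.
  (* [B] eventually bounds the sum of the [|q i h|], so the Taylor remainder with tolerance
     [e / 2 / B] costs at most [e / 2] after division by [h]. *)
  pose B := \sum_i `|c' i| + 1.
  have B0 : 0 < B by rewrite ltr_wpDl// sumr_ge0.
  have e20 : 0 < e / 2 / B by rewrite !divr_gt0.
  have [d d0 H] := C1_taylor (c t) C1 e20.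
  have near1 : \forall h \near 0^', forall i, `|c (h *: 1 + t) ord0 i - c t ord0 i| < d.
    apply: filter_forall => i; have /cvgrPdist_lt/(_ _ d0) := cc i.
    by apply: filterS => h; rewrite distrC.
  have near2 : \forall h \near 0^', `|\sum_i partial i f (c t) * c' i - \sum_i partial i f (c t) * q i h| <= e / 2.
    by have /cvgrPdist_le/(_ (e / 2)) := lin; apply; rewrite divr_gt0.
  have near3 : \forall h \near 0^', \sum_i `|q i h| <= B.
    have := cvgr_le _ M; apply; rewrite /B ltrDl ltr01//.
  near=> h.
  have h1 : forall i, `|c (h *: 1 + t) ord0 i - c t ord0 i| < d by near: h.
  have h2 : `|\sum_i partial i f (c t) * c' i - \sum_i partial i f (c t) * q i h| <= e / 2 by near: h.
  have h3 : \sum_i `|q i h| <= B by near: h.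
  have hn0 : h != 0 by near: h; exact: nbhs_dnbhs_neq.
  rewrite -(subrK (\sum_i partial i f (c t) * q i h) (\sum_i partial i f (c t) * c' i)) -addrA.
  rewrite (le_trans (ler_normD _ _))// [leRHS](splitr e) lerD//.
  have -> : \sum_i partial i f (c t) * q i h =
      h^-1 * \sum_i partial i f (c t) * (c (h *: 1 + t) ord0 i - c t ord0 i).
    by rewrite mulr_sumr; apply: eq_bigr => i _; rewrite /q mulrCA.
  rewrite -mulrBr normrM distrC.
  apply: (@le_trans _ _ (`|h^-1| * (e / 2 / B * \sum_i `|c (h *: 1 + t) ord0 i - c t ord0 i|))).
    by rewrite ler_wpM2l// H.
  rewrite mulrCA mulr_sumr (eq_bigr (fun i => `|q i h|)); last by move=> i _; rewrite -normrM.
  by apply: le_trans (ler_wpM2l (ltW e20) h3) _; rewrite divfK ?gt_eqF.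
by apply: DeriveDef; [apply/cvg_ex; exists (\sum_i partial i f (c t) * c' i)|exact/cvg_lim].
Unshelve. all: by end_near. Qed.

End chain_rule.

(** * The even Poincare inequality on the sphere *)

Section sphere_lift.
Context {R : realType} (n : nat) (f : 'rV[R]_n -> R) (K : R) (f_C1 : C1_rV f).
Hypothesis f_bnd : forall x, `|f x| <= K.
Hypothesis df_bnd : forall i x, `|partial i f x| <= K.
Context (r : R) (r_gt0 : 0 < r) (F : R) (F_bnd : `|F| <= K).
Implicit Types (x y : 'rV[R]_n) (i j : 'I_n).

Definition radial_deriv y := \sum_j unit_rV y ord0 j * partial j f (r *: unit_rV y).

Definition tangential i y := partial i f (r *: unit_rV y) - unit_rV y ord0 i * radial_deriv y.

Let g y := f (r *: unit_rV y) - F.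
(** Homogeneity of degree two is what makes the constant sharp: trace-free quadratic forms are
    extremal for the even Gaussian inequality, and they are the lifts of the spherical harmonics of
    degree two. *)
Definition sphere_lift y := enorm y ^+ 2 * g y.
Definition sphere_lift_partial i y := 2 * y ord0 i * g y + enorm y * r * tangential i y.

Let K_ge0 : 0 <= K. Proof. exact: le_trans (f_bnd 0). Qed.

Lemma enorm_line x i (s : R) :
  enorm (x + s *: delta_mx ord0 i) ^+ 2 = enorm x ^+ 2 + 2 * s * x ord0 i + s ^+ 2.
Proof.
rewrite !enorm_sqr (eq_bigr (fun j => x ord0 j ^+ 2 +
   (if j == i then 2 * s * x ord0 i + s ^+ 2 else 0))); last first.
  move=> j _; rewrite !mxE eqxx/=; have [->|_] := eqVneq j i; last by rewrite mulr0 !addr0.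
  by rewrite mulr1; ring.
by rewrite big_split/= -big_mkcond big_pred1_eq addrA.
Qed.

Lemma is_derive_enorm_line x i (s : R) : x + s *: delta_mx ord0 i != 0 ->
  is_derive s 1 (fun t : R => enorm (x + t *: delta_mx ord0 i))
    ((x + s *: delta_mx ord0 i) ord0 i / enorm (x + s *: delta_mx ord0 i)).
Proof.
set z := x + s *: _ => z0.
have N0 : 0 < enorm z by rewrite lt_neqAle eq_sym enorm_eq0 z0 enorm_ge0.
have -> : (fun t : R => enorm (x + t *: delta_mx ord0 i)) =
    Num.sqrt \o (fun t : R => enorm x ^+ 2 + 2 * t * x ord0 i + t ^+ 2).
  by apply/funext => t /=; rewrite -enorm_line sqrtr_sqr ger0_norm// enorm_ge0.
have Q0 : 0 < enorm x ^+ 2 + 2 * s * x ord0 i + s ^+ 2 by rewrite -enorm_line exprn_gt0.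
have d1 : is_derive s 1 (fun t : R => enorm x ^+ 2 + 2 * t * x ord0 i + t ^+ 2) (2 * x ord0 i + 2 * s).
  by apply: is_derive_eq; rewrite /GRing.scale/=; ring.
have d2 := is_derive1_sqrt Q0.
apply: (@is_derive_eq _ _ _ _ _ _ _ _ (is_derive1_comp _ _)).
rewrite -enorm_line sqrtr_sqr ger0_norm ?enorm_ge0// -/z.
rewrite /z !mxE !eqxx/= mulr1 -/z; field; exact: lt0r_neq0.
Qed.

Lemma is_derive_unit_line x i j (s : R) : x + s *: delta_mx ord0 i != 0 ->
  let z := x + s *: delta_mx ord0 i in
  is_derive s 1 (fun t : R => unit_rV (x + t *: delta_mx ord0 i) ord0 j)
    ((enorm z)^-1 * ((j == i)%:R - unit_rV z ord0 j * unit_rV z ord0 i)).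
Proof.
move=> z0 z; have N0 : enorm z != 0 by rewrite enorm_eq0.
have dN := is_derive_enorm_line z0.
have -> : (fun t : R => unit_rV (x + t *: delta_mx ord0 i) ord0 j) =
    (fun t => (enorm (x + t *: delta_mx ord0 i))^-1 * (x ord0 j + t * (j == i)%:R)).
  by apply/funext => t; rewrite !mxE eqxx.
have dV := @is_deriveV R (fun t : R => enorm (x + t *: delta_mx ord0 i)) s _ 1 N0 dN.
apply: is_derive_eq; rewrite /GRing.scale/= -/z /unit_rV.
have -> : x ord0 j + s * (j == i)%:R = z ord0 j by rewrite /z !mxE eqxx.
rewrite [((enorm z)^-1 *: z) ord0 j]mxE [((enorm z)^-1 *: z) ord0 i]mxE.
by field.
Qed.

Lemma is_derive_sphere_line x i (s : R) : x + s *: delta_mx ord0 i != 0 ->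
  let z := x + s *: delta_mx ord0 i in
  is_derive s 1 (fun t : R => f (r *: unit_rV (x + t *: delta_mx ord0 i)))
    (r / enorm z * tangential i z).
Proof.
move=> z0 z; have N0 : enorm z != 0 by rewrite enorm_eq0.
have dc j : is_derive s 1 (fun t : R => (r *: unit_rV (x + t *: delta_mx ord0 i)) ord0 j)
   (r * ((enorm z)^-1 * ((j == i)%:R - unit_rV z ord0 j * unit_rV z ord0 i))).
  have -> : (fun t : R => (r *: unit_rV (x + t *: delta_mx ord0 i)) ord0 j) =
    (fun t : R => r * unit_rV (x + t *: delta_mx ord0 i) ord0 j).
    by apply/funext => t; rewrite mxE.
  have du := is_derive_unit_line j z0.
  by apply: is_derive_eq; rewrite /GRing.scale/= ?mulr0 ?addr0.
have := C1_chain (c := fun t : R => r *: unit_rV (x + t *: delta_mx ord0 i)) f_C1 dc.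
move/is_derive_eq; apply; rewrite -/z /tangential /radial_deriv mulrBr mulr_sumr mulr_sumr.
rewrite (eq_bigr (fun j => (if j == i then r / enorm z * partial i f (r *: unit_rV z) else 0) -
  r / enorm z * (unit_rV z ord0 i * (unit_rV z ord0 j * partial j f (r *: unit_rV z))))); last first.
  by move=> j _; have [->|_] := eqVneq j i; rewrite /= ?mulr1n ?mulr0n; ring.
by rewrite sumrB -big_mkcond big_pred1_eq.
Qed.

Lemma enorm_coord y i : `|y ord0 i| <= enorm y.
Proof.
rewrite -(@ler_pXn2r _ 2) ?nnegrE ?enorm_ge0// enorm_sqr real_normK ?num_real//.
by rewrite (bigD1 i)//= lerDl sumr_ge0// => j _; exact: sqr_ge0.
Qed.

Lemma unit_coord y i : `|unit_rV y ord0 i| <= 1.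
Proof.
have [->|y0] := eqVneq y 0; first by rewrite /unit_rV scaler0 mxE normr0.
by rewrite (le_trans (enorm_coord _ _))// enorm_unit.
Qed.

Lemma tangential_bnd i y : `|tangential i y| <= K * n.+1%:R.
Proof.
rewrite (le_trans (ler_normB _ _))// -nat1r mulrDr mulr1 lerD//.
rewrite normrM (le_trans (ler_piMl _ (unit_coord _ _)))//.
rewrite (le_trans (ler_norm_sum _ _ _))//.
apply: (@le_trans _ _ (\sum_(j < n) K)); last by rewrite sumr_const card_ord mulr_natr.
apply: ler_sum => j _; rewrite normrM (le_trans _ (df_bnd j (r *: unit_rV y)))//.
by rewrite ler_piMl// unit_coord.
Qed.

Lemma g_bnd y : `|g y| <= 2 * K.
Proof. by rewrite (le_trans (ler_normB _ _))// mulr_natl mulr2n lerD. Qed.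

Let C := 4 * K + r * (K * n.+1%:R).

Let C_ge0 : 0 <= C.
Proof. by rewrite addr_ge0 ?mulr_ge0// ltW. Qed.

Lemma sphere_lift_partial_bnd i y : `|sphere_lift_partial i y| <= C * enorm y.
Proof.
apply: le_trans (ler_normD _ _) _; rewrite [leRHS]mulrDl; apply: lerD.
  rewrite !normrM (ger0_norm (_ : 0 <= 2))//.
  have := ler_pM (normr_ge0 _) (normr_ge0 _) (enorm_coord y i) (g_bnd y); lra.
rewrite !normrM (ger0_norm (enorm_ge0 y)) (gtr0_norm r_gt0).
rewrite -mulrA [leRHS]mulrC ler_wpM2l ?enorm_ge0// ler_wpM2l//; first exact: ltW.
exact: tangential_bnd.
Qed.

(** Away from the origin these are the product and chain rules. At the origin the unit vector is
    discontinuous, but the lift is at most [2 K |y|^2], so its value and its derivative are both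
    zero there. *)
Lemma is_derive_sphere_lift x i (s : R) :
  is_derive s 1 (fun t : R => sphere_lift (x + t *: delta_mx ord0 i))
    (sphere_lift_partial i (x + s *: delta_mx ord0 i)).
Proof.
have [z0|z0] := eqVneq (x + s *: delta_mx ord0 i) 0; last first.
  have N0 : enorm (x + s *: delta_mx ord0 i) != 0 by rewrite enorm_eq0.
  have d1 := is_derive_sphere_line z0; have d2 := is_derive_enorm_line z0.
  rewrite /sphere_lift /g /sphere_lift_partial.
  by apply: is_derive_eq; rewrite /GRing.scale/= /g /GRing.scale/=; field; exact: N0.
have small h : `|sphere_lift (x + (h + s) *: delta_mx ord0 i)| <= 2 * K * h ^+ 2.
  have -> : x + (h + s) *: delta_mx ord0 i = 0 + h *: delta_mx ord0 i.
    by rewrite scalerDl addrCA z0 addr0 add0r.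
  rewrite /sphere_lift normrM ger0_norm ?sqr_ge0// enorm_line mxE mulr0 addr0.
  have -> : enorm (0 : 'rV[R]_n) = 0 by apply/eqP; rewrite enorm_eq0.
  by rewrite expr0n add0r mulrC ler_wpM2r ?sqr_ge0// g_bnd.
have v0 : sphere_lift (x + s *: delta_mx ord0 i) = 0.
  by apply/eqP; rewrite -normr_le0; have := small 0; rewrite add0r expr0n mulr0.
have -> : sphere_lift_partial i (x + s *: delta_mx ord0 i) = 0.
  apply/eqP; rewrite -normr_le0 (le_trans (sphere_lift_partial_bnd _ _))// z0.
  have -> : enorm (0 : 'rV[R]_n) = 0 by apply/eqP; rewrite enorm_eq0.
  by rewrite mulr0.
have lim : h^-1 *: (sphere_lift (x + (h *: 1 + s) *: delta_mx ord0 i) -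
    sphere_lift (x + s *: delta_mx ord0 i)) @[h --> 0^'] --> (0 : R).
  apply/cvgr0Pnorm_le => e e0.
  have d0 : 0 < e / (2 * K + 1) by rewrite divr_gt0// ltr_wpDl// mulr_ge0.
  near=> h; have hn0 : h != 0 by near: h; exact: nbhs_dnbhs_neq.
  have he : `|h| <= e / (2 * K + 1) by near: h; apply: dnbhs0_le.
  rewrite v0 subr0 [h *: 1]mulr1 normrM normrV ?unitfE//.
  rewrite ler_pdivrMl ?normr_gt0// (le_trans (small h))//.
  rewrite -[h ^+ 2]real_normK ?num_real// expr2 mulrCA ler_wpM2l//.
  rewrite (le_trans (ler_wpM2l _ he)) ?mulr_ge0// mulrCA ler_piMr ?ltW//.
  by rewrite ltr_pdivrMr ?mul1r ?ltrDl// ltr_wpDl// mulr_ge0.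
by apply: DeriveDef; [apply/cvg_ex; exists (0 : R)|exact/cvg_lim].
Unshelve. all: by end_near. Qed.

End sphere_lift.

Lemma continuous_rV_comp {R : realType} (n : nat) (h : 'rV[R]_n -> R) (c : R -> 'rV[R]_n) (t : R) :
  {for c t, continuous h} ->
  (forall j, c s ord0 j @[s --> t] --> c t ord0 j) -> h (c s) @[s --> t] --> h (c t).
Proof.
move=> ch cc; apply/cvgrPdist_lt => e e0.
have /cvgrPdist_lt/(_ _ e0)/nbhs_ballP[d /= d0 H] := ch.
have : \forall s \near t, forall j, `|c t ord0 j - c s ord0 j| < d.
  by apply: (@filter_forall _ _ (fun j s => `|c t ord0 j - c s ord0 j| < d) (nbhs t)) => j;
    have /cvgrPdist_lt/(_ _ d0) := cc j.
apply: filterS => s sd; apply: H; split=> // i0 j; rewrite (ord1 i0) /ball/=; exact: sd.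
Qed.

Section sphere_poincare.
Context {R : realType} (n : nat) (n_gt0 : (0 < n)%N) (f : 'rV[R]_n -> R) (K : R).
Hypothesis f_C1 : C1_rV f.
Hypothesis f_cont : continuous f.
Hypothesis f_bnd : forall x, `|f x| <= K.
Hypothesis df_bnd : forall i x, `|partial i f x| <= K.
Hypothesis f_even : forall x, f (- x) = f x.
Context (r : R) (r_gt0 : 0 < r).
Implicit Types (x y : 'rV[R]_n) (i j : 'I_n).
Notation gauss := (prob_rV (@normal01 R) n).

Let K_ge0 : 0 <= K. Proof. exact: le_trans (f_bnd 0). Qed.

(** When the line meets the origin, the bound of the partial derivatives by a multiple of [|y|]
    replaces the missing continuity of the unit vector. *)
Lemma continuous_sphere_lift_partial F x i : `|F| <= K ->
  continuous (fun s : R => sphere_lift_partial f r F i (x + s *: delta_mx ord0 i)).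
Proof.
move=> FK s; set z := x + s *: delta_mx ord0 i.
have derC (h : R -> R) (l : R) : is_derive s 1 h l -> h t @[t --> s] --> h s.
  by move=> [d1 _]; exact/differentiable_continuous/derivable1_diffP.
have cN : enorm (x + t *: delta_mx ord0 i) @[t --> s] --> enorm z.
  have -> : (fun t : R => enorm (x + t *: delta_mx ord0 i)) =
      (fun t : R => Num.sqrt (enorm x ^+ 2 + 2 * t * x ord0 i + t ^+ 2)).
    by apply/funext => t /=; rewrite -enorm_line sqrtr_sqr ger0_norm// enorm_ge0.
  have -> : enorm z = Num.sqrt (enorm x ^+ 2 + 2 * s * x ord0 i + s ^+ 2).
    by rewrite -enorm_line sqrtr_sqr ger0_norm// enorm_ge0.
  apply: (@cvg_comp _ _ _ (fun t : R => enorm x ^+ 2 + 2 * t * x ord0 i + t ^+ 2) Num.sqrt);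
    last exact: sqrt_continuous.
  have d1 : is_derive s 1 (fun t : R => enorm x ^+ 2 + 2 * t * x ord0 i + t ^+ 2) (2 * x ord0 i + 2 * s).
    by apply: is_derive_eq; rewrite /GRing.scale/=; ring.
  exact: derC d1.
have [z0|z0] := eqVneq z 0.
  have v0 : sphere_lift_partial f r F i z = 0.
    apply/eqP; rewrite -normr_le0 (le_trans (sphere_lift_partial_bnd f_bnd df_bnd r_gt0 FK _ _))// z0.
    have -> : enorm (0 : 'rV[R]_n) = 0 by apply/eqP; rewrite enorm_eq0.
    by rewrite mulr0.
  have N0 : enorm z = 0 by apply/eqP; rewrite enorm_eq0 z0.
  rewrite /continuous_at -/z v0; apply/cvgr0Pnorm_le => e e0.
  pose C := 4 * K + r * (K * n.+1%:R) + 1.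
  have C0 : 0 < C by rewrite ltr_wpDl// addr_ge0 ?mulr_ge0// ltW.
  have : \forall t \near s, `|enorm (x + t *: delta_mx ord0 i)| <= e / C.
    by move: cN; rewrite N0 => /cvgr0Pnorm_le; apply; rewrite divr_gt0.
  apply: filterS => t; rewrite ger0_norm ?enorm_ge0// ler_pdivlMr// => le.
  rewrite (le_trans (sphere_lift_partial_bnd f_bnd df_bnd r_gt0 FK _ _))//.
  rewrite (le_trans _ le)// mulrC ler_wpM2l ?enorm_ge0// /C lerDl ler01//.
have cu j : unit_rV (x + t *: delta_mx ord0 i) ord0 j @[t --> s] --> unit_rV z ord0 j.
  exact: derC (is_derive_unit_line j z0).
have cp j : partial j f (r *: unit_rV (x + t *: delta_mx ord0 i)) @[t --> s] -->
    partial j f (r *: unit_rV z).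
  apply: (@continuous_rV_comp R n (partial j f) (fun t => r *: unit_rV (x + t *: delta_mx ord0 i))).
    exact: (C1_continuous f_C1).
  move=> k; rewrite mxE; under eq_fun do rewrite mxE; apply: cvgMr; exact: cu.
have cf : f (r *: unit_rV (x + t *: delta_mx ord0 i)) @[t --> s] --> f (r *: unit_rV z).
  exact: derC (is_derive_sphere_line f_C1 r z0).
have cx : (x + t *: delta_mx ord0 i) ord0 i @[t --> s] --> z ord0 i.
  rewrite /z !mxE; under eq_fun do rewrite !mxE; apply: cvgD; first exact: cvg_cst.
  by apply: cvgMl; exact: cvg_id.
rewrite /continuous_at /sphere_lift_partial /tangential /radial_deriv -/z.
apply: cvgD.
  by apply: cvgM; [apply: cvgMr|apply: cvgB => //; exact: cvg_cst].
apply: cvgM; first exact: cvgMl.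
apply: cvgB; first exact: cp.
by apply: cvgM; [exact: cu|apply: cvg_sumr => j; apply: cvgM; [exact: cu|exact: cp]].
Qed.

Lemma measurable_sphere (h : 'rV[R]_n -> R) : continuous h ->
  measurable_fun setT (fun y => h (r *: unit_rV y)).
Proof.
move=> ch; apply: (measurableT_comp (continuous_measurable_rV ch)).
exact: measurableT_comp (@measurable_scaler_rV R n r) (@measurable_unit_rV R n).
Qed.

Lemma measurable_unit_coord i : measurable_fun setT (fun y => unit_rV y ord0 i).
Proof. exact: measurableT_comp (@measurable_coord _ R n i) (@measurable_unit_rV R n). Qed.

Lemma measurable_radial_deriv : measurable_fun setT (radial_deriv f r).
Proof.
apply: measurable_sum => i; apply: measurable_funM; first exact: measurable_unit_coord.
by apply: measurable_sphere; exact: (C1_continuous f_C1).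
Qed.

Lemma measurable_tangential i : measurable_fun setT (tangential f r i).
Proof.
apply: measurable_funB; first by apply: measurable_sphere; exact: (C1_continuous f_C1).
by apply: measurable_funM; [exact: measurable_unit_coord|exact: measurable_radial_deriv].
Qed.

Lemma cg_sphere_lift F : `|F| <= K ->
  C1_growth (sphere_lift f r F) (sphere_lift_partial f r F) (4 * K + r * (K * n.+1%:R)).
Proof.
move=> FK.
have mg : measurable_fun setT (fun y => f (r *: unit_rV y) - F).
  by apply: measurable_funB => //; exact: measurable_sphere.
have mN := @measurable_enorm R n.
have rK : 0 <= r * (K * n.+1%:R) by rewrite !mulr_ge0// ltW.
split.
- by apply: measurable_funM => //; exact: measurable_funX.
- move=> i; apply: measurable_funD.
    by apply: measurable_funM => //; apply: measurable_funM => //; exact: measurable_coord.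
  apply: measurable_funM; [exact: measurable_funM|exact: measurable_tangential].
- by move=> x i t; exact: (is_derive_sphere_lift f_C1 f_bnd df_bnd r_gt0 FK).
- by move=> x i; exact: continuous_sphere_lift_partial.
- move=> x; rewrite normrM ger0_norm ?sqr_ge0// mulrC ler_pM ?normr_ge0 ?sqr_ge0//.
    by rewrite (le_trans (g_bnd f_bnd r FK x))//; move: rK K_ge0; lra.
  by rewrite lerDr.
- move=> i x; rewrite (le_trans (sphere_lift_partial_bnd f_bnd df_bnd r_gt0 FK _ _))//.
  rewrite ler_wpM2l ?addr_ge0 ?mulr_ge0//; first exact: ltW.
  by have := sqr_ge0 (enorm x - 1); have := enorm_ge0 x; nra.
Qed.

Lemma sum_unit_sqr y : y != 0 -> \sum_i unit_rV y ord0 i ^+ 2 = 1.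
Proof. by move=> y0; rewrite -enorm_sqr enorm_unit// expr1n. Qed.

(** Pythagoras: the gradient has the radial component [2 |y| g] and the tangential component [|y| r]
    times [tangential], which is orthogonal to the unit vector. *)
Lemma sum_sphere_lift_partial_sqr F y : \sum_i sphere_lift_partial f r F i y ^+ 2 =
  4 * (enorm y ^+ 2 * (f (r *: unit_rV y) - F) ^+ 2) +
  r ^+ 2 * (enorm y ^+ 2 * \sum_i tangential f r i y ^+ 2).
Proof.
have [->|y0] := eqVneq y 0.
  have -> : enorm (0 : 'rV[R]_n) = 0 by apply/eqP; rewrite enorm_eq0.
  rewrite big1 ?expr0n/= ?mul0r ?mulr0 ?addr0// => i _; rewrite /sphere_lift_partial.
  have -> : enorm (0 : 'rV[R]_n) = 0 by apply/eqP; rewrite enorm_eq0.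
  by rewrite mxE mulr0 !mul0r addr0 expr0n.
have N0 : enorm y != 0 by rewrite enorm_eq0.
have yE i : y ord0 i = enorm y * unit_rV y ord0 i by rewrite mxE mulrA divff ?mul1r.
have orth : \sum_i unit_rV y ord0 i * tangential f r i y = 0.
  rewrite (eq_bigr (fun i => unit_rV y ord0 i * partial i f (r *: unit_rV y) -
     radial_deriv f r y * unit_rV y ord0 i ^+ 2)).
    by rewrite sumrB -mulr_sumr sum_unit_sqr// mulr1 subrr.
  by move=> i _; rewrite /tangential; ring.
set g := f _ - F.
rewrite (eq_bigr (fun i => 4 * (enorm y ^+ 2 * g ^+ 2) * unit_rV y ord0 i ^+ 2 +
   4 * enorm y ^+ 2 * r * g * (unit_rV y ord0 i * tangential f r i y) +
   r ^+ 2 * enorm y ^+ 2 * tangential f r i y ^+ 2)).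
  rewrite !big_split/= -!mulr_sumr orth sum_unit_sqr//; ring.
by move=> i _; rewrite /sphere_lift_partial yE -/g; ring.
Qed.

Lemma sum_tangential_sqr y : y != 0 -> \sum_i tangential f r i y ^+ 2 =
  \sum_i partial i f (r *: unit_rV y) ^+ 2 - radial_deriv f r y ^+ 2.
Proof.
move=> y0; set D := radial_deriv f r y.
rewrite (eq_bigr (fun i => partial i f (r *: unit_rV y) ^+ 2 -
   2 * D * (unit_rV y ord0 i * partial i f (r *: unit_rV y)) + D ^+ 2 * unit_rV y ord0 i ^+ 2)).
  rewrite !big_split/= sumrN -!mulr_sumr sum_unit_sqr// -/(radial_deriv f r y) -/D; ring.
by move=> i _; rewrite /tangential -/D; ring.
Qed.

End sphere_poincare.

Section bounded_prob.
Context {R : realType}.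

Lemma integrable_bounded d (T : measurableType d) (P : probability T R) (h : T -> R) (M : R) :
  measurable_fun setT h -> (forall x, `|h x| <= M) -> P.-integrable setT (EFin \o h).
Proof.
move=> mh hM; apply: (@le_integrable _ _ _ P setT measurableT _ (EFin \o fun=> M)).
- exact/measurable_EFinP.
- by move=> x _; rewrite /= lee_fin (le_trans (hM x))// ler_norm.
- exact: finite_measure_integrable_cst.
Qed.

Lemma Rintegral_bounded d (T : measurableType d) (P : probability T R) (h : T -> R) (M : R) :
  measurable_fun setT h -> (forall x, `|h x| <= M) -> `|\int[P]_x h x| <= M.
Proof.
move=> mh hM; have ih := integrable_bounded P mh hM.
rewrite (le_trans (le_normr_Rintegral measurableT ih))//.
have -> : M = \int[P]_x M.
  by rewrite Rintegral_cst// [X in fine X]probability_setT mulr1.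
apply: le_Rintegral => //; first exact: integrable_norm ih.
exact: finite_measure_integrable_cst.
Qed.

End bounded_prob.

Section sphere_poincare_inequality.
Context {R : realType} (n : nat) (n_gt0 : (0 < n)%N) (f : 'rV[R]_n -> R) (K : R).
Hypothesis f_C1 : C1_rV f.
Hypothesis f_cont : continuous f.
Hypothesis f_bnd : forall x, `|f x| <= K.
Hypothesis df_bnd : forall i x, `|partial i f x| <= K.
Hypothesis f_even : forall x, f (- x) = f x.
Context (r : R) (r_gt0 : 0 < r).
Implicit Types (x y : 'rV[R]_n) (i j : 'I_n).
Notation gauss := (prob_rV (@normal01 R) n).

Let F := (\int[gauss]_y f (r *: unit_rV y))%R.

Lemma sphere_mean_bnd : `|F| <= K.
Proof. by apply: Rintegral_bounded => //; exact: measurable_sphere. Qed.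

Let FK := sphere_mean_bnd.

Let g y := f (r *: unit_rV y) - F.

Let mg : measurable_fun setT g.
Proof. by apply: measurable_funB => //; exact: measurable_sphere. Qed.

Let gK y : `|g y| <= 2 * K. Proof. exact: g_bnd. Qed.

Let unit_unit y : y != 0 -> unit_rV (unit_rV y) = unit_rV y.
Proof. by move=> y0; rewrite {1}/unit_rV enorm_unit// invr1 scale1r. Qed.

Lemma integral_sphere_mean0 : (\int[gauss]_y (g y)%:E = 0)%E.
Proof.
have ih : gauss.-integrable setT (EFin \o (fun y => f (r *: unit_rV y))).
  by apply: (integrable_bounded gauss (M := K)) => //; exact: measurable_sphere.
rewrite (_ : (fun y => _) = (fun y => (f (r *: unit_rV y))%:E - F%:E)%E); last first.
  by apply/funext => y; rewrite EFinB.
rewrite integralB//; last exact: finite_measure_integrable_cst.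
have fi := integrable_fin_num measurableT ih.
by rewrite integral_prob_cst /F /Rintegral fineK// subee.
Qed.

Lemma integral_enorm_sphere (psi : R -> R) (h : 'rV[R]_n -> R) :
  measurable_fun setT psi -> measurable_fun setT h ->
  (forall t, 0 <= psi t) -> (forall y, 0 <= h y) ->
  (forall y, y != 0 -> h (unit_rV y) = h y) ->
  (\int[gauss]_y (psi (enorm y) * h y)%:E =
   (\int[gauss]_y (psi (enorm y))%:E) * \int[gauss]_y (h y)%:E)%E.
Proof.
move=> mpsi mh psi0 h0 hu.
have mhu : measurable_fun setT (fun y => h (unit_rV y)).
  exact: measurableT_comp mh (@measurable_unit_rV R n).
have mpn : measurable_fun setT (fun y : 'rV[R]_n => psi (enorm y)).
  exact: measurableT_comp mpsi (@measurable_enorm R n).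
rewrite (integral_gauss_off0 n_gt0 (g := fun y => ((psi (enorm y))%:E * (h (unit_rV y))%:E)%E)); first last.
- by move=> y y0; rewrite hu// EFinM.
- by move=> y; rewrite mule_ge0// lee_fin.
- by move=> y; rewrite lee_fin mulr_ge0.
- by apply: emeasurable_funM; exact/measurable_EFinP.
- by apply/measurable_EFinP; exact: measurable_funM.
rewrite (gauss_independence n_gt0 (psi := EFin \o psi) (G := EFin \o h)); first last.
- by move=> y; rewrite lee_fin.
- by move=> t; rewrite lee_fin.
- exact/measurable_EFinP.
- exact/measurable_EFinP.
congr (_ * _)%E; apply: (integral_gauss_off0 n_gt0).
- exact/measurable_EFinP.
- exact/measurable_EFinP.
- by move=> y; rewrite lee_fin.
- by move=> y; rewrite lee_fin.
- by move=> y y0; rewrite /= hu.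
Qed.

Let msq : measurable_fun setT (fun t : R => t ^+ 2).
Proof. exact: measurable_funX. Qed.

Let g_unit y : y != 0 -> g (unit_rV y) = g y.
Proof. by move=> y0; rewrite /g unit_unit. Qed.

Lemma integral_sphere_lift0 : (\int[gauss]_y (sphere_lift f r F y)%:E = 0)%E.
Proof.
(* Independence is stated for nonnegative functions: it is applied to [g + M] and to the constant
   [M], and the results are subtracted. *)
pose M := 2 * K.
have M0 : 0 <= M by exact: le_trans (gK 0).
have h0 y : 0 <= g y + M by have := gK y; rewrite ler_norml /M; lra.
have mh : measurable_fun setT (fun y => g y + M) by exact: measurable_funD.
have part (h : 'rV[R]_n -> R) : measurable_fun setT h -> (forall y, 0 <= h y) ->
   (forall y, y != 0 -> h (unit_rV y) = h y) -> (\int[gauss]_y (h y)%:E = M%:E)%E ->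
   (\int[gauss]_y (enorm y ^+ 2 * h y)%:E = (n%:R * M)%:E)%E.
  move=> mh' h0' hu hM; rewrite (integral_enorm_sphere msq mh') ?gauss_enorm_sqr ?hM//.
  by move=> t; exact: sqr_ge0.
have ig : gauss.-integrable setT (EFin \o g) by exact: (integrable_bounded gauss mg gK).
have Ih : (\int[gauss]_y (g y + M)%:E = M%:E)%E.
  under eq_integral do rewrite EFinD.
  rewrite integralD//; last exact: finite_measure_integrable_cst.
  by rewrite integral_sphere_mean0 integral_prob_cst add0e.
have gu := g_unit.
have hu y : y != 0 -> g (unit_rV y) + M = g y + M by move=> y0; rewrite gu.
have I1 := part _ mh h0 hu Ih.
have I2 := part (fun=> M) (measurable_cst _) (fun=> M0) (fun _ _ => erefl) (integral_prob_cst gauss M%:E).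
have mN2 : measurable_fun setT (fun y : 'rV[R]_n => enorm y ^+ 2).
  by apply: measurable_funX; exact: measurable_enorm.
have i1 : gauss.-integrable setT (EFin \o (fun y => enorm y ^+ 2 * (g y + M))).
  apply: integrable_ge0; first exact: measurable_funM.
    by move=> y; rewrite mulr_ge0// sqr_ge0.
  by rewrite I1 ltry.
have i2 : gauss.-integrable setT (EFin \o (fun y : 'rV[R]_n => enorm y ^+ 2 * M)).
  apply: integrable_ge0; first exact: measurable_funM.
    by move=> y; rewrite mulr_ge0// sqr_ge0.
  by rewrite I2 ltry.
transitivity (\int[gauss]_y ((enorm y ^+ 2 * (g y + M))%:E - (enorm y ^+ 2 * M)%:E))%E.
  by apply: eq_integral => y _; rewrite -EFinB; congr EFin; rewrite /sphere_lift -/(g y); ring.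
by rewrite integralB// I1 I2 subee.
Qed.

(** The even Gaussian inequality for the lift, with independence and the moments [n] and [n (n + 2)]
    of [|y|^2] and [|y|^4]. If [A] and [B] are the integrals of [g^2] and of the squared tangential
    gradient, it reads [n (n + 2) A <= (4 n A + r^2 n B) / 2], that is [n A <= r^2 B / 2]. *)
Lemma sphere_even_poincare :
  (n%:R%:E * \int[gauss]_y ((f (r *: unit_rV y) - F) ^+ 2)%:E <=
   (r ^+ 2 / 2)%:E * \int[gauss]_y (\sum_i tangential f r i y ^+ 2)%:E)%E.
Proof.
pose tau y := \sum_i tangential f r i y ^+ 2.
have mtau : measurable_fun setT tau.
  by apply: measurable_sum => i; apply: measurable_funX; exact: measurable_tangential.
have tau0 y : 0 <= tau y by apply: sumr_ge0 => i _; exact: sqr_ge0.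
have tau_unit y : y != 0 -> tau (unit_rV y) = tau y.
  by move=> y0; apply: eq_bigr => i _; rewrite /tangential /radial_deriv unit_unit.
pose M := n%:R * (K * n.+1%:R) ^+ 2.
have tauM y : `|tau y| <= M.
  rewrite ger0_norm//; apply: (@le_trans _ _ (\sum_(i < n) (K * n.+1%:R) ^+ 2)).
    apply: ler_sum => i _; rewrite -[tangential f r i y ^+ 2]real_normK ?num_real//.
    have b := tangential_bnd df_bnd r i y.
    by rewrite lerXn2r ?nnegrE// (le_trans _ b).
  by rewrite sumr_const card_ord -(mulr_natl ((K * n.+1%:R) ^+ 2)).
have FK' := FK.
have cg := cg_sphere_lift f_C1 f_cont f_bnd df_bnd r_gt0 FK'.
have Phi_even y : sphere_lift f r F (- y) = sphere_lift f r F y.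
  rewrite /sphere_lift -scaleN1r enormZ normrN normr1 mul1r; congr (_ * (_ - _)).
  rewrite /unit_rV enormZ normrN normr1 mul1r -[RHS]f_even; congr f.
  by rewrite scaleN1r !scalerN.
have [c] := gauss_even_poincare cg Phi_even.
have mPhi := cg_mf cg.
have g20 y : 0 <= g y ^+ 2 by exact: sqr_ge0.
have mg2 : measurable_fun setT (fun y => g y ^+ 2) by exact: measurable_funX.
have gu := g_unit.
have g2u y : y != 0 -> g (unit_rV y) ^+ 2 = g y ^+ 2 by move=> y0; rewrite gu.
have Phi2 : (\int[gauss]_y (sphere_lift f r F y ^+ 2)%:E =
    (n%:R * (n%:R + 2))%:E * \int[gauss]_y (g y ^+ 2)%:E)%E.
  rewrite -gauss_enorm_pow4 -(integral_enorm_sphere (psi := fun t => t ^+ 4))//.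
  - by apply: eq_integral => y _; rewrite /sphere_lift -/(g y) exprMn -exprM.
  - by move=> t; rewrite exprn_even_ge0.
have ig2 : gauss.-integrable setT (EFin \o (fun y => g y ^+ 2)).
  apply: (integrable_bounded gauss (M := (2 * K) ^+ 2)) => // y.
  by rewrite normrX lerXn2r ?nnegrE// (le_trans _ (gK y)).
have itau : gauss.-integrable setT (EFin \o tau) by exact: (integrable_bounded gauss mtau tauM).
have fA := integrable_fin_num measurableT ig2.
have fB := integrable_fin_num measurableT itau.
have Phi_fin : (\int[gauss]_y (sphere_lift f r F y ^+ 2)%:E < +oo)%E.
  rewrite Phi2; move: fA => /fineK/= <-; rewrite -EFinM; exact: ltry.
(* The centre [c] is unknown, but the lift has mean zero, so centring it at [c] only increases the
   integral. *)
rewrite (integral_sqr_sub c mPhi Phi_fin).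
rewrite {1}/Rintegral integral_sphere_lift0/= => H.
have {H} : (\int[gauss]_y (sphere_lift f r F y ^+ 2)%:E <=
    2^-1%:E * \sum_(i < n) \int[gauss]_v (sphere_lift_partial f r F i v ^+ 2)%:E)%E.
  apply: le_trans H; rewrite /Rintegral integral_sphere_lift0/=.
  under [in leRHS]eq_integral do rewrite subr0.
  by rewrite leeDl// lee_fin sqr_ge0.
rewrite -ge0_integral_sum//; last 2 first.
- by move=> i; apply: measurable_sqr_EFin; exact: (cg_md cg).
- by move=> i y _; exact: sqr_EFin_ge0.
have -> : (\int[gauss]_y \sum_(i < n) (sphere_lift_partial f r F i y ^+ 2)%:E =
   4%:E * (n%:R%:E * \int[gauss]_y (g y ^+ 2)%:E) +
   (r ^+ 2)%:E * (n%:R%:E * \int[gauss]_y (tau y)%:E))%E.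
  rewrite -(gauss_enorm_sqr n) -!(integral_enorm_sphere (psi := fun t => t ^+ 2))//;
    try (by move=> t; exact: sqr_ge0).
  have mN2 : measurable_fun setT (fun y : 'rV[R]_n => enorm y ^+ 2).
    by apply: measurable_funX; exact: measurable_enorm.
  have mA : measurable_fun setT (fun y : 'rV[R]_n => enorm y ^+ 2 * g y ^+ 2) by exact: measurable_funM.
  have mB : measurable_fun setT (fun y : 'rV[R]_n => enorm y ^+ 2 * tau y) by exact: measurable_funM.
  have A0 y : 0 <= enorm y ^+ 2 * g y ^+ 2 by rewrite mulr_ge0// sqr_ge0.
  have B0 y : 0 <= enorm y ^+ 2 * tau y by rewrite mulr_ge0// sqr_ge0.
  have := ge0_integral_prob_affine gauss mA mB A0 B0 (lexx 0) (ler0n R 4) (sqr_ge0 r).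
  rewrite add0e => <-; apply: eq_integral => y _; rewrite sumEFin; congr EFin.
  by rewrite sum_sphere_lift_partial_sqr// add0r.
rewrite Phi2.
change (\int[gauss]_y ((f (r *: unit_rV y) - F) ^+ 2)%:E)%E with (\int[gauss]_y (g y ^+ 2)%:E)%E.
change (\int[gauss]_y (\sum_i tangential f r i y ^+ 2)%:E)%E with (\int[gauss]_y (tau y)%:E)%E.
move: fA fB => /fineK/= <- /fineK/= <-.
set A := fine _; set B := fine _ => H0.
have H : n%:R * (n%:R + 2) * A <= 2^-1 * (4 * (n%:R * A) + r ^+ 2 * (n%:R * B)).
  by rewrite -lee_fin; exact: H0.
rewrite -!EFinM lee_fin.
have n0 : (0 : R) < n%:R by rewrite ltr0n.
rewrite -(ler_pM2l n0); nra.
Qed.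

End sphere_poincare_inequality.

(** * The radial profile of a convex potential *)

Section radial_profile.
Context {R : realType} (rho : R -> R).
Hypothesis rho_ge0 : forall s, 0 <= s -> 0 <= rho s.
Hypothesis v_convex : convex_ereal (v_of rho).
Hypothesis v_incr : {homo v_of rho : s t / (s <= t)%R >-> (s <= t)%E}.

Let E0 (t : R) : R := rho (expR t).
Let w (t : R) : R := - ln (E0 t).

Lemma rho_exp_ge0 t : 0 <= E0 t. Proof. exact/rho_ge0/expR_ge0. Qed.

Lemma v_of_fin t : 0 < E0 t -> v_of rho t = (w t)%:E.
Proof. by move=> Et; rewrite /v_of lne_EFin. Qed.

Lemma v_of_pinfty t : E0 t <= 0 -> v_of rho t = +oo%E.
Proof. by move=> Et; rewrite /v_of /= -/(E0 t) Et. Qed.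

Lemma v_of_lty t : (v_of rho t < +oo)%E -> 0 < E0 t.
Proof. by move=> vt; rewrite ltNge; apply/negP => Et; move: vt; rewrite v_of_pinfty ?ltxx. Qed.

Lemma rho_exp_ni s t : s <= t -> E0 t <= E0 s.
Proof.
move=> st; have [Et|Et] := leP (E0 t) 0; first exact: le_trans Et (rho_exp_ge0 _).
have vst := v_incr st; rewrite (v_of_fin Et) in vst.
have Es : 0 < E0 s by apply: v_of_lty; apply: le_lt_trans vst (ltry _).
by move: vst; rewrite v_of_fin// lee_fin lerN2 ler_ln.
Qed.

Lemma rho_exp_convex s t p : 0 <= p <= 1 -> 0 < E0 s -> 0 < E0 t ->
  w (p * s + (1 - p) * t) <= p * w s + (1 - p) * w t.
Proof.
move=> p01 Es Et; have := v_convex s t p01; rewrite (v_of_fin Es) (v_of_fin Et) => vle.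
have Ep : 0 < E0 (p * s + (1 - p) * t) by apply: v_of_lty; apply: le_lt_trans vle (ltry _).
by move: vle; rewrite v_of_fin// -!EFinM -EFinD lee_fin.
Qed.

(** As [v] is increasing, its domain is a left half-line; this is its interior, where right
    difference quotients of [v] are eventually finite. *)
Definition in_dom (t : R) : Prop := exists2 s, t < s & 0 < E0 s.

Lemma in_dom_gt0 t : in_dom t -> 0 < E0 t.
Proof. by move=> [s ts Es]; apply: lt_le_trans Es (rho_exp_ni (ltW ts)). Qed.

Lemma in_dom_le s t : s <= t -> in_dom t -> in_dom s.
Proof. by move=> st [r tr Er]; exists r => //; exact: le_lt_trans st tr. Qed.

Lemma w_nd s t : s <= t -> 0 < E0 t -> w s <= w t.
Proof.
by move=> st Et; rewrite lerN2 ler_ln ?rho_exp_ni// posrE (lt_le_trans Et)// rho_exp_ni.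
Qed.

(** Both [t] and [s + e] are convex combinations of [s] and [t + e], with exchanged weights; adding
    the two convexity inequalities gives the claim. For [E] this is the log-concavity [lp_lc]. *)
Lemma w_lc s t e : s <= t -> 0 <= e -> 0 < E0 (t + e) -> w (s + e) + w t <= w s + w (t + e).
Proof.
move=> st e0 Ete.
have Es : 0 < E0 s by apply: lt_le_trans Ete (rho_exp_ni _); rewrite ler_wpDr.
have [L0|L0] := leP (t + e - s) 0.
  have -> : e = 0 by lra.
  have -> : t = s by lra.
  by rewrite addr0.
set L := t + e - s in L0.
have q1 : 0 <= (t - s) / L <= 1.
  apply/andP; split; first by apply: divr_ge0; [rewrite subr_ge0|exact: ltW].
  by rewrite ler_pdivrMr// mul1r /L; lra.
have q2 : 0 <= e / L <= 1.
  apply/andP; split; first by apply: divr_ge0 => //; exact: ltW.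
  by rewrite ler_pdivrMr// mul1r /L; lra.
have := rho_exp_convex q1 Es Ete; have := rho_exp_convex q2 Es Ete.
have Ln0 : L != 0 by exact: lt0r_neq0.
have -> : e / L * s + (1 - e / L) * (t + e) = t.
  by apply: (mulfI Ln0); rewrite mulrDr mulrA (mulrCA L) divff// mulr1 mulrA (mulrBr L) mulr1 mulrCA divff// mulr1 /L; ring.
have -> : (t - s) / L * s + (1 - (t - s) / L) * (t + e) = s + e.
  by apply: (mulfI Ln0); rewrite mulrDr mulrA (mulrCA L) divff// mulr1 mulrA (mulrBr L) mulr1 mulrCA divff// mulr1 /L; ring.
have -> : (t - s) / L = 1 - e / L.
  by apply: (mulfI Ln0); rewrite (mulrBr L) mulr1 !(mulrCA L) divff// !mulr1 /L; ring.
lra.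
Qed.

Let slope t h := (w (t + h) - w t) / h.

Let vslope t h := (fine (v_of rho (t + h)) - fine (v_of rho t)) / h.

(** By convexity the slopes are nondecreasing in [h], and since [v] is increasing they are bounded
    below by [0]; so the right limit exists, as their infimum. *)
Lemma first_deriv_cvg t : in_dom t ->
  slope t h @[h --> 0^'+] --> first_deriv (v_of rho) t.
Proof.
move=> dt; have Et := in_dom_gt0 dt; have [s ts Es] := dt.
have s0 : 0 < s - t by rewrite subr_gt0.
have Eth h : h < s - t -> 0 < E0 (t + h).
  by move=> hs; apply: lt_le_trans Es (rho_exp_ni _); lra.
have eqn : {near 0^'+, slope t =1 vslope t}.
  near=> h; rewrite /slope /vslope v_of_fin ?v_of_fin//.
  by apply: Eth; near: h; exact: nbhs_right_lt.
have nd : {in Interval (BRight (0 : R)) (BLeft (s - t)) &, nondecreasing_fun (slope t)}.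
  move=> h k; rewrite !in_itv/= => /andP[h0 hs] /andP[k0 ks] hk.
  have p01 : 0 <= h / k <= 1.
    apply/andP; split; first by apply: divr_ge0; exact: ltW.
    by rewrite ler_pdivrMr// mul1r.
  have := rho_exp_convex p01 (Eth _ ks) Et.
  have -> : h / k * (t + k) + (1 - h / k) * t = t + h by field; exact: lt0r_neq0.
  move=> le; rewrite /slope ler_pdivrMr// -subr_ge0.
  have -> : (w (t + k) - w t) / k * h - (w (t + h) - w t) =
     h / k * w (t + k) + (1 - h / k) * w t - w (t + h) by field; exact: lt0r_neq0.
  by rewrite subr_ge0.
have lb : has_lbound (slope t @` [set` Interval (BRight (0 : R)) (BLeft (s - t))]).
  exists 0 => _ /= [h + <-]; rewrite in_itv/= => /andP[h0 hs].
  by rewrite divr_ge0 ?(ltW h0)// subr_ge0 w_nd ?Eth// lerDl ltW.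
have := nondecreasing_at_right_cvgr (_ : BRight 0 < BLeft (s - t))%O nd lb.
rewrite bnd_simp => /(_ s0) c.
have -> // : first_deriv (v_of rho) t = inf (slope t @` [set` Interval (BRight (0 : R)) (BLeft (s - t))]).
by apply/cvg_lim => //; apply: cvg_trans c; exact: near_eq_cvg.
Unshelve. all: by end_near. Qed.

Lemma invS_cvg_right : k.+1%:R^-1 @[k --> \oo] --> (0 : R)^'+.
Proof.
move=> A [e /= e0 eA]; have /cvgr0Pnorm_lt/(_ _ e0) := @cvg_harmonic R.
by apply: filterS => k ke; apply: eA; rewrite /= ?sub0r ?normrN ?invr_gt0.
Qed.

Lemma first_deriv_seq t : in_dom t ->
  k.+1%:R * (w (t + k.+1%:R^-1) - w t) @[k --> \oo] --> first_deriv (v_of rho) t.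
Proof.
move=> dt.
rewrite (_ : (fun k => _) = slope t \o (fun k => k.+1%:R^-1)).
  exact: cvg_comp invS_cvg_right (first_deriv_cvg dt).
by apply/funext => k; rewrite /= /slope invrK mulrC.
Qed.

Lemma near_in_dom t : in_dom t -> \forall k \near \oo, in_dom (t + k.+1%:R^-1).
Proof.
move=> [s ts Es]; have s0 : 0 < s - t by rewrite subr_gt0.
have := near_infty_natSinv_lt (PosNum s0).
by apply: filterS => k /= ks; exists s => //; rewrite -ltrBrDl.
Qed.

Lemma first_deriv_ge0 t : in_dom t -> 0 <= first_deriv (v_of rho) t.
Proof.
move=> dt; apply: ler_cvg_to (cvg_cst _) (first_deriv_seq dt) _.
have := near_in_dom dt; apply: filterS => k /in_dom_gt0 Ek.
by rewrite mulr_ge0// subr_ge0 w_nd// lerDl.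
Qed.

Lemma first_deriv_nd s t : s <= t -> in_dom t ->
  first_deriv (v_of rho) s <= first_deriv (v_of rho) t.
Proof.
move=> st dt; have ds := in_dom_le st dt.
apply: ler_cvg_to (first_deriv_seq ds) (first_deriv_seq dt) _.
have := near_in_dom dt; apply: filterS => k /in_dom_gt0 Ek.
have k0 : 0 <= k.+1%:R^-1 :> R by rewrite invr_ge0.
by rewrite ler_wpM2l//; have := w_lc st k0 Ek; lra.
Qed.

(** [rho (e^t)] may be positive at the right end of the domain, where no right derivative is
    available. That single point is given the value [0]. *)
Definition profile t := if `[< in_dom t >] then rho (expR t) else 0.

Definition profile_slope t := if `[< in_dom t >] then first_deriv (v_of rho) t else 0.

Let dslope t (k : nat) : R :=
  k.+1%:R * (profile_slope (t + k.+1%:R^-1) - profile_slope t).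

(** A lower limit always exists and is measurable, unlike a derivative. The maximum with [0] guards
    quotients that leave the domain; [fine] sends an infinite lower limit to [0], which is still a
    valid lower bound of the curvature. *)
Definition profile_curvature t : R :=
  fine (limn_einf (fun k => (Num.max 0 (dslope t k))%:E)).

Lemma profile_in t : in_dom t -> profile t = rho (expR t).
Proof. by move=> dt; rewrite /profile asboolT. Qed.

Lemma profile_out t : ~ in_dom t -> profile t = 0.
Proof. by move=> dt; rewrite /profile asboolF. Qed.

Lemma profile_slope_in t : in_dom t -> profile_slope t = first_deriv (v_of rho) t.
Proof. by move=> dt; rewrite /profile_slope asboolT. Qed.

Lemma profile_ge0 t : 0 <= profile t.
Proof. by rewrite /profile; case: asboolP => // _; exact: rho_exp_ge0. Qed.

Lemma profile_gt0 t : 0 < profile t <-> in_dom t.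
Proof.
split=> [|dt]; last by rewrite profile_in//; exact: in_dom_gt0.
by rewrite /profile; case: asboolP => //; rewrite ltxx.
Qed.

Lemma profile_ni s t : s <= t -> profile t <= profile s.
Proof.
move=> st; have [dt|dt] := pselect (in_dom t).
  by rewrite !profile_in//; [exact: rho_exp_ni|exact: in_dom_le st dt].
by rewrite profile_out// profile_ge0.
Qed.

Lemma profile_slope_ge0 t : 0 <= profile_slope t.
Proof. by rewrite /profile_slope; case: asboolP => // dt; exact: first_deriv_ge0. Qed.

Lemma dslope_ge0 t : in_dom t -> \forall k \near \oo, 0 <= dslope t k.
Proof.
move=> dt; have := near_in_dom dt; apply: filterS => k dk.
apply: mulr_ge0 => //; rewrite subr_ge0 (profile_slope_in dk) (profile_slope_in dt).
by apply: first_deriv_nd => //; rewrite lerDl.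
Qed.

(** With [E = e^(-w)] and [del] the increment of [w], the quotient of [1 - e^(-del)] lies between
    those of [del e^(-del)] and of [del], which have the same limit. *)
Lemma profile_deriv t :
  k.+1%:R * (profile t - profile (t + k.+1%:R^-1)) @[k --> \oo] --> profile_slope t * profile t.
Proof.
have [dt|dt] := pselect (in_dom t); last first.
  rewrite profile_out// mulr0 (_ : (fun k => _) = cst 0); first exact: cvg_cst.
  apply/funext => k; rewrite profile_out ?subrr ?mulr0//.
  by move=> dk; apply: dt; apply: in_dom_le dk; rewrite lerDl.
rewrite profile_slope_in//; set l := first_deriv _ t.
pose del (k : nat) := w (t + k.+1%:R^-1) - w t.
have dl : k.+1%:R * del k @[k --> \oo] --> l := first_deriv_seq dt.
have del0 : del k @[k --> \oo] --> (0 : R).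
  rewrite -[0 : R](mulr0 l) (_ : del = fun k => k.+1%:R * del k * k.+1%:R^-1).
    by apply: cvgM dl _; exact: cvg_harmonic.
  by apply/funext => k; rewrite mulrAC divff ?mul1r// pnatr_eq0.
have delN : - del k @[k --> \oo] --> (0 : R) by rewrite -[0 : R]oppr0; exact: cvgN.
have e0 : expR (- del k) @[k --> \oo] --> (1 : R).
  rewrite -(@expR0 R); apply: (@cvg_comp _ _ _ (fun k => - del k) expR _ _ _ delN).
  exact: continuous_expR.
rewrite mulrC profile_in//.
have dexp : k.+1%:R * (1 - expR (- del k)) @[k --> \oo] --> l.
  apply: (@squeeze_cvgr _ _ _ _ (fun k => k.+1%:R * del k * expR (- del k)) (fun k => k.+1%:R * del k)).
  - near=> k; apply/andP; split.
      rewrite -mulrA ler_wpM2l//.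
      have := expR_ge1Dx (del k); have := expRN (del k); have := expR_gt0 (del k) => p0 -> le.
      by rewrite ler_pdivrMr// mulrBl mul1r mulVf ?gt_eqF//; lra.
    by rewrite ler_wpM2l//; have := expR_ge1Dx (- del k); lra.
  - by rewrite -[l]mulr1; exact: cvgM dl e0.
  - exact: dl.
have lim2 : rho (expR t) * (k.+1%:R * (1 - expR (- del k))) @[k --> \oo] --> rho (expR t) * l.
  exact: cvgMr.
apply: cvg_trans lim2; apply: near_eq_cvg; have := near_in_dom dt; apply: filterS => k dk.
rewrite (profile_in dk) mulrCA; congr (_ * _).
have Et := in_dom_gt0 dt; have Ek := in_dom_gt0 dk.
have -> : - del k = ln (E0 (t + k.+1%:R^-1)) - ln (E0 t) by rewrite /del /w; ring.
rewrite expRD expRN !lnK ?posrE// mulrBr mulr1 -/(E0 t) -/(E0 (t + k.+1%:R^-1)).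
by rewrite mulrCA divff ?mulr1// gt_eqF.
Unshelve. all: by end_near. Qed.

End radial_profile.

Section profile_is_log_profile.
Context {R : realType} (rho : R -> R).
Hypothesis rho_ge0 : forall s, 0 <= s -> 0 <= rho s.
Hypothesis v_convex : convex_ereal (v_of rho).
Hypothesis v_incr : {homo v_of rho : s t / (s <= t)%R >-> (s <= t)%E}.
Notation E := (profile rho).
Notation u := (profile_slope rho).
Notation b := (profile_curvature rho).

Let gt0P t := profile_gt0 rho_ge0 v_incr t.
Let dslope t (k : nat) : R := k.+1%:R * (u (t + k.+1%:R^-1) - u t).

Lemma measurable_profile : measurable_fun setT E.
Proof. by apply: nonincreasing_measurable => // s t; exact: profile_ni. Qed.

Let mshift (f : R -> R) (c : R) : measurable_fun setT f -> measurable_fun setT (fun t : R => f (t + c)).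
Proof. by move=> mf; apply: (measurableT_comp mf); exact: measurable_funD. Qed.

(** The slope is recovered as a pointwise limit, dividing the quotients of [profile_deriv] by [E].
    Off the domain [0^-1 = 0] gives the value [0] that the slope has there. *)
Lemma measurable_profile_slope : measurable_fun setT u.
Proof.
have mE := measurable_profile.
apply: (@measurable_fun_cvg _ _ R setT (fun k t =>
  k.+1%:R * (E t - E (t + k.+1%:R^-1)) * (E t)^-1)) => [k|t _].
  apply: measurable_funM; last exact: measurableT_comp (@measurable_invr R) mE.
  by apply: measurable_funM => //; apply: measurable_funB => //; exact: mshift.
have [/gt0P dt|dt] := pselect (0 < E t); last first.
  have ndt : ~ in_dom rho t by move/gt0P.
  rewrite profile_out// /profile_slope asboolF//.
  by under eq_fun do rewrite invr0 mulr0; exact: cvg_cst.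
have c := @profile_deriv R rho rho_ge0 v_convex v_incr t.
have E0 : E t != 0 by rewrite gt_eqF//; exact/gt0P.
by rewrite -[u t](mulfK E0); exact: cvgMl.
Qed.

Lemma measurable_profile_curvature : measurable_fun setT b.
Proof.
have mu := measurable_profile_slope.
apply: (measurableT_comp (@fine_measurable R setT measurableT)).
rewrite /limn_einf; apply: measurableT_comp => //.
apply: measurable_fun_limn_esup => k; apply: measurableT_comp => //.
apply/measurable_EFinP.
have muk := mshift k.+1%:R^-1 mu.
exact: measurable_maxr (measurable_cst _) (measurable_funM (measurable_cst _) (measurable_funB muk mu)).
Qed.

Lemma profile_curvature_ge0 t : 0 <= b t.
Proof.
apply: fine_ge0; apply: limn_einf_ge => e e0.
by apply: nearW => k; rewrite sub0r le_max (le_trans (y := 0)) ?oppr_le0 ?(ltW e0).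
Qed.

Lemma profile_curvature_le t e : 0 < E t -> 0 < e ->
  \forall k \near \oo, b t - e <= dslope t k.
Proof.
move=> /gt0P dt e0; have q0 := dslope_ge0 rho_ge0 v_convex v_incr dt.
pose m := fun k => (Num.max 0 (dslope t k))%:E.
have bE : b t = fine (limn_einf m) by [].
have [bt|bt] := leP (b t - e) 0; first by apply: filterS q0 => k; exact: le_trans.
have : ((b t - e)%:E < limn_einf m)%E.
  (* An infinite lower limit would make [b t = 0], against [0 < b t - e]. *)
  have lf : limn_einf m \is a fin_num.
    move: bt; rewrite bE; case: (limn_einf m) => [r| |]//=; rewrite sub0r oppr_gt0 ltNge ltW//.
  by rewrite -(fineK lf) -bE lte_fin ltrBlDr ltrDl.
have le := cvg_lim (@ereal_hausdorff R) (@cvg_einfs_sup R m).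
rewrite limn_einf_lim le => /ereal_sup_gt[_ [N _ <-]] mN.
near=> k; have kN : (N <= k)%N by near: k; exact: nbhs_infty_ge.
have qk : 0 <= dslope t k by near: k; exact: q0.
have : ((b t - e)%:E < m k)%E.
  by apply: lt_le_trans mN _; apply: ereal_inf_lbound; exists k.
by rewrite /m max_r// lte_fin => /ltW.
Unshelve. all: by end_near. Qed.

Lemma profile_log_profile : log_profile E u b.
Proof.
split.
- exact: measurable_profile.
- exact: measurable_profile_slope.
- exact: measurable_profile_curvature.
- by move=> t; exact: profile_ge0.
- by move=> t; exact: profile_slope_ge0.
- exact: profile_curvature_ge0.
- by move=> s t; exact: profile_ni.
- move=> s t st /gt0P dt; have ds := in_dom_le st dt.
  by rewrite (profile_slope_in ds) (profile_slope_in dt); exact: first_deriv_nd.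
- move=> s t e st e0.
  have [/gt0P dte|Ete] := pselect (0 < E (t + e)); last first.
    have -> : E (t + e) = 0.
      by apply/eqP; rewrite eq_le profile_ge0// andbT leNgt; apply/negP.
    by rewrite mulr0 mulr_ge0// profile_ge0.
  have dt : in_dom rho t by apply: in_dom_le dte; rewrite lerDl.
  have dse : in_dom rho (s + e) by apply: in_dom_le dte; rewrite lerD2r.
  have ds : in_dom rho s := in_dom_le st dt.
  have p := in_dom_gt0 rho_ge0 v_incr.
  have := w_lc rho_ge0 v_convex v_incr st e0 (p _ dte).
  rewrite !profile_in// -ler_ln ?posrE ?mulr_gt0 ?p// !lnM ?posrE ?p//; lra.
- by move=> t _; exact: profile_deriv.
- by move=> t Et e e0; exact: profile_curvature_le.
Qed.

(** If the defining quotient diverges, [second_deriv] takes the default value [0]. If it converges,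
    its limit is also the limit along [1 / (k + 1)], and therefore equals the lower limit [b t]. In
    both cases the inequality with [1 / b] implies the one with [1 / v'']. *)
Lemma second_deriv_bounds t : in_dom rho t -> 0 <= second_deriv (v_of rho) t <= b t.
Proof.
move=> dt; rewrite /second_deriv /derive1.
set F := (fun h => _ : R).
have [cF|/dvgP ->] := pselect (cvg (F h @[h --> 0^'])); last first.
  by apply/andP; split; [exact: lexx|exact: profile_curvature_ge0].
set l := lim _.
have Fl : F (k.+1%:R^-1) @[k --> \oo] --> l.
  apply: (@cvg_comp _ _ _ (fun k : nat => k.+1%:R^-1 : R) F _ _ _ (@invS_cvg_right R)).
  exact: cvg_dnbhs_at_right cF.
have near1 : \forall k \near \oo, F (k.+1%:R^-1) = Num.max 0 (dslope t k).
  have q0 := dslope_ge0 rho_ge0 v_convex v_incr dt.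
  have := near_in_dom dt; apply: filterS2 q0 => k qk dk.
  rewrite (max_r qk) /dslope (profile_slope_in dk) (profile_slope_in dt).
  by rewrite [t + _]addrC /F invrK.
have ml : Num.max 0 (dslope t k) @[k --> \oo] --> l.
  by apply: cvg_trans Fl; apply: near_eq_cvg; exact: near1.
apply/andP; split.
  by apply: ler_cvg_to (cvg_cst (0 : R)) ml _; apply: nearW => k; rewrite le_max lexx.
have [e _] : ((limn_einf (fun k => (Num.max 0 (dslope t k))%:E) = l%:E) *
    (limn_esup (fun k => (Num.max 0 (dslope t k))%:E) = l%:E))%type.
  by apply: cvg_limn_einf_sup; apply: cvg_EFin ml; exact: nearW.
have -> : b t = fine (limn_einf (fun k => (Num.max 0 (dslope t k))%:E)) by [].
by rewrite e.
Qed.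

End profile_is_log_profile.

(** * The quadratic form of the inverse matrix *)

Section inv_form_bound.
Context {R : realType} (n : nat).
Implicit Types (y xi eta : 'rV[R]_n).

Lemma mulmx_rV_tr (xi eta : 'rV[R]_n) :
  (xi *m eta^T) ord0 ord0 = \sum_i xi ord0 i * eta ord0 i.
Proof. by rewrite mxE; apply: eq_bigr => i _; rewrite mxE. Qed.

Lemma mulmx_proj eta y :
  eta *m (y^T *m y) = (\sum_i eta ord0 i * y ord0 i) *: y.
Proof. by rewrite mulmxA [eta *m y^T]mx11_scalar mul_scalar_mx mulmx_rV_tr. Qed.

(* The inverses of al and be are extended reals: 0 * 0^-1 = 0 and x * 0^-1 = +oo
   for x > 0 match the values of inv_form at a singular matrix.  In both
   nonsingular and singular cases inv_form is eta . xi with eta H = xi. *)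
Lemma inv_form_ge (y xi : 'rV[R]_n) (c al be : R) : y != 0 -> 0 < c -> 0 <= al -> 0 <= be ->
  ((c^-1)%:E *
   (((\sum_i xi ord0 i ^+ 2) - (\sum_i xi ord0 i * y ord0 i) ^+ 2 / enorm y ^+ 2)%R%:E * al%:E^-1 +
    ((\sum_i xi ord0 i * y ord0 i) ^+ 2 / enorm y ^+ 2)%:E * be%:E^-1)
   <= inv_form (c *: (al *: (1%:M - (enorm y ^+ 2)^-1 *: (y^T *m y)) +
                      be *: ((enorm y ^+ 2)^-1 *: (y^T *m y)))) xi)%E.
Proof.
move=> y0 c0 al0 be0; set P := (enorm y ^+ 2)^-1 *: _.
set s := (_ ^+ 2 / enorm y ^+ 2); set H := (X in inv_form X _).
pose N := enorm y ^+ 2.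
have N0 : N != 0 by rewrite expf_neq0// enorm_eq0.
have NE : \sum_i y ord0 i ^+ 2 = N by rewrite -enorm_sqr.
(* Everything is expressed by [k], the component of [eta] along [y], and [A], the squared norm of
   its orthogonal part; no inverse matrix is ever computed. *)
have key eta : eta *m H = xi ->
    ((c^-1)%:E * (((\sum_i xi ord0 i ^+ 2) - s)%R%:E * al%:E^-1 + s%:E * be%:E^-1) =
     ((eta *m xi^T) ord0 ord0)%:E)%E.
  pose p := \sum_i eta ord0 i * y ord0 i; pose k := p / N; pose q := \sum_i eta ord0 i ^+ 2.
  have etaP : eta *m P = k *: y.
    by rewrite /P -scalemxAr mulmx_proj scalerA mulrC.
  have -> : eta *m H = c *: (al *: (eta - k *: y) + be *: (k *: y)).
    by rewrite /H -(scalemxAr c) mulmxDr -(scalemxAr al) -(scalemxAr be) mulmxBr mulmx1 etaP.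
  move=> xiE.
  have xi_i i : xi ord0 i = c * (al * (eta ord0 i - k * y ord0 i) + be * (k * y ord0 i)).
    by rewrite -xiE !mxE.
  have pE : p = k * N by rewrite /k divfK.
  pose A := q - k ^+ 2 * N.
  have sum_xiy : \sum_i xi ord0 i * y ord0 i = c * be * k * N.
    rewrite (eq_bigr (fun i => c * al * (eta ord0 i * y ord0 i) + (c * (be - al) * k) * y ord0 i ^+ 2)).
      by rewrite big_split/= -!mulr_sumr -/p NE pE; ring.
    by move=> i _; rewrite xi_i; ring.
  have sum_xi2 : \sum_i xi ord0 i ^+ 2 = c ^+ 2 * (al ^+ 2 * A + be ^+ 2 * k ^+ 2 * N).
    rewrite (eq_bigr (fun i => c ^+ 2 * al ^+ 2 * eta ord0 i ^+ 2 +
      2 * c ^+ 2 * al * (be - al) * k * (eta ord0 i * y ord0 i) +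
      c ^+ 2 * (be - al) ^+ 2 * k ^+ 2 * y ord0 i ^+ 2)).
      by rewrite !big_split/= -!mulr_sumr -/p -/q NE pE /A; ring.
    by move=> i _; rewrite xi_i; ring.
  have sum_etaxi : (eta *m xi^T) ord0 ord0 = c * (al * A + be * k ^+ 2 * N).
    rewrite mulmx_rV_tr (eq_bigr (fun i => c * al * eta ord0 i ^+ 2 +
      c * (be - al) * k * (eta ord0 i * y ord0 i))).
      by rewrite !big_split/= -!mulr_sumr -/p -/q pE /A; ring.
    by move=> i _; rewrite xi_i; ring.
  have sE : s = c ^+ 2 * be ^+ 2 * k ^+ 2 * N by rewrite /s sum_xiy -/N; field.
  rewrite sum_etaxi sum_xi2 sE.
  (* At [x = 0] the extended inverse [+oo] meets the factor [0], and both sides vanish. *)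
  have inv1 (x z : R) : 0 <= x -> ((x ^+ 2 * z)%:E * x%:E^-1 = (x * z)%:E)%E.
    rewrite le_eqVlt => /predU1P[<-|x0]; first by rewrite expr0n !mul0r mul0e.
    rewrite inver gt_eqF// -EFinM; congr EFin; field; exact: lt0r_neq0.
  have -> : (c ^+ 2 * (al ^+ 2 * A + be ^+ 2 * k ^+ 2 * N) - c ^+ 2 * be ^+ 2 * k ^+ 2 * N) =
     al ^+ 2 * (c ^+ 2 * A) by ring.
  have -> : c ^+ 2 * be ^+ 2 * k ^+ 2 * N = be ^+ 2 * (c ^+ 2 * k ^+ 2 * N) by ring.
  rewrite !inv1// -EFinD -EFinM; congr EFin; field; exact: lt0r_neq0.
rewrite /inv_form; case: ifPn => [Hu|_].
  by rewrite (key (xi *m invmx H)) ?mulmxKV.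
case: ifPn => [sub|_]; last exact: leey.
by rewrite (key (xi *m pinvmx H)) ?mulmxKpV.
Qed.

End inv_form_bound.

Section integral_ae_lower_bound.
Context d (T : measurableType d) (R : realType) (m : {measure set T -> \bar R}).
Implicit Types f g : T -> \bar R.

(* No measurability here: the integral of a nonnegative function is a supremum. *)
Lemma le_ge0_integral f g : (forall x, (0 <= f x)%E) -> (forall x, (f x <= g x)%E) ->
  (\int[m]_x f x <= \int[m]_x g x)%E.
Proof.
move=> f0 fg; have g0 x : (0 <= g x)%E by exact: le_trans (f0 x) (fg x).
rewrite !ge0_integralTE//; apply: le_ereal_sup => _ [h hf <-]; exists h => // x.
exact: le_trans (hf x) (fg x).
Qed.

(** Here [g] may be non-measurable, and arbitrary on [N]. Its negative part is at most [+oo] times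
    the indicator of the null set [N], so it integrates to [0]; its positive part dominates [f]
    everywhere. *)
Lemma ge0_le_integral_off_null f g (N : set T) : measurable N -> m N = 0%E ->
  (forall x, (0 <= f x)%E) -> (forall x, N x -> f x = 0%E) ->
  (forall x, ~ N x -> (f x <= g x)%E) ->
  (\int[m]_x f x <= \int[m]_x g x)%E.
Proof.
move=> mN N0 f0 fN fg; rewrite [leRHS]integralE.
have -> : (\int[m]_x g^\- x = 0)%E.
  apply/eqP; rewrite eq_le; apply/andP; split; last by apply: integral_ge0.
  apply: (@le_trans _ _ (\int[m]_x (cst +oo%E \_ N) x)%E).
    apply: le_ge0_integral => // x; rewrite patchE; case: ifPn => xN; first exact: leey.
    rewrite funenegE ge_max lexx andbT oppe_le0 (le_trans (f0 x))// fg//.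
    by move/mem_set; rewrite (negbTE xN).
  by rewrite -integral_mkcond null_set_integral.
rewrite sube0; apply: le_ge0_integral => // x; rewrite funeposE le_max.
have [xN|xN] := pselect (N x); first by rewrite fN// lexx orbT.
by rewrite fg.
Qed.

End integral_ae_lower_bound.

(** * Reduction of the measure to its radial profile *)

Section compact_support.
Context {R : realType} (n : nat).
Implicit Types (f h : 'rV[R]_n -> R) (x : 'rV[R]_n).

Lemma bounded_of_support h (A : set 'rV[R]_n) : compact A -> continuous h ->
  (forall x, ~ A x -> h x = 0) -> exists K : R, forall x, `|h x| <= K.
Proof.
move=> cA ch hA.
have cI : compact (h @` A) by apply: continuous_compact => //; exact: continuous_subspaceT.
have [M [_ HM]] := compact_bounded cI.
exists (Num.max 0 (M + 1)) => x; rewrite le_max.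
have [Ax|nAx] := pselect (A x); last by rewrite hA// normr0 lexx.
by apply/orP; right; apply: (HM (M + 1)); [rewrite ltrDl|exists x].
Qed.

Lemma smooth_C1 f : smooth f -> C1_rV f.
Proof. by move=> /(_ 1%N)[_ H]; split => i; have [df [cf _]] := H i. Qed.

Lemma smooth_continuous f : smooth f -> continuous f.
Proof. by move=> /(_ 0%N)[]. Qed.

Lemma partial_off_support f i x : ~ closure [set x | f x != 0] x -> partial i f x = 0.
Proof.
move=> nx; have op : open (~` closure [set x | f x != 0]).
  by apply: closed_openC; exact: closed_closure.
have nz : \forall z \near x, f z = cst 0 z.
  have := open_nbhs_nbhs (conj op nx); apply: filterS => z nz.
  by apply/eqP/negPn/negP => fz; apply: nz; exact: subset_closure.
by rewrite /partial (near_eq_derive (delta_mx ord0 i) nz) derive_cst.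
Qed.

(** The third bound is needed for the derivative along a ray, whose factor [|x|] is unbounded; it
    holds because [x . grad f] has compact support as well. *)
Lemma test_function_bound f : smooth f -> compactly_supported f -> exists K : R,
  [/\ forall x, `|f x| <= K, forall i x, `|partial i f x| <= K &
      forall x, `|\sum_i x ord0 i * partial i f x| <= K].
Proof.
move=> sf; rewrite /compactly_supported => cs; have C1 := smooth_C1 sf.
have [K0 H0] : exists K : R, forall x, `|f x| <= K.
  apply: (bounded_of_support cs); first exact: smooth_continuous.
  move=> x nx; apply/eqP/negPn/negP => fx; apply: nx; exact: subset_closure.
have [K1 H1] : exists K : R, forall x, `|\sum_i x ord0 i * partial i f x| <= K.
  apply: (bounded_of_support cs) => [x|x nx].
    apply: (@cvg_sumr _ _ (nbhs x) (@nbhs_filter _ x)) => i.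
    apply: cvgM; first exact: coord_continuous.
    exact: (C1_continuous C1).
  by rewrite big1// => i _; rewrite partial_off_support// mulr0.
have H2 i : {K : R | forall x, `|partial i f x| <= K}.
  apply: cid; apply: (bounded_of_support cs); first exact: (C1_continuous C1).
  by move=> x nx; exact: partial_off_support.
have K00 : 0 <= K0 by exact: le_trans (H0 0).
have K10 : 0 <= K1 by exact: le_trans (H1 0).
have K20 i : 0 <= sval (H2 i) by apply: le_trans (normr_ge0 (partial i f 0)) _; exact: (svalP (H2 i)).
exists (K0 + K1 + \sum_i sval (H2 i)); split=> [x|i x|x].
- by rewrite (le_trans (H0 x))// -addrA lerDl addr_ge0// sumr_ge0.
- rewrite (le_trans (svalP (H2 i) x))// (bigD1 i)//= addrA addrAC lerDr.
  by rewrite !addr_ge0// sumr_ge0.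
- by rewrite (le_trans (H1 x))// addrAC lerDr addr_ge0// sumr_ge0.
Qed.

End compact_support.

(** * The measure of the theorem in polar coordinates *)

Section polar_mu.
Context {R : realType} (n : nat) (n_gt0 : (0 < n)%N) (rho : R -> R).
Hypothesis rho_ge0 : forall s, 0 <= s -> 0 <= rho s.
Hypothesis v_incr : {homo v_of rho : s t / (s <= t)%R >-> (s <= t)%E}.
Context (mu : probability 'rV[R]_n R).
Hypothesis mu_rho : density_proportional_to mu (fun x => rho (enorm x ^+ 2)).
Notation gauss := (prob_rV (@normal01 R) n).
Notation leb1 := (@lebesgue_measure R).
Notation leb := (lebesgue_rV R n).
Notation a := (n%:R / 2 : R).
Notation E := (profile rho).

(** The density read through [t = 2 ln |x|], where monotonicity in [t] gives measurability. The
    value at the origin is immaterial since [n > 0]. *)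
Let g (x : 'rV[R]_n) : R := if 0 < enorm x then rho (expR (2 * ln (enorm x))) else 0.

Let mE0 : measurable_fun setT (fun t : R => rho (expR t)).
Proof. by apply: nonincreasing_measurable => // s t; exact: rho_exp_ni. Qed.

Let mif (r0 : R) : measurable_fun setT (fun x : 'rV[R]_n =>
  if 0 < enorm x then rho (expR (2 * ln (enorm x))) else r0).
Proof.
apply: measurable_fun_ifT => //.
  by apply: measurable_fun_ltr => //; exact: measurable_enorm.
apply: (measurableT_comp mE0); apply: measurable_funM => //.
by apply: (measurableT_comp (@measurable_ln R)); exact: measurable_enorm.
Qed.

Let g_ge0 x : 0 <= g x. Proof. by rewrite /g; case: ifP => // _; exact: rho_exp_ge0. Qed.

(** At most one point is exceptional: of two points where [rho (e^t)] is positive, the smaller is in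
    the interior of the domain. *)
Lemma profile_ae : \forall t \ae leb1, rho (expR t) = E t.
Proof.
have [[t0 nt0]|all] := pselect (exists t0, rho (expR t0) <> E t0); last first.
  by apply: aeW => t; apply: contrapT => nt; apply: all; exists t.
exists [set t0]; split; [exact: measurable_set1|exact: lebesgue_measure_set1|].
have out t : rho (expR t) <> E t -> ~ in_dom rho t /\ 0 < rho (expR t).
  move=> nt; have nd : ~ in_dom rho t by move=> d; apply: nt; rewrite profile_in.
  split=> //; rewrite lt_neqAle rho_exp_ge0// andbT eq_sym.
  by apply/eqP => r0; apply: nt; rewrite profile_out.
move=> t /= nt; have [d0 r0] := out _ nt0; have [d r] := out _ nt.
by case: (ltgtP t t0) => // tt; exfalso; [apply: d; exists t0|apply: d0; exists t].
Qed.

(** [polar_aux] applied to [phi] times the density, which is constant on spheres. The factor [k] is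
    the normalisation of [mu] divided by [radial_mass]; only its positivity matters. *)
Lemma polar_mu : exists2 k : R, 0 < k & forall phi : 'rV[R]_n -> \bar R,
  measurable_fun setT phi -> (forall x, (0 <= phi x)%E) ->
  (\int[mu]_x phi x = k%:E * \int[gauss]_y \int[leb1]_t
    ((E t * expR (a * t))%:E * phi (expR (t / 2) *: unit_rV y)))%E.
Proof.
have [c muE] := mu_rho; have [C C0 CE] := @radial_mass_fin R n n_gt0.
have mg : measurable_fun setT g by exact: mif.
have gE A : measurable A -> (\int[leb]_(x in A) (rho (enorm x ^+ 2))%:E = \int[leb]_(x in A) (g x)%:E)%E.
  move=> mA; rewrite integral_mkcond [RHS]integral_mkcond.
  have rhoE : (fun x : 'rV[R]_n => (rho (enorm x ^+ 2))%:E) =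
     (fun x => (if 0 < enorm x then rho (expR (2 * ln (enorm x))) else rho 0)%:E).
    apply/funext => x; congr EFin; case: ltP => [x0|x0].
      by rewrite -[in LHS](lnK (_ : enorm x \is Num.pos)) ?posrE// -expRM_natl.
    have -> : enorm x = 0 by apply/eqP; rewrite eq_le x0 enorm_ge0.
    by rewrite expr0n.
  apply: integral_rV_off0 => //.
  - apply/(measurable_restrictT _ _).1 => //; apply: measurable_funTS; rewrite rhoE.
    by apply/measurable_EFinP; exact: mif.
  - apply/(measurable_restrictT _ _).1 => //; apply: measurable_funTS; exact/measurable_EFinP.
  - move=> x x0; rewrite !patchE; case: ifP => // _; rewrite [LHS](congr1 (@^~ x) rhoE)/g.
    by rewrite lt_neqAle eq_sym enorm_eq0 x0 enorm_ge0.
(* A nonpositive normalisation would contradict the total mass one of [mu]. *)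
have c0 : 0 < c.
  have := muE _ measurableT; rewrite gE// [X in X = _]probability_setT => e.
  rewrite ltNge; apply/negP => c0.
  have : (c%:E * \int[leb]_(x in setT) (g x)%:E <= 0)%E.
    apply: mule_le0_ge0; first by rewrite lee_fin.
    by apply: integral_ge0 => x _; rewrite lee_fin.
  by rewrite -e lee_fin ler10.
have mcg : measurable_fun setT (fun x => c * g x) by exact: measurable_funM.
have cg0 x : 0 <= c * g x by rewrite mulr_ge0// ltW.
have muE' A : measurable A -> mu A = (\int[leb]_(x in A) (c * g x)%:E)%E.
  move=> mA; rewrite muE// gE// -ge0_integralZl//.
  - by apply: measurable_funTS; exact/measurable_EFinP.
  - by move=> x _; rewrite lee_fin.
  - by rewrite lee_fin ltW.
exists (c / C); first by rewrite divr_gt0.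
move=> phi mphi phi0; rewrite (ge0_integral_density mcg cg0 muE' mphi phi0).
have mf : measurable_fun setT (fun x => phi x * (c * g x)%:E)%E.
  by apply: emeasurable_funM => //; exact/measurable_EFinP.
have f0 x : (0 <= phi x * (c * g x)%:E)%E by rewrite mule_ge0// lee_fin.
have := polar_aux n_gt0 mf f0; rewrite CE.
set I := (\int[leb]_y _)%E => pol.
have -> : I = ((C^-1)%:E * (C%:E * I))%E by rewrite muleA -EFinM mulVf ?mul1e// gt_eqF.
rewrite -pol [c / C]mulrC EFinM -muleA; congr (_ * _)%E.
have mE := measurable_profile rho_ge0 v_incr.
have mexp : measurable_fun setT (fun t : R => expR (a * t)).
  by apply: measurableT_comp => //; exact: mulrl_measurable.
have mw : measurable_fun setT (fun p : measurableTypeR R * 'rV[R]_n =>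
    (E p.1 * expR (a * p.1))%:E * phi (expR (p.1 / 2) *: unit_rV p.2))%E.
  apply: emeasurable_funM.
    apply/measurable_EFinP.
    exact: measurableT_comp (measurable_funM mE mexp) measurable_fst.
  have mq : measurable_fun setT (fun p : measurableTypeR R * 'rV[R]_n => (p.1, unit_rV p.2)).
    apply: measurable_fun_pair; first exact: measurable_fst.
    exact: measurableT_comp (@measurable_unit_rV R n) measurable_snd.
  have ms := @measurable_scaler_pair R n (fun t => expR (t / 2)).
  have mt : measurable_fun setT (fun t : R => expR (t / 2)).
    by apply: measurableT_comp => //; exact: mulrr_measurable.
  exact: measurableT_comp mphi (measurableT_comp (ms mt) mq).
have w0 (p : measurableTypeR R * 'rV[R]_n) :
    (0 <= (E p.1 * expR (a * p.1))%:E * phi (expR (p.1 / 2) *: unit_rV p.2))%E.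
  by rewrite mule_ge0// lee_fin mulr_ge0 ?expR_ge0// profile_ge0.
have mdil : measurable_fun setT (fun p : measurableTypeR R * 'rV[R]_n =>
    (phi (expR (p.1 / 2) *: unit_rV p.2) * (c * g (expR (p.1 / 2) *: unit_rV p.2))%:E) *
    (expR (a * p.1))%:E)%E.
  have mq : measurable_fun setT (fun p : measurableTypeR R * 'rV[R]_n => (p.1, unit_rV p.2)).
    apply: measurable_fun_pair; first exact: measurable_fst.
    exact: measurableT_comp (@measurable_unit_rV R n) measurable_snd.
  exact: measurableT_comp (measurable_dilation mf) mq.
have dil0 (p : measurableTypeR R * 'rV[R]_n) :
    (0 <= (phi (expR (p.1 / 2) *: unit_rV p.2) * (c * g (expR (p.1 / 2) *: unit_rV p.2))%:E) *
    (expR (a * p.1))%:E)%E.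
  by rewrite !mule_ge0// lee_fin ?expR_ge0.
have J0 y : (0 <= \int[leb1]_t ((E t * expR (a * t))%:E * phi (expR (t / 2) *: unit_rV y)))%E.
  by apply: integral_ge0 => t _; exact: (w0 (t, y)).
rewrite -ge0_integralZl//; last 2 first.
- exact: (measurable_fun_fubini_tonelli_G (m1 := leb1) _ mw w0).
- by rewrite lee_fin ltW.
apply: (integral_gauss_off0 n_gt0).
- exact: (measurable_fun_fubini_tonelli_G (m1 := leb1) _ mdil dil0).
- apply: measurable_funeM; exact: (measurable_fun_fubini_tonelli_G (m1 := leb1) _ mw w0).
- by move=> y; apply: integral_ge0 => t _; exact: (dil0 (t, y)).
- by move=> y; rewrite mule_ge0// lee_fin ltW.
move=> y y0; rewrite -ge0_integralZl//; last 3 first.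
- exact: measurableT_comp mw (measurable_pair2 y).
- by move=> t _; exact: (w0 (t, y)).
- by rewrite lee_fin ltW.
apply: ae_eq_integral => //.
- exact: measurableT_comp mdil (measurable_pair2 y).
- apply: measurable_funeM; exact: measurableT_comp mw (measurable_pair2 y).
have [N [mN N0 sN]] := profile_ae; exists N; split=> // t /= nt.
apply: sN => /= tE; apply: nt => _; rewrite -tE.
have gt : g (expR (t / 2) *: unit_rV y) = rho (expR t).
  by rewrite /g enorm_ray// expR_gt0 expRK; congr (rho (expR _)); field.
rewrite gt -[LHS]muleA -EFinM [LHS]muleC [RHS]muleA -EFinM; congr (_%:E * _)%E; ring.
Qed.

End polar_mu.

(** * Spherical means and oscillations along dilations *)

Section radial_flow.
Context {R : realType} (n : nat) (n_gt0 : (0 < n)%N) (f : 'rV[R]_n -> R) (K : R).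
Hypothesis f_C1 : C1_rV f.
Hypothesis f_cont : continuous f.
Hypothesis f_bnd : forall x, `|f x| <= K.
Hypothesis df_bnd : forall i x, `|partial i f x| <= K.
Hypothesis xdf_bnd : forall x : 'rV[R]_n, `|\sum_i x ord0 i * partial i f x| <= K.
Hypothesis f_even : forall x, f (- x) = f x.
Notation gauss := (prob_rV (@normal01 R) n).
Notation mu := (@lebesgue_measure R).
Notation a := (n%:R / 2 : R).
Implicit Types (t : R) (y : 'rV[R]_n).

Definition flow t y := f (expR (t / 2) *: unit_rV y).
Definition dflow t y := 2^-1 * (expR (t / 2) * radial_deriv f (expR (t / 2)) y).
(** At [|x|^2 = e^t] this is the part of [(1/2) H^-1 grad f . grad f] tangent to the sphere,
    multiplied by [v']. *)
Definition tangential2 t y :=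
  expR (t / 2) ^+ 2 / 4 * \sum_i tangential f (expR (t / 2)) i y ^+ 2.
Definition flow_mean t := (\int[gauss]_y flow t y)%R.
Definition dflow_mean t := (\int[gauss]_y dflow t y)%R.

Lemma flow_bnd t y : `|flow t y| <= K. Proof. exact: f_bnd. Qed.

Lemma dflow_bnd t y : `|dflow t y| <= K.
Proof.
have -> : dflow t y = 2^-1 * \sum_i (expR (t / 2) *: unit_rV y) ord0 i *
    partial i f (expR (t / 2) *: unit_rV y).
  rewrite /dflow /radial_deriv; congr (_ * _); rewrite mulr_sumr; apply: eq_bigr => i _.
  by rewrite [in RHS]mxE mulrA.
rewrite normrM ger0_norm// (le_trans (ler_wpM2l _ (xdf_bnd _)))//.
by have := le_trans (normr_ge0 _) (f_bnd 0); lra.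
Qed.

Lemma is_derive_flow t y : is_derive t 1 (fun s => flow s y) (dflow t y).
Proof.
have dc i : is_derive t 1 (fun s => (expR (s / 2) *: unit_rV y) ord0 i)
    (2^-1 * (expR (t / 2) * unit_rV y ord0 i)).
  have -> : (fun s => (expR (s / 2) *: unit_rV y) ord0 i) = (fun s => expR (s / 2) * unit_rV y ord0 i).
    by apply/funext => s; rewrite mxE.
  have de : is_derive t 1 (fun s : R => expR (s / 2)) (expR (t / 2) * 2^-1).
    apply: (@is_derive1_comp R expR (fun s : R => s / 2)).
    by apply: is_derive_eq; rewrite /GRing.scale/=; ring.
  by apply: is_derive_eq; rewrite /GRing.scale/=; ring.
have := C1_chain (c := fun s => expR (s / 2) *: unit_rV y) f_C1 dc.
move/is_derive_eq; apply; rewrite /dflow /radial_deriv !mulr_sumr.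
by apply: eq_bigr => i _; ring.
Qed.

Lemma continuous_dflow y : continuous (fun t => dflow t y).
Proof.
move=> t.
have ce : expR (s / 2) @[s --> t] --> expR (t / 2).
  apply: (@cvg_comp _ _ _ (fun s : R => s / 2) expR _ (nbhs (t / 2))); last exact: continuous_expR.
  exact: mulrr_continuous.
apply: cvgMr; apply: cvgM; first exact: ce.
apply: cvg_sumr => j; apply: cvgMr.
apply: (@continuous_rV_comp R n (partial j f) (fun s => expR (s / 2) *: unit_rV y)).
  exact: (C1_continuous f_C1).
move=> k; rewrite mxE; under eq_fun do rewrite mxE; exact: cvgMl.
Qed.

Let mexp2 : measurable_fun setT (fun t : R => expR (t / 2)).
Proof. by apply: measurableT_comp => //; exact: mulrr_measurable. Qed.

Lemma measurable_polar_pt : measurable_fun setT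
  (fun p : measurableTypeR R * 'rV[R]_n => expR (p.1 / 2) *: unit_rV p.2).
Proof.
have mq : measurable_fun setT (fun p : measurableTypeR R * 'rV[R]_n => (p.1, unit_rV p.2)).
  apply: measurable_fun_pair; first exact: measurable_fst.
  exact: measurableT_comp (@measurable_unit_rV R n) measurable_snd.
exact: measurableT_comp (@measurable_scaler_pair R n (fun t => expR (t / 2)) mexp2) mq.
Qed.

Let mpt (h : 'rV[R]_n -> R) : continuous h -> measurable_fun setT
  (fun p : measurableTypeR R * 'rV[R]_n => h (expR (p.1 / 2) *: unit_rV p.2)).
Proof.
move=> ch; exact: measurableT_comp (continuous_measurable_rV ch) measurable_polar_pt.
Qed.

Let mu1 i : measurable_fun setT (fun p : measurableTypeR R * 'rV[R]_n => unit_rV p.2 ord0 i).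
Proof. exact: measurableT_comp (@measurable_unit_coord R n i) measurable_snd. Qed.

Let me1 : measurable_fun setT (fun p : measurableTypeR R * 'rV[R]_n => expR (p.1 / 2)).
Proof. exact: measurableT_comp mexp2 measurable_fst. Qed.

Lemma measurable_flow_pair :
  measurable_fun setT (fun p : measurableTypeR R * 'rV[R]_n => flow p.1 p.2).
Proof. exact: mpt. Qed.

Let mrad : measurable_fun setT
  (fun p : measurableTypeR R * 'rV[R]_n => radial_deriv f (expR (p.1 / 2)) p.2).
Proof.
apply: measurable_sum => i; apply: measurable_funM; first exact: mu1.
by apply: mpt; exact: (C1_continuous f_C1).
Qed.

Lemma measurable_dflow_pair :
  measurable_fun setT (fun p : measurableTypeR R * 'rV[R]_n => dflow p.1 p.2).
Proof. exact: measurable_funM (measurable_cst _) (measurable_funM me1 mrad). Qed.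

Lemma measurable_tangential2_pair :
  measurable_fun setT (fun p : measurableTypeR R * 'rV[R]_n => tangential2 p.1 p.2).
Proof.
apply: measurable_funM.
  by apply: measurable_funM; [apply: measurable_funX; exact: me1|exact: measurable_cst].
apply: measurable_sum => i; apply: measurable_funX; apply: measurable_funB.
  by apply: mpt; exact: (C1_continuous f_C1).
exact: measurable_funM (mu1 i) mrad.
Qed.

Lemma tangential2_ge0 t y : 0 <= tangential2 t y.
Proof.
by apply: mulr_ge0; [rewrite divr_ge0// sqr_ge0|apply: sumr_ge0 => i _; exact: sqr_ge0].
Qed.

Let sect (h : measurableTypeR R * 'rV[R]_n -> R) t : measurable_fun setT h ->
  measurable_fun setT (fun y : 'rV[R]_n => h (t, y)).
Proof. move=> mh; exact: measurableT_comp mh (measurable_pair1 t). Qed.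

Lemma flow_mean_C1 : (forall t, is_derive t 1 flow_mean (dflow_mean t)) /\ continuous dflow_mean.
Proof.
apply: (@Rintegral_C1 _ _ R gauss flow dflow).
- by move=> t; exact: sect measurable_flow_pair.
- by move=> t; exact: sect measurable_dflow_pair.
- by move=> y t; exact: is_derive_flow.
- exact: continuous_dflow.
- move=> B; exists (fun=> K); first exact: finite_measure_integrable_cst.
  by move=> t y _; split; [exact: flow_bnd|exact: dflow_bnd].
Qed.

Lemma flow_mean_bnd t : `|flow_mean t| <= K.
Proof.
by apply: Rintegral_bounded; [exact: sect measurable_flow_pair|exact: flow_bnd].
Qed.

Lemma dflow_mean_bnd t : `|dflow_mean t| <= K.
Proof.
by apply: Rintegral_bounded; [exact: sect measurable_dflow_pair|exact: dflow_bnd].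
Qed.

Lemma measurable_dflow_mean : measurable_fun setT dflow_mean.
Proof. by apply: continuous_measurable_fun; have [_] := flow_mean_C1. Qed.

Lemma measurable_flow_mean : measurable_fun setT flow_mean.
Proof.
apply: continuous_measurable_fun => t; have [d _] := flow_mean_C1.
by apply/differentiable_continuous/derivable1_diffP; case: (d t).
Qed.

Definition flow_osc t y := flow t y - flow_mean t.
Definition dflow_osc t y := dflow t y - dflow_mean t.

Lemma measurable_flow_osc_pair :
  measurable_fun setT (fun p : measurableTypeR R * 'rV[R]_n => flow_osc p.1 p.2).
Proof.
apply: measurable_funB; first exact: measurable_flow_pair.
exact: measurableT_comp measurable_flow_mean measurable_fst.
Qed.

Lemma measurable_dflow_osc_pair :
  measurable_fun setT (fun p : measurableTypeR R * 'rV[R]_n => dflow_osc p.1 p.2).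
Proof.
apply: measurable_funB; first exact: measurable_dflow_pair.
exact: measurableT_comp measurable_dflow_mean measurable_fst.
Qed.

Lemma integral_sqr_center (h : 'rV[R]_n -> R) : measurable_fun setT h ->
  (forall y, `|h y| <= K) ->
  (\int[gauss]_y (h y ^+ 2)%:E = ((\int[gauss]_y h y)%R ^+ 2)%:E +
    \int[gauss]_y ((h y - (\int[gauss]_z h z)%R) ^+ 2)%:E)%E.
Proof.
move=> mh hK.
have h2 : (\int[gauss]_y (h y ^+ 2)%:E < +oo)%E.
  have i2 : gauss.-integrable setT (EFin \o (fun y => h y ^+ 2)).
    apply: (integrable_bounded gauss (M := K ^+ 2)) => [|y]; first exact: measurable_funX.
    by rewrite normrX lerXn2r ?nnegrE// (le_trans _ (hK y)).
  by rewrite ltey_eq (integrable_fin_num measurableT i2).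
have := integral_sqr_sub 0 mh h2; rewrite subr0 addeC => <-.
by under [RHS]eq_integral do rewrite subr0.
Qed.

(** Half of [sphere_even_poincare] at radius [e^(t/2)]. The constant obtained is [a = n / 2], the
    very exponent of the weight [e^(a t)], so the last term of the weighted inequality is absorbed
    without loss. *)
Lemma sphere_osc_le t :
  (a%:E * \int[gauss]_y (flow_osc t y ^+ 2)%:E <= \int[gauss]_y (tangential2 t y)%:E)%E.
Proof.
have := sphere_even_poincare n_gt0 f_C1 f_cont f_bnd df_bnd f_even (expR_gt0 (t / 2)).
set X := (\int[gauss]_y ((_ - _) ^+ 2)%:E)%E; set S := (\int[gauss]_y (\sum_i _)%:E)%E => le.
have mt : measurable_fun setT (fun y : 'rV[R]_n => \sum_i tangential f (expR (t / 2)) i y ^+ 2).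
  by apply: measurable_sum => i; apply: measurable_funX; exact: measurable_tangential.
have -> : (\int[gauss]_y (tangential2 t y)%:E = (expR (t / 2) ^+ 2 / 4)%:E * S)%E.
  under eq_integral do rewrite EFinM; apply: ge0_integralZl => //.
  - exact/measurable_EFinP.
  - by move=> y _; rewrite lee_fin sumr_ge0// => i _; exact: sqr_ge0.
have -> : (a%:E * \int[gauss]_y (flow_osc t y ^+ 2)%:E = (2^-1)%:E * (n%:R%:E * X))%E.
  by rewrite muleA -EFinM mulrC.
have -> : ((expR (t / 2) ^+ 2 / 4)%:E * S = (2^-1)%:E * ((expR (t / 2) ^+ 2 / 2)%:E * S))%E.
  by rewrite [RHS]muleA -EFinM; congr (_%:E * _)%E; field.
exact: lee_wpmul2l.
Qed.

End radial_flow.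

(** * The inequality in polar coordinates *)

Section flow_inequality.
Context {R : realType} (n : nat) (n_gt0 : (0 < n)%N) (f : 'rV[R]_n -> R) (K : R).
Hypothesis f_C1 : C1_rV f.
Hypothesis f_cont : continuous f.
Hypothesis f_bnd : forall x, `|f x| <= K.
Hypothesis df_bnd : forall i x, `|partial i f x| <= K.
Hypothesis xdf_bnd : forall x : 'rV[R]_n, `|\sum_i x ord0 i * partial i f x| <= K.
Hypothesis f_even : forall x, f (- x) = f x.
Context (E u b : R -> R) (p : log_profile E u b).
Notation gauss := (prob_rV (@normal01 R) n).
Notation mu := (@lebesgue_measure R).
Notation a := (n%:R / 2 : R).
Let m t := E t * expR (a * t).
Hypothesis m_mass : (0 < \int[mu]_t (m t)%:E < +oo)%E.
Hypothesis mean0 : (\int[mu]_t (m t * flow_mean f t)%:E = 0)%E.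

Let a_gt0 : 0 < a. Proof. by rewrite divr_gt0// ltr0n. Qed.
Let m_ge0 t : 0 <= m t. Proof. by rewrite mulr_ge0 ?expR_ge0// (lp_E0 p). Qed.
Let mm : measurable_fun setT m.
Proof.
apply: measurable_funM; first exact: lp_mE p.
by apply: measurableT_comp => //; exact: mulrl_measurable.
Qed.

Let line (h : measurableTypeR R * 'rV[R]_n -> R) : measurable_fun setT h ->
  measurable_fun setT (fun t : R => \int[gauss]_y (h (t, y) ^+ 2)%:E)%E.
Proof.
move=> mh; apply: (measurable_fun_fubini_tonelli_F (fun q => (h q ^+ 2)%:E)).
  exact: measurable_sqr_EFin.
by move=> q; exact: sqr_EFin_ge0.
Qed.

Let swap (h : measurableTypeR R * 'rV[R]_n -> R) (w : R -> \bar R) :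
  measurable_fun setT h -> measurable_fun setT w -> (forall t, (0 <= w t)%E) ->
  (\int[gauss]_y \int[mu]_t (w t * (h (t, y) ^+ 2)%:E) =
   \int[mu]_t (w t * \int[gauss]_y (h (t, y) ^+ 2)%:E))%E.
Proof.
move=> mh mw w0.
have mq : measurable_fun setT (fun q : measurableTypeR R * 'rV[R]_n => w q.1 * (h q ^+ 2)%:E)%E.
  apply: emeasurable_funM; first exact: measurableT_comp mw measurable_fst.
  exact: measurable_sqr_EFin.
have q0 (q : measurableTypeR R * 'rV[R]_n) : (0 <= w q.1 * (h q ^+ 2)%:E)%E.
  by rewrite mule_ge0// sqr_EFin_ge0.
rewrite -(fubini_tonelli (m1 := mu) (fun q : measurableTypeR R * 'rV[R]_n => w q.1 * (h q ^+ 2)%:E)%E mq q0).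
apply: eq_integral => t _.
have mht : measurable_fun setT (fun y : 'rV[R]_n => (h (t, y) ^+ 2)%:E).
  by apply: measurable_sqr_EFin; exact: measurableT_comp mh (measurable_pair1 t).
exact: (@ge0_integralZl _ _ _ gauss setT measurableT (fun y : 'rV[R]_n => (h (t, y) ^+ 2)%:E)
  mht (w t) (fun y _ => sqr_EFin_ge0 _) (w0 t)).
Qed.

Let mte := measurable_tangential2_pair f_C1.

Let T t := (\int[gauss]_y (tangential2 f t y)%:E)%E.
Let G t := (\int[gauss]_y (flow_osc f t y ^+ 2)%:E)%E.
Let G1 t := (\int[gauss]_y (dflow_osc f t y ^+ 2)%:E)%E.

Let T0 t : (0 <= T t)%E.
Proof. by apply: integral_ge0 => y _; rewrite lee_fin tangential2_ge0. Qed.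

Let mT : measurable_fun setT T.
Proof.
apply: (measurable_fun_fubini_tonelli_F (fun q => (tangential2 f q.1 q.2)%:E)).
  by apply/measurable_EFinP; exact: mte.
by move=> q; rewrite lee_fin tangential2_ge0.
Qed.

Let mosc := measurable_flow_osc_pair f_C1 f_cont f_bnd xdf_bnd.
Let mdosc := measurable_dflow_osc_pair f_C1 f_cont f_bnd xdf_bnd.

Let ib0 t : (0 <= (b t)%:E^-1)%E. Proof. by rewrite inve_ge0 lee_fin (lp_b0 p). Qed.
Let iu0 t : (0 <= (u t)%:E^-1)%E. Proof. by rewrite inve_ge0 lee_fin (lp_u0 p). Qed.
Let mib : measurable_fun setT (fun t => (b t)%:E^-1)%E.
Proof. exact: measurable_inve (lp_mb p) (lp_b0 p). Qed.
Let miu : measurable_fun setT (fun t => (u t)%:E^-1)%E.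
Proof. exact: measurable_inve (lp_mu p) (lp_u0 p). Qed.
Let mmE : measurable_fun setT (fun t => (m t)%:E). Proof. exact/measurable_EFinP. Qed.

Let mG : measurable_fun setT G.
Proof. exact: (line (h := fun q => flow_osc f q.1 q.2) mosc). Qed.
Let mG1 : measurable_fun setT G1.
Proof. exact: (line (h := fun q => dflow_osc f q.1 q.2) mdosc). Qed.

(** [lp_weighted_poincare] on each ray, averaged over the directions. Of the coefficient
    [a + d = a (1 + d / a)], the factor [a] is spent on [sphere_osc_le]; then [1 / (u + d)] is
    relaxed to [1 / u], possibly [+oo]. *)
Lemma osc_delta (d : R) : 0 < d ->
  (\int[mu]_t ((m t)%:E * G t) <=
   \int[mu]_t ((m t)%:E * (b t)%:E^-1 * G1 t) +
   (1 + d / a)%:E * \int[mu]_t ((m t)%:E * (u t)%:E^-1 * T t))%E.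
Proof.
move=> d0.
pose wd t : R := m t / (u t + d).
have ud0 t : 0 < u t + d by rewrite ltr_wpDl// (lp_u0 p).
have wd0 t : 0 <= wd t by rewrite divr_ge0// ltW.
have mwd : measurable_fun setT (fun t => (wd t)%:E).
  apply/measurable_EFinP; apply: measurable_funM => //.
  apply: (measurableT_comp (@measurable_invr R)).
  by apply: measurable_funD => //; exact: lp_mu p.
have mb0 t : (0 <= (m t)%:E * (b t)%:E^-1)%E by rewrite mule_ge0// lee_fin.
have mmb : measurable_fun setT (fun t => (m t)%:E * (b t)%:E^-1)%E by exact: emeasurable_funM.
have [C1a C1b] := flow_mean_C1 f_C1 f_cont f_bnd xdf_bnd.
have mslice (h : measurableTypeR R * 'rV[R]_n -> R) (w : R -> \bar R) :
    measurable_fun setT h -> measurable_fun setT w -> (forall t, (0 <= w t)%E) ->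
    measurable_fun setT (fun y : 'rV[R]_n => \int[mu]_t (w t * (h (t, y) ^+ 2)%:E))%E.
  move=> mh mw w0.
  apply: (measurable_fun_fubini_tonelli_G (m1 := mu)
    (fun q : measurableTypeR R * 'rV[R]_n => w q.1 * (h q ^+ 2)%:E)%E).
    apply: emeasurable_funM; first exact: measurableT_comp mw measurable_fst.
    exact: measurable_sqr_EFin.
  by move=> q; rewrite mule_ge0// sqr_EFin_ge0.
have perY y : (\int[mu]_t ((m t)%:E * (flow_osc f t y ^+ 2)%:E) <=
    \int[mu]_t ((m t)%:E * (b t)%:E^-1 * (dflow_osc f t y ^+ 2)%:E) +
    (a + d)%:E * \int[mu]_t ((wd t)%:E * (flow_osc f t y ^+ 2)%:E))%E.
  have K2 s z : `|flow_osc f s z| <= 2 * K.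
    rewrite (le_trans (ler_normB _ _))// mulr_natl mulr2n lerD//; first exact: flow_bnd.
    exact: (flow_mean_bnd f_cont f_bnd).
  have K3 s z : `|dflow_osc f s z| <= 2 * K.
    rewrite (le_trans (ler_normB _ _))// mulr_natl mulr2n lerD//; first exact: (dflow_bnd f_bnd xdf_bnd).
    exact: (dflow_mean_bnd f_C1 f_bnd xdf_bnd).
  have md1 : measurable_fun setT (fun t => dflow_osc f t y).
    exact: measurableT_comp mdosc (measurable_pair2 y).
  have dd (t : R) : is_derive t 1 (fun s => flow_osc f s y) (dflow_osc f t y).
    have d1 := is_derive_flow f_C1 t y; have d2 := C1a t.
    exact: is_deriveB.
  have := lp_weighted_poincare p (ltW a_gt0) d0 (proj2 (andP m_mass))
    (K2^~ y) (K3^~ y) md1 dd.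
  move=> le; apply: le_trans (le_trans _ le) _.
    by rewrite le_eqVlt; apply/orP; left; apply/eqP; apply: eq_integral => t _; rewrite -EFinM.
  rewrite le_eqVlt; apply/orP; left; apply/eqP; congr (_ + _ * _)%E.
    by apply: eq_integral => t _; rewrite EFinM muleAC.
  by apply: eq_integral => t _; rewrite -EFinM /wd; congr EFin; rewrite mulrAC.
rewrite -(swap (h := fun q => flow_osc f q.1 q.2) mosc mmE); last by move=> t; rewrite lee_fin.
rewrite -(swap (h := fun q => dflow_osc f q.1 q.2) mdosc mmb mb0).
apply: (@le_trans _ _ (\int[gauss]_y (\int[mu]_t ((m t)%:E * (b t)%:E^-1 * (dflow_osc f t y ^+ 2)%:E) +
    (a + d)%:E * \int[mu]_t ((wd t)%:E * (flow_osc f t y ^+ 2)%:E)))%E).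
  apply: ge0_le_integralT => [| |y|y]; last exact: perY.
  - by apply: (mslice (fun q => flow_osc f q.1 q.2)) => // t; rewrite lee_fin.
  - apply: emeasurable_funD; first exact: (mslice (fun q => dflow_osc f q.1 q.2)).
    apply: measurable_funeM.
    exact: (mslice (fun q => flow_osc f q.1 q.2) (fun t => (wd t)%:E) mosc mwd wd0).
  - by apply: integral_ge0 => t _; rewrite mule_ge0 ?lee_fin// sqr_ge0.
have ad0 : 0 <= a + d by rewrite addr_ge0// ltW.
rewrite ge0_integralD//; first last.
- apply: measurable_funeM.
  exact: (mslice (fun q => flow_osc f q.1 q.2) (fun t => (wd t)%:E) mosc mwd wd0).
- move=> y _; rewrite mule_ge0 ?lee_fin//; apply: integral_ge0 => t _.
  by rewrite mule_ge0 ?lee_fin// sqr_ge0.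
- exact: (mslice (fun q => dflow_osc f q.1 q.2)).
- by move=> y _; apply: integral_ge0 => t _; rewrite mule_ge0// sqr_EFin_ge0.
apply: leeD => //; rewrite ge0_integralZl//; first last.
- by move=> y _; apply: integral_ge0 => t _; rewrite mule_ge0 ?lee_fin// sqr_ge0.
- exact: (mslice (fun q => flow_osc f q.1 q.2) (fun t => (wd t)%:E) mosc mwd wd0).
rewrite (swap (h := fun q => flow_osc f q.1 q.2) mosc mwd); last by move=> t; rewrite lee_fin.
have -> : (1 + d / a)%:E = ((a + d)%:E * (a^-1)%:E)%E.
  by rewrite -EFinM; congr EFin; field; rewrite pnatr_eq0 -lt0n.
rewrite -muleA; apply: lee_wpmul2l; first by rewrite lee_fin.
have mZ : measurable_fun setT (fun t => (m t)%:E * (u t)%:E^-1 * T t)%E.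
  by apply: emeasurable_funM => //; exact: emeasurable_funM.
have Z0 t : (0 <= (m t)%:E * (u t)%:E^-1 * T t)%E by rewrite !mule_ge0// lee_fin.
rewrite -ge0_integralZl//.
apply: ge0_le_integralT => [| |t|t].
- exact: emeasurable_funM mwd mG.
- exact: measurable_funeM.
- by rewrite mule_ge0 ?lee_fin// integral_sqr_ge0.
have le1 : (G t <= (a^-1)%:E * T t)%E.
  by rewrite lee_pdivlMl//; exact: (sphere_osc_le n_gt0 f_C1 f_cont f_bnd df_bnd f_even).
rewrite -[leRHS]muleCA -muleA.
apply: (@le_trans _ _ ((wd t)%:E * ((a^-1)%:E * T t))%E).
  by apply: lee_wpmul2l => //; rewrite lee_fin.
rewrite /wd EFinM -muleA; apply: lee_wpmul2l; first by rewrite lee_fin.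
apply: lee_wpmul2r.
  by apply: mule_ge0 => //; rewrite lee_fin invr_ge0 ltW.
have := lp_u0 p t; rewrite le_eqVlt => /predU1P[<-|u0]; first by rewrite inve0 leey.
by rewrite inver gt_eqF// lee_fin lef_pV2 ?posrE ?ud0// lerDl ltW.
Qed.

(** Spherical mean and oscillation are orthogonal on every sphere, for [f] and for its
    [t]-derivative alike, so Brascamp-Lieb for the mean and [osc_delta] for the oscillation simply
    add up. *)
Lemma flow_inequality :
  (\int[mu]_t ((m t)%:E * \int[gauss]_y (flow f t y ^+ 2)%:E) <=
   \int[mu]_t ((m t)%:E * (\int[gauss]_y (dflow f t y ^+ 2)%:E * (b t)%:E^-1 + T t * (u t)%:E^-1)))%E.
Proof.
have [C1a C1b] := flow_mean_C1 f_C1 f_cont f_bnd xdf_bnd.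
have mF := measurable_flow_mean f_C1 f_cont f_bnd xdf_bnd.
have mF1 := measurable_dflow_mean f_C1 f_cont f_bnd xdf_bnd.
pose Y1 := (\int[mu]_t ((m t * dflow_mean f t ^+ 2)%:E * (b t)%:E^-1))%E.
pose Y2 := (\int[mu]_t ((m t)%:E * (b t)%:E^-1 * G1 t))%E.
pose Z := (\int[mu]_t ((m t)%:E * (u t)%:E^-1 * T t))%E.
have G0 t : (0 <= G t)%E by exact: integral_sqr_ge0.
have G10 t : (0 <= G1 t)%E by exact: integral_sqr_ge0.
have Y20 : (0 <= Y2)%E by apply: integral_ge0 => t _; rewrite !mule_ge0// lee_fin.
have Z0 : (0 <= Z)%E by apply: integral_ge0 => t _; rewrite !mule_ge0// lee_fin.
have X1 : (\int[mu]_t (m t * flow_mean f t ^+ 2)%:E <= Y1)%E.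
  apply: (lp_brascamp_lieb p (ltW a_gt0) m_mass) => //.
  exact: (flow_mean_bnd f_cont f_bnd).
have X2 : (\int[mu]_t ((m t)%:E * G t) <= Y2 + Z)%E.
  have [Zoo|Zfin] := eqVneq Z +oo%E.
    by rewrite Zoo addey ?leey// -ltNye (lt_le_trans _ Y20).
  have fZ : Z \is a fin_num by rewrite ge0_fin_numE// ltey.
  apply/lee_addgt0Pr => e e0.
  pose z := fine Z; have z0 : 0 <= z by exact: fine_ge0.
  have z1 : 0 < z + 1 by rewrite ltr_wpDl.
  (* For this [d] the excess [(d / a) z] is [e z / (z + 1)], which is at most [e]. *)
  have d0 : 0 < a * (e / (z + 1)) by apply: mulr_gt0 => //; exact: divr_gt0.
  have le := osc_delta d0; apply: (le_trans le).
  change ((Y2 + (1 + a * (e / (z + 1)) / a)%:E * Z <= Y2 + Z + e%:E)%E).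
  rewrite -(addeA Y2 Z e%:E); apply: leeD2l.
  rewrite -(fineK fZ) -/z -EFinM -EFinD lee_fin [a * _]mulrC mulfK ?gt_eqF//.
  by rewrite mulrDl mul1r lerD2l mulrAC ler_pdivrMr// ler_wpM2l ?(ltW e0)// lerDl.
have splitL t : (\int[gauss]_y (flow f t y ^+ 2)%:E = (flow_mean f t ^+ 2)%:E + G t)%E.
  apply: (integral_sqr_center (K := K)); last exact: flow_bnd.
  exact: measurableT_comp (measurable_flow_pair f_cont) (measurable_pair1 t).
have splitR t : (\int[gauss]_y (dflow f t y ^+ 2)%:E = (dflow_mean f t ^+ 2)%:E + G1 t)%E.
  apply: (integral_sqr_center (K := K)); last exact: (dflow_bnd f_bnd xdf_bnd).
  exact: measurableT_comp (measurable_dflow_pair f_C1) (measurable_pair1 t).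
have mmF : measurable_fun setT (fun t => (m t * flow_mean f t ^+ 2)%:E).
  by apply/measurable_EFinP; apply: measurable_funM => //; exact: measurable_funX.
have mmF1 : measurable_fun setT (fun t => (m t * dflow_mean f t ^+ 2)%:E * (b t)%:E^-1)%E.
  apply: emeasurable_funM => //.
  by apply/measurable_EFinP; apply: measurable_funM => //; exact: measurable_funX.
have mY2 : measurable_fun setT (fun t => (m t)%:E * (b t)%:E^-1 * G1 t)%E.
  by apply: emeasurable_funM => //; exact: emeasurable_funM.
have mZ : measurable_fun setT (fun t => (m t)%:E * (u t)%:E^-1 * T t)%E.
  by apply: emeasurable_funM => //; exact: emeasurable_funM.
have -> : (\int[mu]_t ((m t)%:E * \int[gauss]_y (flow f t y ^+ 2)%:E) =
    \int[mu]_t (m t * flow_mean f t ^+ 2)%:E + \int[mu]_t ((m t)%:E * G t))%E.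
  rewrite -ge0_integralD//; first last.
  - exact: emeasurable_funM.
  - by move=> t _; rewrite mule_ge0// lee_fin.
  - by move=> t _; rewrite lee_fin mulr_ge0// sqr_ge0.
  by apply: eq_integral => t _; rewrite splitL ge0_muleDr ?sqr_EFin_ge0// EFinM.
have -> : (\int[mu]_t ((m t)%:E * (\int[gauss]_y (dflow f t y ^+ 2)%:E * (b t)%:E^-1 + T t * (u t)%:E^-1)) =
    Y1 + (Y2 + Z))%E.
  rewrite /Y2 /Z -ge0_integralD//; first last.
  - by move=> t _; rewrite !mule_ge0// lee_fin.
  - by move=> t _; rewrite !mule_ge0// lee_fin.
  rewrite -ge0_integralD//; first last.
  - exact: emeasurable_funD.
  - by move=> t _; rewrite adde_ge0// !mule_ge0// lee_fin.
  - by move=> t _; rewrite mule_ge0// lee_fin mulr_ge0// sqr_ge0.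
  apply: eq_integral => t _; rewrite splitR ge0_muleDl ?sqr_EFin_ge0//.
  rewrite ge0_muleDr ?adde_ge0 ?mule_ge0 ?sqr_EFin_ge0// ge0_muleDr ?mule_ge0 ?sqr_EFin_ge0//.
  rewrite -addeA; congr (_ + (_ + _))%E; first by rewrite muleA -EFinM.
    by rewrite (muleC (G1 t)) muleA.
  by rewrite (muleC (T t)) muleA.
exact: leeD.
Qed.

End flow_inequality.

Lemma lee_inve {R : realType} (x y : R) : 0 <= x -> x <= y -> (y%:E^-1 <= x%:E^-1)%E.
Proof.
rewrite le_eqVlt => /predU1P[<- _|x0 xy]; first by rewrite inve0 leey.
have y0 : 0 < y by exact: lt_le_trans xy.
by rewrite !inver !gt_eqF// lee_fin lef_pV2.
Qed.

(** * Return to R^n and comparison with the quadratic form *)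

Section main.
Context {R : realType} (n : nat) (n_gt0 : (0 < n)%N) (rho : R -> R).
Hypothesis rho_ge0 : forall s, 0 <= s -> 0 <= rho s.
Hypothesis v_convex : convex_ereal (v_of rho).
Hypothesis v_incr : {homo v_of rho : s t / (s <= t)%R >-> (s <= t)%E}.
Context (mu : probability 'rV[R]_n R).
Hypothesis mu_rho : density_proportional_to mu (fun x => rho (enorm x ^+ 2)).
Context (f : 'rV[R]_n -> R).
Hypothesis f_smooth : smooth f.
Hypothesis f_supp : compactly_supported f.
Hypothesis f_even : forall x, f (- x) = f x.
Notation gauss := (prob_rV (@normal01 R) n).
Notation leb1 := (@lebesgue_measure R).
Notation a := (n%:R / 2 : R).
Notation E := (profile rho).
Notation u := (profile_slope rho).
Notation b := (profile_curvature rho).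
Let m t := E t * expR (a * t).

Let logr (x : 'rV[R]_n) : R := 2 * ln (enorm x).
Let good (x : 'rV[R]_n) : bool := (0 < enorm x) && (0 < E (logr x)).
Let Df (x : 'rV[R]_n) : R := 2^-1 * \sum_i x ord0 i * partial i f x.
(** The tangential energy written as total minus radial, which is measurable on [R^n] at once; along
    rays it coincides with [tangential2]. *)
Let Tf (x : 'rV[R]_n) : R := 4^-1 * (enorm x ^+ 2 * \sum_i partial i f x ^+ 2) - Df x ^+ 2.

(** A measurable substitute for half of the integrand of the theorem: it uses [b] for [v''], and is
    set to [0] at the origin and where the profile vanishes, which together form a null set. *)
Definition energy (x : 'rV[R]_n) : \bar R :=
  if good x then ((Df x ^+ 2)%:E * (b (logr x))%:E^-1 + (Tf x)%:E * (u (logr x))%:E^-1)%E else 0%E.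

Let C1 := smooth_C1 f_smooth.

Let logr_ray t (y : 'rV[R]_n) : y != 0 -> logr (expR (t / 2) *: unit_rV y) = t.
Proof. by move=> y0; rewrite /logr enorm_ray// expRK; field. Qed.

Let Df_ray t (y : 'rV[R]_n) : Df (expR (t / 2) *: unit_rV y) = dflow f t y.
Proof.
rewrite /Df /dflow /radial_deriv; congr (_ * _); rewrite mulr_sumr.
by apply: eq_bigr => i _; rewrite mxE mulrA.
Qed.

Let Tf_ray t (y : 'rV[R]_n) : y != 0 ->
  Tf (expR (t / 2) *: unit_rV y) = tangential2 f t y.
Proof.
move=> y0; rewrite /Tf Df_ray /tangential2 sum_tangential_sqr// enorm_ray// /dflow.
by field.
Qed.

Let Tf_ge0 x : 0 <= Tf x.
Proof.
have [->|x0] := eqVneq x 0.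
  have D0 : Df 0 = 0 by rewrite /Df big1 ?mulr0// => i _; rewrite mxE mul0r.
  rewrite /Tf D0 expr0n/= subr0; apply: mulr_ge0 => //; apply: mulr_ge0; first exact: sqr_ge0.
  by apply: sumr_ge0 => i _; exact: sqr_ge0.
have N0 : 0 < enorm x by rewrite lt_neqAle eq_sym enorm_eq0 x0 enorm_ge0.
have xE : x = expR (logr x / 2) *: unit_rV x.
  rewrite /logr mulrC mulrA mulVf ?mul1r ?pnatr_eq0// lnK// /unit_rV scalerA divff ?scale1r//.
  exact: lt0r_neq0.
by rewrite xE Tf_ray// tangential2_ge0.
Qed.

Let energy_ge0 x : (0 <= energy x)%E.
Proof.
rewrite /energy; case: ifP => // _; apply: adde_ge0; apply: mule_ge0.
- exact: sqr_EFin_ge0.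
- by rewrite inve_ge0 lee_fin profile_curvature_ge0.
- by rewrite lee_fin.
- by rewrite inve_ge0 lee_fin profile_slope_ge0.
Qed.

Let mlogr : measurable_fun setT logr.
Proof.
apply: measurable_funM => //.
exact: measurableT_comp (@measurable_ln R) (@measurable_enorm R n).
Qed.

Let mE := measurable_profile rho_ge0 v_incr.

Let mgood : measurable_fun setT good.
Proof.
apply: measurable_and.
  by apply: measurable_fun_ltr => //; exact: measurable_enorm.
by apply: measurable_fun_ltr => //; exact: measurableT_comp mE mlogr.
Qed.

Let mpart i : measurable_fun setT (partial i f).
Proof. by apply: continuous_measurable_rV; exact: (C1_continuous C1). Qed.

Let mDf : measurable_fun setT Df.
Proof.
apply: measurable_funM => //; apply: measurable_sum => i.
by apply: measurable_funM; [exact: measurable_coord|exact: mpart].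
Qed.

Let menergy : measurable_fun setT energy.
Proof.
apply: measurable_fun_ifT => //.
have mTf : measurable_fun setT Tf.
  apply: measurable_funB; last exact: measurable_funX.
  apply: measurable_funM => //; apply: measurable_funM.
    by apply: measurable_funX; exact: measurable_enorm.
  by apply: measurable_sum => i; apply: measurable_funX; exact: mpart.
apply: emeasurable_funD; apply: emeasurable_funM.
- exact: measurable_sqr_EFin.
- apply: (measurableT_comp (f := fun t : R => (b t)%:E^-1%E)) mlogr.
  by apply: measurable_inve => [|t]; [exact: measurable_profile_curvature|exact: profile_curvature_ge0].
- exact/measurable_EFinP.
- apply: (measurableT_comp (f := fun t : R => (u t)%:E^-1%E)) mlogr.
  by apply: measurable_inve => [|t]; [exact: measurable_profile_slope|exact: profile_slope_ge0].
Qed.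

(** [inv_form_ge] with [c = 2 / |x|^2] gives the form with [1 / v'] and [1 / v'']; since
    [second_deriv] is at most [b], the inverse of [b] is the smaller one. *)
Lemma energy_le_inv_form x : good x ->
  (2%:E * energy x <= inv_form (H_of rho x) (gradient f x))%E.
Proof.
move=> gx; rewrite /energy gx; move: gx => /andP[N0 /(profile_gt0 rho_ge0 v_incr) dx].
have x0 : x != 0 by rewrite -enorm_eq0 gt_eqF.
have /andP[sd0 sdb] := second_deriv_bounds rho_ge0 v_convex v_incr dx.
have u0 : 0 <= first_deriv (v_of rho) (logr x) by exact: first_deriv_ge0.
have c0 : 0 < 2 * (enorm x ^+ 2)^-1 by rewrite mulr_gt0// invr_gt0 exprn_gt0.
have := inv_form_ge (gradient f x) x0 c0 u0 sd0.
rewrite /H_of -/(logr x) scalerA; apply: le_trans.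
set S := \sum_i gradient f x ord0 i * x ord0 i; set Q := \sum_i gradient f x ord0 i ^+ 2.
have SE : S = 2 * Df x.
  rewrite /Df mulrA divff ?pnatr_eq0// mul1r; apply: eq_bigr => i _.
  by rewrite mxE mulrC.
have QE : Q = \sum_i partial i f x ^+ 2 by apply: eq_bigr => i _; rewrite mxE.
have Nn0 : enorm x != 0 by exact: lt0r_neq0.
have A1 : 2 * Tf x = (2 * (enorm x ^+ 2)^-1)^-1 * (Q - S ^+ 2 / enorm x ^+ 2).
  by rewrite /Tf -QE SE; field.
have A2 : 2 * Df x ^+ 2 = (2 * (enorm x ^+ 2)^-1)^-1 * (S ^+ 2 / enorm x ^+ 2).
  by rewrite SE; field.
have Q0 : 0 <= Q - S ^+ 2 / enorm x ^+ 2.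
  have : 0 <= 2 * Tf x by rewrite mulr_ge0.
  by rewrite A1 pmulr_rge0// invr_gt0.
have S0 : 0 <= S ^+ 2 / enorm x ^+ 2 by rewrite divr_ge0// sqr_ge0.
have ub0 : (0 <= (u (logr x))%:E^-1)%E by rewrite inve_ge0 lee_fin profile_slope_ge0.
have bb0 : (0 <= (b (logr x))%:E^-1)%E by rewrite inve_ge0 lee_fin profile_curvature_ge0.
have sb0 : (0 <= (second_deriv (v_of rho) (logr x))%:E^-1)%E by rewrite inve_ge0 lee_fin.
have fb0 : (0 <= (first_deriv (v_of rho) (logr x))%:E^-1)%E by rewrite inve_ge0 lee_fin.
rewrite ge0_muleDr ?mule_ge0 ?sqr_EFin_ge0 ?lee_fin//.
rewrite [leRHS]ge0_muleDr ?mule_ge0 ?lee_fin// [leRHS]addeC.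
rewrite !muleA -!EFinM A2 A1; apply: leeD.
  apply: lee_wpmul2l; first by rewrite lee_fin mulr_ge0// invr_ge0 ltW.
  exact: lee_inve.
by rewrite profile_slope_in.
Qed.

Lemma radial_poincare : (\int[mu]_x (f x)%:E = 0)%E ->
  (\int[mu]_x (f x ^+ 2)%:E
   <= (1 / 2)%R%:E * \int[mu]_x inv_form (H_of rho x) (gradient f x))%E.
Proof.
move=> f_mean0.
have [K [fK dfK xdfK]] := test_function_bound f_smooth f_supp.
have fc := smooth_continuous f_smooth; have mf := continuous_measurable_rV fc.
have K0 : 0 <= K by exact: le_trans (fK 0).
have p := profile_log_profile rho_ge0 v_convex v_incr.
have [k k0 polk] := polar_mu n_gt0 rho_ge0 v_incr mu_rho.
have m0 t : 0 <= m t by rewrite mulr_ge0 ?expR_ge0// profile_ge0.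
have mm : measurable_fun setT m.
  apply: measurable_funM; first exact: mE.
  by apply: measurableT_comp => //; exact: mulrl_measurable.
have pol (phi : 'rV[R]_n -> \bar R) : measurable_fun setT phi -> (forall x, (0 <= phi x)%E) ->
    (\int[mu]_x phi x = k%:E * \int[leb1]_t ((m t)%:E *
      \int[gauss]_y phi (expR (t / 2) *: unit_rV y)))%E.
  move=> mphi phi0; rewrite polk//; congr (_ * _)%E.
  have mphip : measurable_fun setT (fun q : measurableTypeR R * 'rV[R]_n =>
      phi (expR (q.1 / 2) *: unit_rV q.2)).
    exact: measurableT_comp mphi (@measurable_polar_pt R n).
  have mq : measurable_fun setT (fun q : measurableTypeR R * 'rV[R]_n =>
      (m q.1)%:E * phi (expR (q.1 / 2) *: unit_rV q.2))%E.
    apply: emeasurable_funM => //; apply/measurable_EFinP.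
    exact: measurableT_comp mm measurable_fst.
  have q0 (q : measurableTypeR R * 'rV[R]_n) :
      (0 <= (m q.1)%:E * phi (expR (q.1 / 2) *: unit_rV q.2))%E.
    by rewrite mule_ge0// lee_fin.
  rewrite -(fubini_tonelli (m1 := leb1) _ mq q0); apply: eq_integral => t _.
  have mpt : measurable_fun setT (fun y : 'rV[R]_n => phi (expR (t / 2) *: unit_rV y)).
    exact: measurableT_comp mphip (measurable_pair1 t).
  by apply: (@ge0_integralZl _ _ _ gauss setT measurableT _ mpt (m t)%:E) => //; rewrite lee_fin.
have mmE : measurable_fun setT (fun t => (m t)%:E) by exact/measurable_EFinP.
pose M := (\int[leb1]_t (m t)%:E)%E.
(* Testing the polar formula with the constant [1] shows that [M] is [1 / k], hence positive and
   finite. *)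
have kM : (k%:E * M = 1)%E.
  have := pol (fun=> 1%E) (measurable_cst _) (fun=> lee01).
  rewrite !integral_prob_cst => ->; congr (_ * _)%E.
  by apply: eq_integral => t _; rewrite mule1.
have M0 : (0 <= M)%E by apply: integral_ge0 => t _; rewrite lee_fin.
have Mb : (0 < M < +oo)%E.
  apply/andP; split.
    by rewrite lt_neqAle M0 andbT; apply/eqP => e; move: kM; rewrite -e mule0 => /eqP; rewrite eqe eq_sym oner_eq0.
  rewrite ltey; apply/eqP => e; move: kM; rewrite e gt0_muley ?lte_fin//.
have fM : M \is a fin_num by rewrite ge0_fin_numE//; case/andP: Mb.
have mFl := measurable_flow_mean C1 fc fK xdfK.
have FK t := flow_mean_bnd fc fK t.
have mean0 : (\int[leb1]_t (m t * flow_mean f t)%:E = 0)%E.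
  have im : leb1.-integrable setT (EFin \o m).
    by apply: integrable_ge0 => //; case/andP: Mb.
  have imF : leb1.-integrable setT (EFin \o (fun t => m t * flow_mean f t)).
    have imK := integrableZl measurableT K im; apply: le_integrable imK => //.
      by apply/measurable_EFinP; exact: measurable_funM.
    move=> t _; rewrite /= lee_fin (normrM (m t)) (normrM K) (ger0_norm (m0 t)) (ger0_norm K0) mulrC.
    exact: ler_wpM2r.
  (* The polar formula is for nonnegative functions: it is applied to [f + K], and the contribution
     [K] of the constant is cancelled at the end. *)
  have fpos x : 0 <= f x + K by have := fK x; rewrite ler_norml; lra.
  have if1 : mu.-integrable setT (EFin \o f) by exact: integrable_bounded mf fK.
  have e1 : (\int[mu]_x (f x + K)%:E = K%:E)%E.
    under eq_integral do rewrite EFinD.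
    rewrite integralD//; last exact: finite_measure_integrable_cst.
    by rewrite f_mean0 integral_prob_cst add0e.
  have e2 : (\int[mu]_x (f x + K)%:E = k%:E * \int[leb1]_t (m t * flow_mean f t + K * m t)%:E)%E.
    rewrite (pol (fun x => (f x + K)%:E)).
    - congr (_ * _)%E; apply: eq_integral => t _.
      have iF : gauss.-integrable setT (EFin \o (fun y => flow f t y)).
        apply: (integrable_bounded gauss (M := K)); last exact: flow_bnd.
        exact: measurableT_comp (measurable_flow_pair fc) (measurable_pair1 t).
      have -> : (\int[gauss]_y (f (expR (t / 2) *: unit_rV y) + K)%:E = (flow_mean f t + K)%:E)%E.
        under eq_integral do rewrite EFinD.
        rewrite integralD//; last exact: finite_measure_integrable_cst.
        by rewrite integral_prob_cst EFinD /flow_mean /Rintegral fineK// (integrable_fin_num measurableT iF).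
      by rewrite -EFinM; congr EFin; ring.
    - by apply/measurable_EFinP; exact: measurable_funD.
    - by move=> x; rewrite lee_fin.
  have imK : leb1.-integrable setT (EFin \o (fun t => K * m t)).
    by have := integrableZl measurableT K im; apply: eq_integrable.
  have e3 : (\int[leb1]_t (m t * flow_mean f t + K * m t)%:E =
     \int[leb1]_t (m t * flow_mean f t)%:E + K%:E * M)%E.
    under eq_integral do rewrite EFinD.
    rewrite integralD//; congr (_ + _)%E; under eq_integral do rewrite EFinM.
    exact: integralZl.
  have fI := integrable_fin_num measurableT imF.
  move: e1; rewrite e2 e3 muleDr ?fin_num_adde_defl// ?fin_numM// muleCA kM mule1 => e.
  have : (k%:E * \int[leb1]_t (m t * flow_mean f t)%:E = 0)%E.
    move: e => /eqP; rewrite -[X in _ == X]add0e; move: (fI) => /fineK <-.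
    by rewrite -EFinM -!EFinD eqe => /eqP/addIr ->.
  by move/eqP; rewrite mule_eq0 eqe gt_eqF//= => /eqP.
have flow_ineq := flow_inequality n_gt0 C1 fc fK dfK xdfK f_even p Mb mean0.
apply: (@le_trans _ _ (\int[mu]_x energy x)%E).
  rewrite pol; last 2 first.
  - exact: measurable_sqr_EFin.
  - by move=> x; exact: sqr_EFin_ge0.
  rewrite (pol energy)//; apply: lee_wpmul2l; first by rewrite lee_fin ltW.
  apply: le_trans flow_ineq _; rewrite le_eqVlt; apply/orP; left; apply/eqP.
  apply: eq_integral => t _; have [Et|Et] := leP (E t) 0.
    have -> : E t * expR (a * t) = 0.
      by rewrite (_ : E t = 0) ?mul0r//; apply/eqP; rewrite eq_le Et profile_ge0.
    have -> : m t = 0.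
      by rewrite /m (_ : E t = 0) ?mul0r//; apply/eqP; rewrite eq_le Et profile_ge0.
    by rewrite !mul0e.
  congr (_ * _)%E.
  have bt0 : (0 <= (b t)%:E^-1)%E by rewrite inve_ge0 lee_fin profile_curvature_ge0.
  have ut0 : (0 <= (u t)%:E^-1)%E by rewrite inve_ge0 lee_fin profile_slope_ge0.
  have md2 : measurable_fun setT (fun y : 'rV[R]_n => (dflow f t y ^+ 2)%:E).
    by apply: measurable_sqr_EFin; exact: measurableT_comp (measurable_dflow_pair C1) (measurable_pair1 t).
  have mt2 : measurable_fun setT (fun y : 'rV[R]_n => (tangential2 f t y)%:E).
    apply/measurable_EFinP.
    exact: measurableT_comp (measurable_tangential2_pair C1) (measurable_pair1 t).
  rewrite -ge0_integralZr//; last by move=> y _; exact: sqr_EFin_ge0.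
  rewrite -ge0_integralZr//; last by move=> y _; rewrite lee_fin tangential2_ge0.
  have mA : measurable_fun setT (fun y : 'rV[R]_n => (dflow f t y ^+ 2)%:E * (b t)%:E^-1)%E.
    exact: emeasurable_funM.
  have mB : measurable_fun setT (fun y : 'rV[R]_n => (tangential2 f t y)%:E * (u t)%:E^-1)%E.
    exact: emeasurable_funM.
  have A0 y : (0 <= (dflow f t y ^+ 2)%:E * (b t)%:E^-1)%E by rewrite mule_ge0// sqr_EFin_ge0.
  have B0 y : (0 <= (tangential2 f t y)%:E * (u t)%:E^-1)%E by rewrite mule_ge0// lee_fin tangential2_ge0.
  rewrite -ge0_integralD//; apply: (integral_gauss_off0 n_gt0).
  - exact: emeasurable_funD.
  - apply: (measurableT_comp menergy).
    exact: measurableT_comp (@measurable_polar_pt R n) (measurable_pair1 t).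
  - by move=> y; exact: adde_ge0.
  - by move=> y; exact: energy_ge0.
  - move=> y y0; rewrite /energy /good logr_ray// Et enorm_ray// expR_gt0/=.
    by rewrite Df_ray Tf_ray.
have -> : (\int[mu]_x energy x = (1 / 2)%:E * \int[mu]_x (2%:E * energy x))%E.
  by rewrite ge0_integralZl// muleA -EFinM (_ : 1 / 2 * 2 = 1 :> R) ?mul1e//; field.
apply: lee_wpmul2l => //.
have mN : measurable [set x | ~~ good x].
  rewrite (_ : [set x | ~~ good x] = setT `&` good @^-1` [set false]); first exact: mgood.
  by rewrite setTI; apply/seteqP; split => x /=; [move/negbTE|move=> ->].
apply: (ge0_le_integral_off_null (N := [set x | ~~ good x])) => //.
(* The complement of [good] is null: a ray with [y != 0] meets it only at those [t] where [E t = 0],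
   and these carry no weight. *)
- have ind0 : (\int[mu]_x (\1_[set x | ~~ good x] x)%:E = 0)%E.
    rewrite (pol (fun x => (\1_[set x | ~~ good x] x)%:E)); last 2 first.
    + by apply/measurable_EFinP; exact: measurable_indic.
    + by move=> x; rewrite lee_fin.
    rewrite [X in (_ * X)%E]integral0_eq ?mule0// => t _; have [Et|Et] := leP (E t) 0.
      by rewrite /m (_ : E t = 0) ?mul0r ?mul0e//; apply/eqP; rewrite eq_le Et profile_ge0.
    rewrite (integral_gauss_off0 n_gt0 (g := fun=> 0%E)) ?integral0 ?mule0//.
    + apply/measurable_EFinP; apply: (measurableT_comp (measurable_indic mN)).
      exact: measurableT_comp (@measurable_polar_pt R n) (measurable_pair1 t).
    + move=> y y0; rewrite indicE memNset//= /good logr_ray// Et enorm_ray// expR_gt0//.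
  by move: ind0; rewrite integral_indic// setIT.
- by move=> x; rewrite mule_ge0.
- by move=> x /= /negbTE gx; rewrite /energy gx mule0.
- by move=> x /= /negP; rewrite negbK; exact: energy_le_inv_form.
Qed.

End main.

Theorem theorem4p1 (R : realType) (n : nat) (n_gt0 : (0 < n)%N)
    (rho : R -> R)
    (rho_ge0 : forall s, 0 <= s -> 0 <= rho s)
    (rho_int : (\int[lebesgue_rV R n]_x (rho (enorm x ^+ 2))%:E < +oo)%E)
    (v_convex : convex_ereal (v_of rho))
    (v_incr : {homo v_of rho : s t / (s <= t)%R >-> (s <= t)%E})
    (mu : probability 'rV[R]_n R)
    (mu_rho : density_proportional_to mu (fun x => rho (enorm x ^+ 2)))
    (f : 'rV[R]_n -> R)
    (f_smooth : smooth f) (f_supp : compactly_supported f)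
    (f_even : forall x, f (- x) = f x)
    (f_mean0 : (\int[mu]_x (f x)%:E = 0)%E) :
  (\int[mu]_x (f x ^+ 2)%:E
   <= (1 / 2)%R%:E * \int[mu]_x inv_form (H_of rho x) (gradient f x))%E.
Proof. exact: (radial_poincare n_gt0 rho_ge0 v_convex v_incr mu_rho f_smooth f_supp f_even f_mean0). Qed.
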